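(* Let $u$ be the solution of the boundary value problem $-\varepsilon\Delta u+b u_x+cu=f$ in $\Omega=(0,1)^2$, $u=0$ on $\partial\Omega$, and suppose that $u$ admits the decomposition $u=S+E_1+E_2+E_{12}$ with the derivative bounds stated in the context. Let $u^I\in V^N$ be the piecewise linear nodal interpolant of $u$ on the Shishkin triangular mesh $\mathcal{T}_N$ and let $u^N\in V^N$ be the SDFEM solution on $\mathcal{T}_N$. Suppose the stabilization parameter $\delta$ satisfies $$0\le\delta_K\le\frac{\mu_0}{2\Vert c\Vert_{L^\infty(K)}^2}\quad\text{for all }K\in\mathcal{T}_N$$ and $$\delta_s\le C^*N^{-1/2},\quad \delta_y\le C^*\varepsilon^{-1/4}N^{-3/2},\quad \delta_x\le C^*\varepsilon N^{-3/2},\quad \delta_{xy}\le C^*\varepsilon^{3/4}N^{-3/2},$$ where $C^*$ is a positive constant independent of $\varepsilon$ and the mesh. Then there is a constant $C$ independent of $\varepsilon$ and $N$ such that $$\Vert u^I-u^N\Vert_\varepsilon\le\Vert u^I-u^N\Vert_{SD}\le CN^{-3/2}\ln^{3/2}N.$$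
   Context: **Problem.** $\Omega=(0,1)^2$; $0<\varepsilon\ll|b|$ is a small parameter; $b,c,f$ are sufficiently smooth functions on $\bar\Omega$ with $b(x,y)\ge\beta>0$ and $c(x,y)-\tfrac12 b_x(x,y)\ge\mu_0>0$ on $\bar\Omega$, where $\beta,\mu_0$ are constants. Constants $C$ denote generic constants independent of $\varepsilon$ and $N$ (they may depend on the data $b,c,f,\beta,\mu_0$, on $C^*$ and on the constant in the regularity assumption). **Regularity assumption.** $u=S+E_1+E_2+E_{12}$ on $\bar\Omega$, and for $0\le i+j\le3$ and all $(x,y)\in\bar\Omega$, with $C$ independent of $\varepsilon$: $|\partial_x^i\partial_y^jS|\le C$; $|\partial_x^i\partial_y^jE_1|\le C\varepsilon^{-i}e^{-\beta(1-x)/\varepsilon}$; $|\partial_x^i\partial_y^jE_2|\le C\varepsilon^{-j/2}(e^{-y/\sqrt\varepsilon}+e^{-(1-y)/\sqrt\varepsilon})$; $|\partial_x^i\partial_y^jE_{12}|\le C\varepsilon^{-(i+j/2)}e^{-\beta(1-x)/\varepsilon}(e^{-y/\sqrt\varepsilon}+e^{-(1-y)/\sqrt\varepsilon})$. **Shishkin mesh.** $N$ is a positive integer divisible by $6$; $\rho=2.5$; $\varepsilon\le\min\{N^{-1},\ln^{-6}N\}$; $\lambda_x=\rho\varepsilon\beta^{-1}\ln N\le\tfrac12$ and $\lambda_y=\rho\sqrt\varepsilon\ln N\le\tfrac14$ (assumed). Subdomains: $\Omega_s=[0,1-\lambda_x]\times[\lambda_y,1-\lambda_y]$, $\Omega_y=[0,1-\lambda_x]\times([0,\lambda_y]\cup[1-\lambda_y,1])$,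 $\Omega_x=[1-\lambda_x,1]\times[\lambda_y,1-\lambda_y]$, $\Omega_{xy}=[1-\lambda_x,1]\times([0,\lambda_y]\cup[1-\lambda_y,1])$. Mesh points $(x_i,y_j)$, $0\le i,j\le N$: $x_i=2i(1-\lambda_x)/N$ for $0\le i\le N/2$, $x_i=1-2(N-i)\lambda_x/N$ for $N/2+1\le i\le N$; $y_j=3j\lambda_y/N$ for $0\le j\le N/3$, $y_j=(3j/N-1)-3(2j-N)\lambda_y/N$ for $N/3+1\le j\le 2N/3$, $y_j=1-3(N-j)\lambda_y/N$ for $2N/3+1\le j\le N$. Each rectangle $[x_i,x_{i+1}]\times[y_j,y_{j+1}]$ is split into two triangles: $K^1_{i,j}$ with vertices $(x_i,y_j),(x_{i+1},y_j),(x_i,y_{j+1})$ and $K^2_{i,j}$ with vertices $(x_i,y_{j+1}),(x_{i+1},y_j),(x_{i+1},y_{j+1})$. The resulting triangulation is $\mathcal{T}_N$; $K$ denotes a generic triangle. **SDFEM.** $V^N\subset H_0^1(\Omega)$ is the space of continuous piecewise linear functions on $\mathcal{T}_N$ vanishing on $\partial\Omega$. The stabilization parameter $\delta$ is constant on each of the four subdomains, with values $\delta_s,\delta_x,\delta_y,\delta_{xy}$ on $\Omega_s,\Omega_x,\Omega_y,\Omega_{xy}$, and $\delta_K=\delta|_K$. $(\cdot,\cdot)_D$ and $\Vert\cdot\Vert_D$ are the $L^2(D)$ inner product and norm ($D=\Omega$ if omitted). The SDFEM solution $u^N\in V^N$ satisfies, for all $v^N\in V^N$, $$a_{SD}(u^N,v^N)=(f,v^N)+\sum_K(f,\delta_Kbv^N_x)_K,\qquad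 a_{SD}=a_{Gal}+a_{stab},$$ $a_{Gal}(w,v)=\varepsilon(\nabla w,\nabla v)+(bw_x+cw,v)$, $a_{stab}(w,v)=\sum_K(-\varepsilon\Delta w+bw_x+cw,\delta_Kbv_x)_K$. **Norms.** $\Vert v\Vert_\varepsilon^2=\varepsilon|v|_1^2+\mu_0\Vert v\Vert^2$ with $|v|_1=\Vert\nabla v\Vert$, and $\Vert v\Vert_{SD}^2=\Vert v\Vert_\varepsilon^2+\sum_K\delta_K\Vert bv_x\Vert_K^2$. *)

(* Defs.v *)
From HB Require Import structures.
From mathcomp Require Import all_boot all_order all_algebra.
From mathcomp Require Import all_classical all_reals all_analysis.

Set Implicit Arguments.
Unset Strict Implicit.
Unset Printing Implicit Defensive.

Import Order.TTheory GRing.Theory Num.Theory.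
Import numFieldNormedType.Exports.

Local Open Scope classical_set_scope.
Local Open Scope ring_scope.

Section Domain.
Context {R : realType}.
Implicit Types (g v w : R * R -> R) (p : R * R).

Definition Omega : set (R * R) := `]0, 1[ `*` `]0, 1[.
Definition Omega_bar : set (R * R) := `[0, 1] `*` `[0, 1].

Definition dx v p : R := derive1 (fun s => v (s, p.2)) p.1.
Definition dy v p : R := derive1 (fun t => v (p.1, t)) p.2.
Definition laplacian v p : R := dx (dx v) p + dy (dy v) p.

(* [derivs k g D]: g is in C^k of the closed square, in the usual sense that
   the partial derivatives of order at most k exist in the open square and
   extend continuously to the closed one; D i j is the extension of
   d^(i+j) g / dx^i dy^j. *)
Definition derivs (k : nat) g (D : nat -> nat -> R * R -> R) : Prop :=
  [/\ forall p, Omega_bar p -> D 0%N 0%N p = g p,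
      forall i j, (i + j <= k)%N -> {within Omega_bar, continuous (D i j)} &
      forall i j, (i + j < k)%N -> forall p, Omega p ->
        is_derive p.1 1 (fun s => D i j (s, p.2)) (D i.+1 j p) /\
        is_derive p.2 1 (fun t => D i j (p.1, t)) (D i j.+1 p)].

Definition smooth (k : nat) g : Prop := exists D, derivs k g D.

Definition bvp_solution (eps : R) (b c f u : R * R -> R) : Prop :=
  [/\ smooth 2 u,
      forall p, Omega p ->
        - eps * laplacian u p + b p * dx u p + c p * u p = f p &
      forall p, (Omega_bar `\` Omega) p -> u p = 0].

Definition derivs_bounded_by (C : R) g (wgt : nat -> nat -> R * R -> R) : Prop :=
  exists2 D, derivs 3 g D &
    forall i j p, (i + j <= 3)%N -> Omega_bar p -> `|D i j p| <= C * wgt i j p.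

Definition exp_layer (eps beta : R) p : R := expR (- beta * (1 - p.1) / eps).
Definition char_layer (eps : R) p : R :=
  expR (- p.2 / Num.sqrt eps) + expR (- (1 - p.2) / Num.sqrt eps).

Definition decomposition (eps beta C : R) (u S E1 E2 E12 : R * R -> R) : Prop :=
  [/\ forall p, Omega_bar p -> u p = S p + E1 p + E2 p + E12 p,
      derivs_bounded_by C S (fun _ _ _ => 1),
      derivs_bounded_by C E1
        (fun i _ p => eps `^ (- i%:R) * exp_layer eps beta p),
      derivs_bounded_by C E2
        (fun _ j p => eps `^ (- (j%:R / 2)) * char_layer eps p) &
      derivs_bounded_by C E12
        (fun i j p => eps `^ (- (i%:R + j%:R / 2)) *
                      exp_layer eps beta p * char_layer eps p)].

End Domain.

Section Mesh.
Context {R : realType}.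
Variables (eps beta : R) (N : nat).

Definition rho : R := 5 / 2.
Definition lambda_x : R := rho * eps * beta^-1 * ln N%:R.
Definition lambda_y : R := rho * Num.sqrt eps * ln N%:R.

Definition fine_y : set R := `[0, lambda_y] `|` `[1 - lambda_y, 1].
Definition Omega_s : set (R * R) :=
  `[0, 1 - lambda_x] `*` `[lambda_y, 1 - lambda_y].
Definition Omega_y : set (R * R) := `[0, 1 - lambda_x] `*` fine_y.
Definition Omega_x : set (R * R) :=
  `[1 - lambda_x, 1] `*` `[lambda_y, 1 - lambda_y].
Definition Omega_xy : set (R * R) := `[1 - lambda_x, 1] `*` fine_y.

Definition mesh_x (i : nat) : R :=
  if (i <= N %/ 2)%N then 2 * i%:R * (1 - lambda_x) / N%:R
  else 1 - 2 * (N%:R - i%:R) * lambda_x / N%:R.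

Definition mesh_y (j : nat) : R :=
  if (j <= N %/ 3)%N then 3 * j%:R * lambda_y / N%:R
  else if (j <= 2 * N %/ 3)%N then
    (3 * j%:R / N%:R - 1) - 3 * (2 * j%:R - N%:R) * lambda_y / N%:R
  else 1 - 3 * (N%:R - j%:R) * lambda_y / N%:R.

Definition node (i j : nat) : R * R := (mesh_x i, mesh_y j).

Definition triangle (A B C : R * R) : set (R * R) :=
  [set p | exists s t : R, [/\ 0 <= s, 0 <= t, s + t <= 1 &
                             p = A + s *: (B - A) + t *: (C - A)]].

(* The triangle of index (i, j, true) is K^1_(i,j), that of index
   (i, j, false) is K^2_(i,j). *)
Definition elt : finType := ('I_N * 'I_N * bool)%type.

Definition tri (K : elt) : set (R * R) :=
  let: (i, j, lower) := K in
  if lower then triangle (node i j) (node i.+1 j) (node i j.+1)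
  else triangle (node i j.+1) (node i.+1 j) (node i.+1 j.+1).

Definition affine_on (D : set (R * R)) (v : R * R -> R) : Prop :=
  exists a0 a1 a2 : R, forall p, D p -> v p = a0 + a1 * p.1 + a2 * p.2.

(* Elements of V^N are total functions on the plane; only their values on
   the closed square matter. *)
Definition VN (v : R * R -> R) : Prop :=
  [/\ {within Omega_bar, continuous v},
      forall K, affine_on (tri K) v &
      forall p, (Omega_bar `\` Omega) p -> v p = 0].

Definition nodal_interpolant (u uI : R * R -> R) : Prop :=
  VN uI /\
  forall i j, (i <= N)%N -> (j <= N)%N -> uI (node i j) = u (node i j).

Definition stab_param (delta : elt -> R) (d_s d_x d_y d_xy : R) : Prop :=
  forall K, [/\ tri K `<=` Omega_s -> delta K = d_s,
                tri K `<=` Omega_x -> delta K = d_x,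
                tri K `<=` Omega_y -> delta K = d_y &
                tri K `<=` Omega_xy -> delta K = d_xy].

End Mesh.

Notation leb2 R := (@lebesgue_measure R \x @lebesgue_measure R)%E.

Section Forms.
Context {R : realType}.
Implicit Types v w : R * R -> R.

Definition ip (D : set (R * R)) v w : R :=
  Rintegral (leb2 R) D (fun p => v p * w p).
Definition L2norm (D : set (R * R)) v : R := Num.sqrt (ip D v v).
(* Extended-real valued: a bound of the form mu0 / (2 * Linfnorm K c ^+ 2) is
   then +oo, i.e. no constraint, when c vanishes on K (0^-1 = +oo in \bar R). *)
Definition Linfnorm (D : set (R * R)) v : \bar R :=
  Lnorm (leb2 R) +oo%E (EFin \o (v \_ D)).

Variables (eps beta mu0 : R) (N : nat) (b c f : R * R -> R) (delta : elt N -> R).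

(* Integrals over a triangle K are taken over its interior, where the
   derivatives of functions of V^N exist; [dx], [dy] of such a function are
   meaningless on the edges, which are null sets. *)
Local Notation T K := (tri eps beta K).

Definition grad_ip w v : R := ip Omega (dx w) (dx v) + ip Omega (dy w) (dy v).

Definition a_Gal w v : R :=
  eps * grad_ip w v + ip Omega (fun p => b p * dx w p + c p * w p) v.

Definition a_stab w v : R :=
  \sum_(K : elt N)
    ip (T K)° (fun p => - eps * laplacian w p + b p * dx w p + c p * w p)
          (fun p => delta K * b p * dx v p).

Definition a_SD w v : R := a_Gal w v + a_stab w v.

Definition sdfem_solution (uN : R * R -> R) : Prop :=
  VN eps beta N uN /\
  forall v, VN eps beta N v ->
    a_SD uN v =
      ip Omega f v + \sum_(K : elt N) ip (T K)° f (fun p => delta K * b p * dx v p).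

Definition norm_eps v : R :=
  Num.sqrt (eps * Num.sqrt (grad_ip v v) ^+ 2 + mu0 * L2norm Omega v ^+ 2).

Definition norm_SD v : R :=
  Num.sqrt (norm_eps v ^+ 2 +
    \sum_(K : elt N) delta K * L2norm (T K)° (fun p => b p * dx v p) ^+ 2).

End Forms.

(* Main.v *)
(* With chi = u^I - u^N, coercivity and Galerkin orthogonality bound half the
   squared SD norm of chi by the consistency error of the interpolant tested
   with chi, which splits into the contributions of S, E1, E2 and E12. On each
   cell a component is either resolved by the mesh or of size N^(-5/2). Plain
   Cauchy-Schwarz is lossy in two places. On the coarse part in x, S and E2 are
   treated by summation by parts in x: chi_x is a difference quotient, and the
   integrals against it vary slowly from cell to cell. The terms in the gradient
   of the interpolation error are summed over pairs of triangles sharing an edge: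
   such triangles are point reflections of each other, chi has the same tangential
   derivative on both, and the leading parts of the errors cancel, except at the
   few transition rows and columns, whose total area is small. *)

Require Import Defs.
From mathcomp Require Import all_boot all_order all_algebra.
From mathcomp Require Import all_classical all_reals all_analysis.
From mathcomp Require Import measurable_realfun ess_sup_inf ring lra zify.
Import Order.TTheory GRing.Theory Num.Theory.
Import numFieldNormedType.Exports.
Local Open Scope classical_set_scope.
Local Open Scope ring_scope.
Set Implicit Arguments.
Unset Strict Implicit.

(** With z = (ln N / N)^(1/2) the mesh resolves every layer up to a factor z^2, so interpolation
    errors are of order z^4 and those of gradients of order z^2 on the scale of the layer. The
    energy norm controls chi_x only up to eps^(-1/2). Inside the layer at x = 1 the square root of
    its area, of order eps ln N, cancels this factor; on the coarse part nothing does. Hence the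
    summation by parts there, whose only boundary term is again a sum over the layer because chi
    vanishes at x = 1. Pairing triangles raises z^2 to z^4; at transition rows and columns z^2
    remains, and the square root of their area supplies the last z: this is the exponent 3/2. E1 and
    E12 on the coarse part need a further device. Their size there is N^(-5/2) because rho = 5/2,
    but each x-derivative costs 1/eps. Derivatives are therefore integrated by parts inside each
    triangle, and an inverse estimate converts the resulting edge terms at the cost of a factor N. A
    single constant [A] dominates all data, so each estimate ends as a comparison of monomials. *)

Section real_functions.
Context {R : realType}.
Implicit Types (f g : R -> R) (x : R).

Lemma is_derive1D f g x a b : is_derive x 1 f a -> is_derive x 1 g b ->
  is_derive x 1 (fun t => f t + g t) (a + b).
Proof. exact: is_deriveD. Qed.

Lemma is_derive1B f g x a b : is_derive x 1 f a -> is_derive x 1 g b ->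
  is_derive x 1 (fun t => f t - g t) (a - b).
Proof. exact: is_deriveB. Qed.

Lemma is_derive1M f g x a b : is_derive x 1 f a -> is_derive x 1 g b ->
  is_derive x 1 (fun t => f t * g t) (f x * b + g x * a).
Proof. exact: is_deriveM. Qed.

Lemma is_derive1_cst x a : is_derive x 1 (fun=> a : R) 0.
Proof. exact: is_derive_cst. Qed.

Lemma is_derive1_id x : is_derive x 1 (fun t : R => t) 1.
Proof. exact: is_derive_id. Qed.

Lemma is_derive1_affine x c d : is_derive x 1 (fun t : R => c + d * t) d.
Proof.
have H := is_derive1D (is_derive1_cst x c) (is_derive1M (is_derive1_cst x d) (is_derive1_id x)).
by apply: is_derive_eq H _; lra.
Qed.

Lemma near_eq_is_derive1 f g x a : (\near x, f x = g x) ->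
  is_derive x 1 f a -> is_derive x 1 g a.
Proof.
by move=> fg; apply: near_eq_is_derive; rewrite ?oner_eq0//.
Qed.

Lemma derivable_within (a b : R) f (df : R -> R) :
  (forall x, is_derive x 1 f (df x)) -> {within `[a, b], continuous f}.
Proof.
move=> H; apply: continuous_subspaceT => x.
by apply: differentiable_continuous; apply/derivable1_diffP; have [] := H x.
Qed.
End real_functions.

Section within.
Context {R : realType} {T : topologicalType} (A : set T).
Implicit Types f g : T -> R.
Lemma within_cst (a : R) : {within A, continuous (fun=> a : R)}.
Proof. by apply: continuous_subspaceT => x; exact: cvg_cst. Qed.
Lemma within_D f g : {within A, continuous f} -> {within A, continuous g} ->
  {within A, continuous (fun x => f x + g x)}.
Proof. by move=> cf cg x; apply: cvgD; [exact: cf|exact: cg]. Qed.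
Lemma within_M f g : {within A, continuous f} -> {within A, continuous g} ->
  {within A, continuous (fun x => f x * g x)}.
Proof. by move=> cf cg x; apply: cvgM; [exact: cf|exact: cg]. Qed.
Lemma within_N f : {within A, continuous f} -> {within A, continuous (fun x => - f x)}.
Proof. by move=> cf x; apply: cvgN; exact: cf. Qed.
End within.

Lemma within_comp {R : realType} {T U : topologicalType} (A : set T) (B : set U)
    (phi : T -> U) (f : U -> R) :
  continuous phi -> (forall x, A x -> B (phi x)) -> {within B, continuous f} ->
  {within A, continuous (fun x => f (phi x))}.
Proof.
move=> cphi AB cf; apply/subspace_continuousP => x Ax.
have H := (subspace_continuousP _ _).1 cf (phi x) (AB _ Ax).
apply: (@cvg_comp _ _ _ phi f _ (within B (nbhs (phi x)))) => // P BP.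
have BP' : nbhs (phi x) [set y | B y -> P y] := BP.
have H' : nbhs x [set t | B (phi t) -> P (phi t)] := cphi x _ BP'.
by apply: filterS H' => t Pt At; apply/Pt/AB.
Qed.

(** * Integration over the reference triangle *)

Section plane_measure.
Context {R : realType}.
Local Notation leb := (@lebesgue_measure R).
Local Notation mu2 := (leb2 R).

Definition openbox (q : rat * rat * rat * rat) : set (R * R) :=
  let: (a, b, c, d) := q in `]ratr a, ratr b[ `*` `]ratr c, ratr d[.

(** Each point of an open set has a box with rational end points around it inside the set, so the
    set is a countable union of measurable rectangles. This ties the open sets of the plane to the
    product sigma-algebra of [leb2]. *)
Lemma open_measurable2 (A : set (R * R)) : open A -> measurable A.
Proof.
move=> oA.
have -> : A = \bigcup_a \bigcup_b \bigcup_c \bigcup_d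
    (if `[< openbox (a, b, c, d) `<=` A >] then openbox (a, b, c, d) else set0).
  apply/seteqP; split => [[x y] Axy|]; last first.
    by move=> p [a _ [b _ [c _ [d _]]]]; case: asboolP => // /[apply].
  have /nbhs_ballP[e /= e0 eA] : nbhs (x, y) A by exact: open_nbhs_nbhs.
  have [a /[!in_itv]/=/andP[a1 a2]] := @rat_in_itvoo R (x - e) x ltac:(lra).
  have [b /[!in_itv]/=/andP[b1 b2]] := @rat_in_itvoo R x (x + e) ltac:(lra).
  have [c /[!in_itv]/=/andP[c1 c2]] := @rat_in_itvoo R (y - e) y ltac:(lra).
  have [d /[!in_itv]/=/andP[d1 d2]] := @rat_in_itvoo R y (y + e) ltac:(lra).
  exists a => //; exists b => //; exists c => //; exists d => //.
  case: asboolP => [_|[]]; first by split; rewrite /= in_itv/=; lra.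
  move=> [u v] [/=]; rewrite !in_itv/= => u1 v1; apply: eA.
  by split; rewrite /ball/= ltr_norml; lra.
do 4 (apply: bigcupT_measurable_rat => ?).
by case: ifP => // _; apply: measurableX; exact: measurable_itv.
Qed.

Lemma open_continuous_measurable2 (U : set (R * R)) (g : R * R -> R) :
  open U -> (forall p, U p -> {for p, continuous g}) -> measurable_fun U g.
Proof.
move=> oU cg; apply: (measurability _ (RGenOInfty.measurableE R)).
move=> _ [_ [a ->] <-]; apply: open_measurable2.
rewrite openE => p [Up gp]; rewrite /interior.
apply: filterI; first by exact: open_nbhs_nbhs.
apply: (cg p Up); apply: open_nbhs_nbhs; split => //.
Qed.

Lemma measurable_affine (a h : R) : measurable_fun [set: R] (fun s : R => a + h * s).
Proof. by apply: measurable_funD => //; exact: measurable_funM. Qed.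

(** The image measure under the affine map, scaled by |h|, agrees with length on half-open
    intervals, hence everywhere by uniqueness. For negative [h] the preimage is open on the other
    side, with the same length. *)
Lemma lebesgue_measure_affine_preimage (a h : R) (A : set R) : h != 0 ->
  measurable A ->
  leb ((fun s => a + h * s) @^-1` A) = (`|h|^-1%:E * leb A)%E.
Proof.
move=> h0 mA.
have mphi : @measurable_fun _ _ (measurableTypeR R) (measurableTypeR R) setT
    (fun s => a + h * s) := measurable_affine a h.
pose pf := 
  measure_function_pushforward__canonical__measure_function_Measure leb mphi.
have H : leb A = mscale (NngNum (normr_ge0 h)) pf A.
  apply: lebesgue_measure_unique => // _ [[x y] _ <-] /=.
  rewrite /mscale /= /pushforward lebesgue_measure_itv/= lte_fin.
  have [hn|hp] := ltrP h 0.
  - have -> : (fun s => a + h * s) @^-1` `]x, y] = `[(y - a) / h, (x - a) / h[%classic.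
      apply/seteqP; split=> s /=; rewrite !in_itv/= ltr_ndivlMr// ler_ndivrMr//; lra.
    rewrite lebesgue_measure_itv/= lte_fin ltr_nM2r ?invr_lt0// ltrD2r.
    case: ifPn => xy; last by rewrite mule0.
    rewrite -!EFinD -EFinM ltr0_norm//; congr EFin; field; lra.
  - have {}hp : 0 < h by rewrite lt_neqAle eq_sym h0.
    have -> : (fun s => a + h * s) @^-1` `]x, y] = `](x - a) / h, (y - a) / h]%classic.
      apply/seteqP; split=> s /=; rewrite !in_itv/= ltr_pdivrMr// ler_pdivlMr//; lra.
    rewrite lebesgue_measure_itv/= lte_fin ltr_pM2r ?invr_gt0// ltrD2r.
    case: ifPn => xy; last by rewrite mule0.
    rewrite -!EFinD -EFinM gtr0_norm//; congr EFin; field; lra.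
rewrite H /mscale /= muleA -EFinM mulVf ?normr_eq0// mul1e //.
Qed.

Definition affmap (x y h k : R) (p : R * R) : R * R := (x + h * p.1, y + k * p.2).

Lemma measurable_affmap (x y h k : R) : measurable_fun setT (affmap x y h k).
Proof.
apply/measurable_fun_pairP; split.
  by apply: (measurableT_comp (measurable_affine x h)) => //; exact: measurable_fst.
by apply: (measurableT_comp (measurable_affine y k)) => //; exact: measurable_snd.
Qed.

(** Uniqueness of the product measure reduces the claim to rectangles, where the one-dimensional
    formula applies to each side. *)
Lemma leb2_affmap_preimage (x y h k : R) (A : set (R * R)) : h != 0 -> k != 0 ->
  measurable A ->
  mu2 A = (`|h * k|%:E * mu2 (affmap x y h k @^-1` A))%E.
Proof.
move=> h0 k0 mA.
have mphi : @measurable_fun _ _ (measurableTypeR R * measurableTypeR R)%type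
    (measurableTypeR R * measurableTypeR R)%type setT (affmap x y h k) :=
  @measurable_affmap x y h k.
pose pf := measure_function_pushforward__canonical__measure_function_Measure mu2 mphi.
rewrite -[RHS]/(mscale (NngNum (normr_ge0 (h * k))) pf A).
apply: (@product_measure_unique _ _ _ _ _ leb leb (mscale (NngNum (normr_ge0 (h * k))) pf)) => // B D mB mD.
rewrite /mscale/= /pushforward.
have mhB : measurable ((fun s => x + h * s) @^-1` B).
  by rewrite -[X in measurable X]setTI; exact: measurable_affine.
have mkD : measurable ((fun s => y + k * s) @^-1` D).
  by rewrite -[X in measurable X]setTI; exact: measurable_affine.
transitivity (`|h * k|%:E * mu2 (((fun s => x + h * s)%R @^-1` B) `*`
    ((fun s => y + k * s)%R @^-1` D)))%E; first by congr (_ * mu2 _)%E.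
rewrite product_measure1E//= !lebesgue_measure_affine_preimage//.
rewrite [X in (_ * X)%E]muleACA [LHS]muleA -!EFinM normrM mulrACA.
by rewrite !divff ?normr_eq0// mulr1 mul1e.
Qed.
End plane_measure.

Section plane_integral.
Context {R : realType}.
Local Notation leb := (@lebesgue_measure R).
Local Notation mu2 := (leb2 R).
Implicit Types (U D : set (R * R)) (g F : R * R -> R).

Definition cbounded U g :=
  (forall p, U p -> {for p, continuous g}) /\
  (exists M, forall p, U p -> `|g p| <= M).

Lemma cbounded_integrable U g : open U -> (mu2 U < +oo)%E -> cbounded U g ->
  mu2.-integrable U (EFin \o g).
Proof.
move=> oU Uoo [cg [M gM]]; have mU := open_measurable2 oU.
apply: measurable_bounded_integrable => //.
- exact: open_continuous_measurable2.
- exists M; split; first exact: num_real.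
  by move=> x Mx p Up; apply: le_trans (gM _ Up) (ltW Mx).
Qed.

Lemma cboundedD U g1 g2 : cbounded U g1 -> cbounded U g2 ->
  cbounded U (fun p => g1 p + g2 p).
Proof.
move=> [c1 [M1 b1]] [c2 [M2 b2]]; split=> [p Up|].
  by apply: cvgD; [exact: c1|exact: c2].
exists (M1 + M2) => p Up; apply: le_trans (ler_normD _ _) _.
by apply: lerD; [exact: b1|exact: b2].
Qed.

Lemma cboundedM U g1 g2 : cbounded U g1 -> cbounded U g2 ->
  cbounded U (fun p => g1 p * g2 p).
Proof.
move=> [c1 [M1 b1]] [c2 [M2 b2]]; split=> [p Up|].
  by apply: cvgM; [exact: c1|exact: c2].
exists (M1 * M2) => p Up; rewrite normrM.
by apply: ler_pM => //; [exact: b1|exact: b2].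
Qed.

Lemma cbounded_cst U (a : R) : cbounded U (fun=> a).
Proof. by split=> [p _|]; [exact: cst_continuous|exists `|a|]. Qed.

Lemma ge0_integral_affmap (x y h k : R) D (f : R * R -> \bar R) :
  h != 0 -> k != 0 -> measurable D -> measurable_fun D f ->
  (forall p, D p -> 0 <= f p)%E ->
  (\int[mu2]_(p in D) f p =
   `|h * k|%:E * \int[mu2]_(p in affmap x y h k @^-1` D) f (affmap x y h k p))%E.
Proof.
move=> h0 k0 mD mf f0; pose r := NngNum (normr_ge0 (h * k)).
have mphi : @measurable_fun _ _ (measurableTypeR R * measurableTypeR R)%type
    (measurableTypeR R * measurableTypeR R)%type setT (affmap x y h k) :=
  @measurable_affmap R x y h k.
pose pf := measure_function_pushforward__canonical__measure_function_Measure mu2 mphi.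
transitivity (\int[mscale r pf]_(p in D) f p)%E.
  by apply: eq_measure_integral => A mA _; exact: leb2_affmap_preimage.
transitivity (`|h * k|%:E * \int[pf]_(p in D) f p)%E.
  exact: (@ge0_integral_mscale _ _ _ pf D mD r f mf f0).
apply: (congr1 (fun z => `|h * k|%:E * z)%E).
have f0' : {in D, forall p, (0 <= f p)%E} by move=> p /set_mem; exact: f0.
exact: (ge0_integral_pushforward mphi mu2 mD mf f0').
Qed.

Lemma Rintegral_affmap (x y h k : R) D g : h != 0 -> k != 0 ->
  measurable D -> measurable_fun D g ->
  Rintegral mu2 D g =
  `|h * k| * Rintegral mu2 (affmap x y h k @^-1` D) (g \o affmap x y h k).
Proof.
move=> h0 k0 mD mg.
have mgE : measurable_fun D (EFin \o g) by exact/measurable_EFinP.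
have Hp := @ge0_integral_affmap x y h k D _ h0 k0 mD (measurable_funepos mgE) (fun p _ => funepos_ge0 _ p).
have Hn := @ge0_integral_affmap x y h k D _ h0 k0 mD (measurable_funeneg mgE) (fun p _ => funeneg_ge0 _ p).
have k_gt0 : 0 < `|h * k| by rewrite normr_gt0 mulf_neq0.
(* Valid for infinite values as well, so the change of variables needs measurability of [g] but no
   integrability. *)
have A (a b : \bar R) : fine (`|h * k|%:E * a - `|h * k|%:E * b)%E =
    `|h * k| * fine (a - b)%E.
  have kE : (0%R%:E < `|h * k|%:E)%E by rewrite lte_fin.
  move: a b => [a| |] [b| |]; rewrite ?(gt0_muley kE) ?(gt0_muleNy kE)/= ?mulr0//.
  exact/esym/mulrBr.
rewrite /Rintegral integralE Hp Hn A; apply: (congr1 (fun z => `|h * k| * fine z)).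
symmetry; rewrite integralE; congr (_ - _)%E; apply: eq_integral => p _.
  by rewrite -[LHS]/((((EFin \o g) \o affmap x y h k)^\+)%E p) funepos_comp.
by rewrite -[LHS]/((((EFin \o g) \o affmap x y h k)^\-)%E p) funeneg_comp.
Qed.

Definition tref : set (R * R) := [set p | [/\ 0 < p.1, 0 < p.2 & p.1 + p.2 < 1]].

Lemma open_tref : open tref.
Proof.
have -> : tref = fst @^-1` [set x | 0 < x] `&` snd @^-1` [set x | 0 < x] `&`
    (fun p : R * R => p.1 + p.2) @^-1` [set x | x < 1].
  by apply/seteqP; split=> p /=; [case|case=> -[]].
by apply: openI; [apply: openI|]; apply: open_comp;
  first [exact: open_gt|exact: open_lt|move=> p _; exact: cvg_fst
    |move=> p _; exact: cvg_snd
    |move=> p _; apply: cvgD; [exact: cvg_fst|exact: cvg_snd]].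
Qed.

Lemma measurable_tref : measurable tref.
Proof. apply: open_measurable2; exact: open_tref. Qed.

Lemma tref_lty : (mu2 tref < +oo)%E.
Proof.
apply: (@le_lt_trans _ _ (mu2 (`]0, 1[ `*` `]0, 1[))).
  apply: le_measure; rewrite ?inE//.
  - exact: measurable_tref.
  - by apply: measurableX; exact: measurable_itv.
  - by move=> -[s t] [/= s0 t0 st]; split; rewrite /= in_itv/=; lra.
rewrite product_measure1E; [|exact: measurable_itv..].
rewrite /= lebesgue_measure_itv/= lte_fin ltr01 -EFinD -EFinM.
exact: ltry.
Qed.

Lemma pairl_continuous (t : R) : continuous (fun s : R => (s, t)).
Proof.
move=> s; apply: (@cvg_pair _ _ _ (nbhs s) (nbhs s) (nbhs t)).
  exact: cvg_id.
exact: cvg_cst.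
Qed.

Lemma pairr_continuous (s : R) : continuous (fun t : R => (s, t)).
Proof.
move=> t; apply: (@cvg_pair _ _ _ (nbhs t) (nbhs s) (nbhs t)).
  exact: cvg_cst.
exact: cvg_id.
Qed.

Lemma cbounded_integrable_oo (a b : R) (f : R -> R) :
  (forall x, a < x < b -> {for x, continuous f}) ->
  (exists M, forall x, a < x < b -> `|f x| <= M) ->
  leb.-integrable `]a, b[ (EFin \o f).
Proof.
move=> cf [M fM]; apply: measurable_bounded_integrable => //.
- rewrite /= lebesgue_measure_itv/= lte_fin; case: ifP => // _.
  by rewrite -EFinD ltry.
- apply: open_continuous_measurable_fun; first exact: interval_open.
  by move=> x /set_mem/=; rewrite in_itv/=; exact: cf.
- exists M; split; first exact: num_real.
  move=> x Mx p; rewrite /= in_itv/= => /fM H.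
  exact: le_trans H (ltW Mx).
Qed.

Lemma Rintegral_tref_xE g : cbounded tref g ->
  Rintegral mu2 tref g =
  Rintegral leb `]0, 1[ (fun t => Rintegral leb `]0, 1 - t[ (fun s => g (s, t))).
Proof.
move=> cg.
have ig := cbounded_integrable open_tref tref_lty cg.
have iG : mu2.-integrable setT ((EFin \o g) \_ tref).
  by have [+ _] := @integrable_mkcond _ _ _ mu2 tref (EFin \o g) measurable_tref; apply.
rewrite /Rintegral integral_mkcond -(integral21_prod_meas1 iG).
rewrite [in RHS]integral_mkcond; congr fine; apply: eq_integral => t _.
rewrite patchE; case: ifPn => [/set_mem/=|/negP tn]; last first.
  apply: integral0_eq => s _; rewrite patchE ifF//; apply/negP => /set_mem[/= s0 t0 st].
  by apply: tn; apply/mem_set; rewrite /= in_itv/=; lra.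
rewrite in_itv/= => /andP[t0 t1].
transitivity (\int[leb]_(s in `]0%R, (1 - t)%R[) (g (s, t))%:E)%E.
  rewrite [RHS]integral_mkcond; apply: eq_integral => s _.
  rewrite !patchE; congr (if _ then _ else _).
  by apply/idP/idP => /set_mem H; apply/mem_set; move: H; rewrite /tref/= in_itv/=;
    [move=> [? ? ?]; lra|move=> /andP[? ?]; split; lra].
rewrite fineK//; apply: integrable_fin_num => //.
case: cg => cg [M gM]; apply: (@cbounded_integrable_oo _ _ (fun s => g (s, t))).
- move=> s st; apply: (@continuous_comp _ _ _ (fun s => (s, t)) g).
    exact: pairl_continuous.
  by apply: cg; split=> /=; lra.
- by exists M => s st; apply: gM; split=> /=; lra.
Qed.

Lemma Rintegral_tref_yE g : cbounded tref g ->
  Rintegral mu2 tref g =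
  Rintegral leb `]0, 1[ (fun s => Rintegral leb `]0, 1 - s[ (fun t => g (s, t))).
Proof.
move=> cg.
have ig := cbounded_integrable open_tref tref_lty cg.
have iG : mu2.-integrable setT ((EFin \o g) \_ tref).
  by have [+ _] := @integrable_mkcond _ _ _ mu2 tref (EFin \o g) measurable_tref; apply.
rewrite /Rintegral integral_mkcond -(integral12_prod_meas1 iG).
rewrite [in RHS]integral_mkcond; congr fine; apply: eq_integral => s _.
rewrite patchE; case: ifPn => [/set_mem/=|/negP sn]; last first.
  apply: integral0_eq => t _; rewrite patchE ifF//; apply/negP => /set_mem[/= s0 t0 st].
  by apply: sn; apply/mem_set; rewrite /= in_itv/=; lra.
rewrite in_itv/= => /andP[s0 s1].
transitivity (\int[leb]_(t in `]0%R, (1 - s)%R[) (g (s, t))%:E)%E.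
  rewrite [RHS]integral_mkcond; apply: eq_integral => t _.
  rewrite !patchE; congr (if _ then _ else _).
  by apply/idP/idP => /set_mem H; apply/mem_set; move: H; rewrite /tref/= in_itv/=;
    [move=> [? ? ?]; lra|move=> /andP[? ?]; split; lra].
rewrite fineK//; apply: integrable_fin_num => //.
case: cg => cg [M gM]; apply: (@cbounded_integrable_oo _ _ (fun t => g (s, t))).
- move=> t st; apply: (@continuous_comp _ _ _ (fun t => (s, t)) g).
    exact: pairr_continuous.
  by apply: cg; split=> /=; lra.
- by exists M => t st; apply: gM; split=> /=; lra.
Qed.

Lemma Rintegral_FTC (a b : R) (F f : R -> R) : a < b ->
  {within `[a, b], continuous F} -> {within `[a, b], continuous f} ->
  (forall x, a < x < b -> is_derive x 1 F (f x)) ->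
  Rintegral leb `]a, b[ f = F b - F a.
Proof.
move=> ab cF cf dF; have [cFo cFa cFb] := (continuous_within_itvP F ab).1 cF.
have cfo : {in `]a, b[, continuous f} by have [] := (continuous_within_itvP f ab).1 cf.
have mf : measurable_fun `]a, b[ f.
  by apply: open_continuous_measurable_fun; [exact: interval_open|move=> x /set_mem; exact: cfo].
rewrite /Rintegral -(@integral_itv_bndoo _ _ _ _ true false); last exact/measurable_EFinP.
rewrite (@continuous_FTC2 _ f F a b ab cf)//.
  by split=> // x /[!in_itv]/= /dF [].
by move=> x /[!in_itv]/= /dF H; rewrite derive1E derive_val.
Qed.

(** Green's formula on the reference triangle: integrating along horizontal lines leaves the
    hypotenuse and the vertical leg. *)
Lemma Rintegral_tref_dx F G : cbounded tref G ->
  (forall t, 0 < t < 1 -> [/\ {within `[0, 1 - t], continuous (fun s => F (s, t))},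
     {within `[0, 1 - t], continuous (fun s => G (s, t))} &
     forall s, 0 < s < 1 - t -> is_derive s 1 (fun s => F (s, t)) (G (s, t))]) ->
  Rintegral mu2 tref G = Rintegral leb `]0, 1[ (fun t => F (1 - t, t) - F (0, t)).
Proof.
move=> cG H; rewrite Rintegral_tref_xE//; apply: eq_Rintegral => t /set_mem/=.
rewrite in_itv/= => t01; have [cF cGt dF] := H _ t01.
by rewrite (Rintegral_FTC _ cF cGt dF)//; lra.
Qed.

Lemma Rintegral_tref_dy F G : cbounded tref G ->
  (forall s, 0 < s < 1 -> [/\ {within `[0, 1 - s], continuous (fun t => F (s, t))},
     {within `[0, 1 - s], continuous (fun t => G (s, t))} &
     forall t, 0 < t < 1 - s -> is_derive t 1 (fun t => F (s, t)) (G (s, t))]) ->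
  Rintegral mu2 tref G = Rintegral leb `]0, 1[ (fun s => F (s, 1 - s) - F (s, 0)).
Proof.
move=> cG H; rewrite Rintegral_tref_yE//; apply: eq_Rintegral => s /set_mem/=.
rewrite in_itv/= => s01; have [cF cGt dF] := H _ s01.
by rewrite (Rintegral_FTC _ cF cGt dF)//; lra.
Qed.

End plane_integral.

(** * Integrals over a partition up to a null set *)

Section almost_partition.
Local Open Scope ereal_scope.
Context d (T : measurableType d) (R : realType) (mu : {measure set T -> \bar R}).
Import HBNNSimple.

(* [f] need not be measurable: [\int] is a lower integral on nonnegative
   functions, which does not see the null set [D `\` U]. *)
Lemma ge0_integral_ae_subset (D U : set T) (f : T -> \bar R) :
  measurable D -> measurable U -> U `<=` D -> mu (D `\` U) = 0 ->
  (forall x, 0 <= f x) -> \int[mu]_(x in D) f x = \int[mu]_(x in U) f x.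
Proof.
move=> mD mU UD DU0 f0; have f0' (V : set T) x : 0 <= (f \_ V) x.
  by rewrite patchE; case: ifP.
rewrite !ge0_integralE; [|by move=> x _; exact: f0..].
apply/eqP; rewrite eq_le; apply/andP; split.
  apply: ge_ereal_sup => _ [h hf <-].
  apply: ereal_sup_ubound; exists (proj_nnsfun h mU).
    move=> x; rewrite -mrestrict !patchE; case: ifPn => // xU.
    by apply: le_trans (hf x) _; rewrite patchE ifT//; apply/mem_set/UD/set_mem.
  rewrite -mrestrict -integral_nnsfun// -integralT_nnsfun.
  have mN : measurable (D `\` U) by exact: measurableD.
  rewrite (ge0_negligible_integral mN measurableT)//; last 2 first.
    exact/measurable_EFinP.
    by move=> x _; rewrite lee_fin.
  rewrite integral_mkcond [RHS]integral_mkcond; apply: eq_integral => x _.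
  rewrite !patchE; case: ifPn => xU; case: ifPn => // xD.
    by move: xD => /negP[]; apply/mem_set; split=> // -[_]; apply; exact/set_mem.
  have xD' : x \notin D.
    apply/negP => /set_mem Dx; move/set_mem : xD => -[_]; apply; split => // Ux.
    by move/negP: xU; apply; exact/mem_set.
  have h_le0 : (h x <= 0)%R.
    by have := hf x; rewrite patchE (negbTE xD') lee_fin.
  have h_ge0 : (0 <= h x)%R by exact: fun_ge0.
  by have -> : h x = 0%R by apply/eqP; rewrite eq_le h_le0 h_ge0.
apply: ge_ereal_sup => _ [h hf <-]; apply: ereal_sup_ubound; exists h => //.
move=> x; apply: le_trans (hf x) _; rewrite !patchE; case: ifPn => xU.
  by rewrite ifT//; apply/mem_set/UD/set_mem.
by have := f0' D x; rewrite patchE.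
Qed.

Lemma integral_ae_subset (D U : set T) (f : T -> \bar R) :
  measurable D -> measurable U -> U `<=` D -> mu (D `\` U) = 0 ->
  \int[mu]_(x in D) f x = \int[mu]_(x in U) f x.
Proof.
by move=> mD mU UD DU0; rewrite integralE [RHS]integralE; congr (_ - _);
  exact: ge0_integral_ae_subset.
Qed.

(** Pieces of full total measure miss only a null set. [f] is constrained on the pieces alone: the
    gradient of a piecewise linear function is not controlled on the edges, so measurability on [D]
    cannot be asked for. *)
Lemma Rintegral_ae_partition (I : finType) (D : set T) (F : I -> set T) (f : T -> R) :
  measurable D -> mu D < +oo -> (forall i, measurable (F i)) ->
  trivIset setT F -> (forall i, F i `<=` D) ->
  mu D = \sum_(i : I) mu (F i) ->
  (forall i, mu.-integrable (F i) (EFin \o f)) ->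
  Rintegral mu D f = (\sum_(i : I) Rintegral mu (F i) f)%R.
Proof.
move=> mD Doo mF tF FD muD intf.
pose U := \big[setU/set0]_(i <- index_enum I) F i.
have mU : measurable U by exact: bigsetU_measurable.
have UE : U = \bigcup_(i in setT) F i.
  by rewrite /U -bigcup_seq; apply: eq_bigcupl; split => // i _ /=; rewrite mem_index_enum.
have UD : U `<=` D by rewrite UE => x [i _]; exact: FD.
have tF' : trivIset [set` index_enum I] F by apply: sub_trivIset tF.
have muU : mu U = mu D.
  have := @ge0_integral_bigsetU _ T R mu I F (cst 1) (index_enum I) mF
    (index_enum_uniq I) tF' (measurable_cst _) (fun _ _ => lee01).
  rewrite /= integral_cst// mul1e muD => ->.
  by apply: eq_bigr => i _; rewrite integral_cst// mul1e.
have DU0 : mu (D `\` U) = 0.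
  have DU : D `&` U = U by rewrite setIC; exact/setIidPl.
  transitivity (mu D - mu U); first by rewrite measureD// DU.
  by rewrite muU subee// ge0_fin_numE.
have mf : measurable_fun U (EFin \o f).
  move=> _ Y mY; rewrite UE setI_bigcupl; apply: fin_bigcup_measurable => //.
  by move=> i _; have /integrableP[mfi _] := intf i; exact: mfi.
rewrite /Rintegral (@integral_ae_subset D U)// integral_bigsetU_EFin//.
by rewrite -sum_fine// => i _; exact: integrable_fin_num.
exact: index_enum_uniq.
Qed.
End almost_partition.

(** * Triangulations of the unit square *)

(** Geometry, Green's formula and the error identity hold on any tensor-product grid; the particular
    Shishkin points enter later, through step sizes and areas. *)
Record is_mesh {R : realType} (N : nat) (xs ys : nat -> R) : Prop := IsMesh {
  mesh_xs0 : xs 0%N = 0;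
  mesh_xsN : xs N = 1;
  mesh_ys0 : ys 0%N = 0;
  mesh_ysN : ys N = 1;
  mesh_xs_lt : forall i, (i < N)%N -> xs i < xs i.+1;
  mesh_ys_lt : forall j, (j < N)%N -> ys j < ys j.+1 }.

Section mesh.
Context {R : realType}.
Local Notation mu2 := (leb2 R).
Variables (N : nat) (xs ys : nat -> R).
Hypothesis M : is_mesh N xs ys.
Let xs0 := mesh_xs0 M.
Let xsN := mesh_xsN M.
Let ys0 := mesh_ys0 M.
Let ysN := mesh_ysN M.
Let xs_lt := mesh_xs_lt M.
Let ys_lt := mesh_ys_lt M.

Definition stepx i := xs i.+1 - xs i.
Definition stepy j := ys j.+1 - ys j.

Lemma hx_gt0 i : (i < N)%N -> 0 < stepx i. Proof. by move=> /xs_lt; rewrite /stepx subr_gt0. Qed.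
Lemma hy_gt0 j : (j < N)%N -> 0 < stepy j. Proof. by move=> /ys_lt; rewrite /stepy subr_gt0. Qed.

(* Vertex of the right angle and signed side lengths: with these the upper
   triangle K^2 is the point reflection of a lower one. *)
Definition cornx (K : elt N) := if K.2 then xs K.1.1 else xs K.1.1.+1.
Definition corny (K : elt N) := if K.2 then ys K.1.2 else ys K.1.2.+1.
Definition legx (K : elt N) := if K.2 then stepx K.1.1 else - stepx K.1.1.
Definition legy (K : elt N) := if K.2 then stepy K.1.2 else - stepy K.1.2.

Definition refmap (K : elt N) : R * R -> R * R := affmap (cornx K) (corny K) (legx K) (legy K).
Definition Kinv (K : elt N) (p : R * R) : R * R :=
  ((p.1 - cornx K) / legx K, (p.2 - corny K) / legy K).
Definition open_tri (K : elt N) : set (R * R) := Kinv K @^-1` tref.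
Definition tri_area (K : elt N) := stepx K.1.1 * stepy K.1.2 / 2.

Lemma legx_neq0 K : legx K != 0.
Proof. by rewrite /legx; have := hx_gt0 (ltn_ord K.1.1); case: K.2 => h; lra. Qed.
Lemma legy_neq0 K : legy K != 0.
Proof. by rewrite /legy; have := hy_gt0 (ltn_ord K.1.2); case: K.2 => h; lra. Qed.

Lemma norm_legs K : `|legx K * legy K| = 2 * tri_area K.
Proof.
have h := hx_gt0 (ltn_ord K.1.1); have k := hy_gt0 (ltn_ord K.1.2).
rewrite /legx /legy /tri_area; case: K.2; rewrite normrM ?normrN !gtr0_norm//; lra.
Qed.

Lemma area_gt0 K : 0 < tri_area K.
Proof.
have h := hx_gt0 (ltn_ord K.1.1); have k := hy_gt0 (ltn_ord K.1.2).
by rewrite /tri_area divr_gt0// mulr_gt0.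
Qed.

Lemma Kinv_map K p : Kinv K (refmap K p) = p.
Proof.
have h := legx_neq0 K; have k := legy_neq0 K.
by case: p => s t; rewrite /Kinv /refmap /affmap/=; congr pair; field.
Qed.

Lemma refmap_inv K p : refmap K (Kinv K p) = p.
Proof.
have h := legx_neq0 K; have k := legy_neq0 K.
by case: p => s t; rewrite /Kinv /refmap /affmap/=; congr pair; field.
Qed.

Lemma refmap_otri K p : open_tri K (refmap K p) <-> tref p.
Proof. by rewrite /open_tri /preimage /mkset Kinv_map. Qed.

Lemma refmap_preimage_otri K : refmap K @^-1` open_tri K = tref.
Proof. by apply/seteqP; split=> p; rewrite /open_tri /preimage /mkset Kinv_map. Qed.

Lemma refmap_continuous K : continuous (refmap K).
Proof.
move=> p; apply: (@cvg_pair _ _ _ (nbhs p) (nbhs (refmap K p).1) (nbhs (refmap K p).2)).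
  by apply: cvgD; [exact: cvg_cst|apply: cvgM; [exact: cvg_cst|exact: cvg_fst]].
by apply: cvgD; [exact: cvg_cst|apply: cvgM; [exact: cvg_cst|exact: cvg_snd]].
Qed.

Lemma Kinv_continuous K : continuous (Kinv K).
Proof.
move=> p; apply: (@cvg_pair _ _ _ (nbhs p) (nbhs (Kinv K p).1) (nbhs (Kinv K p).2)).
  by apply: cvgM; [apply: cvgD; [exact: cvg_fst|exact: cvg_cst]|exact: cvg_cst].
by apply: cvgM; [apply: cvgD; [exact: cvg_snd|exact: cvg_cst]|exact: cvg_cst].
Qed.

Lemma open_otri K : open (open_tri K).
Proof. by apply: open_comp => [p _|]; [exact: Kinv_continuous|exact: open_tref]. Qed.

Lemma measurable_otri K : measurable (open_tri K).
Proof. by apply: open_measurable2; exact: open_otri. Qed.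

Lemma Rintegral_otri K (g : R * R -> R) : measurable_fun (open_tri K) g ->
  Rintegral mu2 (open_tri K) g = 2 * tri_area K * Rintegral mu2 tref (g \o refmap K).
Proof.
move=> mg; have h := legx_neq0 K; have k := legy_neq0 K.
rewrite (Rintegral_affmap (cornx K) (corny K) h k (measurable_otri K) mg) norm_legs.
by rewrite -/(refmap K) refmap_preimage_otri.
Qed.

(** The constant 1 is the x-derivative of the first coordinate, so Green's formula reduces the area
    to the integral of 1 - t. *)
Lemma mu2_tref : mu2 tref = (1 / 2)%:E.
Proof.
have H1 := @Rintegral_cst _ _ R mu2 tref (@measurable_tref R) 1.
have H2 := @Rintegral_tref_dx R (fun p => p.1) (fun=> 1) (cbounded_cst _ 1).
rewrite mul1r in H1.
rewrite -[LHS]fineK ?ge0_fin_numE ?tref_lty// -H1 H2.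
  congr EFin; rewrite /=.
  have dF (t : R) : is_derive t 1 (fun t => t - t * t / 2) (1 - t - 0).
    have H := is_derive1B (is_derive1_id t) (is_derive1M (is_derive1M
      (is_derive1_id t) (is_derive1_id t)) (is_derive1_cst t (2^-1))).
    by apply: is_derive_eq H _; lra.
  have df (t : R) : is_derive t 1 (fun t => 1 - t - 0) (- 1).
    have H := is_derive1B (is_derive1B (is_derive1_cst t 1) (is_derive1_id t))
       (is_derive1_cst t 0).
    by apply: is_derive_eq H _; lra.
  rewrite (Rintegral_FTC ltr01 (derivable_within dF) (derivable_within df))//.
  lra.
move=> t t01; split=> /=.
- exact: derivable_within (fun s => is_derive1_id s).
- exact: within_cst.
- by move=> s _; exact: is_derive1_id.
Qed.

Lemma mu2_otri K : mu2 (open_tri K) = (tri_area K)%:E.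
Proof.
have h := legx_neq0 K; have k := legy_neq0 K.
rewrite (leb2_affmap_preimage (cornx K) (corny K) h k (measurable_otri K)) norm_legs.
rewrite -/(refmap K) refmap_preimage_otri mu2_tref -EFinM; congr EFin; lra.
Qed.

Lemma xs_le i k : (i <= k <= N)%N -> xs i <= xs k.
Proof.
move=> /andP[ik kN]; elim: k ik kN => [|k IH]; first by rewrite leqn0 => /eqP->.
rewrite leq_eqVlt => /predU1P[->//|ik kN].
exact: le_trans (IH ik (ltnW kN)) (ltW (xs_lt kN)).
Qed.

Lemma ys_le i k : (i <= k <= N)%N -> ys i <= ys k.
Proof.
move=> /andP[ik kN]; elim: k ik kN => [|k IH]; first by rewrite leqn0 => /eqP->.
rewrite leq_eqVlt => /predU1P[->//|ik kN].
exact: le_trans (IH ik (ltnW kN)) (ltW (ys_lt kN)).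
Qed.

Lemma refmap_box (K : elt N) (s t : R) : 0 <= s -> 0 <= t -> s + t <= 1 ->
  [/\ xs K.1.1 <= (refmap K (s, t)).1, (refmap K (s, t)).1 <= xs K.1.1.+1,
      ys K.1.2 <= (refmap K (s, t)).2 & (refmap K (s, t)).2 <= ys K.1.2.+1].
Proof.
move=> s0 t0 st; have h := hx_gt0 (ltn_ord K.1.1); have k := hy_gt0 (ltn_ord K.1.2).
have hs0 : 0 <= stepx K.1.1 * s by rewrite mulr_ge0// ltW.
have ht0 : 0 <= stepy K.1.2 * t by rewrite mulr_ge0// ltW.
have hs1 : stepx K.1.1 * s <= stepx K.1.1 by apply: ler_piMr; [exact: ltW|lra].
have ht1 : stepy K.1.2 * t <= stepy K.1.2 by apply: ler_piMr; [exact: ltW|lra].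
have e1 : xs K.1.1.+1 = xs K.1.1 + stepx K.1.1 by rewrite /stepx subrKC.
have e2 : ys K.1.2.+1 = ys K.1.2 + stepy K.1.2 by rewrite /stepy subrKC.
by rewrite /refmap /affmap /cornx /corny /legx /legy /=; case: K.2; split; rewrite ?mulNr; lra.
Qed.

Lemma otri_box (K : elt N) (p : R * R) : open_tri K p ->
  [/\ xs K.1.1 < p.1, p.1 < xs K.1.1.+1, ys K.1.2 < p.2 & p.2 < ys K.1.2.+1].
Proof.
rewrite -{2 3 4 5}(refmap_inv K p) /open_tri /preimage /mkset; case: (Kinv K p) => s t [/= s0 t0 st].
have h := hx_gt0 (ltn_ord K.1.1); have k := hy_gt0 (ltn_ord K.1.2).
have hs0 : 0 < stepx K.1.1 * s by rewrite mulr_gt0.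
have ht0 : 0 < stepy K.1.2 * t by rewrite mulr_gt0.
have hs1 : stepx K.1.1 * s < stepx K.1.1 by rewrite gtr_pMr//; lra.
have ht1 : stepy K.1.2 * t < stepy K.1.2 by rewrite gtr_pMr//; lra.
have e1 : xs K.1.1.+1 = xs K.1.1 + stepx K.1.1 by rewrite /stepx subrKC.
have e2 : ys K.1.2.+1 = ys K.1.2 + stepy K.1.2 by rewrite /stepy subrKC.
by rewrite /refmap /affmap /cornx /corny /legx /legy /=; case: K.2; split; rewrite ?mulNr; lra.
Qed.

Lemma xs_cell_inj i k (z : R) : (i < N)%N -> (k < N)%N -> xs i < z < xs i.+1 ->
  xs k < z < xs k.+1 -> i = k.
Proof.
move=> iN kN zi zk; apply/eqP; rewrite eqn_leq; apply/andP; split; rewrite leqNgt;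
  apply/negP => ik.
- by have := @xs_le k.+1 i; rewrite ik ltnW// => /(_ isT); lra.
- by have := @xs_le i.+1 k; rewrite ik ltnW// => /(_ isT); lra.
Qed.

Lemma ys_cell_inj i k (z : R) : (i < N)%N -> (k < N)%N -> ys i < z < ys i.+1 ->
  ys k < z < ys k.+1 -> i = k.
Proof.
move=> iN kN zi zk; apply/eqP; rewrite eqn_leq; apply/andP; split; rewrite leqNgt;
  apply/negP => ik.
- by have := @ys_le k.+1 i; rewrite ik ltnW// => /(_ isT); lra.
- by have := @ys_le i.+1 k; rewrite ik ltnW// => /(_ isT); lra.
Qed.

Lemma trivIset_otri : trivIset setT open_tri.
Proof.
move=> K L _ _ [p [pK pL]].
have [a1 a2 a3 a4] := otri_box pK; have [b1 b2 b3 b4] := otri_box pL.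
case: K L pK pL a1 a2 a3 a4 b1 b2 b3 b4 => [[i j] l] [[i' j'] l'] /= pK pL *.
have ii : i = i'.
  by apply/val_inj/(@xs_cell_inj _ _ p.1) => //=; apply/andP; split.
have jj : j = j'.
  by apply/val_inj/(@ys_cell_inj _ _ p.2) => //=; apply/andP; split.
rewrite -{}ii -{}jj in pL *.
have h := hx_gt0 (ltn_ord i); have k := hy_gt0 (ltn_ord j).
(* The reference coordinates for the upper triangle are 1 minus those for the lower one, so the two
   sums add up to 2 and cannot both be below 1. *)
have E : (p.1 - xs i.+1) / - stepx i + (p.2 - ys j.+1) / - stepy j =
    2 - ((p.1 - xs i) / stepx i + (p.2 - ys j) / stepy j).
  have h0 := lt0r_neq0 h; have k0 := lt0r_neq0 k.
  rewrite (_ : xs i.+1 = xs i + stepx i); last by rewrite /stepx subrKC.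
  rewrite (_ : ys j.+1 = ys j + stepy j); last by rewrite /stepy subrKC.
  by field; rewrite h0 k0.
move: pK pL; case: l; case: l' => //; rewrite /open_tri /preimage /mkset /Kinv /tref /mkset /=;
  rewrite /cornx /corny /legx /legy/= => -[? ? H1] [? ? H2]; exfalso; lra.
Qed.

Lemma big_elt (V : nmodType) (F : elt N -> V) :
  \sum_(K : elt N) F K = \sum_(i < N) \sum_(j < N) (F (i, j, true) + F (i, j, false)).
Proof.
transitivity (\sum_(i < N) \sum_(j < N) \sum_(l : bool) F (i, j, l)).
  rewrite (pair_bigA _ (fun i j => \sum_(l : bool) F (i, j, l)))/=.
  rewrite (pair_bigA _ (fun p l => F (p.1, p.2, l)))/=.
  by apply: eq_bigr => -[[i j] l].
by apply: eq_bigr => i _; apply: eq_bigr => j _; rewrite big_bool.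
Qed.

Lemma sum_hx : \sum_(i < N) stepx i = 1.
Proof.
by rewrite -(big_mkord xpredT stepx) telescope_sumr// xsN xs0 subr0.
Qed.

Lemma sum_hy : \sum_(j < N) stepy j = 1.
Proof.
by rewrite -(big_mkord xpredT stepy) telescope_sumr// ysN ys0 subr0.
Qed.

Lemma sum_area : \sum_(K : elt N) tri_area K = 1.
Proof.
rewrite big_elt -[RHS]mulr1 -{1}sum_hx -{1}sum_hy mulr_suml; apply: eq_bigr => i _.
by rewrite mulr_sumr; apply: eq_bigr => j _; rewrite /tri_area/=; lra.
Qed.

Lemma measurable_Omega : measurable (@Omega R).
Proof. by apply: measurableX; exact: measurable_itv. Qed.

Lemma mu2_Omega : mu2 Omega = 1%E.
Proof.
rewrite product_measure1E; [|exact: measurable_itv..].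
by rewrite /= lebesgue_measure_itv/= lte_fin ltr01 -EFinD -EFinM subr0 mulr1.
Qed.

Lemma otri_Omega K : open_tri K `<=` Omega.
Proof.
move=> p /otri_box[a1 a2 a3 a4].
have [i0 i1] := (ltn_ord K.1.1, ltn_ord K.1.2).
have := @xs_le 0 K.1.1; have := @xs_le K.1.1.+1 N.
have := @ys_le 0 K.1.2; have := @ys_le K.1.2.+1 N.
rewrite !leqnn !i0 !i1 !(ltnW i0) !(ltnW i1) xs0 xsN ys0 ysN => /(_ isT) ? /(_ isT) ? /(_ isT) ? /(_ isT) ?.
by split; rewrite /= in_itv/=; lra.
Qed.

Lemma Rintegral_Omega (f : R * R -> R) (g : elt N -> R * R -> R) :
  (forall K, cbounded (open_tri K) (g K)) ->
  (forall K p, open_tri K p -> f p = g K p) ->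
  Rintegral mu2 Omega f = \sum_(K : elt N) Rintegral mu2 (open_tri K) (g K).
Proof.
move=> cg fg; rewrite (@Rintegral_ae_partition _ _ _ mu2 (elt N) Omega open_tri).
- by apply: eq_bigr => K _; apply: eq_Rintegral => p /set_mem; exact: fg.
- exact: measurable_Omega.
- exact: (eq_ind_r (fun z => (z < +oo)%E) (ltry 1) mu2_Omega).
- exact: measurable_otri.
- exact: trivIset_otri.
- exact: otri_Omega.
- transitivity (1%:E : \bar R); first exact: mu2_Omega.
  rewrite -sum_area -sumEFin; apply: eq_bigr => K _.
  exact/esym/mu2_otri.
- move=> K; apply: (@eq_integrable _ _ _ mu2 _ (measurable_otri K) (EFin \o g K)).
    by move=> p /set_mem pK; rewrite /= (fg K).
  by apply: cbounded_integrable => //; [exact: open_otri|exact: (eq_ind_r (fun z => (z < +oo)%E) (ltry _) (mu2_otri K))].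
Qed.

Definition closed_tri (K : elt N) : set (R * R) := [set p | let q := Kinv K p in
  [/\ 0 <= q.1, 0 <= q.2 & q.1 + q.2 <= 1]].

Lemma otri_ctri K : open_tri K `<=` closed_tri K.
Proof. by move=> p [? ? ?]; split; exact: ltW. Qed.

Lemma interior_ctri K : (closed_tri K)° = open_tri K.
Proof.
apply/seteqP; split; last first.
  by rewrite -open_subsetE; [exact: otri_ctri|exact: open_otri].
move=> p /nbhs_ballP[e /= e0 eK].
have h := legx_neq0 K; have k := legy_neq0 K.
pose d := e / (2 * (1 + `|legx K| + `|legy K|)).
have D0 : 0 < 1 + `|legx K| + `|legy K|.
  by have := normr_ge0 (legx K); have := normr_ge0 (legy K); lra.
have d0 : 0 < d by rewrite /d divr_gt0// mulr_gt0.
have dE : d * (1 + `|legx K| + `|legy K|) = e / 2 by rewrite /d; field; rewrite lt0r_neq0.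
have bnd z : 0 <= z -> z <= `|legx K| + `|legy K| -> z * d < e.
  move=> z0 z1; have : z * d <= (1 + `|legx K| + `|legy K|) * d by rewrite ler_pM2r//; lra.
  by rewrite [X in _ <= X]mulrC dE; lra.
(* Moving along the vector of the two legs adds the same number to both reference coordinates. A
   step [d] forwards and one backwards stay in the closed triangle, which makes all three
   inequalities strict. *)
have key (c : R) : `|c| = d -> closed_tri K (p.1 + legx K * c, p.2 + legy K * c).
  move=> cd; apply: eK; split; rewrite /ball/=;
    [rewrite (_ : p.1 - _ = - (legx K * c)); last by lra|
     rewrite (_ : p.2 - _ = - (legy K * c)); last by lra];
    by rewrite normrN normrM cd; apply: bnd; rewrite ?normr_ge0// ?lerDl ?lerDr.
have KE c : Kinv K (p.1 + legx K * c, p.2 + legy K * c) = ((Kinv K p).1 + c, (Kinv K p).2 + c).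
  by rewrite /Kinv/=; congr pair; field.
have := key d (gtr0_norm d0); have := key (- d); rewrite normrN (gtr0_norm d0) => /(_ erefl).
rewrite /closed_tri /mkset !KE /open_tri /preimage /mkset.
by case: (Kinv K p) => s t /= [? ? ?] [? ? ?]; split=> /=; lra.
Qed.

Definition gtri (K : elt N) : set (R * R) :=
  let: (i, j, lower) := K in
  if lower then triangle (xs i, ys j) (xs i.+1, ys j) (xs i, ys j.+1)
  else triangle (xs i, ys j.+1) (xs i.+1, ys j) (xs i.+1, ys j.+1).

Lemma gtriE K : gtri K = closed_tri K.
Proof.
case: K => [[i j] l]; have h := hx_gt0 (ltn_ord i); have k := hy_gt0 (ltn_ord j).
have [h0 k0] := (lt0r_neq0 h, lt0r_neq0 k).
apply/seteqP; split=> p.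
- case: l => -[s [t [s0 t0 st ->]]]; rewrite /closed_tri /mkset /Kinv /cornx /corny /legx /legy/=.
    have -> : (xs i + s * (xs i.+1 - xs i) + t * (xs i - xs i) - xs i) / stepx i = s.
      by rewrite -/(stepx i); field.
    have -> : (ys j + s * (ys j - ys j) + t * (ys j.+1 - ys j) - ys j) / stepy j = t.
      by rewrite -/(stepy j); field.
    by [].
  (* The given parametrization of the upper triangle starts at its upper left vertex, [Kinv] at its
     upper right one: the parameters (s, t) turn into (1 - s - t, s). *)
  have -> : (xs i + s * (xs i.+1 - xs i) + t * (xs i.+1 - xs i) - xs i.+1) / - stepx i = 1 - s - t.
    rewrite -/(stepx i) (_ : xs i.+1 = xs i + stepx i); last by rewrite /stepx; ring.
    by field.
  have -> : (ys j.+1 + s * (ys j - ys j.+1) + t * (ys j.+1 - ys j.+1) - ys j.+1) / - stepy j = s.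
    rewrite (_ : ys j.+1 = ys j + stepy j); last by rewrite /stepy; ring.
    by field.
  by split; lra.
- case: l => -[]; rewrite /Kinv /cornx /corny /legx /legy/=; set s := _ / _; set t := (p.2 - _) / _.
    move=> s0 t0 st; exists s, t; split=> //.
    rewrite [LHS]surjective_pairing; congr pair => /=.
      rewrite -[RHS]/(xs i + s * (xs i.+1 - xs i) + t * (xs i - xs i)).
      by rewrite /s (_ : xs i.+1 = xs i + stepx i); [field|rewrite /stepx; ring].
    rewrite -[RHS]/(ys j + s * (ys j - ys j) + t * (ys j.+1 - ys j)).
    by rewrite /t (_ : ys j.+1 = ys j + stepy j); [field|rewrite /stepy; ring].
  move=> s0 t0 st; exists t, (1 - s - t); split=> //; [lra|lra|].
  rewrite [LHS]surjective_pairing; congr pair => /=.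
    rewrite -[RHS]/(xs i + t * (xs i.+1 - xs i) + (1 - s - t) * (xs i.+1 - xs i)).
    by rewrite /s /t (_ : xs i.+1 = xs i + stepx i); [field; rewrite h0 k0|rewrite /stepx; ring].
  rewrite -[RHS]/(ys j.+1 + t * (ys j - ys j.+1) + (1 - s - t) * (ys j.+1 - ys j.+1)).
  by rewrite /t (_ : ys j.+1 = ys j + stepy j); [field|rewrite /stepy; ring].
Qed.

Lemma interior_gtri K : (gtri K)° = open_tri K.
Proof. by rewrite gtriE interior_ctri. Qed.

End mesh.

(** * Continuous functions on the closed square and on segments *)

Section unit_square.
Context {R : realType}.
Implicit Types g : R * R -> R.

Definition sqcont g := {within @Omega_bar R, continuous g}.

Lemma open_Omega : open (@Omega R).
Proof.
rewrite (_ : Omega = fst @^-1` `]0, 1[ `&` snd @^-1` `]0, 1[).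
  by apply: openI; apply: open_comp; first [exact: interval_open
    |move=> p _; exact: cvg_fst|move=> p _; exact: cvg_snd].
by apply/seteqP; split.
Qed.

Lemma compact_Omega_bar : compact (@Omega_bar R).
Proof. by apply: compact_setX; exact: segment_compact. Qed.

Lemma Omega_sub : @Omega R `<=` Omega_bar.
Proof. by move=> p [/= /[!in_itv]/= ? ?]; split; rewrite /= in_itv/=; lra. Qed.

Lemma sqcont_bounded g : sqcont g -> exists M, forall p, Omega_bar p -> `|g p| <= M.
Proof.
move=> cg; have /compact_bounded[M [_ H]] := continuous_compact cg compact_Omega_bar.
exists (M + 1) => p Op; apply: (H (M + 1)); first by rewrite ltrDl.
by exists p.
Qed.

Lemma sqcont_at g p : sqcont g -> Omega p -> {for p, continuous g}.
Proof.
move=> cg Op; have H := (subspace_continuousP _ _).1 cg p (Omega_sub Op).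
have Oi : (@Omega_bar R)° p.
  by apply: (filterS (@Omega_sub)); apply: open_nbhs_nbhs; split=> //; exact: open_Omega.
by rewrite within_interior in H.
Qed.

Lemma sqcont_cbounded (U : set (R * R)) g : U `<=` Omega -> sqcont g -> cbounded U g.
Proof.
move=> UO cg; split=> [p Up|]; first by apply: sqcont_at => //; exact: UO.
by have [M H] := sqcont_bounded cg; exists M => p Up; apply/H/Omega_sub/UO.
Qed.

Lemma sqcont_fst : sqcont fst.
Proof. by apply: continuous_subspaceT => x; exact: cvg_fst. Qed.
Lemma sqcont_snd : sqcont snd.
Proof. by apply: continuous_subspaceT => x; exact: cvg_snd. Qed.

Lemma sqcont_segment (g : R * R -> R) (phi : R -> R * R) (a b : R) :
  sqcont g -> continuous phi -> (forall t, a <= t <= b -> Omega_bar (phi t)) ->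
  {within `[a, b], continuous (fun t => g (phi t))}.
Proof.
move=> cg cphi H; apply: within_comp cphi _ cg => t /=; rewrite in_itv/=; exact: H.
Qed.
End unit_square.

Section segment_integral.
Context {R : realType}.
Local Notation leb := (@lebesgue_measure R).

Lemma within01_integrable (f : R -> R) : {within `[0, 1], continuous f} ->
  leb.-integrable `]0, 1[ (EFin \o f).
Proof.
move=> cf; have H := @continuous_compact_integrable R f `[0, 1] (@segment_compact R 0 1) cf.
by apply: integrableS H => //; exact: subset_itv_oo_cc.
Qed.

Lemma Rintegral01_B (f g : R -> R) : {within `[0, 1], continuous f} ->
  {within `[0, 1], continuous g} ->
  Rintegral leb `]0, 1[ (fun t => f t - g t) =
  Rintegral leb `]0, 1[ f - Rintegral leb `]0, 1[ g.
Proof. by move=> cf cg; rewrite RintegralB//; exact: within01_integrable. Qed.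

Lemma Rintegral01_Zl (a : R) (f : R -> R) : {within `[0, 1], continuous f} ->
  Rintegral leb `]0, 1[ (fun t => a * f t) = a * Rintegral leb `]0, 1[ f.
Proof. by move=> cf; rewrite RintegralZl//; exact: within01_integrable. Qed.

Lemma Rintegral01_bound (f : R -> R) (M : R) : {within `[0, 1], continuous f} ->
  (forall t, 0 < t < 1 -> `|f t| <= M) -> `|Rintegral leb `]0, 1[ f| <= M.
Proof.
move=> cf fM; have intf := within01_integrable cf.
apply: (le_trans (le_normr_Rintegral _ intf)) => //.
have -> : M = Rintegral leb `]0, 1[ (fun=> M).
  rewrite Rintegral_cst//= lebesgue_measure_itv/= lte_fin ltr01 -EFinD/=; lra.
apply: le_Rintegral => //.
- have : leb.-integrable `]0, 1[ (EFin \o (fun t => `|f t|)).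
    have := integrable_abse intf.
    by apply: eq_integrable.
  exact.
- by apply: within01_integrable; exact: within_cst.
Qed.

(** The reference maps of two neighbouring triangles run through their common edge in opposite
    directions. *)
Lemma Rintegral01_onem (f : R -> R) : {within `[0, 1], continuous f} ->
  Rintegral leb `]0, 1[ (fun t => f (1 - t)) = Rintegral leb `]0, 1[ f.
Proof.
move=> cf.
have cf1 : {within `[0, 1], continuous (fun t => f (1 - t))}.
  apply: (@within_comp R R R `[0, 1]%classic `[0, 1]%classic (fun t => 1 - t) f) => //.
    by move=> t; apply: cvgB; [exact: cvg_cst|exact: cvg_id].
  by move=> t /=; rewrite !in_itv/=; lra.
have m (g : R -> R) : {within `[0, 1], continuous g} -> measurable_fun (`]0, 1[%classic : set R) (EFin \o g).
  by move=> /within01_integrable/integrableP[].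
rewrite /Rintegral -(@integral_itv_bndoo _ _ _ _ true false); last exact: m.
rewrite -[in RHS](@integral_itv_bndoo _ _ _ _ true false); last exact: m.
rewrite [in RHS](@integration_by_substitution_onem R f 1) ?ler01 ?lexx//.
have E : forall z : R, z = 0 ->
    (\int[leb]_(t in `[0%R, 1%R]) (f (1 - t))%:E =
     \int[leb]_(t in `[z, 1%R]) (f (1 - t))%:E)%E by move=> z ->.
by rewrite (E _ (subrr 1)).
Qed.
End segment_integral.

Section tri_integral.
Context {R : realType}.
Local Notation mu2 := (leb2 R).
Variables (N : nat) (xs ys : nat -> R).
Hypothesis M : is_mesh N xs ys.
Implicit Types (K : elt N) (g F G : R * R -> R).

Definition tri_int K g := Rintegral mu2 (open_tri xs ys K) g.

Lemma sqcont_otri K g : sqcont g -> cbounded (open_tri xs ys K) g.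
Proof. exact/sqcont_cbounded/otri_Omega. Qed.

Lemma tri_int_integrable K g : cbounded (open_tri xs ys K) g -> mu2.-integrable (open_tri xs ys K) (EFin \o g).
Proof.
move=> cg; apply: cbounded_integrable => //; first exact: open_otri.
exact: (eq_ind_r (fun z => (z < +oo)%E) (ltry _) (mu2_otri M K)).
Qed.

Lemma sq_integrable K g : sqcont g -> mu2.-integrable (open_tri xs ys K) (EFin \o g).
Proof. by move=> cg; apply/tri_int_integrable/sqcont_otri. Qed.

Lemma eq_tri_int K f g : (forall p, open_tri xs ys K p -> f p = g p) -> tri_int K f = tri_int K g.
Proof. by move=> fg; apply: eq_Rintegral => p /set_mem; exact: fg. Qed.

Lemma tri_intD K f g : sqcont f -> sqcont g ->
  tri_int K (fun p => f p + g p) = tri_int K f + tri_int K g.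
Proof.
move=> cf cg; apply: RintegralD; [exact: measurable_otri|exact: sq_integrable..].
Qed.

Lemma tri_intZ K a g : sqcont g -> tri_int K (fun p => a * g p) = a * tri_int K g.
Proof.
move=> cg; apply: RintegralZl; [exact: measurable_otri|exact: sq_integrable].
Qed.

Lemma tri_intN K g : sqcont g -> tri_int K (fun p => - g p) = - tri_int K g.
Proof.
by move=> cg; rewrite -mulN1r -tri_intZ//; apply: eq_tri_int => p _; rewrite mulN1r.
Qed.

Lemma tri_intB K f g : sqcont f -> sqcont g ->
  tri_int K (fun p => f p - g p) = tri_int K f - tri_int K g.
Proof. by move=> cf cg; rewrite tri_intD ?tri_intN//; exact: within_N. Qed.

Lemma tri_int_cst K a : tri_int K (fun=> a) = a * tri_area xs ys K.
Proof.
rewrite /tri_int Rintegral_cst; last exact: measurable_otri.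
by congr (_ * _); rewrite -[RHS]/(fine (tri_area xs ys K)%:E); congr fine; exact: mu2_otri.
Qed.

Lemma tri_int_le K f g : sqcont f -> sqcont g ->
  (forall p, open_tri xs ys K p -> f p <= g p) -> tri_int K f <= tri_int K g.
Proof.
move=> cf cg H; apply: le_Rintegral; [exact: measurable_otri|exact: sq_integrable
  |exact: sq_integrable|exact: H].
Qed.

Lemma tri_int_ge0 K g : (forall p, open_tri xs ys K p -> 0 <= g p) -> 0 <= tri_int K g.
Proof. by move=> H; rewrite /tri_int; apply: Rintegral_ge0. Qed.

Lemma tri_int_bound K g B : sqcont g -> (forall p, open_tri xs ys K p -> `|g p| <= B) ->
  `|tri_int K g| <= tri_area xs ys K * B.
Proof.
move=> cg gB; rewrite mulrC -tri_int_cst ler_norml -tri_intN; last exact: within_cst.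
have cB : sqcont (fun=> B : R) by exact: within_cst.
by apply/andP; split; apply: tri_int_le => //; try exact: within_N;
  move=> p /gB; rewrite ler_norml => /andP[].
Qed.

Lemma cbounded_refmap K g : cbounded (open_tri xs ys K) g -> cbounded tref (g \o refmap xs ys K).
Proof.
move=> [cg [B gB]]; split=> [p pT|]; last first.
  by exists B => p pT; apply/gB/(refmap_otri M).
apply: continuous_comp; first exact: refmap_continuous.
by apply: cg; apply/(refmap_otri M).
Qed.

Lemma tri_int_ref K g : sqcont g ->
  tri_int K g = 2 * tri_area xs ys K * Rintegral mu2 tref (g \o refmap xs ys K).
Proof.
move=> cg; apply: Rintegral_otri => //.
by have /tri_int_integrable/integrableP[/measurable_EFinP] := sqcont_otri K cg.
Qed.

(* Comparison of the integrals over two congruent triangles, in particular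
   translates ([sg = 1]) and point reflections of each other ([sg = -1]). *)
Lemma tri_int_compare K L (sg B : R) f g : sqcont f -> sqcont g ->
  tri_area xs ys K = tri_area xs ys L ->
  (forall p, tref p -> `|f (refmap xs ys K p) - sg * g (refmap xs ys L p)| <= B) ->
  `|tri_int K f - sg * tri_int L g| <= tri_area xs ys K * B.
Proof.
move=> cf cg KL H; have A0 := area_gt0 M K.
have int g' K' : sqcont g' -> mu2.-integrable tref (EFin \o (g' \o refmap xs ys K')).
  move=> cg'; apply: cbounded_integrable; [exact: open_tref|exact: tref_lty|].
  by apply/cbounded_refmap/sqcont_otri.
have mT := @measurable_tref R.
have intZ : mu2.-integrable tref (EFin \o (fun p => sg * (g (refmap xs ys L p)))).
  have := @integrableZl _ _ _ mu2 tref mT sg _ (int _ L cg).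
  exact.
rewrite !tri_int_ref// -KL [sg * _]mulrCA -mulrBr -RintegralZl//; last exact: int.
rewrite -RintegralB//; last exact: int.
have A2 : 0 < 2 * tri_area xs ys K by lra.
rewrite (_ : tri_area xs ys K * B = 2 * tri_area xs ys K * (B / 2)); last by lra.
rewrite normrM (gtr0_norm A2) ler_pM2l//.
have HD : mu2.-integrable tref (EFin \o (fun p => f (refmap xs ys K p) - sg * g (refmap xs ys L p))).
  by have := @integrableB _ _ _ mu2 tref mT _ _ (int _ K cf) intZ.
apply: (@le_trans _ _ (Rintegral mu2 tref (fun=> B))).
  apply: (le_trans (@le_normr_Rintegral _ _ _ mu2 tref _ mT HD)).
  apply: le_Rintegral => //.
    by have := integrable_abse HD.
  apply: cbounded_integrable; [exact: open_tref|exact: tref_lty|exact: cbounded_cst].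
rewrite Rintegral_cst// (_ : fine _ = 1 / 2); first lra.
by rewrite -[RHS]/(fine (1/2)%:E); congr fine; exact: mu2_tref.
Qed.
End tri_integral.

(** * Green's formula and cancellation over interior edges *)

Section green.
Context {R : realType}.
Local Notation leb := (@lebesgue_measure R).
Variables (N : nat) (xs ys : nat -> R).
Hypothesis M : is_mesh N xs ys.
Implicit Types (K : elt N) (g F G : R * R -> R).
Local Notation hx := (stepx xs).
Local Notation hy := (stepy ys).
Local Notation area := (tri_area xs ys).
Local Notation Kmap := (refmap xs ys).
Local Notation eh := (legx xs).
Local Notation ek := (legy ys).
Local Notation ex := (cornx xs).
Local Notation ey := (corny ys).
Local Notation otri := (open_tri xs ys).
Local Notation IK := (tri_int xs ys).

Lemma box_Omega_bar (i j : nat) (p : R * R) : (i < N)%N -> (j < N)%N ->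
  xs i <= p.1 <= xs i.+1 -> ys j <= p.2 <= ys j.+1 -> Omega_bar p.
Proof.
move=> iN jN pi pj.
have := @xs_le _ _ _ _ M 0 i; have := @xs_le _ _ _ _ M i.+1 N.
have := @ys_le _ _ _ _ M 0 j; have := @ys_le _ _ _ _ M j.+1 N.
rewrite !leqnn !iN !jN !(ltnW iN) !(ltnW jN) (mesh_xs0 M) (mesh_xsN M) (mesh_ys0 M) (mesh_ysN M).
move=> /(_ isT) ? /(_ isT) ? /(_ isT) ? /(_ isT) ?.
by split; rewrite /= in_itv/=; lra.
Qed.

Lemma refmap_Omega_bar K s t : 0 <= s -> 0 <= t -> s + t <= 1 -> Omega_bar (Kmap K (s, t)).
Proof.
move=> s0 t0 st; have [a1 a2 a3 a4] := refmap_box M K s0 t0 st.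
by apply: (@box_Omega_bar K.1.1 K.1.2) => //; apply/andP.
Qed.

Lemma cont_affine2 (a b c d : R) : continuous (fun t : R => (a + b * t, c + d * t)).
Proof.
move=> t; apply: (@cvg_pair _ _ _ (nbhs t) (nbhs (a + b * t)) (nbhs (c + d * t)));
by apply: cvgD; [exact: cvg_cst|apply: cvgM; [exact: cvg_cst|exact: cvg_id]].
Qed.

Lemma segment_cont F (a b c d : R) (u v : R) : sqcont F ->
  (forall t, u <= t <= v -> Omega_bar (a + b * t, c + d * t)) ->
  {within `[u, v], continuous (fun t => F (a + b * t, c + d * t))}.
Proof. move=> cF H; exact: (@sqcont_segment R F (fun t => (a + b * t, c + d * t)) u v cF (@cont_affine2 a b c d) H). Qed.

Lemma refmap_hypE K t : Kmap K (1 - t, t) =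
  (ex K + eh K + (- eh K) * t, ey K + ek K * t).
Proof. by rewrite /refmap /affmap/=; congr pair; ring. Qed.

Lemma refmap_leftE K t : Kmap K (0, t) = (ex K + 0 * t, ey K + ek K * t).
Proof. by rewrite /refmap /affmap/=; congr pair; ring. Qed.

Lemma refmap_botE K t : Kmap K (t, 0) = (ex K + eh K * t, ey K + 0 * t).
Proof. by rewrite /refmap /affmap/=; congr pair; ring. Qed.

Lemma refmap_hyp'E K t : Kmap K (t, 1 - t) =
  (ex K + eh K * t, ey K + ek K + (- ek K) * t).
Proof. by rewrite /refmap /affmap/=; congr pair; ring. Qed.

Lemma hyp_cont K F : sqcont F -> {within `[0, 1], continuous (fun t => F (Kmap K (1 - t, t)))}.
Proof.
move=> cF; under [X in continuous X]eq_fun do rewrite refmap_hypE.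
by apply: segment_cont => // t t01; rewrite -refmap_hypE; apply: refmap_Omega_bar; lra.
Qed.

Lemma hyp'_cont K F : sqcont F -> {within `[0, 1], continuous (fun t => F (Kmap K (t, 1 - t)))}.
Proof.
move=> cF; under [X in continuous X]eq_fun do rewrite refmap_hyp'E.
by apply: segment_cont => // t t01; rewrite -refmap_hyp'E; apply: refmap_Omega_bar; lra.
Qed.

Lemma left_cont K F : sqcont F -> {within `[0, 1], continuous (fun t => F (Kmap K (0, t)))}.
Proof.
move=> cF; under [X in continuous X]eq_fun do rewrite refmap_leftE.
by apply: segment_cont => // t t01; rewrite -refmap_leftE; apply: refmap_Omega_bar; lra.
Qed.

Lemma bot_cont K F : sqcont F -> {within `[0, 1], continuous (fun t => F (Kmap K (t, 0)))}.
Proof.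
move=> cF; under [X in continuous X]eq_fun do rewrite refmap_botE.
by apply: segment_cont => // t t01; rewrite -refmap_botE; apply: refmap_Omega_bar; lra.
Qed.

(** The horizontal leg does not contribute, its normal having no x-component. The sign of [legx]
    orients the formula for both kinds of triangles. *)
Lemma tri_int_dx K F G : sqcont F -> sqcont G ->
  (forall p, otri K p -> is_derive p.1 1 (fun s => F (s, p.2)) (G p)) ->
  IK K G = 2 * area K / eh K * (Rintegral leb `]0, 1[ (fun t => F (Kmap K (1 - t, t)))
    - Rintegral leb `]0, 1[ (fun t => F (Kmap K (0, t)))).
Proof.
move=> cF cG dF; have h0 := legx_neq0 M K; rewrite (tri_int_ref M)//.
rewrite (@Rintegral_tref_dx R (fun p => (eh K)^-1 * F (Kmap K p))).
- rewrite -[RHS]mulrA; congr (_ * _); rewrite -Rintegral01_B; [|exact: hyp_cont|exact: left_cont].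
  rewrite -Rintegral01_Zl; last first.
    by apply: within_D; [exact: hyp_cont|apply: within_N; exact: left_cont].
  by apply: eq_Rintegral => t _; rewrite mulrBr.
- exact/(cbounded_refmap M)/(sqcont_otri M).
move=> t t01.
have sE g : (fun s => g (Kmap K (s, t))) =
    (fun s => g (ex K + eh K * s, (ey K + ek K * t) + 0 * s)).
  by apply/funext => s; rewrite /refmap /affmap/=; congr (g (_, _)); ring.
have cg g : sqcont g -> {within `[0, 1 - t], continuous (fun s => g (Kmap K (s, t)))}.
  move=> cg; rewrite sE; apply: segment_cont => // s st.
  have -> : (ex K + eh K * s, (ey K + ek K * t) + 0 * s) = Kmap K (s, t).
    by rewrite /refmap /affmap/=; congr pair; ring.
  by apply: refmap_Omega_bar; lra.
split.
- by apply: within_M; [exact: within_cst|exact: cg].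
- exact: cg.
move=> s st.
have := dF (Kmap K (s, t)); rewrite (refmap_otri M) => H.
have {}H : is_derive (ex K + eh K * s) 1 (fun s' => F (s', ey K + ek K * t))
  (G (Kmap K (s, t))) by apply: H; split=> /=; lra.
have := @is_derive1_comp R _ (fun s => ex K + eh K * s) s _ _ H (is_derive1_affine s _ _).
move=> /(is_derive1M (is_derive1_cst s (eh K)^-1)) D.
have {}D : is_derive s 1 (fun s => (eh K)^-1 * F (Kmap K (s, t)))
  ((eh K)^-1 * (G (Kmap K (s, t)) * eh K) + F (Kmap K (s, t)) * 0) := D.
by apply: is_derive_eq D _ => /=; field.
Qed.

Lemma tri_int_dy K F G : sqcont F -> sqcont G ->
  (forall p, otri K p -> is_derive p.2 1 (fun t => F (p.1, t)) (G p)) ->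
  IK K G = 2 * area K / ek K * (Rintegral leb `]0, 1[ (fun s => F (Kmap K (s, 1 - s)))
    - Rintegral leb `]0, 1[ (fun s => F (Kmap K (s, 0)))).
Proof.
move=> cF cG dF; have k0 := legy_neq0 M K; rewrite (tri_int_ref M)//.
rewrite (@Rintegral_tref_dy R (fun p => (ek K)^-1 * F (Kmap K p))).
- rewrite -[RHS]mulrA; congr (_ * _); rewrite -Rintegral01_B; [|exact: hyp'_cont|exact: bot_cont].
  rewrite -Rintegral01_Zl; last first.
    by apply: within_D; [exact: hyp'_cont|apply: within_N; exact: bot_cont].
  by apply: eq_Rintegral => t _; rewrite mulrBr.
- exact/(cbounded_refmap M)/(sqcont_otri M).
move=> s s01.
have tE g : (fun t => g (Kmap K (s, t))) =
    (fun t => g ((ex K + eh K * s) + 0 * t, ey K + ek K * t)).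
  by apply/funext => t; rewrite /refmap /affmap/=; congr (g (_, _)); ring.
have cg g : sqcont g -> {within `[0, 1 - s], continuous (fun t => g (Kmap K (s, t)))}.
  move=> cg; rewrite tE; apply: segment_cont => // t st.
  have -> : ((ex K + eh K * s) + 0 * t, ey K + ek K * t) = Kmap K (s, t).
    by rewrite /refmap /affmap/=; congr pair; ring.
  by apply: refmap_Omega_bar; lra.
split.
- by apply: within_M; [exact: within_cst|exact: cg].
- exact: cg.
move=> t st.
have := dF (Kmap K (s, t)); rewrite (refmap_otri M) => H.
have {}H : is_derive (ey K + ek K * t) 1 (fun t' => F (ex K + eh K * s, t'))
  (G (Kmap K (s, t))) by apply: H; split=> /=; lra.
have := @is_derive1_comp R _ (fun t => ey K + ek K * t) t _ _ H (is_derive1_affine t _ _).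
move=> /(is_derive1M (is_derive1_cst t (ek K)^-1)) D.
have {}D : is_derive t 1 (fun t => (ek K)^-1 * F (Kmap K (s, t)))
  ((ek K)^-1 * (G (Kmap K (s, t)) * ek K) + F (Kmap K (s, t)) * 0) := D.
by apply: is_derive_eq D _ => /=; field.
Qed.

(** Only values of [F] enter, with an edge length in place of the area. On coarse cells this removes
    the factor 1/eps that an x-derivative of an exponential layer costs. *)
Lemma tri_int_dx_bound K F G B : sqcont F -> sqcont G ->
  (forall p, otri K p -> is_derive p.1 1 (fun s => F (s, p.2)) (G p)) ->
  (forall p, xs K.1.1 <= p.1 <= xs K.1.1.+1 -> ys K.1.2 <= p.2 <= ys K.1.2.+1 -> `|F p| <= B) ->
  `|IK K G| <= 2 * hy K.1.2 * B.
Proof.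
move=> cF cG dF FB; rewrite (tri_int_dx cF cG dF).
have h := hx_gt0 M (ltn_ord K.1.1); have k := hy_gt0 M (ltn_ord K.1.2).
have -> : 2 * hy K.1.2 * B = hy K.1.2 * (B + B) by ring.
rewrite normrM; apply: ler_pM => //.
  rewrite /tri_area /legx; case: K.2; rewrite ?invrN ?mulrN ?normrN.
    by rewrite (_ : _ / _ = hy K.1.2) ?gtr0_norm//; field; rewrite lt0r_neq0.
  by rewrite (_ : _ / _ = hy K.1.2) ?gtr0_norm//; field; rewrite lt0r_neq0.
have key s t : 0 <= s -> 0 <= t -> s + t <= 1 -> `|F (Kmap K (s, t))| <= B.
  by move=> s0 t0 st; have [? ? ? ?] := refmap_box M K s0 t0 st; apply: FB; apply/andP.
apply: (le_trans (ler_normB _ _)); apply: lerD; apply: Rintegral01_bound.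
- exact: hyp_cont.
- by move=> t t01; apply: key; lra.
- exact: left_cont.
- by move=> t t01; apply: key; lra.
Qed.

(** Means of [F] over the left, the bottom and the diagonal edge of a rectangle. Each edge interior
    to the square occurs in two triangles, with opposite signs. *)
Let V F i j := Rintegral leb `]0, 1[ (fun t => F (xs i + 0 * t, ys j + hy j * t)).
Let W F i j := Rintegral leb `]0, 1[ (fun t => F (xs i + hx i * t, ys j + 0 * t)).
Let D F i j := Rintegral leb `]0, 1[ (fun t => F (xs i + hx i + (- hx i) * t, ys j + hy j * t)).

Lemma tri_int_dx_true (i j : 'I_N) F G : sqcont F -> sqcont G ->
  (forall p, otri (i, j, true) p -> is_derive p.1 1 (fun s => F (s, p.2)) (G p)) ->
  IK (i, j, true) G = hy j * (D F i j - V F i j).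
Proof.
move=> cF cG dF; rewrite (tri_int_dx cF cG dF).
have h := hx_gt0 M (ltn_ord i).
congr (_ * (_ - _)).
- by rewrite /tri_area /legx/=; field; rewrite lt0r_neq0.
- by apply: eq_Rintegral => t _; rewrite refmap_hypE.
- by apply: eq_Rintegral => t _; rewrite refmap_leftE.
Qed.

Lemma tri_int_dx_false (i j : 'I_N) F G : sqcont F -> sqcont G ->
  (forall p, otri (i, j, false) p -> is_derive p.1 1 (fun s => F (s, p.2)) (G p)) ->
  IK (i, j, false) G = hy j * (V F i.+1 j - D F i j).
Proof.
move=> cF cG dF; rewrite (tri_int_dx cF cG dF).
have h := hx_gt0 M (ltn_ord i).
rewrite -opprB mulrN -mulNr; congr (_ * (_ - _)).
- by rewrite /tri_area /legx/=; field; rewrite lt0r_neq0.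
- rewrite -Rintegral01_onem; last exact: left_cont.
  apply: eq_Rintegral => t _; congr F; rewrite /refmap /affmap/= /legy /stepy /cornx /corny/=.
  by congr pair; ring.
- rewrite -Rintegral01_onem; last exact: hyp_cont.
  apply: eq_Rintegral => t _; congr F; rewrite /refmap /affmap/= /legy /legx /stepy /stepx /cornx /corny/=.
  by congr pair; ring.
Qed.

Lemma tri_int_dy_true (i j : 'I_N) F G : sqcont F -> sqcont G ->
  (forall p, otri (i, j, true) p -> is_derive p.2 1 (fun t => F (p.1, t)) (G p)) ->
  IK (i, j, true) G = hx i * (D F i j - W F i j).
Proof.
move=> cF cG dF; rewrite (tri_int_dy cF cG dF).
have k := hy_gt0 M (ltn_ord j).
congr (_ * (_ - _)).
- by rewrite /tri_area /legy/=; field; rewrite lt0r_neq0.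
- rewrite -Rintegral01_onem; last exact: hyp'_cont.
  apply: eq_Rintegral => t _; congr F; rewrite /refmap /affmap/= /legy /legx /stepy /stepx /cornx /corny/=.
  by congr pair; ring.
- by apply: eq_Rintegral => t _; rewrite refmap_botE.
Qed.

Lemma tri_int_dy_false (i j : 'I_N) F G : sqcont F -> sqcont G ->
  (forall p, otri (i, j, false) p -> is_derive p.2 1 (fun t => F (p.1, t)) (G p)) ->
  IK (i, j, false) G = hx i * (W F i j.+1 - D F i j).
Proof.
move=> cF cG dF; rewrite (tri_int_dy cF cG dF).
have k := hy_gt0 M (ltn_ord j).
rewrite -opprB mulrN -mulNr; congr (_ * (_ - _)).
- by rewrite /tri_area /legy/=; field; rewrite lt0r_neq0.
- rewrite -Rintegral01_onem; last exact: bot_cont.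
  apply: eq_Rintegral => t _; congr F; rewrite /refmap /affmap/= /legx /stepx /cornx /corny/=.
  by congr pair; ring.
- apply: eq_Rintegral => t _; congr F; rewrite /refmap /affmap/= /legy /legx /stepy /stepx /cornx /corny/=.
  by congr pair; ring.
Qed.

(* Integrals over interior edges cancel, those over boundary edges vanish. *)
Lemma sum_tri_int_dx F (G : elt N -> R * R -> R) : sqcont F -> (forall K, sqcont (G K)) ->
  (forall K p, otri K p -> is_derive p.1 1 (fun s => F (s, p.2)) (G K p)) ->
  (forall p, (Omega_bar `\` Omega) p -> F p = 0) ->
  \sum_(K : elt N) IK K (G K) = 0.
Proof.
move=> cF cG dF F0; rewrite big_elt exchange_big/= big1// => j _.
have V0 i : i = 0%N \/ i = N -> V F i j = 0.
  move=> iN; transitivity (Rintegral leb `]0, 1[ (fun=> 0 : R)); last by rewrite Rintegral_cst ?mul0r.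
  apply: eq_Rintegral => t /set_mem; rewrite /= in_itv/= => t01; apply: F0; split.
    have hj := hy_gt0 M (ltn_ord j).
    have k1 : 0 <= hy j * t by apply: mulr_ge0; lra.
    have k2 : hy j * t <= hy j by apply: ler_piMr; lra.
    have e2 : ys j.+1 = ys j + hy j by rewrite /stepy subrKC.
    have := @ys_le _ _ _ _ M 0 j; have := @ys_le _ _ _ _ M j.+1 N.
    rewrite leqnn ltn_ord (ltnW (ltn_ord j)) (mesh_ys0 M) (mesh_ysN M).
    move=> /(_ isT) ? /(_ isT) ?.
    split; rewrite /= in_itv/=; last by lra.
    by case: iN => ->; rewrite ?(mesh_xs0 M) ?(mesh_xsN M); lra.
  move=> [/= + _]; rewrite in_itv/=.
  by case: iN => ->; rewrite ?(mesh_xs0 M) ?(mesh_xsN M); lra.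
under eq_bigr => i _ do rewrite (tri_int_dx_true cF (cG _) (dF _)) (tri_int_dx_false cF (cG _) (dF _))
  -mulrDr addrC subrKA.
rewrite -mulr_sumr -(big_mkord xpredT (fun i => V F i.+1 j - V F i j)) telescope_sumr//.
by rewrite !V0 ?subrr ?mulr0//; [left|right].
Qed.

Lemma sum_tri_int_dy F (G : elt N -> R * R -> R) : sqcont F -> (forall K, sqcont (G K)) ->
  (forall K p, otri K p -> is_derive p.2 1 (fun t => F (p.1, t)) (G K p)) ->
  (forall p, (Omega_bar `\` Omega) p -> F p = 0) ->
  \sum_(K : elt N) IK K (G K) = 0.
Proof.
move=> cF cG dF F0; rewrite big_elt/= big1// => i _.
have W0 j : j = 0%N \/ j = N -> W F i j = 0.
  move=> jN; transitivity (Rintegral leb `]0, 1[ (fun=> 0 : R)); last by rewrite Rintegral_cst ?mul0r.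
  apply: eq_Rintegral => t /set_mem; rewrite /= in_itv/= => t01; apply: F0; split.
    have hi := hx_gt0 M (ltn_ord i).
    have k1 : 0 <= hx i * t by apply: mulr_ge0; lra.
    have k2 : hx i * t <= hx i by apply: ler_piMr; lra.
    have e2 : xs i.+1 = xs i + hx i by rewrite /stepx subrKC.
    have := @xs_le _ _ _ _ M 0 i; have := @xs_le _ _ _ _ M i.+1 N.
    rewrite leqnn ltn_ord (ltnW (ltn_ord i)) (mesh_xs0 M) (mesh_xsN M).
    move=> /(_ isT) ? /(_ isT) ?.
    split; rewrite /= in_itv/=; first by lra.
    by case: jN => ->; rewrite ?(mesh_ys0 M) ?(mesh_ysN M); lra.
  move=> [/= _ +]; rewrite in_itv/=.
  by case: jN => ->; rewrite ?(mesh_ys0 M) ?(mesh_ysN M); lra.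
under eq_bigr => j _ do rewrite (tri_int_dy_true cF (cG _) (dF _)) (tri_int_dy_false cF (cG _) (dF _))
  -mulrDr addrC subrKA.
rewrite -mulr_sumr -(big_mkord xpredT (fun j => W F i j.+1 - W F i j)) telescope_sumr//.
by rewrite !W0 ?subrr ?mulr0//; [left|right].
Qed.
End green.

(** * Piecewise linear functions *)

Lemma open_near_x {R : realType} (U : set (R * R)) p : open U -> U p ->
  \forall s \near p.1, U (s, p.2).
Proof.
case: p => x y oU Up; have H : nbhs (x, y) U by exact: open_nbhs_nbhs.
exact: (@pairl_continuous R y x U H).
Qed.

Lemma open_near_y {R : realType} (U : set (R * R)) p : open U -> U p ->
  \forall t \near p.2, U (p.1, t).
Proof.
case: p => x y oU Up; have H : nbhs (x, y) U by exact: open_nbhs_nbhs.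
exact: (@pairr_continuous R x y U H).
Qed.

Section linear_interpolation.
Context {R : realType}.
Local Notation leb := (@lebesgue_measure R).
Local Notation mu2 := (leb2 R).
Variables (N : nat) (xs ys : nat -> R).
Hypothesis M : is_mesh N xs ys.
Implicit Types (K : elt N) (v w F G : R * R -> R) (p : R * R).
Local Notation area := (tri_area xs ys).
Local Notation Kmap := (refmap xs ys).
Local Notation eh := (legx xs).
Local Notation ek := (legy ys).
Local Notation ex := (cornx xs).
Local Notation ey := (corny ys).
Local Notation otri := (open_tri xs ys).
Local Notation IK := (tri_int xs ys).

Definition vert0 w K := w (ex K, ey K).
Definition vert1 w K := w (ex K + eh K, ey K).
Definition vert2 w K := w (ex K, ey K + ek K).
Definition gradx w K := (vert1 w K - vert0 w K) / eh K.
Definition grady w K := (vert2 w K - vert0 w K) / ek K.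
(** An affine function on the whole plane: the interpolation error of a triangle then makes sense on
    its entire rectangle, where mean value arguments along the axes apply. *)
Definition lin_interp w K p := vert0 w K + gradx w K * (p.1 - ex K) + grady w K * (p.2 - ey K).

Lemma sqcont_lin w K : sqcont (lin_interp w K).
Proof.
apply: within_D; first apply: within_D.
- exact: within_cst.
- by apply: within_M; [exact: within_cst|apply: within_D; [exact: sqcont_fst|exact: within_cst]].
- by apply: within_M; [exact: within_cst|apply: within_D; [exact: sqcont_snd|exact: within_cst]].
Qed.

Lemma lin_derive_x w K p : is_derive p.1 1 (fun s => lin_interp w K (s, p.2)) (gradx w K).
Proof.
have D := is_derive1D (is_derive1D (is_derive1_cst p.1 (vert0 w K))
  (is_derive1M (is_derive1_cst p.1 (gradx w K))
    (is_derive1B (is_derive1_id p.1) (is_derive1_cst p.1 (ex K)))))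
  (is_derive1_cst p.1 (grady w K * (p.2 - ey K))).
by apply: is_derive_eq D _; ring.
Qed.

Lemma lin_derive_y w K p : is_derive p.2 1 (fun t => lin_interp w K (p.1, t)) (grady w K).
Proof.
have D := is_derive1D (is_derive1_cst p.2 (vert0 w K + gradx w K * (p.1 - ex K)))
  (is_derive1M (is_derive1_cst p.2 (grady w K))
    (is_derive1B (is_derive1_id p.2) (is_derive1_cst p.2 (ey K)))).
by apply: is_derive_eq D _; ring.
Qed.

Definition P1_function v := [/\ sqcont v, forall K, affine_on (gtri xs ys K) v &
  forall p, (Omega_bar `\` Omega) p -> v p = 0].

Lemma P1_lin v K p : P1_function v -> gtri xs ys K p -> v p = lin_interp v K p.
Proof.
move=> [_ /(_ K)[a0 [a1 [a2 H]]] _] Kp.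
have h := legx_neq0 M K; have k := legy_neq0 M K.
have v0 : vert0 v K = a0 + a1 * ex K + a2 * ey K.
  by apply: H; rewrite (gtriE M) /closed_tri /mkset /Kinv/= !subrr !mul0r; split; lra.
have v1 : vert1 v K = a0 + a1 * (ex K + eh K) + a2 * ey K.
  by apply: H; rewrite (gtriE M) /closed_tri /mkset /Kinv/= subrr addrAC subrr add0r divff// mul0r; split; lra.
have v2 : vert2 v K = a0 + a1 * ex K + a2 * (ey K + ek K).
  by apply: H; rewrite (gtriE M) /closed_tri /mkset /Kinv/= subrr addrAC subrr add0r divff// mul0r; split; lra.
by rewrite H// /lin_interp /gradx /grady v0 v1 v2; field; rewrite h k.
Qed.

Lemma otri_gtri K : otri K `<=` gtri xs ys K.
Proof. by rewrite (gtriE M); exact: otri_ctri. Qed.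

Lemma P1_derive_x v K p : P1_function v -> otri K p ->
  is_derive p.1 1 (fun s => v (s, p.2)) (gradx v K).
Proof.
move=> Pv Kp; apply: (near_eq_is_derive1 _ (lin_derive_x v K p)).
apply: (filterS _ (open_near_x (@open_otri R N xs ys K) Kp)) => s /otri_gtri sK; rewrite (P1_lin Pv sK)//.
Qed.

Lemma P1_derive_y v K p : P1_function v -> otri K p ->
  is_derive p.2 1 (fun t => v (p.1, t)) (grady v K).
Proof.
move=> Pv Kp; apply: (near_eq_is_derive1 _ (lin_derive_y v K p)).
apply: (filterS _ (open_near_y (@open_otri R N xs ys K) Kp)) => s /otri_gtri sK; rewrite (P1_lin Pv sK)//.
Qed.

Lemma P1_dx v K p : P1_function v -> otri K p -> dx v p = gradx v K.
Proof. by move=> Pv Kp; rewrite /dx derive1E; have [_ ->] := P1_derive_x Pv Kp. Qed.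

Lemma P1_dy v K p : P1_function v -> otri K p -> dy v p = grady v K.
Proof. by move=> Pv Kp; rewrite /dy derive1E; have [_ ->] := P1_derive_y Pv Kp. Qed.

(** The second-order term of the stabilization thus drops out for discrete functions; only that of
    the exact solution survives in the error. *)
Lemma P1_laplacian v K p : P1_function v -> otri K p -> laplacian v p = 0.
Proof.
move=> Pv Kp; rewrite /laplacian.
have -> : dx (dx v) p = 0.
  rewrite {1}/dx derive1E.
  have : is_derive p.1 1 (fun s => dx v (s, p.2)) 0.
    apply: (near_eq_is_derive1 _ (is_derive1_cst p.1 (gradx v K))).
    apply: (filterS _ (open_near_x (@open_otri R N xs ys K) Kp)) => s sK; rewrite (P1_dx Pv sK)//.
  by case.
have -> : dy (dy v) p = 0.
  rewrite {1}/dy derive1E.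
  have : is_derive p.2 1 (fun s => dy v (p.1, s)) 0.
    apply: (near_eq_is_derive1 _ (is_derive1_cst p.2 (grady v K))).
    apply: (filterS _ (open_near_y (@open_otri R N xs ys K) Kp)) => s sK; rewrite (P1_dy Pv sK)//.
  by case.
by rewrite addr0.
Qed.

Lemma P1B v w : P1_function v -> P1_function w -> P1_function (v \- w).
Proof.
move=> [cv av v0] [cw aw w0]; split.
- by apply: within_D => //; exact: within_N.
- move=> K; have [a0 [a1 [a2 H]]] := av K; have [b0 [b1 [b2 H']]] := aw K.
  exists (a0 - b0), (a1 - b1), (a2 - b2) => p Kp /=.
  by rewrite H// H'//; ring.
- by move=> p Op /=; rewrite v0// w0// subrr.
Qed.

Lemma gradxB v w K : gradx (v \- w) K = gradx v K - gradx w K.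
Proof. by rewrite /gradx /vert0 /vert1/=; ring. Qed.

Lemma gradyB v w K : grady (v \- w) K = grady v K - grady w K.
Proof. by rewrite /grady /vert0 /vert2/=; ring. Qed.

Lemma lin_interp_refmap w K s t : lin_interp w K (Kmap K (s, t)) =
  vert0 w K + (vert1 w K - vert0 w K) * s + (vert2 w K - vert0 w K) * t.
Proof.
have h := legx_neq0 M K; have k := legy_neq0 M K.
by rewrite /lin_interp /gradx /grady /refmap /affmap/=; field; rewrite h k.
Qed.

(** In Horner form the primitive visibly vanishes at 0 and takes the value a + b + c + d at 1. *)
Lemma is_derive_poly4 (a b c d x : R) :
  is_derive x 1 (fun t => t * (a + t * (b + t * (c + t * d))))
    (a + 2 * b * x + 3 * c * x ^+ 2 + 4 * d * x ^+ 3).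
Proof.
have I := is_derive1_id x.
have D := is_derive1M I (is_derive1D (is_derive1_cst x a) (is_derive1M I
  (is_derive1D (is_derive1_cst x b) (is_derive1M I (is_derive1D (is_derive1_cst x c)
  (is_derive1M I (is_derive1_cst x d))))))).
by apply: is_derive_eq D _; ring.
Qed.

Lemma is_derive_cubic (a b c d x : R) :
  is_derive x 1 (fun t => a + 2 * b * t + 3 * c * t ^+ 2 + 4 * d * t ^+ 3)
    (2 * b + 6 * c * x + 12 * d * x ^+ 2).
Proof.
have I := is_derive1_id x; have C := is_derive1_cst x.
have D := is_derive1D (is_derive1D (is_derive1D (C a) (is_derive1M (C (2 * b)) I))
  (is_derive1M (C (3 * c)) (is_derive1M I I)))
  (is_derive1M (C (4 * d)) (is_derive1M I (is_derive1M I I))).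
have {}D := is_derive_eq D (_ : _ = 2 * b + 6 * c * x + 12 * d * x ^+ 2).
rewrite (_ : (fun t => _) = (fun t => a + 2 * b * t + 3 * c * (t * t) + 4 * d * (t * (t * t)))).
  by apply: D; ring.
by apply/funext => t; ring.
Qed.

Lemma Rintegral_cubic (a b c d : R) :
  Rintegral leb `]0, 1[ (fun t => a + 2 * b * t + 3 * c * t ^+ 2 + 4 * d * t ^+ 3) =
  a + b + c + d.
Proof.
have E := Rintegral_FTC ltr01 (derivable_within (is_derive_poly4 a b c d))
  (derivable_within (is_derive_cubic a b c d)) (fun x _ => is_derive_poly4 a b c d x).
by rewrite E; ring.
Qed.

Lemma Rintegral_tref_affine_sqr (a b c : R) :
  Rintegral mu2 tref (fun p => (a + b * p.1 + c * p.2) ^+ 2) =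
  (a ^+ 2 + (a + b) ^+ 2 + (a + c) ^+ 2 + (3 * a + b + c) ^+ 2) / 24.
Proof.
(* Primitive in x of the square, in the Horner form of [is_derive_poly4] with last coefficient
   zero. *)
pose F (p : R * R) := p.1 * ((a + c * p.2) ^+ 2 + p.1 * ((a + c * p.2) * b + p.1 * (b ^+ 2 / 3 + p.1 * 0))).
pose G (p : R * R) := (a + b * p.1 + c * p.2) ^+ 2.
have GE s t : G (s, t) = (a + c * t) ^+ 2 + 2 * ((a + c * t) * b) * s
    + 3 * (b ^+ 2 / 3) * s ^+ 2 + 4 * 0 * s ^+ 3.
  by rewrite /G/=; field.
have cG : cbounded tref G.
  have cq : cbounded tref (fun p => a + b * p.1 + c * p.2).
    have c1 : cbounded tref (fun p : R * R => p.1).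
      split=> [p _|]; first exact: cvg_fst.
      by exists 1 => p [? ? ?]; rewrite ger0_norm; lra.
    have c2 : cbounded tref (fun p : R * R => p.2).
      split=> [p _|]; first exact: cvg_snd.
      by exists 1 => p [? ? ?]; rewrite ger0_norm; lra.
    by apply: cboundedD; [apply: cboundedD|]; rewrite ?mulr1; try exact: cbounded_cst;
      apply: cboundedM => //; exact: cbounded_cst.
  rewrite (_ : G = (fun p => (a + b * p.1 + c * p.2) * (a + b * p.1 + c * p.2))).
    exact: cboundedM.
  by apply/funext => p; rewrite /G expr2.
rewrite (@Rintegral_tref_dx R F G cG).
  transitivity (Rintegral leb `]0, 1[ (fun t =>
    (a ^+ 2 + a * b + b ^+ 2 / 3) +
    2 * ((2 * a * c - a ^+ 2 - 2 * a * b + b * c - b ^+ 2) / 2) * t +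
    3 * ((c ^+ 2 - 2 * a * c - 2 * b * c + a * b + b ^+ 2) / 3) * t ^+ 2 +
    4 * ((- c ^+ 2 + b * c - b ^+ 2 / 3) / 4) * t ^+ 3)).
    by apply: eq_Rintegral => t _; rewrite /F/=; field.
  by rewrite Rintegral_cubic; field.
move=> t _; split.
- exact: (derivable_within (is_derive_poly4 ((a + c * t) ^+ 2) ((a + c * t) * b) (b ^+ 2 / 3) 0)).
- have -> : (fun s => G (s, t)) = (fun s => (a + c * t) ^+ 2 + 2 * ((a + c * t) * b) * s
      + 3 * (b ^+ 2 / 3) * s ^+ 2 + 4 * 0 * s ^+ 3) by apply/funext => s; exact: GE.
  exact: (derivable_within (is_derive_cubic ((a + c * t) ^+ 2) ((a + c * t) * b) (b ^+ 2 / 3) 0)).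
- by move=> s _; rewrite GE; exact: (is_derive_poly4 ((a + c * t) ^+ 2) ((a + c * t) * b) (b ^+ 2 / 3) 0).
Qed.

(** Exact mass formula. As a sum of squares that contains those of the vertex values, it lets the L2
    norm control point values of the test function. *)
Lemma P1_sqr_int v K : P1_function v -> IK K (fun p => v p ^+ 2) =
  area K / 12 * (vert0 v K ^+ 2 + vert1 v K ^+ 2 + vert2 v K ^+ 2
    + (vert0 v K + vert1 v K + vert2 v K) ^+ 2).
Proof.
move=> Pv; have [cv _ _] := Pv.
transitivity (IK K (fun p => lin_interp v K p * lin_interp v K p)).
  by apply: eq_tri_int => p /otri_gtri Kp; rewrite (P1_lin Pv Kp) expr2.
rewrite (tri_int_ref M); last by apply: within_M; exact: sqcont_lin.
transitivity (2 * area K * Rintegral mu2 tref (fun p =>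
   (vert0 v K + (vert1 v K - vert0 v K) * p.1 + (vert2 v K - vert0 v K) * p.2) ^+ 2)).
  by congr (_ * _); apply: eq_Rintegral => -[s t] _; rewrite -(lin_interp_refmap v K s t).
by rewrite Rintegral_tref_affine_sqr; field.
Qed.
End linear_interpolation.

(** * Coercivity and the error equation *)

Section energy_identity.
Context {R : realType}.
Variables (eps beta mu0 : R) (N : nat) (b c f : R * R -> R) (delta : elt N -> R).
Local Notation xs := (mesh_x eps beta N).
Local Notation ys := (mesh_y eps N).
Hypothesis M : is_mesh N xs ys.
Implicit Types (K : elt N) (v w F G : R * R -> R) (p : R * R) (W : nat -> nat -> R * R -> R).
Local Notation area := (tri_area xs ys).
Local Notation otri := (open_tri xs ys).
Local Notation IK := (tri_int xs ys).
Local Notation P1 := (P1_function N xs ys).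
Local Notation gx := (gradx xs ys).
Local Notation gy := (grady xs ys).

Lemma tri_gtri K : tri eps beta K = gtri xs ys K.
Proof. by case: K => [[i j] []]. Qed.

Lemma interior_tri K : (tri eps beta K)° = otri K.
Proof. by rewrite tri_gtri (interior_gtri M). Qed.

Lemma VN_P1 v : VN eps beta N v -> P1 v.
Proof. by move=> [cv av v0]; split=> // K; rewrite -tri_gtri. Qed.

Lemma ip_Omega v w (g : elt N -> R * R -> R) : (forall K, sqcont (g K)) ->
  (forall K p, otri K p -> v p * w p = g K p) -> ip Omega v w = \sum_(K : elt N) IK K (g K).
Proof.
move=> cg H; rewrite /ip (Rintegral_Omega M (g := g))// => K; exact: sqcont_otri.
Qed.

Lemma ip_tri K v w g : (forall p, otri K p -> v p * w p = g p) ->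
  ip (tri eps beta K)° v w = IK K g.
Proof. by move=> H; rewrite /ip interior_tri; apply: eq_tri_int. Qed.

Hypotheses (cb : sqcont b) (cc : sqcont c).

(** Share of one triangle in [a_SD] for piecewise linear arguments: gradients are constant and leave
    the integrals, and the Laplacian of [w] vanishes. *)
Definition sd_form w v K :=
  eps * area K * (gx w K * gx v K + gy w K * gy v K)
  + IK K (fun p => (b p * gx w K + c p * w p) * v p)
  + delta K * gx v K * IK K (fun p => (b p * gx w K + c p * w p) * b p).

Lemma grad_ipE w v : P1 w -> P1 v -> grad_ip w v =
  \sum_(K : elt N) area K * (gx w K * gx v K + gy w K * gy v K).
Proof.
move=> Pw Pv; rewrite /grad_ip.
rewrite (@ip_Omega _ _ (fun K _ => gx w K * gx v K)); last 2 first.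
- by move=> K; exact: within_cst.
- by move=> K p Kp; rewrite (P1_dx M Pw Kp) (P1_dx M Pv Kp).
rewrite (@ip_Omega _ _ (fun K _ => gy w K * gy v K)); last 2 first.
- by move=> K; exact: within_cst.
- by move=> K p Kp; rewrite (P1_dy M Pw Kp) (P1_dy M Pv Kp).
by rewrite -big_split/=; apply: eq_bigr => K _; rewrite !(tri_int_cst M); ring.
Qed.

Lemma sqcont_conv w K : sqcont w -> sqcont (fun p => b p * gx w K + c p * w p).
Proof.
move=> cw; apply: within_D; last exact: within_M.
by apply: within_M => //; exact: within_cst.
Qed.

Lemma a_SD_form w v : P1 w -> P1 v -> a_SD eps beta b c delta w v = \sum_(K : elt N) sd_form w v K.
Proof.
move=> Pw Pv; have [cw _ _] := Pw; have [cv _ _] := Pv.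
rewrite /a_SD /a_Gal /a_stab grad_ipE// mulr_sumr.
rewrite (@ip_Omega _ _ (fun K p => (b p * gx w K + c p * w p) * v p)); last 2 first.
- by move=> K; apply: within_M => //; exact: sqcont_conv.
- by move=> K p Kp; rewrite (P1_dx M Pw Kp).
rewrite -!big_split/=; apply: eq_bigr => K _; rewrite /sd_form mulrA; congr (_ + _).
rewrite -(tri_intZ M); last by apply: within_M => //; exact: sqcont_conv.
by apply: ip_tri => p Kp; rewrite (P1_laplacian M Pw Kp) (P1_dx M Pw Kp) (P1_dx M Pv Kp); ring.
Qed.

Lemma form_sub w w' v K : P1 w -> P1 w' -> P1 v ->
  sd_form (w \- w') v K = sd_form w v K - sd_form w' v K.
Proof.
move=> [cw _ _] [cw' _ _] [cv _ _]; rewrite /sd_form.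
have -> : IK K (fun p => (b p * gx (w \- w') K + c p * (w \- w') p) * v p) =
  IK K (fun p => (b p * gx w K + c p * w p) * v p)
  - IK K (fun p => (b p * gx w' K + c p * w' p) * v p).
  rewrite -(tri_intB M); try (by apply: within_M => //; exact: sqcont_conv).
  by apply: eq_tri_int => p _; rewrite gradxB/=; ring.
have -> : IK K (fun p => (b p * gx (w \- w') K + c p * (w \- w') p) * b p) =
  IK K (fun p => (b p * gx w K + c p * w p) * b p)
  - IK K (fun p => (b p * gx w' K + c p * w' p) * b p).
  rewrite -(tri_intB M); try (by apply: within_M => //; exact: sqcont_conv).
  by apply: eq_tri_int => p _; rewrite gradxB/=; ring.
by rewrite gradxB gradyB; ring.
Qed.

Definition normK v K := eps * area K * (gx v K ^+ 2 + gy v K ^+ 2)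
  + mu0 * IK K (fun p => v p ^+ 2) + delta K * gx v K ^+ 2 * IK K (fun p => b p ^+ 2).

Hypotheses (eps_gt0 : 0 < eps) (mu0_gt0 : 0 < mu0) (delta_ge0 : forall K, 0 <= delta K).

Lemma sqcont_sqr v : sqcont v -> sqcont (fun p => v p ^+ 2).
Proof. by move=> cv; rewrite (_ : (fun p => _) = (fun p => v p * v p))//; exact: within_M. Qed.

Lemma norm_eps_sqr v : P1 v -> norm_eps eps mu0 v ^+ 2 =
  \sum_(K : elt N) (eps * area K * (gx v K ^+ 2 + gy v K ^+ 2)
  + mu0 * IK K (fun p => v p ^+ 2)).
Proof.
move=> Pv; have [cv _ _] := Pv; rewrite /norm_eps.
have g0 : 0 <= grad_ip v v.
  rewrite grad_ipE//; apply: sumr_ge0 => K _; have a0 := area_gt0 M K.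
  by apply: mulr_ge0; [exact: ltW|apply: addr_ge0; rewrite -expr2 sqr_ge0].
have l0 : 0 <= ip Omega v v by apply: Rintegral_ge0 => p _; rewrite -expr2 sqr_ge0.
rewrite /L2norm (sqr_sqrtr g0) (sqr_sqrtr l0) sqr_sqrtr; last first.
  by apply: addr_ge0; apply: mulr_ge0 => //; exact: ltW.
rewrite grad_ipE// (@ip_Omega _ _ (fun _ p => v p ^+ 2)).
- by rewrite !mulr_sumr -big_split/=; apply: eq_bigr => K _; rewrite !expr2; ring.
- by move=> _; exact: sqcont_sqr.
- by move=> K p _; rewrite expr2.
Qed.

Lemma norm_SD_sqr v : P1 v -> norm_SD eps beta mu0 b delta v ^+ 2 = \sum_(K : elt N) normK v K.
Proof.
move=> Pv; rewrite /norm_SD.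
have H K : delta K * L2norm (tri eps beta K)° (fun p => b p * dx v p) ^+ 2 =
   delta K * gx v K ^+ 2 * IK K (fun p => b p ^+ 2).
  rewrite /L2norm sqr_sqrtr; last by apply: Rintegral_ge0 => p _; rewrite -expr2 sqr_ge0.
  rewrite -mulrA -(tri_intZ M); last exact: sqcont_sqr.
  by congr (_ * _); apply: ip_tri => p Kp; rewrite (P1_dx M Pv Kp); ring.
rewrite sqr_sqrtr; last first.
  apply: addr_ge0; first exact: sqr_ge0.
  by apply: sumr_ge0 => K _; apply: mulr_ge0; rewrite ?sqr_ge0.
rewrite norm_eps_sqr// -big_split/=; apply: eq_bigr => K _.
by rewrite H.
Qed.

Lemma norm_eps_le_SD v : norm_eps eps mu0 v <= norm_SD eps beta mu0 b delta v.
Proof.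
have n0 : 0 <= norm_eps eps mu0 v by exact: sqrtr_ge0.
rewrite /norm_SD -[leLHS](ger0_norm n0) -sqrtr_sqr; apply: ler_wsqrtr.
rewrite lerDl; apply: sumr_ge0 => K _; apply: mulr_ge0 => //; exact: sqr_ge0.
Qed.
End energy_identity.

Section derivs_theory.
Context {R : realType}.
Implicit Types (g v w : R * R -> R) (p : R * R) (D W : nat -> nat -> R * R -> R).

Lemma eq_sqcont g g' : (forall p, Omega_bar p -> g p = g' p) -> sqcont g -> sqcont g'.
Proof.
move=> E cg; apply: (subspace_eq_continuous _ cg) => p /set_mem; exact: E.
Qed.

Lemma derivs_cont k g D i j : derivs k g D -> (i + j <= k)%N -> sqcont (D i j).
Proof. by case=> _ H _; exact: H. Qed.

Lemma derivs_sqcont k g D : derivs k g D -> sqcont g.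
Proof.
move=> H; have cD : sqcont (D 0%N 0%N) by exact: derivs_cont H _.
by apply: eq_sqcont cD => p; case: H => + _ _; exact.
Qed.

Lemma derivs_x k g D i j p : derivs k g D -> (i + j < k)%N -> Omega p ->
  is_derive p.1 1 (fun s => D i j (s, p.2)) (D i.+1 j p).
Proof. by case=> _ _ H ij Op; have [] := H i j ij p Op. Qed.

Lemma derivs_y k g D i j p : derivs k g D -> (i + j < k)%N -> Omega p ->
  is_derive p.2 1 (fun t => D i j (p.1, t)) (D i j.+1 p).
Proof. by case=> _ _ H ij Op; have [] := H i j ij p Op. Qed.

Lemma derivs0_x k g D p : derivs k g D -> (0 < k)%N -> Omega p ->
  is_derive p.1 1 (fun s => g (s, p.2)) (D 1%N 0%N p).
Proof.
move=> H k0 Op; apply: near_eq_is_derive1 (derivs_x H (i := 0) (j := 0) k0 Op).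
apply: (filterS _ (open_near_x (@open_Omega R) Op)) => s Os.
by case: H => + _ _; apply; exact: Omega_sub.
Qed.

Lemma derivs0_y k g D p : derivs k g D -> (0 < k)%N -> Omega p ->
  is_derive p.2 1 (fun t => g (p.1, t)) (D 0%N 1%N p).
Proof.
move=> H k0 Op; apply: near_eq_is_derive1 (derivs_y H (i := 0) (j := 0) k0 Op).
apply: (filterS _ (open_near_y (@open_Omega R) Op)) => s Os.
by case: H => + _ _; apply; exact: Omega_sub.
Qed.

Lemma derivs_dx k g D p : derivs k g D -> (0 < k)%N -> Omega p -> dx g p = D 1%N 0%N p.
Proof. by move=> H k0 Op; rewrite /dx derive1E; have [_ ->] := derivs0_x H k0 Op. Qed.

Lemma derivs_dy k g D p : derivs k g D -> (0 < k)%N -> Omega p -> dy g p = D 0%N 1%N p.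
Proof. by move=> H k0 Op; rewrite /dy derive1E; have [_ ->] := derivs0_y H k0 Op. Qed.

Lemma derivs_laplacian k g D p : derivs k g D -> (1 < k)%N -> Omega p ->
  laplacian g p = D 2%N 0%N p + D 0%N 2%N p.
Proof.
move=> H k1 Op; have k0 := ltnW k1; rewrite /laplacian; congr (_ + _).
  rewrite {1}/dx derive1E.
  have : is_derive p.1 1 (fun s => dx g (s, p.2)) (D 2%N 0%N p).
    apply: near_eq_is_derive1 (derivs_x H (i := 1) (j := 0) k1 Op).
    apply: (filterS _ (open_near_x (@open_Omega R) Op)) => s Os.
    by rewrite (derivs_dx H).
  by case.
rewrite {1}/dy derive1E.
have : is_derive p.2 1 (fun s => dy g (p.1, s)) (D 0%N 2%N p).
  apply: near_eq_is_derive1 (derivs_y H (i := 0) (j := 1) k1 Op).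
  apply: (filterS _ (open_near_y (@open_Omega R) Op)) => s Os.
  by rewrite (derivs_dy H).
by case.
Qed.

Lemma derivsD k g g' D D' : derivs k g D -> derivs k g' D' ->
  derivs k (fun p => g p + g' p) (fun i j p => D i j p + D' i j p).
Proof.
move=> [e1 c1 d1] [e2 c2 d2]; split=> [p Op|i j ij|i j ij p Op].
- by rewrite e1// e2.
- by apply: within_D; [exact: c1|exact: c2].
- have [dx1 dy1] := d1 i j ij p Op; have [dx2 dy2] := d2 i j ij p Op.
  by split; exact: is_derive1D.
Qed.

Lemma eq_derivs k g g' D : (forall p, Omega_bar p -> g p = g' p) ->
  derivs k g D -> derivs k g' D.
Proof. by move=> E [e c d]; split=> // p Op; rewrite e// E. Qed.
End derivs_theory.

(** * Pointwise bounds from the essential supremum *)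

Section essential_bound.
Context {R : realType}.
Local Notation mu2 := (leb2 R).

Lemma open_leb2_gt0 (U : set (R * R)) p : open U -> U p -> (0 < mu2 U)%E.
Proof.
move=> oU Up; have /nbhs_ballP[e /= e0 eU] : nbhs p U by exact: open_nbhs_nbhs.
apply: (@lt_le_trans _ _ (mu2 (`]p.1 - e, p.1 + e[ `*` `]p.2 - e, p.2 + e[))).
  rewrite product_measure1E; [|exact: measurable_itv..].
  rewrite /= !lebesgue_measure_itv/= !lte_fin !ltrD2l !gtrN// -!EFinD -EFinM lte_fin.
  by apply: mulr_gt0; lra.
apply: le_measure; rewrite ?inE.
- by apply: measurableX; exact: measurable_itv.
- exact: open_measurable2.
- move=> q [/= /[!in_itv]/= q1 q2]; apply: eU; split; rewrite /ball/= ltr_norml; lra.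
Qed.

(** If |c p| exceeded the essential supremum, continuity would give a nonempty open set where it is
    exceeded, and nonempty open sets have positive measure. *)
Lemma Linfnorm_ge (D U : set (R * R)) (c : R * R -> R) p :
  open U -> U `<=` D -> (forall q, U q -> {for q, continuous c}) -> U p ->
  (`|c p|%:E <= Linfnorm D c)%E.
Proof.
move=> oU UD cc Up.
have muT : (0%:E < mu2 setT)%E by apply: (@open_leb2_gt0 setT p) => //; exact: openT.
rewrite /Linfnorm unlock /=. 
rewrite ifT; last exact: muT.
set f := (f in ess_sup _ f); set L := ess_sup _ _.
have := ess_sup_ge mu2 f; rewrite -/L => -[A [mA A0 sA]].
rewrite leNgt; apply/negP => Lc.
pose V := [set q | U q /\ (L < `|c q|%:E)%E].
have oV : open V.
  rewrite openE => q [Uq Lq]; apply: filterI; first exact: open_nbhs_nbhs.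
  have [l lL lc] : exists2 l : R, (L <= l%:E)%E & l < `|c q|.
    move: Lq; case: (L) => [l||] //.
      by rewrite lte_fin => ?; exists l.
    by move=> _; exists (`|c q| - 1); rewrite ?leNye// ltrBlDr ltrDl.
  have : nbhs q [set q' | l < `|c q'|].
    have cn : `|c q'| @[q' --> q] --> `|c q| by apply: cvg_norm; exact: cc.
    have N : nbhs `|c q| [set y | l < y].
      by apply: open_nbhs_nbhs; split=> //; exact: open_gt.
    exact: (cn _ N).
  by apply: filterS => q' /= lq'; apply: (le_lt_trans lL); rewrite lte_fin.
have VA : V `<=` A.
  move=> q [Uq Lq]; apply: sA => /=; apply/negP; rewrite -ltNge.
  by rewrite /f/= patchE ifT//; apply/mem_set/UD.
have : (mu2 V <= mu2 A)%E.
  by apply: le_measure => //; rewrite inE//; exact: open_measurable2.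
by rewrite A0 leNgt (open_leb2_gt0 oV (p := p)).
Qed.

(** Pointwise form of the upper bound on the stabilization parameter. A zero norm makes the extended
    quotient infinite but forces c = 0 on [U]; an infinite norm makes the quotient zero and forces
    [d] = 0. *)
Lemma Linfnorm_bound (D U : set (R * R)) (c : R * R -> R) (d m : R) :
  open U -> U `<=` D -> (forall p, U p -> {for p, continuous c}) -> 0 <= d -> 0 < m ->
  (d%:E <= m%:E / (2%:E * Linfnorm D c ^+ 2))%E ->
  forall p, U p -> d * c p ^+ 2 <= m / 2.
Proof.
move=> oU UD cc d0 m0 dL p Up; have := Linfnorm_ge oU UD cc Up.
case: (Linfnorm D c) dL => [l||] dL cl //.
- have {}cl : `|c p| <= l by rewrite -lee_fin.
  have [l0|l0] := eqVneq l 0.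
    have -> : c p = 0 by apply/eqP; rewrite -normr_le0 -l0.
    by rewrite expr0n/= mulr0; lra.
  have {}l0 : 0 < l by rewrite lt_neqAle eq_sym l0 (le_trans _ cl).
  have : d <= m / (2 * l ^+ 2).
    have l2 : 2 * (l * l) != 0 by rewrite lt0r_neq0// !mulr_gt0.
    move: dL; rewrite expe2 -!EFinM inver (negbTE l2) -EFinM lee_fin.
    by rewrite expr2.
  rewrite ler_pdivlMr ?mulr_gt0 ?exprn_gt0// => H.
  have c2 : c p ^+ 2 <= l ^+ 2 by rewrite -real_normK ?num_real// lerXn2r ?nnegrE// ltW.
  by have := ler_wpM2l d0 c2; lra.
- have -> : d = 0.
    apply/eqP; rewrite eq_le d0 andbT.
    move: dL; rewrite expe2 mulyy gt0_muley ?lte_fin// invey mule0.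
    by rewrite lee_fin.
  by rewrite mul0r; lra.
Qed.
End essential_bound.

Lemma sqcont_cst {R : realType} (a : R) : sqcont (fun=> a).
Proof. exact: within_cst. Qed.
Lemma sqcontD {R : realType} (f g : R * R -> R) : sqcont f -> sqcont g -> sqcont (fun p => f p + g p).
Proof. exact: within_D. Qed.
Lemma sqcontM {R : realType} (f g : R * R -> R) : sqcont f -> sqcont g -> sqcont (fun p => f p * g p).
Proof. exact: within_M. Qed.
Lemma sqcontN {R : realType} (f : R * R -> R) : sqcont f -> sqcont (fun p => - f p).
Proof. exact: within_N. Qed.

Ltac sqc := lazymatch goal with
  | |- sqcont (fun=> ?a) => exact (@sqcont_cst _ a)
  | |- sqcont (fun p => @?f p + @?g p) => refine (@sqcontD _ f g _ _); cbv beta; sqc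
  | |- sqcont (fun p => @?f p * @?g p) => refine (@sqcontM _ f g _ _); cbv beta; sqc
  | |- sqcont (fun p => - @?f p) => refine (@sqcontN _ f _); cbv beta; sqc
  | |- sqcont (fun p => @?f p ^+ 2) => refine (@sqcont_sqr _ f _); cbv beta; sqc
  | |- sqcont _ => assumption
  end.

Section error_identity.
Context {R : realType}.
Variables (eps beta mu0 : R) (N : nat) (b c f : R * R -> R) (delta : elt N -> R).
Local Notation xs := (mesh_x eps beta N).
Local Notation ys := (mesh_y eps N).
Hypothesis M : is_mesh N xs ys.
Implicit Types (K : elt N) (v w F G : R * R -> R) (p : R * R) (W : nat -> nat -> R * R -> R).
Local Notation area := (tri_area xs ys).
Local Notation otri := (open_tri xs ys).
Local Notation IK := (tri_int xs ys).
Local Notation P1 := (P1_function N xs ys).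
Local Notation gx := (gradx xs ys).
Local Notation gy := (grady xs ys).
Local Notation lin := (lin_interp xs ys).
Variable (Db : nat -> nat -> R * R -> R).
Hypotheses (b_smooth : derivs 3 b Db) (cc : sqcont c).
Let cb : sqcont b := derivs_sqcont b_smooth.
Let cDb : sqcont (Db 1%N 0%N) := derivs_cont b_smooth (erefl : (1 + 0 <= 3)%N).

(** Half the integrals of (b v^2)_x, which sum to zero, are subtracted: (b v_x, v) becomes -(b_x v,
    v) / 2, and c - b_x / 2 >= mu0 applies. The mixed stabilization term costs half of the
    streamline part and mu0 / 4 times the squared L2 norm, because delta c^2 <= mu0 / 2. *)
Lemma coercive v : 0 < eps -> 0 < mu0 -> (forall K, 0 <= delta K) ->
  (forall K p, otri K p -> delta K * c p ^+ 2 <= mu0 / 2) ->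
  (forall p, Omega_bar p -> mu0 <= c p - 1 / 2 * Db 1%N 0%N p) -> P1 v ->
  1 / 2 * \sum_(K : elt N) normK eps beta mu0 b delta v K
    <= \sum_(K : elt N) sd_form eps beta b c delta v v K.
Proof.
move=> eps0 mu00 d0 dc c_ge Pv; have [cv _ v0] := Pv.
have cv2 := sqcont_sqr cv.
pose G K p := Db 1%N 0%N p * v p ^+ 2 + 2 * gx v K * (b p * v p).
have cG K : sqcont (G K).
  apply: within_D; first exact: within_M.
  by apply: within_M; [exact: within_cst|exact: within_M].
have sum0 : \sum_(K : elt N) IK K (G K) = 0.
  apply: (sum_tri_int_dx M (F := fun p => b p * (v p * v p))) => //.
  - by apply: within_M => //; exact: within_M.
  - move=> K p Kp.
    have D1 := derivs0_x b_smooth isT (otri_Omega M Kp).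
    have D2 := P1_derive_x M Pv Kp.
    by apply: is_derive_eq (is_derive1M D1 (is_derive1M D2 D2)) _; rewrite /G -!surjective_pairing; ring.
  - by move=> p Op; rewrite v0// !mulr0.
have -> : \sum_(K : elt N) sd_form eps beta b c delta v v K =
    \sum_(K : elt N) (sd_form eps beta b c delta v v K - 1 / 2 * IK K (G K)).
  by rewrite sumrB -mulr_sumr sum0 mulr0 subr0.
rewrite mulr_sumr; apply: ler_sum => K _.
have a0 := area_gt0 M K.
have IG : IK K (G K) = IK K (fun p => Db 1%N 0%N p * v p ^+ 2) + 2 * gx v K * IK K (fun p => b p * v p).
  by rewrite (tri_intD M); [rewrite (tri_intZ M); [|sqc]|sqc|sqc].
have I1 : IK K (fun p => (b p * gx v K + c p * v p) * v p) =
    gx v K * IK K (fun p => b p * v p) + IK K (fun p => c p * v p ^+ 2).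
  transitivity (IK K (fun p => gx v K * (b p * v p) + c p * v p ^+ 2)).
    by apply: eq_tri_int => p _; ring.
  by rewrite (tri_intD M); [rewrite (tri_intZ M); [|sqc]|sqc|sqc].
have I2 : mu0 * IK K (fun p => v p ^+ 2) <= IK K (fun p => c p * v p ^+ 2)
    - 1 / 2 * IK K (fun p => Db 1%N 0%N p * v p ^+ 2).
  have -> : mu0 * IK K (fun p => v p ^+ 2) = IK K (fun p => mu0 * v p ^+ 2).
    by rewrite (tri_intZ M).
  have -> : 1 / 2 * IK K (fun p => Db 1%N 0%N p * v p ^+ 2) =
     IK K (fun p => 1 / 2 * (Db 1%N 0%N p * v p ^+ 2)).
    by rewrite (tri_intZ M)//; sqc.
  rewrite -(tri_intB M); [|sqc|sqc].
  apply: (tri_int_le M); [sqc|sqc|].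
  move=> p Kp; have := c_ge p (Omega_sub (otri_Omega M Kp)).
  by move=> /(ler_wpM2r (sqr_ge0 (v p))); lra.
have I3 : delta K * gx v K * IK K (fun p => (b p * gx v K + c p * v p) * b p)
    >= 1 / 2 * (delta K * gx v K ^+ 2 * IK K (fun p => b p ^+ 2))
      - mu0 / 4 * IK K (fun p => v p ^+ 2).
  have cb2 := sqcont_sqr cb.
  have -> : 1 / 2 * (delta K * gx v K ^+ 2 * IK K (fun p => b p ^+ 2)) =
     IK K (fun p => 1 / 2 * (delta K * gx v K ^+ 2) * b p ^+ 2).
    by rewrite (tri_intZ M) ?mulrA.
  have -> : mu0 / 4 * IK K (fun p => v p ^+ 2) = IK K (fun p => mu0 / 4 * v p ^+ 2).
    by rewrite (tri_intZ M).
  rewrite -(tri_intB M); [|sqc|sqc].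
  rewrite -(tri_intZ M); last by sqc.
  apply: (tri_int_le M); [sqc|sqc|].
  move=> p Kp; have H1 := ler_wpM2r (sqr_ge0 (v p)) (dc K p Kp).
  (* Completing the square: the difference of the two sides is half the sum of this square and of
     the slack in delta c^2 <= mu0 / 2. *)
  have H2 : 0 <= delta K * (gx v K * b p + c p * v p) ^+ 2 by rewrite mulr_ge0// sqr_ge0.
  rewrite -subr_ge0; apply: le_trans (_ : 0 <= (delta K * (gx v K * b p + c p * v p) ^+ 2
    + (mu0 / 2 * v p ^+ 2 - delta K * c p ^+ 2 * v p ^+ 2)) / 2) _; first by lra.
  by rewrite le_eqVlt; apply/orP; left; apply/eqP; field.
rewrite /normK /sd_form I1 IG.
have N0 : 0 <= eps * area K * (gx v K ^+ 2 + gy v K ^+ 2).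
  by apply: mulr_ge0; [apply: mulr_ge0; exact: ltW|apply: addr_ge0; exact: sqr_ge0].
have V0 : 0 <= mu0 * IK K (fun p => v p ^+ 2).
  by apply: mulr_ge0; [exact: ltW|apply: tri_int_ge0 => p _; exact: sqr_ge0].
move: I2 I3 N0 V0; rewrite -!expr2.
set X1 := eps * _ * _; set X2 := IK K _; set X3 := IK K _; set X4 := IK K _; set X5 := IK K _.
move=> I2 I3 N0 V0; lra.
Qed.

Definition interp_err W K p := lin (W 0%N 0%N) K p - W 0%N 0%N p.
Definition interp_err_x W K p := gx (W 0%N 0%N) K - W 1%N 0%N p.
Definition interp_err_y W K p := gy (W 0%N 0%N) K - W 0%N 1%N p.
(* After integrating the convection term by parts, this collects everything
   that is tested against the x-derivative of the test function. *)
Definition stream_flux W K p := eps * interp_err_x W K p - b p * interp_err W K p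
  + delta K * (b p * (eps * (W 2%N 0%N p + W 0%N 2%N p) + b p * interp_err_x W K p + c p * interp_err W K p)).
(** The gradient of the piecewise linear [v] is constant on [K] and leaves the integrals. In c - b_x
    the first term is the reaction, the second is left by integrating the convection term by
    parts. *)
Definition consistency_err v W K := gx v K * IK K (stream_flux W K) + eps * gy v K * IK K (interp_err_y W K)
  + IK K (fun p => (c p - Db 1%N 0%N p) * interp_err W K p * v p).

Definition C2 W := forall i j, (i + j <= 2)%N -> sqcont (W i j).

Lemma sqcont_interp_err W K : C2 W -> sqcont (interp_err W K).
Proof. by move=> cW; apply: within_D; [exact: sqcont_lin|apply: within_N; exact: cW]. Qed.
Lemma sqcont_interp_err_x W K : C2 W -> sqcont (interp_err_x W K).
Proof. by move=> cW; apply: within_D; [exact: within_cst|apply: within_N; exact: cW]. Qed.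
Lemma sqcont_interp_err_y W K : C2 W -> sqcont (interp_err_y W K).
Proof. by move=> cW; apply: within_D; [exact: within_cst|apply: within_N; exact: cW]. Qed.
Lemma sqcont_stream_flux W K : C2 W -> sqcont (stream_flux W K).
Proof.
move=> cW; have [c1 c2] := (sqcont_interp_err (K := K) cW, sqcont_interp_err_x (K := K) cW).
have [c20 c02] := (cW 2%N 0%N isT, cW 0%N 2%N isT); rewrite /stream_flux; sqc.
Qed.
Lemma sqcont_reaction v W K : C2 W -> sqcont v ->
  sqcont (fun p => (c p - Db 1%N 0%N p) * interp_err W K p * v p).
Proof.
move=> cW cv; have c1 := sqcont_interp_err (K := K) cW; apply: within_M => //; apply: within_M => //.
by apply: within_D => //; exact: within_N.
Qed.

Lemma lin_add (w w' : R * R -> R) K p :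
  lin (fun p => w p + w' p) K p = lin w K p + lin w' K p.
Proof. by rewrite /lin /lin_interp /gradx /grady /vert0 /vert1 /vert2; ring. Qed.

Lemma consistency_errD v W W' K : C2 W -> C2 W' -> sqcont v ->
  consistency_err v (fun i j p => W i j p + W' i j p) K = consistency_err v W K + consistency_err v W' K.
Proof.
move=> cW cW' cv; rewrite /consistency_err.
have E p : interp_err (fun i j p => W i j p + W' i j p) K p = interp_err W K p + interp_err W' K p.
  by rewrite /interp_err lin_add; ring.
have Ex p : interp_err_x (fun i j p => W i j p + W' i j p) K p = interp_err_x W K p + interp_err_x W' K p.
  by rewrite /interp_err_x /gradx /vert0 /vert1; ring.
have Ey p : interp_err_y (fun i j p => W i j p + W' i j p) K p = interp_err_y W K p + interp_err_y W' K p.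
  by rewrite /interp_err_y /grady /vert0 /vert2; ring.
have [c1 c1'] := (sqcont_stream_flux (K := K) cW, sqcont_stream_flux (K := K) cW').
have [c2 c2'] := (sqcont_interp_err_y (K := K) cW, sqcont_interp_err_y (K := K) cW').
have [c3 c3'] := (sqcont_reaction (K := K) cW cv, sqcont_reaction (K := K) cW' cv).
have -> : IK K (stream_flux (fun i j p => W i j p + W' i j p) K) = IK K (stream_flux W K) + IK K (stream_flux W' K).
  by rewrite -(tri_intD M)//; apply: eq_tri_int => p _; rewrite /stream_flux E Ex; ring.
have -> : IK K (interp_err_y (fun i j p => W i j p + W' i j p) K) = IK K (interp_err_y W K) + IK K (interp_err_y W' K).
  by rewrite -(tri_intD M)//; apply: eq_tri_int => p _; rewrite Ey.
have -> : IK K (fun p => (c p - Db 1%N 0%N p) * interp_err (fun i j p => W i j p + W' i j p) K p * v p) =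
  IK K (fun p => (c p - Db 1%N 0%N p) * interp_err W K p * v p)
  + IK K (fun p => (c p - Db 1%N 0%N p) * interp_err W' K p * v p).
  by rewrite -(tri_intD M)//; apply: eq_tri_int => p _; rewrite E; ring.
ring.
Qed.
End error_identity.

Section galerkin.
Context {R : realType}.
Variables (eps beta : R) (N : nat) (b c f : R * R -> R) (delta : elt N -> R).
Local Notation xs := (mesh_x eps beta N).
Local Notation ys := (mesh_y eps N).
Hypothesis M : is_mesh N xs ys.
Implicit Types (K : elt N) (v w F G : R * R -> R) (p : R * R) (W : nat -> nat -> R * R -> R).
Local Notation IK := (tri_int xs ys).
Local Notation P1 := (P1_function N xs ys).
Local Notation gx := (gradx xs ys).
Local Notation gy := (grady xs ys).
Local Notation lin := (lin_interp xs ys).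
Local Notation eta := (@interp_err R eps beta N).
Local Notation etax := (@interp_err_x R eps beta N).
Local Notation etay := (@interp_err_y R eps beta N).
Variable (Db : nat -> nat -> R * R -> R).
Hypotheses (b_smooth : derivs 3 b Db) (cc : sqcont c).
Let cb : sqcont b := derivs_sqcont b_smooth.
Let cDb : sqcont (Db 1%N 0%N) := derivs_cont b_smooth (erefl : (1 + 0 <= 3)%N).
Local Notation err := (@consistency_err R eps beta N b c delta Db).
Local Notation form := (sd_form eps beta b c delta).

Lemma node_vert (P : R * R -> Prop) : (forall i j, (i <= N)%N -> (j <= N)%N -> P (xs i, ys j)) ->
  forall K, [/\ P (cornx xs K, corny ys K), P (cornx xs K + legx xs K, corny ys K) &
    P (cornx xs K, corny ys K + legy ys K)].
Proof.
move=> H K; have [iN jN] := (ltn_ord K.1.1, ltn_ord K.1.2).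
rewrite /cornx /corny /legx /legy /stepx /stepy; case: K.2;
  by rewrite ?opprB !subrKC; split; apply: H => //; exact: ltnW.
Qed.

Lemma node_Omega_bar i j : (i <= N)%N -> (j <= N)%N -> Omega_bar (xs i, ys j).
Proof.
move=> iN jN; have := @xs_le _ _ _ _ M 0 i; have := @xs_le _ _ _ _ M i N.
have := @ys_le _ _ _ _ M 0 j; have := @ys_le _ _ _ _ M j N.
rewrite !leqnn !iN !jN (mesh_xs0 M) (mesh_xsN M) (mesh_ys0 M) (mesh_ysN M).
move=> /(_ isT) ? /(_ isT) ? /(_ isT) ? /(_ isT) ?.
by split; rewrite /= in_itv/=; lra.
Qed.

Variables (u uI uN : R * R -> R) (U : nat -> nat -> R * R -> R).
Hypotheses (uU : derivs 2 u U) (u_sol : bvp_solution eps b c f u)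
  (uI_int : nodal_interpolant eps beta N u uI)
  (uN_sol : sdfem_solution eps beta b c f delta uN).
Local Notation chi := (uI \- uN).

Let C2U : C2 U. Proof. by move=> i j; exact: derivs_cont uU. Qed.
Let PuI : P1 uI. Proof. by apply: VN_P1; case: uI_int. Qed.
Let PuN : P1 uN. Proof. by apply: VN_P1; case: uN_sol. Qed.
Let Pchi : P1 chi. Proof. exact: P1B. Qed.
Let VNchi : VN eps beta N chi.
Proof. by case: Pchi => cv av v0; split=> // K; rewrite tri_gtri. Qed.

Lemma interpolant_verts K : [/\ vert0 xs ys uI K = vert0 xs ys (U 0%N 0%N) K,
  vert1 xs ys uI K = vert1 xs ys (U 0%N 0%N) K & vert2 xs ys uI K = vert2 xs ys (U 0%N 0%N) K].
Proof.
apply: (node_vert (P := fun p => uI p = U 0%N 0%N p)) => i j iN jN.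
case: uI_int => _ H; rewrite (H i j iN jN); have [e _ _] := uU.
by rewrite (e _ (node_Omega_bar iN jN)).
Qed.

Lemma interpolant_lin K p : gtri xs ys K p -> uI p = lin (U 0%N 0%N) K p.
Proof.
move=> Kp; rewrite (P1_lin M PuI Kp) /lin_interp /gradx /grady.
by have [-> -> ->] := interpolant_verts K.
Qed.

Lemma interpolant_grad K : gx uI K = gx (U 0%N 0%N) K /\ gy uI K = gy (U 0%N 0%N) K.
Proof. by rewrite /gradx /grady; have [-> -> ->] := interpolant_verts K. Qed.

Let rhs p := - eps * (U 2%N 0%N p + U 0%N 2%N p) + b p * U 1%N 0%N p + c p * U 0%N 0%N p.

Let f_rhs p : Omega p -> f p = rhs p.
Proof.
move=> Op; case: u_sol => _ H _; rewrite -(H p Op) (derivs_laplacian uU)// (derivs_dx uU)//.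
by rewrite /rhs; have [e _ _] := uU; rewrite (e _ (Omega_sub Op)).
Qed.

(** Testing the scheme with [chi] replaces [uN] by [f], and [f] by the differential operator applied
    to [u]. The products u_x chi, u_y chi and b (uI - u) chi are continuous and vanish on the
    boundary, so the integrals of their derivatives sum to zero. Once these are added, the two sides
    agree pointwise on each triangle. *)
Lemma galerkin_orthogonality :
  \sum_(K : elt N) form chi chi K = \sum_(K : elt N) err chi U K.
Proof.
have [cchi _ chi0] := Pchi; have [cuI _ uI0] := PuI.
have c00 : sqcont (U 0%N 0%N) by exact: C2U. have c10 : sqcont (U 1%N 0%N) by exact: C2U. have c01 : sqcont (U 0%N 1%N) by exact: C2U.
have c20 : sqcont (U 2%N 0%N) by exact: C2U. have c02 : sqcont (U 0%N 2%N) by exact: C2U.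
have crhs : sqcont rhs by rewrite /rhs; sqc.
have e1 : \sum_(K : elt N) form uN chi K =
    \sum_(K : elt N) (IK K (fun p => rhs p * chi p)
      + delta K * gx chi K * IK K (fun p => rhs p * b p)).
  rewrite -(a_SD_form _ M cb cc)//; case: uN_sol => _ /(_ _ VNchi) ->.
  rewrite big_split/=; congr (_ + _).
    rewrite (@ip_Omega _ _ _ _ M _ _ (fun _ p => rhs p * chi p))//.
      by move=> _; sqc.
    by move=> K p Kp; rewrite f_rhs//; exact: (otri_Omega M Kp).
  apply: eq_bigr => K _.
  rewrite -(tri_intZ M); last by sqc.
  apply: (ip_tri M) => p Kp; rewrite f_rhs; last exact: (otri_Omega M Kp).
  by rewrite (P1_dx M Pchi Kp); ring.
have ibp_x : \sum_(K : elt N) IK K (fun p => U 1%N 0%N p * gx chi K + chi p * U 2%N 0%N p) = 0.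
  apply: (sum_tri_int_dx M (F := fun p => U 1%N 0%N p * chi p)); [sqc|by move=> K; sqc| |].
  - move=> K p Kp; have Op := otri_Omega M Kp.
    have D1 := derivs_x uU (erefl : (1 + 0 < 2)%N) Op.
    have D2 := P1_derive_x M Pchi Kp.
    by apply: is_derive_eq (is_derive1M D1 D2) _; rewrite -!surjective_pairing.
  - by move=> p Op; rewrite chi0// mulr0.
have ibp_y : \sum_(K : elt N) IK K (fun p => U 0%N 1%N p * gy chi K + chi p * U 0%N 2%N p) = 0.
  apply: (sum_tri_int_dy M (F := fun p => U 0%N 1%N p * chi p)); [sqc|by move=> K; sqc| |].
  - move=> K p Kp; have Op := otri_Omega M Kp.
    have D1 := derivs_y uU (erefl : (0 + 1 < 2)%N) Op.
    have D2 := P1_derive_y M Pchi Kp.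
    by apply: is_derive_eq (is_derive1M D1 D2) _; rewrite -!surjective_pairing.
  - by move=> p Op; rewrite chi0// mulr0.
have ibp_b : \sum_(K : elt N) IK K (fun p => Db 1%N 0%N p * (eta U K p * chi p)
    + b p * (etax U K p * chi p + eta U K p * gx chi K)) = 0.
  have ce K : sqcont (eta U K) by exact: sqcont_interp_err.
  have cex K : sqcont (etax U K) by exact: sqcont_interp_err_x.
  apply: (sum_tri_int_dx M (F := fun p => b p * ((uI p - U 0%N 0%N p) * chi p)));
    [sqc|by move=> K; have [? ?] := (ce K, cex K); sqc| |].
  - move=> K p Kp; have Op := otri_Omega M Kp.
    have D1 := derivs0_x b_smooth isT Op.
    have D2 := P1_derive_x M Pchi Kp.
    have D3 := P1_derive_x M PuI Kp.
    have D4 := derivs_x uU (erefl : (0 + 0 < 2)%N) Op.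
    apply: is_derive_eq (is_derive1M D1 (is_derive1M (is_derive1B D3 D4) D2)) _.
    rewrite -!surjective_pairing (interpolant_lin (otri_gtri M Kp)) /interp_err /interp_err_x.
    by have [-> _] := interpolant_grad K; ring.
  - by move=> p Op; rewrite chi0// !mulr0.
have -> : \sum_(K : elt N) form chi chi K = \sum_(K : elt N) form uI chi K - \sum_(K : elt N) form uN chi K.
  by rewrite -sumrB; apply: eq_bigr => K _; rewrite (form_sub _ M cb cc).
rewrite e1 -sumrB.
have -> : \sum_(K : elt N) err chi U K = \sum_(K : elt N) (err chi U K
    + (eps * IK K (fun p => U 1%N 0%N p * gx chi K + chi p * U 2%N 0%N p)
    + eps * IK K (fun p => U 0%N 1%N p * gy chi K + chi p * U 0%N 2%N p)
    + IK K (fun p => Db 1%N 0%N p * (eta U K p * chi p)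
        + b p * (etax U K p * chi p + eta U K p * gx chi K)))).
  by rewrite !big_split/= -!mulr_sumr ibp_x ibp_y ibp_b !mulr0 !addr0.
apply: eq_bigr => K _.
have ce : sqcont (eta U K) by exact: sqcont_interp_err.
have cex : sqcont (etax U K) by exact: sqcont_interp_err_x.
have cey : sqcont (etay U K) by exact: sqcont_interp_err_y.
have cL : sqcont (lin (U 0%N 0%N) K) by exact: sqcont_lin.
have [gxE gyE] := interpolant_grad K.
rewrite /sd_form /consistency_err gxE gyE.
have -> : IK K (fun p => (b p * gx (U 0%N 0%N) K + c p * uI p) * chi p) =
    IK K (fun p => (b p * gx (U 0%N 0%N) K + c p * lin (U 0%N 0%N) K p) * chi p).
  by apply: eq_tri_int => p /(otri_gtri M) Kp; rewrite (interpolant_lin Kp).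
have -> : IK K (fun p => (b p * gx (U 0%N 0%N) K + c p * uI p) * b p) =
    IK K (fun p => (b p * gx (U 0%N 0%N) K + c p * lin (U 0%N 0%N) K p) * b p).
  by apply: eq_tri_int => p /(otri_gtri M) Kp; rewrite (interpolant_lin Kp).
have cF : sqcont (stream_flux eps beta b c delta U K) by exact: (sqcont_stream_flux b_smooth cc C2U).
pose A0 := eps * (gx (U 0%N 0%N) K * gx chi K + gy (U 0%N 0%N) K * gy chi K).
transitivity (IK K (fun p => A0 +
    ((b p * gx (U 0%N 0%N) K + c p * lin (U 0%N 0%N) K p) * chi p
    + delta K * gx chi K * ((b p * gx (U 0%N 0%N) K + c p * lin (U 0%N 0%N) K p) * b p)
    - (rhs p * chi p + delta K * gx chi K * (rhs p * b p))))).
  rewrite (tri_intD M) ?(tri_int_cst M); [|sqc|sqc].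
  rewrite (tri_intB M); [|sqc|sqc].
  rewrite (tri_intD M); [|sqc|sqc]; rewrite (tri_intZ M); last by sqc.
  rewrite (tri_intD M); [|sqc|sqc]; rewrite (tri_intZ M); last by sqc.
  by rewrite /A0; ring.
transitivity (IK K (fun p => (gx chi K * stream_flux eps beta b c delta U K p
   + eps * gy chi K * etay U K p) + (c p - Db 1%N 0%N p) * eta U K p * chi p
   + (eps * (U 1%N 0%N p * gx chi K + chi p * U 2%N 0%N p)
   + eps * (U 0%N 1%N p * gy chi K + chi p * U 0%N 2%N p)
   + (Db 1%N 0%N p * (eta U K p * chi p)
    + b p * (etax U K p * chi p + eta U K p * gx chi K))))).
  by apply: eq_tri_int => p _; rewrite /stream_flux /rhs /A0 /interp_err_x /interp_err_y /interp_err; ring.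
rewrite (tri_intD M); [|sqc|sqc].
congr (_ + _).
  rewrite (tri_intD M); [|sqc|sqc]; congr (_ + _).
  rewrite (tri_intD M); [|sqc|sqc]; rewrite (tri_intZ M); last by sqc.
  by rewrite (tri_intZ M).
rewrite (tri_intD M); [|sqc|sqc]; congr (_ + _).
rewrite (tri_intD M); [|sqc|sqc]; rewrite (tri_intZ M); last by sqc.
by rewrite (tri_intZ M)//; sqc.
Qed.
End galerkin.

(** * Interpolation on a cell *)

Section rectangles.
Context {R : realType}.
Implicit Types (a b c d x y : R) (f g : R * R -> R) (p q : R * R).

Definition rect a b c d : set (R * R) := [set p | a <= p.1 <= b /\ c <= p.2 <= d].
Definition orect a b c d : set (R * R) := [set p | a < p.1 < b /\ c < p.2 < d].

Definition C1_rect a b c d f fx fy := [/\ {within rect a b c d, continuous f},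
  forall p, orect a b c d p -> is_derive p.1 1 (fun s => f (s, p.2)) (fx p) &
  forall p, orect a b c d p -> is_derive p.2 1 (fun t => f (p.1, t)) (fy p)].

(** Derivatives are available only inside a rectangle; continuity carries the resulting bounds to
    its sides. *)
Lemma within_closure_bound a b (phi : R -> R) m : a < b -> {within `[a, b], continuous phi} ->
  (forall x, a < x < b -> `|phi x| <= m) -> forall x, a <= x <= b -> `|phi x| <= m.
Proof.
move=> ab cphi H x xab; have [_ ca cb] := (continuous_within_itvP phi ab).1 cphi.
have [xa|nxa] := eqVneq x a.
  rewrite xa; have L : `|phi t| @[t --> a^'+] --> `|phi a| by apply: cvg_norm.
  apply: (@closed_cvg _ _ _ _ (fun t => `|phi t|) [set z | z <= m] (@closed_le R m) _ _ L).
  near=> t; apply: H; apply/andP; split.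
    by near: t; exact: nbhs_right_gt.
  by near: t; exact: nbhs_right_lt.
have [xb|nxb] := eqVneq x b.
  rewrite xb; have L : `|phi t| @[t --> b^'-] --> `|phi b| by apply: cvg_norm.
  apply: (@closed_cvg _ _ _ _ (fun t => `|phi t|) [set z | z <= m] (@closed_le R m) _ _ L).
  near=> t; apply: H; apply/andP; split.
    by near: t; exact: nbhs_left_gt.
  by near: t; exact: nbhs_left_lt.
by apply: H; rewrite !lt_neqAle eq_sym nxa nxb.
Unshelve. all: by end_near. Qed.

Lemma C1_rect_mvx a b c d f fx fy (k m : R) : a < b -> c < d -> C1_rect a b c d f fx fy ->
  (forall p, orect a b c d p -> `|fx p - k| <= m) ->
  forall x x' y, a <= x <= b -> a <= x' <= b -> c <= y <= d ->
  `|f (x', y) - f (x, y) - k * (x' - x)| <= m * `|x' - x|.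
Proof.
move=> ab cd [cf dfx _] H.
have segx u v y : a <= u -> v <= b -> c <= y <= d -> {within `[u, v], continuous (fun s => f (s, y))}.
  move=> au vb yc; apply: (@within_comp _ R _ _ (rect a b c d) (fun s => (s, y)) f) => //.
    exact: pairl_continuous.
  by move=> s /=; rewrite in_itv/= => ?; split => /=; lra.
have main x x' y : a <= x -> x < x' -> x' <= b -> c <= y <= d ->
    `|f (x', y) - f (x, y) - k * (x' - x)| <= m * `|x' - x|.
  move=> ax xx' x'b; move: y.
  apply: (@within_closure_bound c d (fun y => f (x', y) - f (x, y) - k * (x' - x))) => //.
    have segy u : a <= u <= b -> {within `[c, d], continuous (fun t => f (u, t))}.
      move=> uab; apply: (@within_comp _ R _ _ (rect a b c d) (fun t => (u, t)) f) => //.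
        exact: pairr_continuous.
    apply: within_D; last by apply: within_N; exact: within_cst.
    apply: within_D; first by apply: segy; lra.
    by apply: within_N; apply: segy; lra.
  move=> y yc.
  have D s : s \in `]x, x'[%R -> is_derive s 1 (fun s => f (s, y)) (fx (s, y)).
    by rewrite in_itv/= => ?; apply: (dfx (s, y)); split=> /=; lra.
  have [z zx E] := MVT xx' D (segx x x' y ax x'b ltac:(lra)).
  have {}zx : x < z < x' by move: zx; rewrite in_itv.
  rewrite E; rewrite -mulrBl normrM ler_wpM2r//.
  by apply: H; split=> /=; lra.
move=> x x' y xa x'a yc; have [xx'|x'x|->] := ltgtP x x'.
- by apply: main => //; lra.
- rewrite [`|x' - x|]distrC.
  rewrite (_ : f (x', y) - f (x, y) - k * (x' - x) = - (f (x, y) - f (x', y) - k * (x - x'))); last by ring.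
  by rewrite normrN; apply: main => //; lra.
- by rewrite !subrr mulr0 subrr normr0 mulr0.
Qed.

Lemma C1_rect_swap a b c d f fx fy : C1_rect a b c d f fx fy ->
  C1_rect c d a b (fun p => f (p.2, p.1)) (fun p => fy (p.2, p.1)) (fun p => fx (p.2, p.1)).
Proof.
move=> [cf dfx dfy]; split.
- apply: (@within_comp _ _ _ _ (rect a b c d) (fun p : R * R => (p.2, p.1)) f) => //.
    move=> p; apply: (@cvg_pair _ _ _ (nbhs p) (nbhs p.2) (nbhs p.1)).
      exact: cvg_snd.
    exact: cvg_fst.
  by move=> p [? ?]; split.
- by move=> p [? ?]; apply: (dfy (p.2, p.1)); split.
- by move=> p [? ?]; apply: (dfx (p.2, p.1)); split.
Qed.

Lemma C1_rect_mvy a b c d f fx fy (k m : R) : a < b -> c < d -> C1_rect a b c d f fx fy ->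
  (forall p, orect a b c d p -> `|fy p - k| <= m) ->
  forall x y y', a <= x <= b -> c <= y <= d -> c <= y' <= d ->
  `|f (x, y') - f (x, y) - k * (y' - y)| <= m * `|y' - y|.
Proof.
move=> ab cd /C1_rect_swap C H x y y' xa yc y'c.
have H' p : orect c d a b p -> `|fy (p.2, p.1) - k| <= m by move=> [? ?]; apply: H; split.
exact: (C1_rect_mvx cd ab C H' yc y'c xa).
Qed.

Lemma orect_rect a b c d p : orect a b c d p -> rect a b c d p.
Proof. by move=> [? ?]; split; lra. Qed.

Lemma C1_rect_osc a b c d f fx fy (mx my : R) : a < b -> c < d -> C1_rect a b c d f fx fy ->
  (forall p, rect a b c d p -> `|fx p| <= mx) -> (forall p, rect a b c d p -> `|fy p| <= my) ->
  forall p q, rect a b c d p -> rect a b c d q ->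
  `|f q - f p| <= mx * `|q.1 - p.1| + my * `|q.2 - p.2|.
Proof.
move=> ab cd C Hx Hy [x y] [x' y'] [/= xa yc] [/= xa' yc'].
have H1 := C1_rect_mvx (k := 0) ab cd C (fun p Hp =>
  eq_ind_r (fun z => `|z| <= mx) (Hx p (orect_rect Hp)) (subr0 _)) xa xa' yc.
have H2 := C1_rect_mvy (k := 0) ab cd C (fun p Hp =>
  eq_ind_r (fun z => `|z| <= my) (Hy p (orect_rect Hp)) (subr0 _)) xa' yc yc'.
rewrite !mul0r !subr0 in H1 H2.
rewrite (_ : f (x', y') - f (x, y) = (f (x', y) - f (x, y)) + (f (x', y') - f (x', y))); last by ring.
by apply: (le_trans (ler_normD _ _)); apply: lerD.
Qed.

Lemma C1_rectB a b c d f fx fy g gx gy : C1_rect a b c d f fx fy -> C1_rect a b c d g gx gy ->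
  C1_rect a b c d (fun p => f p - g p) (fun p => fx p - gx p) (fun p => fy p - gy p).
Proof.
move=> [cf dfx dfy] [cg dgx dgy]; split.
- by apply: within_D => //; exact: within_N.
- by move=> p Hp; apply: is_derive1B; [exact: dfx|exact: dgx].
- by move=> p Hp; apply: is_derive1B; [exact: dfy|exact: dgy].
Qed.

Lemma C1_rectW a b c d a' b' c' d' f fx fy : a <= a' -> b' <= b -> c <= c' -> d' <= d ->
  C1_rect a b c d f fx fy -> C1_rect a' b' c' d' f fx fy.
Proof.
move=> aa bb cc dd [cf dfx dfy]; split.
- by apply: continuous_subspaceW cf => p [/= ? ?]; split; lra.
- by move=> p [? ?]; apply: dfx; split; lra.
- by move=> p [? ?]; apply: dfy; split; lra.
Qed.

Lemma C1_rect_comp (sg tx ty : R) a b c d a' b' c' d' f fx fy :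
  (forall p, rect a b c d p -> rect a' b' c' d' (sg * p.1 + tx, sg * p.2 + ty)) ->
  (forall p, orect a b c d p -> orect a' b' c' d' (sg * p.1 + tx, sg * p.2 + ty)) ->
  C1_rect a' b' c' d' f fx fy ->
  C1_rect a b c d (fun p => f (sg * p.1 + tx, sg * p.2 + ty))
    (fun p => sg * fx (sg * p.1 + tx, sg * p.2 + ty))
    (fun p => sg * fy (sg * p.1 + tx, sg * p.2 + ty)).
Proof.
move=> Hr Ho [cf dfx dfy].
have aff (u t x : R) : is_derive x 1 (fun x => u * x + t) u.
  have D := is_derive1D (is_derive1M (is_derive1_cst x u) (is_derive1_id x)) (is_derive1_cst x t).
  by apply: is_derive_eq D _; ring.
split.
- apply: (@within_comp _ _ _ _ (rect a' b' c' d') (fun p : R * R => (sg * p.1 + tx, sg * p.2 + ty)) f) => //.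
  move=> p; apply: (@cvg_pair _ _ _ (nbhs p) (nbhs (sg * p.1 + tx)) (nbhs (sg * p.2 + ty))).
    by apply: cvgD; [apply: cvgM; [exact: cvg_cst|exact: cvg_fst]|exact: cvg_cst].
  by apply: cvgD; [apply: cvgM; [exact: cvg_cst|exact: cvg_snd]|exact: cvg_cst].
- move=> p Hp; have D := dfx _ (Ho p Hp).
  have := @is_derive1_comp R (fun s => f (s, sg * p.2 + ty)) (fun s => sg * s + tx) p.1 _ _ D (aff _ _ _).
  by move=> D'; apply: is_derive_eq D' _; ring.
- move=> p Hp; have D := dfy _ (Ho p Hp).
  have := @is_derive1_comp R (fun s => f (sg * p.1 + tx, s)) (fun s => sg * s + ty) p.2 _ _ D (aff _ _ _).
  by move=> D'; apply: is_derive_eq D' _; ring.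
Qed.
End rectangles.

Section cell_interpolation.
Context {R : realType}.
Variables (N : nat) (xs ys : nat -> R).
Hypothesis M : is_mesh N xs ys.
Implicit Types (K : elt N) (g : R * R -> R) (p : R * R).
Local Notation hx := (stepx xs).
Local Notation hy := (stepy ys).
Local Notation gx := (gradx xs ys).
Local Notation gy := (grady xs ys).
Local Notation lin := (lin_interp xs ys).
Definition cell K := rect (xs K.1.1) (xs K.1.1.+1) (ys K.1.2) (ys K.1.2.+1).
Definition C1_cell K := C1_rect (xs K.1.1) (xs K.1.1.+1) (ys K.1.2) (ys K.1.2.+1).
Let ltx K : xs K.1.1 < xs K.1.1.+1. Proof. exact: mesh_xs_lt M _ (ltn_ord _). Qed.
Let lty K : ys K.1.2 < ys K.1.2.+1. Proof. exact: mesh_ys_lt M _ (ltn_ord _). Qed.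

Lemma gradxE g K : gx g K = (g (xs K.1.1.+1, corny ys K) - g (xs K.1.1, corny ys K)) / hx K.1.1.
Proof.
rewrite /gradx /vert1 /vert0 /legx /cornx /stepx; case: K.2.
  by rewrite subrKC.
by rewrite opprB subrKC -[RHS]mulrNN -invrN !opprB.
Qed.

Lemma gradyE g K : gy g K = (g (cornx xs K, ys K.1.2.+1) - g (cornx xs K, ys K.1.2)) / hy K.1.2.
Proof.
rewrite /grady /vert2 /vert0 /legy /corny /stepy; case: K.2.
  by rewrite subrKC.
by rewrite opprB subrKC -[RHS]mulrNN -invrN !opprB.
Qed.

Lemma cornx_itv K : xs K.1.1 <= cornx xs K <= xs K.1.1.+1.
Proof. by have := ltx K; rewrite /cornx; case: K.2; lra. Qed.
Lemma corny_itv K : ys K.1.2 <= corny ys K <= ys K.1.2.+1.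
Proof. by have := lty K; rewrite /corny; case: K.2; lra. Qed.

Lemma cell_diam K p q : cell K p -> cell K q ->
  `|p.1 - q.1| <= hx K.1.1 /\ `|p.2 - q.2| <= hy K.1.2.
Proof. by move=> [? ?] [? ?]; rewrite !ler_norml /stepx /stepy; split; lra. Qed.

Lemma gradx_near g g10 g01 K (k m : R) : C1_cell K g g10 g01 ->
  (forall p, cell K p -> `|g10 p - k| <= m) -> `|gx g K - k| <= m.
Proof.
move=> C H; have h := hx_gt0 M (ltn_ord K.1.1).
have H' p (Kp : orect (xs K.1.1) (xs K.1.1.+1) (ys K.1.2) (ys K.1.2.+1) p) := H p (orect_rect Kp).
have xr : xs K.1.1 <= xs K.1.1 <= xs K.1.1.+1 by have := ltx K; lra.
have xr' : xs K.1.1 <= xs K.1.1.+1 <= xs K.1.1.+1 by have := ltx K; lra.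
have := C1_rect_mvx (ltx K) (lty K) C H' xr xr' (corny_itv K).
rewrite -/(hx _) (gtr0_norm h) gradxE => D.
rewrite (_ : _ / _ - k = (g (xs K.1.1.+1, corny ys K) - g (xs K.1.1, corny ys K) - k * hx K.1.1) / hx K.1.1).
  by rewrite normrM normfV (gtr0_norm h) ler_pdivrMr.
by field; rewrite lt0r_neq0.
Qed.

Lemma grady_near g g10 g01 K (k m : R) : C1_cell K g g10 g01 ->
  (forall p, cell K p -> `|g01 p - k| <= m) -> `|gy g K - k| <= m.
Proof.
move=> C H; have h := hy_gt0 M (ltn_ord K.1.2).
have H' p (Kp : orect (xs K.1.1) (xs K.1.1.+1) (ys K.1.2) (ys K.1.2.+1) p) := H p (orect_rect Kp).
have yr : ys K.1.2 <= ys K.1.2 <= ys K.1.2.+1 by have := lty K; lra.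
have yr' : ys K.1.2 <= ys K.1.2.+1 <= ys K.1.2.+1 by have := lty K; lra.
have := C1_rect_mvy (ltx K) (lty K) C H' (cornx_itv K) yr yr'.
rewrite -/(hy _) (gtr0_norm h) gradyE => D.
rewrite (_ : _ / _ - k = (g (cornx xs K, ys K.1.2.+1) - g (cornx xs K, ys K.1.2) - k * hy K.1.2) / hy K.1.2).
  by rewrite normrM normfV (gtr0_norm h) ler_pdivrMr.
by field; rewrite lt0r_neq0.
Qed.

Lemma gradx_bound g g10 g01 K (m : R) : C1_cell K g g10 g01 ->
  (forall p, cell K p -> `|g10 p| <= m) -> `|gx g K| <= m.
Proof.
move=> C H; rewrite -[gx g K]subr0; apply: (gradx_near C) => p Kp.
by rewrite subr0; exact: H.
Qed.

Lemma grady_bound g g10 g01 K (m : R) : C1_cell K g g10 g01 ->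
  (forall p, cell K p -> `|g01 p| <= m) -> `|gy g K| <= m.
Proof.
move=> C H; rewrite -[gy g K]subr0; apply: (grady_near C) => p Kp.
by rewrite subr0; exact: H.
Qed.

Lemma osc_cell g g10 g01 K (m10 m01 : R) : C1_cell K g g10 g01 ->
  (forall p, cell K p -> `|g10 p| <= m10) -> (forall p, cell K p -> `|g01 p| <= m01) ->
  forall p q, cell K p -> cell K q -> `|g q - g p| <= hx K.1.1 * m10 + hy K.1.2 * m01.
Proof.
move=> C H1 H2 p q Kp Kq; have [d1 d2] := cell_diam Kq Kp.
apply: (le_trans (C1_rect_osc (ltx K) (lty K) C H1 H2 Kp Kq)).
have m1 : 0 <= m10 := le_trans (normr_ge0 _) (H1 p Kp).
have m2 : 0 <= m01 := le_trans (normr_ge0 _) (H2 p Kp).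
by apply: lerD; rewrite mulrC; exact: ler_wpM2r.
Qed.

Lemma gradx_error g g10 g01 g20 g11 K (m20 m11 : R) :
  C1_cell K g g10 g01 -> C1_cell K g10 g20 g11 ->
  (forall p, cell K p -> `|g20 p| <= m20) -> (forall p, cell K p -> `|g11 p| <= m11) ->
  forall p, cell K p -> `|gx g K - g10 p| <= hx K.1.1 * m20 + hy K.1.2 * m11.
Proof.
move=> C C10 H20 H11 p Kp; apply: (gradx_near C) => q Kq.
exact: (osc_cell C10 H20 H11).
Qed.

Lemma grady_error g g10 g01 g11 g02 K (m11 m02 : R) :
  C1_cell K g g10 g01 -> C1_cell K g01 g11 g02 ->
  (forall p, cell K p -> `|g11 p| <= m11) -> (forall p, cell K p -> `|g02 p| <= m02) ->
  forall p, cell K p -> `|gy g K - g01 p| <= hx K.1.1 * m11 + hy K.1.2 * m02.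
Proof.
move=> C C01 H11 H02 p Kp; apply: (grady_near C) => q Kq.
exact: (osc_cell C01 H11 H02).
Qed.

(** The error vanishes at the right-angled vertex. From there the point is reached by a horizontal
    and a vertical move, along which the error grows at the rate of one gradient error each. *)
Lemma lin_error g g10 g01 K (m1 m2 : R) : C1_cell K g g10 g01 ->
  (forall p, cell K p -> `|gx g K - g10 p| <= m1) ->
  (forall p, cell K p -> `|gy g K - g01 p| <= m2) ->
  forall p, cell K p -> `|lin g K p - g p| <= hx K.1.1 * m1 + hy K.1.2 * m2.
Proof.
move=> C H1 H2 [x y] Kp; have [/= xr yr] := Kp.
have H1' q (Kq : orect (xs K.1.1) (xs K.1.1.+1) (ys K.1.2) (ys K.1.2.+1) q) :
  `|g10 q - gx g K| <= m1 by rewrite distrC; exact: H1 (orect_rect Kq).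
have H2' q (Kq : orect (xs K.1.1) (xs K.1.1.+1) (ys K.1.2) (ys K.1.2.+1) q) :
  `|g01 q - gy g K| <= m2 by rewrite distrC; exact: H2 (orect_rect Kq).
have D1 := C1_rect_mvx (ltx K) (lty K) C H1' (cornx_itv K) xr (corny_itv K).
have D2 := C1_rect_mvy (ltx K) (lty K) C H2' xr (corny_itv K) yr.
have Kc : cell K (cornx xs K, corny ys K) by split; [exact: cornx_itv|exact: corny_itv].
have [d1 d2] := cell_diam Kp Kc; rewrite /= in d1 d2.
rewrite (_ : lin g K (x, y) - g (x, y) =
  - ((g (x, corny ys K) - g (cornx xs K, corny ys K) - gx g K * (x - cornx xs K))
     + (g (x, y) - g (x, corny ys K) - gy g K * (y - corny ys K)))); last first.
  by rewrite /lin_interp /vert0/=; ring.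
rewrite normrN; apply: (le_trans (ler_normD _ _)).
have m10 : 0 <= m1 := le_trans (normr_ge0 _) (H1 _ Kp).
have m20 : 0 <= m2 := le_trans (normr_ge0 _) (H2 _ Kp).
apply: lerD; [apply: (le_trans D1)|apply: (le_trans D2)]; by rewrite mulrC; exact: ler_wpM2r.
Qed.

(** The point ranges over the whole rectangle, where the affine function of one triangle is
    extrapolated: 5 = 1 + 2 + 2, one value and one increment per leg. *)
Lemma lin_bound g K (m : R) : (forall p, cell K p -> `|g p| <= m) ->
  forall p, cell K p -> `|lin g K p| <= 5 * m.
Proof.
move=> H p Kp; have h := legx_neq0 M K; have k := legy_neq0 M K.
have Kc : cell K (cornx xs K, corny ys K) by split; [exact: cornx_itv|exact: corny_itv].
have hxE : `|legx xs K| = hx K.1.1.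
  by rewrite /legx; case: K.2; rewrite ?normrN gtr0_norm//; exact: (hx_gt0 M (ltn_ord K.1.1)).
have hyE : `|legy ys K| = hy K.1.2.
  by rewrite /legy; case: K.2; rewrite ?normrN gtr0_norm//; exact: (hy_gt0 M (ltn_ord K.1.2)).
have b0 : `|vert0 xs ys g K| <= m by exact: H.
have b1 : `|vert1 xs ys g K| <= m.
  apply: H; split; last exact: corny_itv.
  by have := ltx K; rewrite /cornx /legx /stepx/=; case: K.2; lra.
have b2 : `|vert2 xs ys g K| <= m.
  apply: H; split; first exact: cornx_itv.
  by have := lty K; rewrite /corny /legy /stepy/=; case: K.2; lra.
have [d1 d2] := cell_diam Kp Kc; rewrite /= in d1 d2.
have m0 : 0 <= m := le_trans (normr_ge0 _) b0.
have t1 : `|gx g K * (p.1 - cornx xs K)| <= 2 * m.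
  rewrite /gradx mulrAC normrM normfV hxE ler_pdivrMr ?(hx_gt0 M)// normrM.
  apply: ler_pM => //; apply: (le_trans (ler_normB _ _)); lra.
have t2 : `|gy g K * (p.2 - corny ys K)| <= 2 * m.
  rewrite /grady mulrAC normrM normfV hyE ler_pdivrMr ?(hy_gt0 M)// normrM.
  apply: ler_pM => //; apply: (le_trans (ler_normB _ _)); lra.
rewrite /lin_interp; apply: (le_trans (ler_normD _ _)).
have := ler_normD (vert0 xs ys g K) (gx g K * (p.1 - cornx xs K)); lra.
Qed.

Lemma open_tri_cell K p : open_tri xs ys K p -> cell K p.
Proof. by move=> /(otri_box M)[? ? ? ?]; split; lra. Qed.

Lemma derivs_C1_rect (a b c d : R) (w : R * R -> R) (W : nat -> nat -> R * R -> R) i j : 0 <= a -> b <= 1 -> 0 <= c -> d <= 1 ->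
  derivs 3 w W -> (i + j < 3)%N -> C1_rect a b c d (W i j) (W i.+1 j) (W i j.+1).
Proof.
move=> a0 b1 c0 d1 wW ij; split.
- apply: continuous_subspaceW (derivs_cont wW (ltnW ij)) => p [? ?].
  by split; rewrite /= in_itv/=; lra.
- by move=> p [? ?]; apply: (derivs_x wW ij); split; rewrite /= in_itv/=; lra.
- by move=> p [? ?]; apply: (derivs_y wW ij); split; rewrite /= in_itv/=; lra.
Qed.
End cell_interpolation.

(** * Discrete sums *)

Section finite_sums.
Context {R : realType}.

Lemma weighted_cauchy_schwarz (I : finType) (P : pred I) (w a : I -> R) (A B : R) :
  (forall i, 0 <= w i) -> 0 <= A -> 0 <= B ->
  \sum_(i | P i) w i <= A ^+ 2 -> \sum_(i | P i) w i * a i ^+ 2 <= B ^+ 2 ->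
  \sum_(i | P i) w i * `|a i| <= A * B.
Proof.
move=> w0 A0 B0; set W := \sum_(i | P i) w i; set Q := \sum_(i | P i) _; set S := \sum_(i | P i) _.
move=> WA QB.
have W0 : 0 <= W by apply: sumr_ge0.
have S0 : 0 <= S by apply: sumr_ge0 => i _; rewrite mulr_ge0.
have Q0 : 0 <= Q by apply: sumr_ge0 => i _; rewrite mulr_ge0// sqr_ge0.
have SQ : S ^+ 2 <= W * Q.
  have [W00|Wn0] := eqVneq W 0.
    have wi i : P i -> w i = 0.
      by move=> Pi; apply/eqP; move/eqP: W00; rewrite psumr_eq0// => /allP/(_ i (mem_index_enum _)); rewrite Pi.
    by rewrite W00 mul0r /S big1 ?expr0n// => i /wi ->; rewrite mul0r.
  have Wp : 0 < W by rewrite lt_neqAle eq_sym Wn0.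
  have : 0 <= \sum_(i | P i) w i * (W * `|a i| - S) ^+ 2.
    by apply: sumr_ge0 => i _; rewrite mulr_ge0// sqr_ge0.
  have -> : \sum_(i | P i) w i * (W * `|a i| - S) ^+ 2 = W * (W * Q - S ^+ 2).
    transitivity (\sum_(i | P i) (W ^+ 2 * (w i * a i ^+ 2) + - 2 * W * S * (w i * `|a i|) + S ^+ 2 * w i)).
      by apply: eq_bigr => i _; rewrite -[a i ^+ 2]real_normK ?num_real//; ring.
    by rewrite !big_split/= -!mulr_sumr -/W -/Q -/S; ring.
  by rewrite pmulr_rge0// subr_ge0.
rewrite -/S -(ger0_norm S0) -sqrtr_sqr -(ger0_norm (mulr_ge0 A0 B0)) -sqrtr_sqr.
by apply: ler_wsqrtr; rewrite exprMn; apply: (le_trans SQ); exact: ler_pM.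
Qed.

Lemma summation_by_parts (x m : nat -> R) n : x 0%N = 0 ->
  \sum_(i < n.+1) (x i.+1 - x i) * m i =
  x n.+1 * m n - \sum_(i < n) x i.+1 * (m i.+1 - m i).
Proof.
move=> x0; elim: n => [|n IH]; first by rewrite big_ord_recr !big_ord0/= x0; ring.
by rewrite big_ord_recr/= IH [in RHS]big_ord_recr/=; ring.
Qed.

Lemma summation_by_parts_bound (x m : nat -> R) n (a H al : R) : x 0%N = 0 ->
  `|m n| <= al * a -> (forall i, (i < n)%N -> `|m i.+1 - m i| <= al * a * H) ->
  `|\sum_(i < n.+1) (x i.+1 - x i) * m i| <=
  al * a * `|x n.+1| + \sum_(i < n) al * a * H * `|x i.+1|.
Proof.
move=> x0 mn dm; rewrite summation_by_parts//; apply: (le_trans (ler_normB _ _)).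
apply: lerD; first by rewrite normrM mulrC ler_wpM2r.
apply: (le_trans (ler_norm_sum _ _ _)); apply: ler_sum => i _.
by rewrite normrM mulrC ler_wpM2r//; exact: dm.
Qed.

(** [d j] is the tangential derivative on the j-th of a stack of parallel edges; [t j] and [f j]
    belong to the lower and the upper triangle of strip j, which lie at the edges j and j + 1.
    Regrouping by edges pairs [t j.+1] with [f j]; the two extreme edges drop out because [d]
    vanishes there. *)
Lemma paired_sum_bound (d t f al A : nat -> R) n : d 0%N = 0 -> d n = 0 ->
  (forall j, (j.+1 < n)%N -> `|t j.+1 + f j| <= A j.+1 * (al j.+1 + al j)) ->
  `|\sum_(j < n) (d j * t j + d j.+1 * f j)| <=
  \sum_(j < n) (al j * `|d j| * A j + al j * `|d j.+1| * A j.+1).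
Proof.
case: n => [|n] d0 dn H; first by rewrite !big_ord0 normr0.
rewrite !big_split/= big_ord_recl/= d0 mul0r add0r [X in _ + X]big_ord_recr/= dn mul0r addr0 -big_split/=.
rewrite [X in _ <= X + _]big_ord_recl/= d0 normr0 mulr0 mul0r add0r.
rewrite [X in _ <= _ + X]big_ord_recr/= dn normr0 mulr0 mul0r addr0 -big_split/=.
apply: (le_trans (ler_norm_sum _ _ _)); apply: ler_sum => i _ /=.
rewrite /bump/= add1n -mulrDr normrM.
have := ler_wpM2l (normr_ge0 (d i.+1)) (H i (ltn_ord i)); lra.
Qed.
End finite_sums.

Section discrete_estimates.
Context {R : realType}.
Variables (N : nat) (xs ys : nat -> R).
Hypothesis M : is_mesh N xs ys.
Implicit Types (K : elt N) (p : R * R) (P : pred (elt N)).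
Local Notation hx := (stepx xs).
Local Notation hy := (stepy ys).
Local Notation area := (tri_area xs ys).
Local Notation gx := (gradx xs ys).
Local Notation gy := (grady xs ys).
Variables (v : R * R -> R) (v0 : forall p, (Omega_bar `\` Omega) p -> v p = 0).

(** Dominates |v| on the triangle as well as the x-step times |v_x|, while its square, weighted by
    the area, is bounded by the squared L2 norm. *)
Definition vsum K := `|vert0 xs ys v K| + `|vert1 xs ys v K| + `|vert2 xs ys v K|.

Lemma vsum_ge0 K : 0 <= vsum K. Proof. by rewrite /vsum !addr_ge0. Qed.

Let area0 K : 0 <= area K. Proof. exact/ltW/area_gt0. Qed.

Lemma sum_area_rect (PI PJ : pred 'I_N) :
  \sum_(K : elt N | PI K.1.1 && PJ K.1.2) area K =
  (\sum_(i | PI i) hx i) * (\sum_(j | PJ j) hy j).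
Proof.
rewrite big_mkcond big_elt/= mulr_suml [RHS]big_mkcond; apply: eq_bigr => i _.
rewrite mulr_sumr; case: ifP => _ /=; last by rewrite big1// => j _; rewrite addr0.
rewrite [RHS]big_mkcond; apply: eq_bigr => j _.
by case: ifP => _; rewrite ?addr0// /tri_area/=; lra.
Qed.

Variables (E s A : R) (delta : elt N -> R).
Hypotheses (E0 : 0 <= E) (s0 : 0 < s) (A0 : 0 <= A)
  (Egx : \sum_(K : elt N) area K * gx v K ^+ 2 <= (E / s) ^+ 2)
  (Egy : \sum_(K : elt N) area K * gy v K ^+ 2 <= (E / s) ^+ 2)
  (Ev : \sum_(K : elt N) area K * vsum K ^+ 2 <= (A * E) ^+ 2)
  (Ed : \sum_(K : elt N) area K * (Num.sqrt (delta K) * gx v K) ^+ 2 <= (A * E) ^+ 2).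

Let subsum P (F : elt N -> R) B : (forall K, 0 <= F K) -> \sum_(K : elt N) F K <= B ->
  \sum_(K | P K) F K <= B.
Proof. by move=> F0; apply: le_trans; rewrite [leRHS](bigID P)/= lerDl sumr_ge0. Qed.

Lemma sum_gx_le P B : 0 <= B -> \sum_(K | P K) area K <= B ^+ 2 ->
  \sum_(K | P K) area K * `|gx v K| <= B * (E / s).
Proof.
move=> B0 HB; apply: weighted_cauchy_schwarz => //; first by rewrite divr_ge0// ltW.
by apply: subsum Egx => K; rewrite mulr_ge0// sqr_ge0.
Qed.

Lemma sum_gy_le P B : 0 <= B -> \sum_(K | P K) area K <= B ^+ 2 ->
  \sum_(K | P K) area K * `|gy v K| <= B * (E / s).
Proof.
move=> B0 HB; apply: weighted_cauchy_schwarz => //; first by rewrite divr_ge0// ltW.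
by apply: subsum Egy => K; rewrite mulr_ge0// sqr_ge0.
Qed.

Lemma sum_v_le P B : 0 <= B -> \sum_(K | P K) area K <= B ^+ 2 ->
  \sum_(K | P K) area K * vsum K <= B * (A * E).
Proof.
move=> B0 HB; under eq_bigr => K _ do rewrite -(ger0_norm (vsum_ge0 K)).
apply: weighted_cauchy_schwarz => //; first by rewrite mulr_ge0.
by apply: subsum Ev => K; rewrite mulr_ge0// sqr_ge0.
Qed.

Lemma sum_dgx_le P B : 0 <= B -> \sum_(K | P K) area K <= B ^+ 2 ->
  \sum_(K | P K) area K * (Num.sqrt (delta K) * `|gx v K|) <= B * (A * E).
Proof.
move=> B0 HB.
under eq_bigr => K _ do rewrite -{1}(ger0_norm (sqrtr_ge0 (delta K))) -normrM.
apply: weighted_cauchy_schwarz => //; first by rewrite mulr_ge0.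
by apply: subsum Ed => K; rewrite mulr_ge0// sqr_ge0.
Qed.

Let node_zero i j : (i <= N)%N -> (j <= N)%N -> (i = 0 \/ i = N \/ j = 0 \/ j = N)%N ->
  v (xs i, ys j) = 0.
Proof.
move=> iN jN ij; apply: v0; split.
  have := @xs_le _ _ _ _ M 0 i; have := @xs_le _ _ _ _ M i N.
  have := @ys_le _ _ _ _ M 0 j; have := @ys_le _ _ _ _ M j N.
  rewrite !leqnn !iN !jN (mesh_xs0 M) (mesh_xsN M) (mesh_ys0 M) (mesh_ysN M).
  move=> /(_ isT) ? /(_ isT) ? /(_ isT) ? /(_ isT) ?.
  by split; rewrite /= in_itv/=; lra.
move=> [/=]; rewrite !in_itv/=.
by case: ij => [->|[->|[->|->]]]; rewrite ?(mesh_xs0 M) ?(mesh_xsN M) ?(mesh_ys0 M) ?(mesh_ysN M); lra.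
Qed.

Let gx_true (i j : 'I_N) : gx v (i, j, true) = (v (xs i.+1, ys j) - v (xs i, ys j)) / hx i.
Proof. by rewrite /gradx /vert1 /vert0 /legx /cornx /corny /stepx/= subrKC. Qed.
Let gx_false (i j : 'I_N) : gx v (i, j, false) = (v (xs i.+1, ys j.+1) - v (xs i, ys j.+1)) / hx i.
Proof.
rewrite /gradx /vert1 /vert0 /legx /cornx /corny /stepx/= opprB subrKC.
by rewrite -[RHS]mulrNN -invrN !opprB.
Qed.
Let gy_true (i j : 'I_N) : gy v (i, j, true) = (v (xs i, ys j.+1) - v (xs i, ys j)) / hy j.
Proof. by rewrite /grady /vert2 /vert0 /legy /cornx /corny /stepy/= subrKC. Qed.
Let gy_false (i j : 'I_N) : gy v (i, j, false) = (v (xs i.+1, ys j.+1) - v (xs i.+1, ys j)) / hy j.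
Proof.
rewrite /grady /vert2 /vert0 /legy /cornx /corny /stepy/= opprB subrKC.
by rewrite -[RHS]mulrNN -invrN !opprB.
Qed.

(** [a] is the bound for a pair whose errors cancel, [a'] the excess on the rows in [bad]. The index
    handed to [bad] is that of the horizontal edge of [K], on which both triangles of a pair have
    the same x-slope: row j for a lower triangle, row j + 1 for an upper one. *)
Lemma paired_gx_bound (PI : pred 'I_N) (bad : pred nat) (a a' : R) (m : elt N -> R) :
  (forall i j j' : 'I_N, PI i -> val j' = j.+1 ->
    `|m (i, j', true) + m (i, j, false)| <=
    (a + a' *+ bad j.+1) * (area (i, j', true) + area (i, j, true))) ->
  `|\sum_(K : elt N | PI K.1.1) gx v K * m K| <=
  \sum_(K : elt N | PI K.1.1) area K * `|gx v K| * (a + a' *+ bad (if K.2 then val K.1.2 else K.1.2.+1)).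
Proof.
move=> H; rewrite big_mkcond [leRHS]big_mkcond !big_elt/=; apply: (le_trans (ler_norm_sum _ _ _)).
apply: ler_sum => i _; have [Pi|_] := boolP (PI i); last by rewrite !big1 ?normr0// => j _; rewrite addr0.
(* [i] serves merely as a default element for indices that are out of range. *)
pose ordj j := insubd i j.
have ordE (j : 'I_N) : ordj j = j by apply: val_inj; rewrite val_insubd ltn_ord.
pose d j := (v (xs i.+1, ys j) - v (xs i, ys j)) / hx i.
have := @paired_sum_bound R d (fun j => m (i, ordj j, true)) (fun j => m (i, ordj j, false))
  (fun j => area (i, ordj j, true)) (fun j => a + a' *+ bad j) N.
rewrite (eq_bigr (fun j : 'I_N => gx v (i, j, true) * m (i, j, true) + gx v (i, j, false) * m (i, j, false))); last first.
  by move=> j _; rewrite gx_true gx_false ordE.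
rewrite [X in _ -> _ -> _ -> _ <= X](eq_bigr (fun j : 'I_N =>
   area (i, j, true) * `|gx v (i, j, true)| * (a + a' *+ bad j) +
   area (i, j, false) * `|gx v (i, j, false)| * (a + a' *+ bad j.+1))); last first.
  by move=> j _; rewrite gx_true gx_false ordE.
apply.
- by rewrite /d !node_zero ?subrr ?mul0r//; [exact: ltnW|right; right; left|right; right; left].
- by rewrite /d !node_zero ?subrr ?mul0r//; [exact: ltnW|do 3 right|do 3 right].
- move=> j jN; have Ej : val (ordj j) = j by rewrite val_insubd (ltnW jN).
  by have := H i (ordj j) (ordj j.+1) Pi; rewrite /= in Ej *; rewrite Ej; apply; rewrite val_insubd jN.
Qed.

Lemma paired_gy_bound (PJ : pred 'I_N) (bad : pred nat) (a a' : R) (m : elt N -> R) :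
  (forall i i' j : 'I_N, PJ j -> val i' = i.+1 ->
    `|m (i', j, true) + m (i, j, false)| <=
    (a + a' *+ bad i.+1) * (area (i', j, true) + area (i, j, true))) ->
  `|\sum_(K : elt N | PJ K.1.2) gy v K * m K| <=
  \sum_(K : elt N | PJ K.1.2) area K * `|gy v K| * (a + a' *+ bad (if K.2 then val K.1.1 else K.1.1.+1)).
Proof.
move=> H; rewrite big_mkcond [leRHS]big_mkcond !big_elt/= exchange_big/= [leRHS]exchange_big/=.
apply: (le_trans (ler_norm_sum _ _ _)).
apply: ler_sum => j _; have [Pj|_] := boolP (PJ j); last by rewrite !big1 ?normr0// => i _; rewrite addr0.
pose ordi i := insubd j i.
have ordE (i : 'I_N) : ordi i = i by apply: val_inj; rewrite val_insubd ltn_ord.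
pose d i := (v (xs i, ys j.+1) - v (xs i, ys j)) / hy j.
have := @paired_sum_bound R d (fun i => m (ordi i, j, true)) (fun i => m (ordi i, j, false))
  (fun i => area (ordi i, j, true)) (fun i => a + a' *+ bad i) N.
rewrite (eq_bigr (fun i : 'I_N => gy v (i, j, true) * m (i, j, true) + gy v (i, j, false) * m (i, j, false))); last first.
  by move=> i _; rewrite gy_true gy_false ordE.
rewrite [X in _ -> _ -> _ -> _ <= X](eq_bigr (fun i : 'I_N =>
   area (i, j, true) * `|gy v (i, j, true)| * (a + a' *+ bad i) +
   area (i, j, false) * `|gy v (i, j, false)| * (a + a' *+ bad i.+1))); last first.
  by move=> i _; rewrite gy_true gy_false ordE.
apply.
- by rewrite /d !node_zero ?subrr ?mul0r//; [exact: ltnW|left|left].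
- by rewrite /d !node_zero ?subrr ?mul0r//; [exact: ltnW|right; left|right; left].
- move=> i iN; have Ei : val (ordi i) = i by rewrite val_insubd (ltnW iN).
  by have := H (ordi i) (ordi i.+1) j Pj; rewrite /= in Ei *; rewrite Ei; apply; rewrite val_insubd iN.
Qed.
Section streamline_summation.
Variables (n : nat) (H a : R) (m : elt N -> R) (PJ : pred 'I_N).
Hypotheses (n0 : (0 < n)%N) (nN : (n < N)%N) (H0 : 0 < H) (a0 : 0 <= a)
  (hxH : forall i, (i < n)%N -> hx i = H)
  (mb : forall (i j : 'I_N) l, (i < n)%N -> PJ j -> `|m (i, j, l)| <= area (i, j, l) * a)
  (md : forall (i i' j : 'I_N) l, val i' = i.+1 -> (i' < n)%N -> PJ j ->
    `|m (i', j, l) - m (i, j, l)| <= area (i, j, l) * a * H).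

Let row_bound (j : 'I_N) l : PJ j ->
  `|\sum_(i < N | (i < n)%N) gx v (i, j, l) * m (i, j, l)| <=
  a * (\sum_(i < N | (i < n)%N) area (i, j, l) * vsum (i, j, l) +
       \sum_(i < N | (n <= i)%N) area (i, j, l) * `|gx v (i, j, l)|).
Proof.
move=> Pj; pose X i := v (xs i, ys (if l then val j else j.+1)).
have jl : ((if l then val j else j.+1) <= N)%N by case: (l) => //; exact: (ltnW (ltn_ord j)).
have gxX (i : 'I_N) : gx v (i, j, l) = (X i.+1 - X i) / hx i.
  by case: (l) @X; rewrite ?gx_true ?gx_false.
(* [v] vanishes at x = 1, so its value at the transition point is minus the sum of its increments
   through the layer. *)
have Xn : 0 < H /\ `|X n| <= \sum_(i < N | (n <= i)%N) hx i * `|gx v (i, j, l)|.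
  split=> //.
  have XN : X N = 0.
    by apply: node_zero => //; right; left.
  have -> : X n = - \sum_(n <= i < N) (X i.+1 - X i).
    by rewrite telescope_sumr ?(ltnW nN)// XN; lra.
  rewrite normrN (le_trans (ler_norm_sum _ _ _))//.
  rewrite (big_nat_widenl _ 0%N)// big_mkord/=.
  rewrite ler_sum// => i _; have hi := hx_gt0 M (ltn_ord i).
  rewrite gxX normrM (@gtr0_norm _ (hx i)^-1) ?invr_gt0// mulrCA divff ?mulr1//.
  by rewrite gt_eqF.
pose ordi i := insubd j i.
have ordE (i : 'I_N) : ordi i = i by apply: val_inj; rewrite val_insubd ltn_ord.
have nn : n = n.-1.+1 by rewrite prednK.
have areaE (i : 'I_N) : area (i, j, l) = hx i * (hy j / 2) by rewrite /tri_area/= mulrA.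
have hyj : 0 <= hy j / 2 by rewrite divr_ge0// ltW// (hy_gt0 M).
have Hn0 : H != 0 by rewrite gt_eqF.
have -> : \sum_(i < N | (i < n)%N) gx v (i, j, l) * m (i, j, l) =
    \sum_(i < n.-1.+1) (X i.+1 - X i) * (m (ordi i, j, l) / H).
  rewrite -nn (big_ord_widen N (fun i => (X i.+1 - X i) * (m (ordi i, j, l) / H)) (ltnW nN)).
  by apply: eq_bigr => i lin; rewrite ordE gxX hxH//; field.
have X0 : X 0%N = 0.
  by apply: node_zero => //; left.
have Ei i : (i < n)%N -> val (ordi i) = i.
  by move=> ilt; rewrite val_insubd (ltn_trans ilt nN).
apply: le_trans (@summation_by_parts_bound _ X (fun i => m (ordi i, j, l) / H) n.-1 a H (hy j / 2) X0 _ _) _.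
- have ln : (n.-1 < n)%N by rewrite [X in (_ < X)%N]nn.
  have := @mb (ordi n.-1) j l; rewrite areaE (Ei _ ln) hxH// => /(_ ln Pj) h.
  by rewrite normrM (@gtr0_norm _ H^-1) ?invr_gt0// ler_pdivrMr//; lra.
- move=> i ilt; have i1 : (i.+1 < n)%N by rewrite nn ltnS.
  have := @md (ordi i) (ordi i.+1) j l; rewrite areaE !Ei ?(ltnW i1)// hxH ?(ltnW i1)// => /(_ erefl i1 Pj) h.
  rewrite -mulrBl normrM (@gtr0_norm _ H^-1) ?invr_gt0// ler_pdivrMr//; lra.
rewrite -nn mulrDr addrC lerD//.
  rewrite mulr_sumr (big_ord_widen n (fun i => hy j / 2 * a * H * `|X i.+1|)) ?leq_pred//.
  rewrite (big_ord_widen_cond N (fun i => (i < n.-1)%N) (fun i => hy j / 2 * a * H * `|X i.+1|)) ?(ltnW nN)//.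
  rewrite big_mkcond [leRHS]big_mkcond/=; apply: ler_sum => i _.
  have [ilt|ige] := ltnP i n; last by rewrite andbF.
  have Xle : `|X i.+1| <= vsum (i, j, l).
    rewrite /vsum; case: (l) @X {gxX Xn X0} => /=.
      rewrite [X in _ <= _ + X + _](_ : _ = `|v (xs i.+1, ys j)|); last first.
        by rewrite /vert1 /legx /cornx /corny /stepx/= subrKC.
      by rewrite addrAC lerDr addr_ge0.
    by rewrite /vert0 /cornx /corny/= -addrA lerDl addr_ge0.
  have hh : 0 <= a * (hy j / 2 * H) := mulr_ge0 a0 (mulr_ge0 hyj (ltW H0)).
  rewrite andbT areaE hxH//; case: ifP => _; last first.
    by apply: mulr_ge0 => //; apply: mulr_ge0; [exact: mulr_ge0 (ltW H0) hyj|exact: vsum_ge0].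
  have := ler_wpM2l hh Xle; lra.
have [_ Xb] := Xn; apply: le_trans (ler_wpM2l (mulr_ge0 hyj a0) Xb) _.
rewrite !mulr_sumr ler_sum// => i _; rewrite areaE; lra.
Qed.

(* The x-derivative of [v] is a difference quotient, so that for a weight that
   varies slowly from cell to cell it can be traded for values of [v] and a
   boundary term, which is controlled by the gradient inside the layer. *)
Lemma sum_gx_by_parts :
  `|\sum_(K : elt N | (K.1.1 < n)%N && PJ K.1.2) gx v K * m K| <=
  a * (\sum_(K : elt N | (K.1.1 < n)%N && PJ K.1.2) area K * vsum K +
       \sum_(K : elt N | (n <= K.1.1)%N && PJ K.1.2) area K * `|gx v K|).
Proof.
have split_rows (Q : pred 'I_N) (F : elt N -> R) :
    \sum_(K : elt N | Q K.1.1 && PJ K.1.2) F K =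
    \sum_(j | PJ j) (\sum_(i | Q i) F (i, j, true) + \sum_(i | Q i) F (i, j, false)).
  rewrite big_mkcond big_elt/= exchange_big/= [RHS]big_mkcond; apply: eq_bigr => j _.
  case: ifP => _; last by rewrite big1// => i _; rewrite andbF addr0.
  rewrite -big_split/= [RHS]big_mkcond; apply: eq_bigr => i _.
  by rewrite andbT; case: ifP; rewrite ?addr0.
rewrite (split_rows (fun i => (i < n)%N)) (split_rows (fun i => (i < n)%N)) (split_rows (fun i => (n <= i)%N)).
apply: (le_trans (ler_norm_sum _ _ _)); rewrite -big_split/= mulr_sumr; apply: ler_sum => j Pj.
apply: (le_trans (ler_normD _ _)).
apply: (le_trans (lerD (row_bound true Pj) (row_bound false Pj))); lra.
Qed.
End streamline_summation.
End discrete_estimates.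

(** * Layer components on a cell *)

Section component_bounds.
Context {R : realType}.
Implicit Types (a b c d x y : R) (p q : R * R) (W : nat -> nat -> R * R -> R).

Definition amplitude (D : set (R * R)) k W (m t u : R) :=
  forall i j p, (i + j <= k)%N -> D p -> `|W i j p| <= m * (t ^+ i * u ^+ j).

Definition C1_jet a b c d W k := forall i j, (i + j < k)%N ->
  C1_rect a b c d (W i j) (W i.+1 j) (W i j.+1).

(* The derivatives of [w - w o tau] for the isometry [tau p = sg p + (tx, ty)]. *)
Definition isometry_diff (sg tx ty : R) W i j p :=
  W i j p - sg ^+ (i + j) * W i j (sg * p.1 + tx, sg * p.2 + ty).

Lemma C1_rectZ (k : R) a b c d f fx fy : C1_rect a b c d f fx fy ->
  C1_rect a b c d (fun p => k * f p) (fun p => k * fx p) (fun p => k * fy p).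
Proof.
move=> [cf dfx dfy]; split.
- by apply: within_M => //; exact: within_cst.
- move=> p Hp; have := is_derive1M (is_derive1_cst p.1 k) (dfx p Hp).
  by move=> D; apply: is_derive_eq D _; ring.
- move=> p Hp; have := is_derive1M (is_derive1_cst p.2 k) (dfy p Hp).
  by move=> D; apply: is_derive_eq D _; ring.
Qed.

Lemma C1_jet_diff sg tx ty a b c d a' b' c' d' W k :
  a' <= a -> b <= b' -> c' <= c -> d <= d' ->
  (forall p, rect a b c d p -> rect a' b' c' d' (sg * p.1 + tx, sg * p.2 + ty)) ->
  (forall p, orect a b c d p -> orect a' b' c' d' (sg * p.1 + tx, sg * p.2 + ty)) ->
  C1_jet a' b' c' d' W k -> C1_jet a b c d (isometry_diff sg tx ty W) k.
Proof.
move=> aa bb cc dd Hr Ho H i j ij.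
have [cF dF1 dF2] := C1_rectB (C1_rectW aa bb cc dd (H i j ij)) (C1_rectZ (sg ^+ (i + j)) (C1_rect_comp Hr Ho (H i j ij))).
split=> // p Hp; [have := dF1 p Hp|have := dF2 p Hp]; rewrite /isometry_diff ?addnS ?addSn exprSr => D;
  by apply: is_derive_eq D _; rewrite mulrA.
Qed.
End component_bounds.

Section cell_bounds.
Context {R : realType}.
Variables (N : nat) (xs ys : nat -> R).
Hypothesis M : is_mesh N xs ys.
Implicit Types (K : elt N) (p : R * R) (W : nat -> nat -> R * R -> R).
Local Notation hx := (stepx xs).
Local Notation hy := (stepy ys).
Local Notation gx := (gradx xs ys).
Local Notation gy := (grady xs ys).
Local Notation lin := (lin_interp xs ys).
Local Notation cell := (@cell R N xs ys).
Local Notation jet K := (C1_jet (xs K.1.1) (xs K.1.1.+1) (ys K.1.2) (ys K.1.2.+1)).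

Section one_cell.
Variables (K : elt N) (W : nat -> nat -> R * R -> R) (m t u A k : R).
Hypotheses (m0 : 0 <= m) (t0 : 0 <= t) (u0 : 0 <= u) (A1 : 1 <= A) (k0 : 0 <= k) (k1 : k <= 1).
Hypotheses (HC : jet K W 2) (HW : amplitude (cell K) 2 W m t u).
Let A0 : 0 <= A. Proof. exact: le_trans A1. Qed.
Let hx0 : 0 <= hx K.1.1. Proof. by rewrite ltW// (hx_gt0 M). Qed.
Let hy0 : 0 <= hy K.1.2. Proof. by rewrite ltW// (hy_gt0 M). Qed.

Lemma crude_etax p : cell K p -> `|gx (W 0 0) K - W 1 0 p| <= 2 * (m * t).
Proof.
move=> Kp; have B q : cell K q -> `|W 1 0 q| <= m * t.
  by move=> /(HW (erefl : (1 + 0 <= 2)%N)); rewrite expr1 expr0 mulr1.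
apply: (le_trans (ler_normB _ _)).
have := gradx_bound M (HC (erefl : (0 + 0 < 2)%N)) B; have := B p Kp; lra.
Qed.

Lemma crude_etay p : cell K p -> `|gy (W 0 0) K - W 0 1 p| <= 2 * (m * u).
Proof.
move=> Kp; have B q : cell K q -> `|W 0 1 q| <= m * u.
  by move=> /(HW (erefl : (0 + 1 <= 2)%N)); rewrite expr1 expr0 mul1r.
apply: (le_trans (ler_normB _ _)).
have := grady_bound M (HC (erefl : (0 + 0 < 2)%N)) B; have := B p Kp; lra.
Qed.

Lemma crude_eta p : cell K p -> `|lin (W 0 0) K p - W 0 0 p| <= 6 * m.
Proof.
move=> Kp; have B q : cell K q -> `|W 0 0 q| <= m.
  by move=> /(HW (erefl : (0 + 0 <= 2)%N)); rewrite !expr0 !mulr1.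
apply: (le_trans (ler_normB _ _)).
have := lin_bound M B Kp; have := B p Kp; lra.
Qed.

Section resolved.
Hypotheses (hxt : hx K.1.1 * t <= A * k) (hyu : hy K.1.2 * u <= A * k).

Lemma resolved_etax p : cell K p -> `|gx (W 0 0) K - W 1 0 p| <= 2 * A * k * (m * t).
Proof.
move=> Kp.
have B20 q : cell K q -> `|W 2 0 q| <= m * t * t.
  by move=> /(HW (erefl : (2 + 0 <= 2)%N)); rewrite expr0 mulr1 expr2 mulrA.
have B11 q : cell K q -> `|W 1 1 q| <= m * t * u.
  by move=> /(HW (erefl : (1 + 1 <= 2)%N)); rewrite !expr1 mulrA.
apply: le_trans (gradx_error M (HC (erefl : (0 + 0 < 2)%N)) (HC (erefl : (1 + 0 < 2)%N)) B20 B11 Kp) _.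
have mt : 0 <= m * t by exact: mulr_ge0.
have := ler_wpM2l mt hxt; have := ler_wpM2l mt hyu; lra.
Qed.

Lemma resolved_etay p : cell K p -> `|gy (W 0 0) K - W 0 1 p| <= 2 * A * k * (m * u).
Proof.
move=> Kp.
have B02 q : cell K q -> `|W 0 2 q| <= m * u * u.
  by move=> /(HW (erefl : (0 + 2 <= 2)%N)); rewrite expr0 mul1r expr2 mulrA.
have B11 q : cell K q -> `|W 1 1 q| <= m * u * t.
  by move=> /(HW (erefl : (1 + 1 <= 2)%N)); rewrite !expr1 -mulrA (mulrC u).
apply: le_trans (grady_error M (HC (erefl : (0 + 0 < 2)%N)) (HC (erefl : (0 + 1 < 2)%N)) B11 B02 Kp) _.
have mu : 0 <= m * u by exact: mulr_ge0.
have := ler_wpM2l mu hxt; have := ler_wpM2l mu hyu; lra.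
Qed.

Lemma resolved_eta p : cell K p -> `|lin (W 0 0) K p - W 0 0 p| <= 4 * A ^+ 2 * k ^+ 2 * m.
Proof.
move=> Kp.
apply: le_trans (lin_error M (HC (erefl : (0 + 0 < 2)%N)) (fun q => @resolved_etax q)
  (fun q => @resolved_etay q) Kp) _.
have h : 0 <= 2 * A * k * m by rewrite !mulr_ge0//.
have := ler_wpM2l h hxt; have := ler_wpM2l h hyu; lra.
Qed.
End resolved.

(** [h] is 1 for a component itself and the cell width for the difference between a component and
    its translate, so the same bounds give both the size of the errors and their variation from cell
    to cell. *)
Variable h : R.
Hypotheses (h0 : 0 <= h)
  (res : (hx K.1.1 * t <= A * k /\ hy K.1.2 * u <= A * k /\ m <= A * h) \/ m <= A * k ^+ 2 * h).

Let kk : k ^+ 2 <= k. Proof. by rewrite expr2 ler_piMl. Qed.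
Let AA : A <= A ^+ 2. Proof. by rewrite expr2 ler_peMl. Qed.
Let AAA : A <= A ^+ 3. Proof. by rewrite exprS ler_peMr// (le_trans A1). Qed.
Let mk_le : m <= A * k ^+ 2 * h -> m <= A ^+ 2 * k * h.
Proof. by move=> mk; apply: (le_trans mk); rewrite ler_wpM2r//; exact: ler_pM (sqr_ge0 k) AA kk. Qed.

(** A component that is not resolved enters with the crude bound, which needs no relation between
    step and scale; its small amplitude supplies the factor [k]. *)
Lemma etax_le p : cell K p -> `|gx (W 0 0) K - W 1 0 p| <= 2 * A ^+ 2 * k * t * h.
Proof.
move=> Kp; case: res => [[h1 [h2 mA]]|/mk_le mk].
  apply: le_trans (resolved_etax h1 h2 Kp) _.
  have w : 0 <= 2 * A * k * t by rewrite !mulr_ge0.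
  have := ler_wpM2l w mA; lra.
apply: le_trans (crude_etax Kp) _; have := ler_wpM2r t0 mk; lra.
Qed.

Lemma etay_le p : cell K p -> `|gy (W 0 0) K - W 0 1 p| <= 2 * A ^+ 2 * k * u * h.
Proof.
move=> Kp; case: res => [[h1 [h2 mA]]|/mk_le mk].
  apply: le_trans (resolved_etay h1 h2 Kp) _.
  have w : 0 <= 2 * A * k * u by rewrite !mulr_ge0.
  have := ler_wpM2l w mA; lra.
apply: le_trans (crude_etay Kp) _; have := ler_wpM2r u0 mk; lra.
Qed.

Lemma eta_le p : cell K p -> `|lin (W 0 0) K p - W 0 0 p| <= 6 * A ^+ 3 * k ^+ 2 * h.
Proof.
move=> Kp; have kh : 0 <= k ^+ 2 * h by rewrite mulr_ge0 ?sqr_ge0.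
case: res => [[h1 [h2 mA]]|mk].
  apply: le_trans (resolved_eta h1 h2 Kp) _.
  have w : 0 <= 4 * A ^+ 2 * k ^+ 2 by rewrite !mulr_ge0// sqr_ge0.
  have := ler_wpM2l w mA; have := mulr_ge0 (exprn_ge0 3 A0) kh; lra.
apply: le_trans (crude_eta Kp) _; have := ler_wpM2r kh AAA; lra.
Qed.
End one_cell.

Let refmap_cell K q : tref q -> cell K (refmap xs ys K q).
Proof.
case: q => a b [/= a0 b0 ab].
by have [? ? ? ?] := @refmap_box _ _ _ _ M K a b (ltW a0) (ltW b0) (ltW ab); split; apply/andP.
Qed.

(* The two triangles sharing a vertical edge are exchanged by the point
   reflection in its midpoint, under which the leading error terms cancel. *)
Lemma pair_y_le (i i' j : 'I_N) W (m t u A k : R) q :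
  0 <= m -> 0 <= t -> 0 <= u -> 0 <= A -> 0 <= k ->
  val i' = i.+1 -> hx i' = hx i ->
  C1_jet (xs i) (xs i'.+1) (ys j) (ys j.+1) W 3 ->
  amplitude (rect (xs i) (xs i'.+1) (ys j) (ys j.+1)) 3 W m t u ->
  hx i * t <= A * k -> hy j * u <= A * k -> tref q ->
  `|gy (W 0 0) (i', j, true) - W 0 1 (refmap xs ys (i', j, true) q) -
    -1 * (gy (W 0 0) (i, j, false) - W 0 1 (refmap xs ys (i, j, false) q))|
  <= 6 * A ^+ 2 * k ^+ 2 * (m * u).
Proof.
move=> m0 t0 u0 A0 k0 ii hh HC HW hxt hyu Tq.
set K := (i', j, true) : elt N; set p := refmap xs ys K q.
have xi : xs i' = xs i.+1 by rewrite -ii.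
have hxi : xs i'.+1 = xs i.+1 + hx i by move: hh; rewrite /stepx xi; lra.
have hi : xs i.+1 = xs i + hx i by rewrite /stepx; lra.
have hj : ys j.+1 = ys j + hy j by rewrite /stepy; lra.
have h0 : 0 < hx i := hx_gt0 M (ltn_ord i).
have g0 : 0 < hy j := hy_gt0 M (ltn_ord j).
pose tx := 2 * xs i.+1; pose ty := ys j + ys j.+1; pose V := isometry_diff (-1) tx ty W.
have refl : refmap xs ys (i, j, false) q = (-1 * p.1 + tx, -1 * p.2 + ty).
  by rewrite /p /K /refmap /affmap /cornx /corny /legx /legy/= hh xi /tx /ty; congr pair; rewrite ?hj; ring.
have cellE r : cell K r -> rect (xs i) (xs i'.+1) (ys j) (ys j.+1) r /\
    rect (xs i) (xs i'.+1) (ys j) (ys j.+1) (-1 * r.1 + tx, -1 * r.2 + ty).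
  by move=> [/=]; rewrite xi hxi hi hj /tx /ty => ? ?; split; split=> /=; lra.
have VC : C1_jet (xs K.1.1) (xs K.1.1.+1) (ys K.1.2) (ys K.1.2.+1) V 3.
  apply: (C1_jet_diff _ _ _ _ _ _ HC) => //=; rewrite ?xi; first lra.
  - by move=> r /=; rewrite /rect /orect/= /tx /ty hxi hi hj => -[? ?]; split; lra.
  - by move=> r /=; rewrite /rect /orect/= /tx /ty hxi hi hj => -[? ?]; split; lra.
have lt1 : xs i < xs i'.+1 by rewrite hxi hi; lra.
have lt2 : ys j < ys j.+1 by rewrite hj; lra.
(* The reflection preserves the sign of second derivatives. Those of [V] are therefore differences
   of second derivatives of the component between points at most two cells apart, and a third
   derivative supplies the second factor [k]. *)
have osc a b r : (a + b = 2)%N -> cell K r ->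
    `|V a b r| <= 3 * A * k * (m * (t ^+ a * u ^+ b)).
  move=> ab Kr; have [R1 R2] := cellE r Kr.
  have ab2 : (a + b < 3)%N by rewrite ab.
  have B1 s : rect (xs i) (xs i'.+1) (ys j) (ys j.+1) s -> `|W a.+1 b s| <= m * (t ^+ a * u ^+ b) * t.
    by move=> Rs; apply: le_trans (HW _ _ _ _ Rs) _; [rewrite addSn ab|rewrite exprS; lra].
  have B2 s : rect (xs i) (xs i'.+1) (ys j) (ys j.+1) s -> `|W a b.+1 s| <= m * (t ^+ a * u ^+ b) * u.
    by move=> Rs; apply: le_trans (HW _ _ _ _ Rs) _; [rewrite addnS ab|rewrite exprS; lra].
  have := C1_rect_osc lt1 lt2 (HC _ _ ab2) B1 B2 R2 R1.
  rewrite /V /isometry_diff ab sqrrN expr1n mul1r => /le_trans; apply => /=.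
  have d1 : `|r.1 - (-1 * r.1 + tx)| <= 2 * hx i.
    by case: Kr => /=; rewrite xi hxi /tx => ? ?; rewrite ler_norml; lra.
  have d2 : `|r.2 - (-1 * r.2 + ty)| <= hy j.
    by case: Kr => /=; rewrite /ty hj => ? ?; rewrite ler_norml; lra.
  have h : 0 <= m * (t ^+ a * u ^+ b) by rewrite !mulr_ge0// exprn_ge0.
  have := ler_wpM2l (mulr_ge0 h t0) d1; have := ler_wpM2l (mulr_ge0 h u0) d2.
  have := ler_wpM2l h hxt; have := ler_wpM2l h hyu; lra.
have := grady_error M (VC _ _ (erefl : (0 + 0 < 3)%N)) (VC _ _ (erefl : (0 + 1 < 3)%N))
  (fun r => @osc 1%N 1%N r erefl) (fun r => @osc 0%N 2%N r erefl) (@refmap_cell K q Tq).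
rewrite -/p refl.
have -> : gy (V 0 0) K - V 0 1 p = gy (W 0 0) K - W 0 1 p -
    -1 * (gy (W 0 0) (i, j, false) - W 0 1 (-1 * p.1 + tx, -1 * p.2 + ty)).
  rewrite !gradyE /V /isometry_diff /K /cornx/= xi.
  have -> : -1 * xs i.+1 + tx = xs i.+1 by rewrite /tx; ring.
  have -> : -1 * ys j + ty = ys j.+1 by rewrite /ty; ring.
  have -> : -1 * ys j.+1 + ty = ys j by rewrite /ty; ring.
  by rewrite /stepy; field; rewrite gt_eqF//; lra.
move=> /le_trans; apply; rewrite /= hh !expr1 expr0 mul1r.
have h : 0 <= 3 * A * k * (m * u) by rewrite !mulr_ge0.
have := ler_wpM2l h hxt; have := ler_wpM2l h hyu; lra.
Qed.
Lemma pair_x_le (i j j' : 'I_N) W (m t u A k : R) q :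
  0 <= m -> 0 <= t -> 0 <= u -> 0 <= A -> 0 <= k ->
  val j' = j.+1 -> hy j' = hy j ->
  C1_jet (xs i) (xs i.+1) (ys j) (ys j'.+1) W 3 ->
  amplitude (rect (xs i) (xs i.+1) (ys j) (ys j'.+1)) 3 W m t u ->
  hx i * t <= A * k -> hy j * u <= A * k -> tref q ->
  `|gx (W 0 0) (i, j', true) - W 1 0 (refmap xs ys (i, j', true) q) -
    -1 * (gx (W 0 0) (i, j, false) - W 1 0 (refmap xs ys (i, j, false) q))|
  <= 6 * A ^+ 2 * k ^+ 2 * (m * t).
Proof.
move=> m0 t0 u0 A0 k0 jj hh HC HW hxt hyu Tq.
set K := (i, j', true) : elt N; set p := refmap xs ys K q.
have yj : ys j' = ys j.+1 by rewrite -jj.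
have hyj : ys j'.+1 = ys j.+1 + hy j by move: hh; rewrite /stepy yj; lra.
have hj : ys j.+1 = ys j + hy j by rewrite /stepy; lra.
have hi : xs i.+1 = xs i + hx i by rewrite /stepx; lra.
have h0 : 0 < hx i := hx_gt0 M (ltn_ord i).
have g0 : 0 < hy j := hy_gt0 M (ltn_ord j).
pose tx := xs i + xs i.+1; pose ty := 2 * ys j.+1; pose V := isometry_diff (-1) tx ty W.
have refl : refmap xs ys (i, j, false) q = (-1 * p.1 + tx, -1 * p.2 + ty).
  by rewrite /p /K /refmap /affmap /cornx /corny /legx /legy/= hh yj /tx /ty; congr pair; rewrite ?hi; ring.
have cellE r : cell K r -> rect (xs i) (xs i.+1) (ys j) (ys j'.+1) r /\
    rect (xs i) (xs i.+1) (ys j) (ys j'.+1) (-1 * r.1 + tx, -1 * r.2 + ty).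
  by move=> [/=]; rewrite yj hyj hi hj /tx /ty => ? ?; split; split=> /=; lra.
have VC : C1_jet (xs K.1.1) (xs K.1.1.+1) (ys K.1.2) (ys K.1.2.+1) V 3.
  apply: (C1_jet_diff _ _ _ _ _ _ HC) => //=; rewrite ?yj; first lra.
  - by move=> r /=; rewrite /rect /orect/= /tx /ty hyj hi hj => -[? ?]; split; lra.
  - by move=> r /=; rewrite /rect /orect/= /tx /ty hyj hi hj => -[? ?]; split; lra.
have lt1 : xs i < xs i.+1 by rewrite hi; lra.
have lt2 : ys j < ys j'.+1 by rewrite hyj hj; lra.
have osc a b r : (a + b = 2)%N -> cell K r ->
    `|V a b r| <= 3 * A * k * (m * (t ^+ a * u ^+ b)).
  move=> ab Kr; have [R1 R2] := cellE r Kr.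
  have ab2 : (a + b < 3)%N by rewrite ab.
  have B1 s : rect (xs i) (xs i.+1) (ys j) (ys j'.+1) s -> `|W a.+1 b s| <= m * (t ^+ a * u ^+ b) * t.
    by move=> Rs; apply: le_trans (HW _ _ _ _ Rs) _; [rewrite addSn ab|rewrite exprS; lra].
  have B2 s : rect (xs i) (xs i.+1) (ys j) (ys j'.+1) s -> `|W a b.+1 s| <= m * (t ^+ a * u ^+ b) * u.
    by move=> Rs; apply: le_trans (HW _ _ _ _ Rs) _; [rewrite addnS ab|rewrite exprS; lra].
  have := C1_rect_osc lt1 lt2 (HC _ _ ab2) B1 B2 R2 R1.
  rewrite /V /isometry_diff ab sqrrN expr1n mul1r => /le_trans; apply => /=.
  have d1 : `|r.1 - (-1 * r.1 + tx)| <= hx i.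
    by case: Kr => /=; rewrite /tx hi => ? ?; rewrite ler_norml; lra.
  have d2 : `|r.2 - (-1 * r.2 + ty)| <= 2 * hy j.
    by case: Kr => /=; rewrite yj hyj /ty => ? ?; rewrite ler_norml; lra.
  have h : 0 <= m * (t ^+ a * u ^+ b) by rewrite !mulr_ge0// exprn_ge0.
  have := ler_wpM2l (mulr_ge0 h t0) d1; have := ler_wpM2l (mulr_ge0 h u0) d2.
  have := ler_wpM2l h hxt; have := ler_wpM2l h hyu; lra.
have := gradx_error M (VC _ _ (erefl : (0 + 0 < 3)%N)) (VC _ _ (erefl : (1 + 0 < 3)%N))
  (fun r => @osc 2%N 0%N r erefl) (fun r => @osc 1%N 1%N r erefl) (@refmap_cell K q Tq).
rewrite -/p refl.
have -> : gx (V 0 0) K - V 1 0 p = gx (W 0 0) K - W 1 0 p -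
    -1 * (gx (W 0 0) (i, j, false) - W 1 0 (-1 * p.1 + tx, -1 * p.2 + ty)).
  rewrite !gradxE /V /isometry_diff /K /corny/= yj.
  have -> : -1 * ys j.+1 + ty = ys j.+1 by rewrite /ty; ring.
  have -> : -1 * xs i + tx = xs i.+1 by rewrite /tx; ring.
  have -> : -1 * xs i.+1 + tx = xs i by rewrite /tx; ring.
  by rewrite /stepx; field; rewrite gt_eqF//; lra.
move=> /le_trans; apply; rewrite /= hh !expr1 expr0 mulr1.
have h : 0 <= 3 * A * k * (m * t) by rewrite !mulr_ge0.
have := ler_wpM2l h hxt; have := ler_wpM2l h hyu; lra.
Qed.

Section translation.
Variables (i i' j : 'I_N) (l : bool) (W : nat -> nat -> R * R -> R) (m t u : R).
Let H := hx i.
Let K := (i, j, l) : elt N.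
Let K' := (i', j, l) : elt N.
Let V := isometry_diff 1 H 0 W.
Hypotheses (ii : val i' = i.+1) (hh : hx i' = hx i)
  (HC : C1_jet (xs i) (xs i'.+1) (ys j) (ys j.+1) W 3)
  (HW : amplitude (rect (xs i) (xs i'.+1) (ys j) (ys j.+1)) 3 W m t u).

Let xi : xs i' = xs i.+1. Proof. by rewrite -ii. Qed.
Let hxi : xs i'.+1 = xs i + H + H. Proof. by move: hh; rewrite /stepx xi /H /stepx; lra. Qed.
Let hi : xs i.+1 = xs i + H. Proof. by rewrite /H /stepx; lra. Qed.
Let H0 : 0 < H. Proof. rewrite /H; exact: (hx_gt0 M (ltn_ord i)). Qed.

Let shiftE p : (1 * p.1 + H, 1 * p.2 + 0) = (p.1 + H, p.2).
Proof. by rewrite !mul1r addr0. Qed.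

Lemma refmap_shift q : refmap xs ys K' q =
  ((refmap xs ys K q).1 + H, (refmap xs ys K q).2).
Proof.
rewrite /refmap /affmap /cornx /corny /legx /legy/= hh xi.
by congr pair; case: (l); rewrite ?hxi -?xi ?hxi ?xi ?hi; ring.
Qed.

Lemma jet_shift : C1_jet (xs K.1.1) (xs K.1.1.+1) (ys K.1.2) (ys K.1.2.+1) V 3.
Proof.
apply: (C1_jet_diff _ _ _ _ _ _ HC) => //=; first by rewrite hxi hi lerDl ltW.
- by move=> r /=; rewrite /rect/= hxi hi => -[? ?]; split; lra.
- by move=> r /=; rewrite /orect/= hxi hi => -[? ?]; split; lra.
Qed.

(** One x-derivative is traded for the cell width; the scales [t] and [u] stay the same. *)
Lemma amplitude_shift : amplitude (cell K) 2 V (m * t * H) t u.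
Proof.
move=> a b r ab [/= r1 r2]; have h0 := H0; rewrite /V /isometry_diff expr1n mul1r shiftE.
have lt1 : xs i < xs i'.+1 by rewrite hxi; lra.
have lt2 : ys j < ys j.+1 := mesh_ys_lt M (ltn_ord j).
have B q : orect (xs i) (xs i'.+1) (ys j) (ys j.+1) q -> `|W a.+1 b q - 0| <= m * (t ^+ a.+1 * u ^+ b).
  by rewrite subr0 => /orect_rect; apply: HW.
have ab3 : (a + b < 3)%N by rewrite ltnS.
have r1b : xs i <= r.1 <= xs i'.+1 by move: r1; rewrite hxi hi; lra.
have r1c : xs i <= r.1 + H <= xs i'.+1 by move: r1; rewrite hxi hi; lra.
have := C1_rect_mvx lt1 lt2 (HC ab3) B r1b r1c r2.
rewrite mul0r subr0 distrC -surjective_pairing (_ : r.1 + H - r.1 = H); last by ring.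
by rewrite (gtr0_norm H0) => /le_trans; apply; rewrite exprS; lra.
Qed.

Let gx_shift : gx (V 0 0) K = gx (W 0 0) K - gx (W 0 0) K'.
Proof.
rewrite !gradxE /V /isometry_diff addn0 expr0 !shiftE /= hh.
have -> : corny ys K' = corny ys K by [].
by rewrite xi hxi hi; ring.
Qed.

Let gy_shift : gy (V 0 0) K = gy (W 0 0) K - gy (W 0 0) K'.
Proof.
rewrite !gradyE /V /isometry_diff addn0 expr0 !shiftE /=.
have -> : cornx xs K' = cornx xs K + H by rewrite /cornx/=; case: (l); rewrite ?xi ?hxi hi.
by ring.
Qed.

(** Interpolation commutes with the translation by one cell, so the change of the error between
    neighbours is itself an interpolation error, that of [V], up to sign. *)
Lemma etax_shift p : gx (W 0 0) K' - W 1 0 (p.1 + H, p.2) - (gx (W 0 0) K - W 1 0 p) =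
  - (gx (V 0 0) K - V 1 0 p).
Proof. by rewrite gx_shift /V /isometry_diff addn0 expr1 mul1r shiftE; ring. Qed.

Lemma eta_shift p : lin (W 0 0) K' (p.1 + H, p.2) - W 0 0 (p.1 + H, p.2) -
  (lin (W 0 0) K p - W 0 0 p) = - (lin (V 0 0) K p - V 0 0 p).
Proof.
rewrite /lin_interp gx_shift gy_shift /vert0.
have -> : cornx xs K' = cornx xs K + H by rewrite /cornx/=; case: (l); rewrite ?xi ?hxi hi.
have -> : corny ys K' = corny ys K by [].
by rewrite /V /isometry_diff addn0 expr0 !shiftE/=; ring.
Qed.
End translation.
End cell_bounds.

(* The constant [A] absorbs the dependence on [beta]. *)
Record shishkin {R : realType} (eps beta : R) (N : nat) (A : R) : Prop := Shishkin {
  sh_eps : 0 < eps;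
  sh_beta : 0 < beta;
  sh_N : (0 < N)%N;
  sh_N6 : (6 %| N)%N;
  sh_epsN : eps <= N%:R^-1;
  sh_lx : lambda_x eps beta N <= 1 / 2;
  sh_ly : lambda_y eps N <= 1 / 4;
  sh_A8 : 8 <= A;
  sh_Ab : 5 / beta <= A }.

(** * Step sizes of the Shishkin mesh *)

Section shishkin_mesh.
Context {R : realType}.
Variables (eps beta : R) (N : nat) (A : R).
Hypothesis S : shishkin eps beta N A.
Local Notation xs := (mesh_x eps beta N).
Local Notation ys := (mesh_y eps N).
Local Notation hx := (stepx xs).
Local Notation hy := (stepy ys).
Local Notation L := (ln N%:R : R).
Local Notation lx := (lambda_x eps beta N).
Local Notation ly := (lambda_y eps N).

(** All rates are half-integral powers. With r = N^(-1/2) and l = (ln N)^(1/2) they become natural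
    powers, accessible to [ring] and [lra]: the size of a layer on the coarse part is r^5, and the
    bound to prove is (r l)^3. *)
Definition root_invN : R := Num.sqrt N%:R^-1.
Definition root_ln : R := Num.sqrt L.
(* The square root of ln N / N. *)
Definition root_rate : R := root_ln * root_invN.
Local Notation r := root_invN.
Local Notation l := root_ln.
Local Notation z := root_rate.
Local Notation s := (Num.sqrt eps).
Local Notation q := (Num.sqrt (Num.sqrt eps)).

Lemma N_ge6 : (6 <= N)%N.
Proof. by have [_ _ N0 N6 _ _ _ _ _] := S; exact: dvdn_leq. Qed.

Let N0 : 0 < N%:R :> R. Proof. by rewrite ltr0n; exact: sh_N S. Qed.

Lemma ln_ge1 : 1 <= L.
Proof.
have h : (1 / 2 : R) <= expR (- (1 / 2)) by have := expR_ge1Dx (- (1 / 2) : R); lra.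
have e0 := expR_gt0 (1 / 2 : R).
have e1 : expR (1 / 2 : R) * expR (- (1 / 2)) = 1 by rewrite expRxMexpNx_1.
have e2 : expR (1 / 2 : R) <= 2.
  have := ler_wpM2l (ltW e0) h; lra.
have e3 : expR (1 : R) <= 6.
  have -> : (1 : R) = 1 / 2 + 1 / 2 by lra.
  rewrite expRD; have := ler_pM (ltW e0) (ltW e0) e2 e2; lra.
have e4 : expR (1 : R) <= N%:R by apply: (le_trans e3); rewrite (ler_nat _ 6); exact: N_ge6.
by rewrite -[leLHS](@expRK R) ler_ln ?posrE ?expR_gt0.
Qed.

Lemma root_invN_gt0 : 0 < r. Proof. by rewrite sqrtr_gt0 invr_gt0. Qed.
Lemma root_invN_sqr : r ^+ 2 = N%:R^-1. Proof. by rewrite sqr_sqrtr// invr_ge0 ltW. Qed.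
Lemma root_ln_sqr : l ^+ 2 = L. Proof. by rewrite sqr_sqrtr//; have := ln_ge1; lra. Qed.
Lemma root_ln_ge1 : 1 <= l.
Proof. by rewrite -sqrtr1; apply: ler_wsqrtr; exact: ln_ge1. Qed.
Lemma root_rate_gt0 : 0 < z.
Proof. by rewrite mulr_gt0 ?root_invN_gt0// (lt_le_trans _ root_ln_ge1). Qed.
Lemma root_invN_le : r <= z.
Proof. by rewrite /root_rate ler_peMl ?root_ln_ge1// ltW// root_invN_gt0. Qed.
Lemma root_rate_sqr : z ^+ 2 = L / N%:R.
Proof. by rewrite exprMn root_ln_sqr root_invN_sqr. Qed.
Lemma root_rate_le1 : z <= 1.
Proof.
have z0 := ltW root_rate_gt0.
rewrite -(@ler_pXn2r _ 2)// ?nnegrE// expr1n root_rate_sqr.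
by rewrite ler_pdivrMr// mul1r ltW// ln_sublinear.
Qed.
(** The cubic term of the exponential series gives (ln N)^3 <= 6 N. This absorbs the logarithms: z^4
    l^2 <= 3 z^3. *)
Lemma root_rate_ln : z * l ^+ 2 <= 3.
Proof.
have L1 := ln_ge1.
have zl0 := mulr_ge0 (ltW root_rate_gt0) (sqr_ge0 l).
rewrite -(@ler_pXn2r _ 2)// ?nnegrE//.
rewrite exprMn root_rate_sqr root_ln_sqr mulrAC ler_pdivrMr//.
have L0 : 0 <= L by lra.
by have := N0; have := expR_ge1Dxn 2 L0; rewrite lnK ?posrE// (_ : 3`!%:R = 6 :> R)//; lra.
Qed.
Lemma sqrt_eps_gt0 : 0 < s. Proof. by rewrite sqrtr_gt0; exact: sh_eps S. Qed.
Lemma sqrt_eps_sqr : s ^+ 2 = eps. Proof. by rewrite sqr_sqrtr// ltW//; exact: sh_eps S. Qed.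
Lemma root4_eps_gt0 : 0 < q. Proof. by rewrite sqrtr_gt0 sqrt_eps_gt0. Qed.
Lemma root4_eps_sqr : q ^+ 2 = s. Proof. by rewrite sqr_sqrtr// ltW// sqrt_eps_gt0. Qed.
Lemma sqrt_eps_le : s <= r. Proof. by apply: ler_wsqrtr; exact: sh_epsN S. Qed.
(** The value of the layer exponentials at the transition points: 5 / 2 is the factor rho of
    [lambda_x] and [lambda_y]. *)
Lemma root_invN_exp : expR (- (5 / 2) * L) = r ^+ 5.
Proof.
have rE : r = expR (- (1 / 2) * L).
  have r0 := ltW root_invN_gt0; have x0 := expR_ge0 (- (1 / 2) * L).
  apply/eqP; rewrite -(@eqrXn2 _ 2)//.
  rewrite root_invN_sqr -expRM_natl mulrA (_ : 2%:R * - (1 / 2) = -1 :> R); last by lra.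
  by rewrite mulN1r expRN lnK// posrE.
by rewrite rE -expRM_natl; congr expR; lra.
Qed.

Lemma lambda_x_gt0 : 0 < lx.
Proof.
rewrite /lambda_x /rho mulr_gt0//; last by have := ln_ge1; lra.
by rewrite mulr_gt0 ?invr_gt0 ?(sh_beta S)// mulr_gt0 ?(sh_eps S)//; lra.
Qed.
Lemma lambda_y_gt0 : 0 < ly.
Proof.
rewrite /lambda_y /rho mulr_gt0//; last by have := ln_ge1; lra.
by rewrite mulr_gt0 ?sqrt_eps_gt0//; lra.
Qed.

Definition nx := (N %/ 2)%N.
Definition fine_row j := (j < N %/ 3)%N || (2 * N %/ 3 <= j)%N.
(* Rows j - 1 and j have the same height unless j is one of these. *)
Definition transition_row j := (j == N %/ 3)%N || (j == 2 * N %/ 3)%N.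

Let k := (N %/ 6)%N.
Let Nk : N = (6 * k)%N. Proof. by rewrite mulnC divnK//; exact: sh_N6 S. Qed.
Let nk : (N %/ 2 = 3 * k)%N. Proof. by rewrite Nk; lia. Qed.
Let n3 : (N %/ 3 = 2 * k)%N. Proof. by rewrite Nk; lia. Qed.
Let n23 : (2 * N %/ 3 = 4 * k)%N. Proof. by rewrite Nk; lia. Qed.
Let kN : k%:R = N%:R / 6 :> R. Proof. by rewrite [in RHS]Nk natrM; field. Qed.
Let nN0 : N%:R != 0 :> R. Proof. by rewrite gt_eqF. Qed.
Let natS i : i.+1%:R = i%:R + 1 :> R. Proof. by rewrite -natr1. Qed.

Lemma nx_gt0 : (0 < nx)%N. Proof. by have := N_ge6; rewrite /nx; lia. Qed.
Lemma nx_lt : (nx < N)%N. Proof. by have := N_ge6; rewrite /nx; lia. Qed.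
Lemma mesh_x_nx : xs nx = 1 - lx.
Proof. by rewrite /mesh_x leqnn /nx nk natrM kN; field. Qed.

Lemma stepx_coarse i : (i < nx)%N -> hx i = 2 * (1 - lx) / N%:R.
Proof. by move=> h; rewrite /stepx /mesh_x h (ltnW h) (natS i); field. Qed.

Lemma stepx_fine i : (nx <= i)%N -> hx i = 2 * lx / N%:R.
Proof.
move=> h; rewrite /stepx /mesh_x ltnNge h/= (natS i).
(* For i = N / 2 the left node comes from the coarse formula and the right one from the fine
   formula; the coarse one still gives 1 - lambda_x there. *)
case: ifPn => h2; last by field.
have -> : i = (3 * k)%N by apply/eqP; rewrite -nk eqn_leq h2.
by rewrite natrM kN; field.
Qed.

Lemma stepy_fine j : (j < N)%N -> fine_row j -> hy j = 3 * ly / N%:R.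
Proof.
rewrite /fine_row /stepy /mesh_y n3 n23 (natS j) => jN /orP[h|h].
  by rewrite h (ltnW h); field.
have k0 : (0 < k)%N by have := N_ge6; rewrite Nk; lia.
have -> : (j.+1 <= 2 * k)%N = false by clear -h k0; lia.
have -> : (j <= 2 * k)%N = false by clear -h k0; lia.
have -> : (j.+1 <= 4 * k)%N = false by clear -h k0; lia.
case: ifPn => h2; last by field.
have -> : j = (4 * k)%N by apply/eqP; rewrite eqn_leq h2.
by rewrite natrM kN; field.
Qed.

Lemma stepy_coarse j : ~~ fine_row j -> hy j = 3 * (1 - 2 * ly) / N%:R.
Proof.
rewrite /fine_row negb_or -leqNgt -ltnNge /stepy /mesh_y n3 n23 (natS j) => /andP[h1 h2].
have -> : (j.+1 <= 2 * k)%N = false by clear -h1; lia.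
rewrite h2 (ltnW h2).
case: ifPn => h3; last by field.
have -> : j = (2 * k)%N by apply/eqP; rewrite eqn_leq h3.
by rewrite natrM kN; field.
Qed.

Lemma stepx_gt0 i : 0 < hx i.
Proof.
have := lambda_x_gt0; have := sh_lx S => h1 h2.
by case: (ltnP i nx) => h; [rewrite stepx_coarse|rewrite stepx_fine]; rewrite // divr_gt0//; lra.
Qed.

Lemma stepy_gt0 j : (j < N)%N -> 0 < hy j.
Proof.
have := lambda_y_gt0; have := sh_ly S => h1 h2 jN.
by case: (boolP (fine_row j)) => h; [rewrite stepy_fine|rewrite stepy_coarse]; rewrite // divr_gt0//; lra.
Qed.

Lemma shishkin_is_mesh : is_mesh N xs ys.
Proof.
have k0 : (0 < k)%N by have := N_ge6; rewrite Nk; lia.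
split.
- by rewrite /mesh_x leq0n mulr0 !mul0r.
- by rewrite /mesh_x nk leqNgt {1}Nk (_ : (3 * k < 6 * k)%N)/=; [rewrite subrr; ring|lia].
- by rewrite /mesh_y leq0n mulr0 !mul0r.
- rewrite /mesh_y n3 n23 [X in if X then _ else _](_ : _ = false); last by lia.
  rewrite [X in if X then _ else _](_ : _ = false); last by lia.
  by rewrite subrr; ring.
- by move=> i _; rewrite -subr_gt0; exact: stepx_gt0.
- by move=> j jN; rewrite -subr_gt0; exact: stepy_gt0.
Qed.
End shishkin_mesh.

(* [E] stands for the SD norm of [v]; the factor [A] absorbs mu0 and beta. *)
Record energy_bounds {R : realType} (N : nat) (xs ys : nat -> R) (eps A : R) (delta : elt N -> R)
    (v : R * R -> R) (E : R) : Prop := EnergyBounds {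
  eb_E : 0 <= E;
  eb_P1 : P1_function N xs ys v;
  eb_gx : \sum_(K : elt N) tri_area xs ys K * gradx xs ys v K ^+ 2 <= (E / Num.sqrt eps) ^+ 2;
  eb_gy : \sum_(K : elt N) tri_area xs ys K * grady xs ys v K ^+ 2 <= (E / Num.sqrt eps) ^+ 2;
  eb_v : \sum_(K : elt N) tri_area xs ys K * vsum xs ys v K ^+ 2 <= (A * E) ^+ 2;
  eb_d : \sum_(K : elt N) tri_area xs ys K * (Num.sqrt (delta K) * gradx xs ys v K) ^+ 2 <= (A * E) ^+ 2 }.

Lemma weighted_sum_bound {R : realDomainType} (I : finType) (P : pred I) (w g m : I -> R) (a : R) :
  (forall i, P i -> `|m i| <= w i * a) ->
  `|\sum_(i | P i) g i * m i| <= a * \sum_(i | P i) w i * `|g i|.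
Proof.
move=> H; apply: (le_trans (ler_norm_sum _ _ _)); rewrite mulr_sumr; apply: ler_sum => i Pi.
by rewrite normrM; have := ler_wpM2l (normr_ge0 (g i)) (H i Pi); lra.
Qed.

(** * Weighted sums over the layers and the transition cells *)

Section layer_budget.
Context {R : realType}.
Variables (eps beta : R) (N : nat) (A : R).
Hypothesis S : shishkin eps beta N A.
Local Notation xs := (mesh_x eps beta N).
Local Notation ys := (mesh_y eps N).
Local Notation hx := (stepx xs).
Local Notation hy := (stepy ys).
Local Notation L := (ln N%:R : R).
Local Notation lx := (lambda_x eps beta N).
Local Notation ly := (lambda_y eps N).
Local Notation area := (tri_area xs ys).
Local Notation gx := (gradx xs ys).
Local Notation gy := (grady xs ys).
Local Notation r := (@root_invN R N).
Local Notation l := (@root_ln R N).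
Local Notation z := (@root_rate R N).
Local Notation s := (Num.sqrt eps).
Local Notation q := (Num.sqrt (Num.sqrt eps)).
Let M : is_mesh N xs ys := shishkin_is_mesh S.
Let r0 : 0 < r. Proof. exact: root_invN_gt0 S. Qed.
Let l1 : 1 <= l. Proof. exact: root_ln_ge1 S. Qed.
Let z0 : 0 < z. Proof. exact: root_rate_gt0 S. Qed.
Let s0 : 0 < s. Proof. exact: sqrt_eps_gt0 S. Qed.
Let q0 : 0 < q. Proof. exact: root4_eps_gt0 S. Qed.
Let e0 : 0 < eps. Proof. exact: sh_eps S. Qed.
Let A8 : 8 <= A. Proof. exact: sh_A8 S. Qed.
Let r2 : N%:R^-1 = r ^+ 2. Proof. by rewrite root_invN_sqr. Qed.
Let lxE : lx / N%:R = 5 / beta / 2 * eps * z ^+ 2.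
Proof. by rewrite (root_rate_sqr S) /lambda_x /rho; ring. Qed.
Let lyE : ly / N%:R = 5 / 2 * s * z ^+ 2.
Proof. by rewrite (root_rate_sqr S) /lambda_y /rho; ring. Qed.
Let rz : r ^+ 2 <= z ^+ 2.
Proof. by have h := root_invN_le S; have := ler_pM (ltW r0) (ltW r0) h h; rewrite !expr2. Qed.
Let s1 : s <= 1.
Proof. exact: le_trans (sqrt_eps_le S) (le_trans (root_invN_le S) (root_rate_le1 S)). Qed.
Let e1 : eps <= 1.
Proof. by rewrite -(sqrt_eps_sqr S) expr2; apply: mulr_ile1 => //; exact: ltW. Qed.
Let N0 : 0 < N%:R :> R. Proof. by rewrite ltr0n; exact: sh_N S. Qed.

Lemma stepx_fine_le i : (nx N <= i)%N -> hx i <= A * z ^+ 2 * eps.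
Proof.
move=> h; rewrite (stepx_fine S h) -mulrA lxE.
have ez : 0 <= eps * z ^+ 2 by rewrite mulr_ge0 ?sqr_ge0// ltW.
have := ler_wpM2r ez (sh_Ab S); lra.
Qed.

Lemma stepx_coarse_bounds i : (i < nx N)%N -> r ^+ 2 <= hx i <= 2 * r ^+ 2.
Proof.
move=> h; rewrite (stepx_coarse S h) r2.
have l0 := lambda_x_gt0 S; have l2 := sh_lx S; have R2 := sqr_ge0 r.
have h1 : 1 <= 2 * (1 - lx) by lra.
have h2 : 2 * (1 - lx) <= 2 by lra.
have := ler_wpM2r R2 h1; have := ler_wpM2r R2 h2; lra.
Qed.

Lemma stepx_le2 i : hx i <= 2 * r ^+ 2.
Proof.
case: (ltnP i (nx N)) => h; first by case/andP: (stepx_coarse_bounds h).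
rewrite (stepx_fine S h) r2; apply: ler_wpM2r; first exact: sqr_ge0.
by have := sh_lx S; lra.
Qed.

Lemma stepx_le i : hx i <= A * z ^+ 2.
Proof.
apply: (le_trans (stepx_le2 i)); have a8 := A8; have Rz := rz.
have := ler_wpM2r (sqr_ge0 z) a8; have := sqr_ge0 z; lra.
Qed.

Lemma stepy_fine_le j : (j < N)%N -> fine_row N j -> hy j <= A * z ^+ 2 * s.
Proof.
move=> jN h; rewrite (stepy_fine S jN h) -mulrA lyE; have a8 := A8.
have sz : 0 <= s * z ^+ 2 by rewrite mulr_ge0 ?sqr_ge0// ltW.
have := ler_wpM2r sz a8; lra.
Qed.

Lemma stepy_le3 j : (j < N)%N -> hy j <= 3 * r ^+ 2.
Proof.
move=> jN; have l0 := lambda_y_gt0 S; have l2 := sh_ly S.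
case: (boolP (fine_row N j)) => h; [rewrite (stepy_fine S jN h)|rewrite (stepy_coarse S h)];
  by rewrite r2; apply: ler_wpM2r; rewrite ?sqr_ge0//; lra.
Qed.

Lemma stepy_le j : (j < N)%N -> hy j <= A * z ^+ 2.
Proof.
move=> /stepy_le3 /le_trans; apply; have a8 := A8; have Rz := rz.
have := ler_wpM2r (sqr_ge0 z) a8; have := sqr_ge0 z; lra.
Qed.

Lemma transition_fine_row j : ~~ transition_row N j.+1 -> fine_row N j.+1 = fine_row N j.
Proof.
rewrite /transition_row /fine_row; move: (N %/ 3)%N (2 * N %/ 3)%N => a b.
by clear; lia.
Qed.

Lemma transition_stepy j : (j.+1 < N)%N -> ~~ transition_row N j.+1 -> hy j.+1 = hy j.
Proof.
move=> jN /transition_fine_row fE.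
case: (boolP (fine_row N j)) => h; last by rewrite (stepy_coarse S h) (stepy_coarse S)// fE.
by rewrite (stepy_fine S (ltnW jN) h) (stepy_fine S jN)// fE.
Qed.

Let big_N (P : pred 'I_N) (F : 'I_N -> R) (a : R) : 0 <= a -> (forall i, P i -> F i <= a) ->
  \sum_(i | P i) F i <= N%:R * a.
Proof.
move=> a0 H; apply: (@le_trans _ _ (\sum_(i < N) a)).
  rewrite big_mkcond; apply: ler_sum => i _; case: ifP => // /H //.
by rewrite big_const_ord iter_addr_0 mulr_natl.
Qed.

Lemma sum_stepx_fine : \sum_(i < N | (nx N <= i)%N) hx i <= A * (s * l) ^+ 2.
Proof.
apply: (@le_trans _ _ (N%:R * (2 * lx / N%:R))).
  apply: big_N; last by move=> i h; rewrite (stepx_fine S h).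
  by rewrite divr_ge0// mulr_ge0// ltW// (lambda_x_gt0 S).
rewrite mulrCA divff ?gt_eqF// mulr1 exprMn (sqrt_eps_sqr S) (root_ln_sqr S) /lambda_x /rho.
have eL : 0 <= eps * L by rewrite mulr_ge0 ?ltW// (lt_le_trans ltr01 (ln_ge1 S)).
have := ler_wpM2r eL (sh_Ab S); lra.
Qed.

Lemma sum_stepy_fine : \sum_(j < N | fine_row N j) hy j <= A * s * l ^+ 2.
Proof.
apply: (@le_trans _ _ (N%:R * (3 * ly / N%:R))).
  apply: big_N; last by move=> j h; rewrite (stepy_fine S _ h).
  by rewrite divr_ge0// mulr_ge0// ltW// (lambda_y_gt0 S).
rewrite mulrCA divff ?gt_eqF// mulr1 (root_ln_sqr S) /lambda_y /rho.
have sL : 0 <= s * L by rewrite mulr_ge0 ?ltW// (lt_le_trans ltr01 (ln_ge1 S)).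
have := ler_wpM2r sL A8; lra.
Qed.

Lemma sum_step_all (h : nat -> R) (P : pred 'I_N) : (forall i, (i < N)%N -> 0 < h i) ->
  \sum_(i < N) h i = 1 -> \sum_(i < N | P i) h i <= 1.
Proof.
move=> h0 <-; rewrite [leRHS](bigID P)/= lerDl; apply: sumr_ge0 => i _.
by rewrite ltW// h0.
Qed.

Lemma area_le (P : pred (elt N)) (PI PJ : pred 'I_N) (X Y : R) : 0 <= Y ->
  (forall K, P K -> PI K.1.1 && PJ K.1.2) ->
  \sum_(i | PI i) hx i <= X -> \sum_(j | PJ j) hy j <= Y ->
  \sum_(K | P K) area K <= X * Y.
Proof.
move=> Y0 H HX HY; apply: (@le_trans _ _ (\sum_(K : elt N | PI K.1.1 && PJ K.1.2) area K)).
  rewrite big_mkcond [leRHS]big_mkcond; apply: ler_sum => K _.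
  case: ifP => [/H ->//|_]; case: ifP => // _; exact/ltW/area_gt0.
rewrite sum_area_rect; apply: ler_pM => //; apply: sumr_ge0 => i _; rewrite ltW//.
- exact: (hx_gt0 M).
- exact: (hy_gt0 M).
Qed.

(** Serves the transition rows and columns: a fixed number of strips of width O(1/N). *)
Lemma sum_few (P : pred 'I_N) (h : nat -> R) (cs : seq nat) (y : R) :
  0 <= y -> (forall i : 'I_N, P i -> nat_of_ord i \in cs) ->
  (forall i : 'I_N, 0 <= h i <= y) -> \sum_(i | P i) h i <= (size cs)%:R * y.
Proof.
move=> y0 H hy.
apply: (@le_trans _ _ (\sum_(i < N) \sum_(c <- cs) y *+ (nat_of_ord i == c))).
  rewrite big_mkcond; apply: ler_sum => i _; have /andP[h0 h1] := hy i.
  have nn c : 0 <= y *+ (nat_of_ord i == c) by rewrite mulrn_wge0.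
  case: ifP => [/H ic|_]; last by rewrite sumr_ge0.
  rewrite (big_rem _ ic)/= eqxx; apply: (le_trans h1); rewrite lerDl sumr_ge0//.
have one c : \sum_(i < N) y *+ (nat_of_ord i == c) <= y.
  rewrite -[leRHS]mulr1n; case: (ltnP c N) => cN.
    rewrite (bigD1 (Ordinal cN))//= eqxx big1 ?addr0// => i /eqP ic.
    by rewrite (negbTE (_ : nat_of_ord i != c))//; apply/eqP => e; apply: ic; exact: val_inj.
  by rewrite big1// => i _; rewrite ltn_eqF// (leq_trans (ltn_ord i)).
rewrite exchange_big/=; apply: (@le_trans _ _ (\sum_(c <- cs) y)); first exact: ler_sum.
by rewrite big_const_seq count_predT iter_addr_0 mulr_natl.
Qed.

Section budgets.
Variables (v : R * R -> R) (E : R) (delta : elt N -> R).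
Hypothesis En : energy_bounds xs ys eps A delta v E.
Implicit Types P : pred (elt N).
Local Notation vs := (vsum xs ys v).
Let E0 : 0 <= E. Proof. exact: eb_E En. Qed.
Let A1 : 1 <= A. Proof. by have := A8; lra. Qed.
Let A0 : 0 <= A. Proof. exact: le_trans A1. Qed.
Let AA : A <= A ^+ 2. Proof. by rewrite expr2 ler_peMl. Qed.
Let hx1 (PI : pred 'I_N) : \sum_(i < N | PI i) hx i <= 1.
Proof. by apply: sum_step_all; [exact: hx_gt0 M|exact: sum_hx M]. Qed.
Let hy1 (PJ : pred 'I_N) : \sum_(j < N | PJ j) hy j <= 1.
Proof. by apply: sum_step_all; [exact: hy_gt0 M|exact: sum_hy M]. Qed.
Let sl0 : 0 <= s * l. Proof. by rewrite mulr_ge0 ?(le_trans _ l1)// ltW. Qed.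
Let l0 : 0 <= l. Proof. exact: le_trans l1. Qed.

Let area1 P : \sum_(K | P K) area K <= 1 ^+ 2.
Proof.
rewrite expr1n -[leRHS]mul1r; apply: (@area_le _ predT predT) => //.
Qed.

Let area_fine_x P : (forall K, P K -> (nx N <= K.1.1)%N) ->
  \sum_(K | P K) area K <= (A * s * l) ^+ 2.
Proof.
move=> H; apply: le_trans (@area_le _ (fun i => nx N <= i)%N predT _ 1 _ _ sum_stepx_fine (hy1 _)) _ => //.
  by move=> K /H ->.
have := ler_wpM2r (sqr_ge0 (s * l)) AA; lra.
Qed.

Let area_fine_y P : (forall K, P K -> fine_row N K.1.2) ->
  \sum_(K | P K) area K <= (A * q * l) ^+ 2.
Proof.
move=> H; apply: le_trans (@area_le _ predT (fun j => fine_row N j) 1 _ _ _ (hx1 _) sum_stepy_fine) _ => //.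
- by rewrite !mulr_ge0 ?sqr_ge0// ltW.
- have sl2 : 0 <= s * l ^+ 2 by rewrite mulr_ge0 ?sqr_ge0// ltW.
  have := ler_wpM2r sl2 AA; rewrite !exprMn root4_eps_sqr; lra.
Qed.

Lemma sum_gy_all P : \sum_(K | P K) area K * `|gy v K| <= E / s.
Proof. by have := sum_gy_le M E0 s0 (eb_gy En) ler01 (area1 P); rewrite mul1r. Qed.
Lemma sum_v_all P : \sum_(K | P K) area K * vs K <= A * E.
Proof. by have := sum_v_le M E0 A0 (eb_v En) ler01 (area1 P); rewrite mul1r. Qed.
Lemma sum_dgx_all P : \sum_(K | P K) area K * (Num.sqrt (delta K) * `|gx v K|) <= A * E.
Proof. by have := sum_dgx_le M E0 A0 (eb_d En) ler01 (area1 P); rewrite mul1r. Qed.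

(** The square root s l of the layer area cancels the factor 1 / s with which the energy controls
    the gradient. *)
Lemma sum_gx_fine P : (forall K, P K -> (nx N <= K.1.1)%N) ->
  \sum_(K | P K) area K * `|gx v K| <= A * l * E.
Proof.
move=> H; have B0 : 0 <= A * s * l by rewrite -mulrA mulr_ge0.
apply: le_trans (sum_gx_le M E0 s0 (eb_gx En) B0 (area_fine_x H)) _.
by rewrite le_eqVlt; apply/orP; left; apply/eqP; field; rewrite gt_eqF.
Qed.

(** The additional factor q l is the square root of the total height of the fine rows. It
    compensates the eps^(-1/4) allowed in the stabilization there. *)
Lemma sum_gx_corner P : (forall K, P K -> (nx N <= K.1.1)%N && fine_row N K.1.2) ->
  \sum_(K | P K) area K * `|gx v K| <= A * q * l ^+ 2 * E.
Proof.
move=> H; have B0 : 0 <= A * s * q * l ^+ 2.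
  by rewrite mulr_ge0 ?sqr_ge0// mulr_ge0 ?(ltW q0)// mulr_ge0// ltW.
have HB : \sum_(K | P K) area K <= (A * s * q * l ^+ 2) ^+ 2.
  apply: le_trans (@area_le _ (fun i => nx N <= i)%N (fun j => fine_row N j) _ _ _ H sum_stepx_fine sum_stepy_fine) _.
    by rewrite !mulr_ge0 ?sqr_ge0// ltW.
  by rewrite !exprMn root4_eps_sqr le_eqVlt; apply/orP; left; apply/eqP; ring.
apply: le_trans (sum_gx_le M E0 s0 (eb_gx En) B0 HB) _.
by rewrite le_eqVlt; apply/orP; left; apply/eqP; field; rewrite gt_eqF.
Qed.

Lemma sum_v_fine P : (forall K, P K -> fine_row N K.1.2) ->
  \sum_(K | P K) area K * vs K <= A ^+ 2 * q * l * E.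
Proof.
move=> H; have B0 : 0 <= A * q * l by rewrite !mulr_ge0// ltW.
by apply: le_trans (sum_v_le M E0 A0 (eb_v En) B0 (area_fine_y H)) _; lra.
Qed.

Lemma sum_dgx_fine P : (forall K, P K -> fine_row N K.1.2) ->
  \sum_(K | P K) area K * (Num.sqrt (delta K) * `|gx v K|) <= A ^+ 2 * q * l * E.
Proof.
move=> H; have B0 : 0 <= A * q * l by rewrite !mulr_ge0// ltW.
by apply: le_trans (sum_dgx_le M E0 A0 (eb_d En) B0 (area_fine_y H)) _; lra.
Qed.

(** A vertical edge on the transition line belongs to a lower triangle in column N / 2 and to an
    upper one in column N / 2 - 1: two columns of width O(1/N), whence the factor r. *)
Lemma sum_gy_transition P :
  (forall K, P K -> (if K.2 then nat_of_ord K.1.1 else K.1.1.+1) = nx N) ->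
  \sum_(K | P K) area K * `|gy v K| <= 2 * r * (E / s).
Proof.
move=> H; have B0 : 0 <= 2 * r by rewrite mulr_ge0// ltW.
apply: (sum_gy_le M E0 s0 (eb_gy En) B0).
apply: le_trans (@area_le _ (fun i => nat_of_ord i \in [:: nx N; (nx N).-1]) predT (2 * (2 * r ^+ 2)) 1 _ _ _ (hy1 _)) _ => //.
- by move=> K /H; rewrite !inE andbT; case: ifP => _ <-; rewrite ?eqxx ?orbT.
- apply: (@sum_few _ hx [:: nx N; (nx N).-1]) => //; first by rewrite mulr_ge0 ?sqr_ge0.
  by move=> i; rewrite stepx_le2 ltW// (hx_gt0 M).
- lra.
Qed.

(** Four rows of height O(1/N) inside the layer: the square root of the area is s l r up to
    constants, that is s z, and s cancels. *)
Lemma sum_gx_transition P : (forall K, P K -> (nx N <= K.1.1)%N /\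
    transition_row N (if K.2 then nat_of_ord K.1.2 else K.1.2.+1)) ->
  \sum_(K | P K) area K * `|gx v K| <= 4 * A * z * E.
Proof.
move=> H; have B0 : 0 <= 4 * A * s * z.
  by rewrite mulr_ge0 ?(ltW z0)// mulr_ge0 ?(ltW s0)// mulr_ge0.
pose cs := [:: N %/ 3; 2 * N %/ 3; (N %/ 3).-1; (2 * N %/ 3).-1]%N.
have HB : \sum_(K | P K) area K <= (4 * A * s * z) ^+ 2.
  apply: le_trans (@area_le _ (fun i => nx N <= i)%N (fun j => nat_of_ord j \in cs) _ (4 * (3 * r ^+ 2)) _ _ sum_stepx_fine _) _ => //.
  - by have := sqr_ge0 r; lra.
  - move=> K /H[-> /=]; rewrite /transition_row !inE; case: ifP => _ /orP[/eqP <-|/eqP <-];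
      by rewrite ?eqxx ?orbT.
  - apply: (@sum_few _ hy cs) => //; first by rewrite mulr_ge0 ?sqr_ge0.
    by move=> j; rewrite stepy_le3// ltW// (hy_gt0 M).
  have w0 : 0 <= (s * l * r) ^+ 2 := sqr_ge0 _.
  have := ler_wpM2r w0 AA; have := mulr_ge0 (sqr_ge0 A) w0; rewrite /root_rate; lra.
apply: le_trans (sum_gx_le M E0 s0 (eb_gx En) B0 HB) _.
by rewrite le_eqVlt; apply/orP; left; apply/eqP; field; rewrite gt_eqF.
Qed.
End budgets.
End layer_budget.

(** * Consistency errors of the components *)

Record data_bounds {R : realType} (b c : R * R -> R) (Db Dc : nat -> nat -> R * R -> R) (A : R) : Prop :=
  DataBounds {
  db_b : derivs 3 b Db;
  db_c : derivs 3 c Dc;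
  db_b0 : forall p, Omega_bar p -> `|b p| <= A;
  db_b1 : forall p, Omega_bar p -> `|Db 1 0 p| <= A;
  db_c0 : forall p, Omega_bar p -> `|c p| <= A;
  db_c1 : forall p, Omega_bar p -> `|Dc 1 0 p| <= A;
  db_cb : forall p, Omega_bar p -> `|c p - Db 1 0 p| <= A }.

(* A component varying on the scales 1 / t in x and 1 / u in y, of amplitude [mm]
   depending on whether the cell lies in the fine part in x, resp. in y. Either
   the mesh resolves the scales or the component is negligible. *)
Record component {R : realType} (eps beta : R) (N : nat) (A : R) (W : nat -> nat -> R * R -> R)
    (t u : R) (mm : bool -> bool -> R) : Prop := Component {
  cp_W : exists w, derivs 3 w W;
  cp_t : 0 <= t;
  cp_u : 0 <= u;
  cp_su : Num.sqrt eps * u <= 1;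
  cp_mm : forall bx b2, 0 <= mm bx b2;
  cp_amp : forall K : elt N, amplitude (@cell R N (mesh_x eps beta N) (mesh_y eps N) K) 3 W
    (mm (nx N <= K.1.1)%N (fine_row N K.1.2)) t u;
  cp_res : forall K : elt N,
    (stepx (mesh_x eps beta N) K.1.1 * t <= A * root_rate N ^+ 2 /\
     stepy (mesh_y eps N) K.1.2 * u <= A * root_rate N ^+ 2 /\
     mm (nx N <= K.1.1)%N (fine_row N K.1.2) <= A) \/
    mm (nx N <= K.1.1)%N (fine_row N K.1.2) <= A * (root_rate N ^+ 2) ^+ 2 }.

Section component_theory.
Context {R : realType}.
Variables (eps beta : R) (N : nat) (A : R).
Hypothesis S : shishkin eps beta N A.
Variables (b c : R * R -> R) (Db Dc : nat -> nat -> R * R -> R).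
Hypothesis D : data_bounds b c Db Dc A.
Variables (delta : elt N -> R) (v : R * R -> R) (E : R).
Local Notation xs := (mesh_x eps beta N).
Local Notation ys := (mesh_y eps N).
Hypothesis En : energy_bounds xs ys eps A delta v E.
Variables (W : nat -> nat -> R * R -> R) (t u : R) (mm : bool -> bool -> R).
Hypothesis C : component eps beta N A W t u mm.
Implicit Types (K : elt N) (p : R * R).
Local Notation hx := (stepx xs).
Local Notation hy := (stepy ys).
Local Notation area := (tri_area xs ys).
Local Notation gx := (gradx xs ys).
Local Notation gy := (grady xs ys).
Local Notation IK := (tri_int xs ys).
Local Notation cell := (@cell R N xs ys).
Local Notation eta := (@interp_err R eps beta N).
Local Notation etax := (@interp_err_x R eps beta N).
Local Notation etay := (@interp_err_y R eps beta N).
Local Notation z := (@root_rate R N).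
Local Notation amp K := (mm (nx N <= K.1.1)%N (fine_row N K.1.2)).
Let M : is_mesh N xs ys := shishkin_is_mesh S.
Let A1 : 1 <= A. Proof. by have := sh_A8 S; lra. Qed.
Let A0 : 0 <= A. Proof. exact: le_trans A1. Qed.
Let k0 : 0 <= z ^+ 2. Proof. exact: sqr_ge0. Qed.
Let k1 : z ^+ 2 <= 1.
Proof.
rewrite expr2; apply: mulr_ile1; rewrite ?(ltW (root_rate_gt0 S))//; exact: root_rate_le1 S.
Qed.

Lemma cell_Omega_bar K p : cell K p -> Omega_bar p.
Proof. by move=> [h1 h2]; exact: (box_Omega_bar M (ltn_ord K.1.1) (ltn_ord K.1.2)). Qed.

Lemma component_jet (i i' j j' : nat) : (i <= i' <= N)%N -> (j <= j' <= N)%N ->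
  C1_jet (xs i) (xs i') (ys j) (ys j') W 3.
Proof.
move=> /andP[ii iN] /andP[jj jN]; have [w dW] := cp_W C.
move=> a a' ab; apply: (derivs_C1_rect _ _ _ _ dW ab).
- by rewrite -(mesh_xs0 M); apply: (xs_le M); rewrite leq0n (leq_trans ii).
- by rewrite -(mesh_xsN M); apply: (xs_le M); rewrite iN leqnn.
- by rewrite -(mesh_ys0 M); apply: (ys_le M); rewrite leq0n (leq_trans jj).
- by rewrite -(mesh_ysN M); apply: (ys_le M); rewrite jN leqnn.
Qed.

Let cjet K : C1_jet (xs K.1.1) (xs K.1.1.+1) (ys K.1.2) (ys K.1.2.+1) W 2.
Proof.
move=> i j ij; apply: component_jet; rewrite ?leqnSn ?ltn_ord//.
exact: leq_trans ij _.
Qed.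
Let camp K : amplitude (cell K) 2 W (amp K) t u.
Proof. by move=> i j p ij; apply: (cp_amp C); exact: leq_trans ij _. Qed.
Let cres K : (hx K.1.1 * t <= A * z ^+ 2 /\ hy K.1.2 * u <= A * z ^+ 2 /\ amp K <= A * 1) \/
  amp K <= A * (z ^+ 2) ^+ 2 * 1.
Proof. by rewrite !mulr1; exact: cp_res C K. Qed.

Lemma component_etax K p : cell K p -> `|etax W K p| <= 2 * A ^+ 2 * z ^+ 2 * t.
Proof.
move=> Kp; have := etax_le M (cp_mm C _ _) (cp_t C) A1 k0 k1 (@cjet K) (@camp K) ler01 (cres K) Kp.
by rewrite mulr1.
Qed.

Lemma component_etay K p : cell K p -> `|etay W K p| <= 2 * A ^+ 2 * z ^+ 2 * u.
Proof.
move=> Kp; have := etay_le M (cp_mm C _ _) (cp_u C) A1 k0 k1 (@cjet K) (@camp K) ler01 (cres K) Kp.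
by rewrite mulr1.
Qed.

Lemma component_eta K p : cell K p -> `|eta W K p| <= 6 * A ^+ 3 * (z ^+ 2) ^+ 2.
Proof.
move=> Kp; have := eta_le M (cp_mm C _ _) (cp_t C) (cp_u C) A1 k0 (@cjet K) (@camp K) ler01 (cres K) Kp.
by rewrite mulr1.
Qed.

Lemma component_etax_crude K p : cell K p -> `|etax W K p| <= 2 * (amp K * t).
Proof. by move=> Kp; exact: (crude_etax M (@cjet K) (@camp K) Kp). Qed.

Lemma component_etay_crude K p : cell K p -> `|etay W K p| <= 2 * (amp K * u).
Proof. by move=> Kp; exact: (crude_etay M (@cjet K) (@camp K) Kp). Qed.

Lemma component_eta_crude K p : cell K p -> `|eta W K p| <= 6 * amp K.
Proof. by move=> Kp; exact: (crude_eta M (@camp K) Kp). Qed.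

Lemma component_C2 : C2 W.
Proof.
have [w dW] := cp_W C; move=> i j ij; apply: (derivs_cont dW); exact: leq_trans ij _.
Qed.

Lemma P1_le_vsum K p : open_tri xs ys K p -> `|v p| <= vsum xs ys v K.
Proof.
move=> Kp; rewrite (P1_lin M (eb_P1 En) (otri_gtri M Kp)).
have [q Tq <-] : exists2 q, tref q & refmap xs ys K q = p.
  by exists (Kinv xs ys K p) => //; exact: (refmap_inv M).
case: q Tq => x y [/= x0 y0 xy]; rewrite (lin_interp_refmap M) /vsum.
set v0 := vert0 _ _ _ _; set v1 := vert1 _ _ _ _; set v2 := vert2 _ _ _ _.
rewrite (_ : _ + _ = (1 - x - y) * v0 + x * v1 + y * v2); last by ring.
have one a w : 0 <= a -> a <= 1 -> `|a * w| <= `|w|.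
  by move=> a0 a1; rewrite normrM ger0_norm// ler_piMl.
apply: (le_trans (ler_normD _ _)); apply: lerD; last by apply: one; lra.
by apply: (le_trans (ler_normD _ _)); apply: lerD; apply: one; lra.
Qed.

(** No gradient of the test function occurs, so the pointwise error of order z^4 and the L2 part of
    the norm suffice. *)
Lemma component_reaction :
  `|\sum_(K : elt N) IK K (fun p => (c p - Db 1 0 p) * eta W K p * v p)| <= 6 * A ^+ 5 * z ^+ 3 * E.
Proof.
have w0 : 0 <= 6 * A ^+ 4 * (z ^+ 2) ^+ 2.
  by rewrite mulr_ge0 ?sqr_ge0// mulr_ge0// exprn_ge0.
apply: (le_trans (ler_norm_sum _ _ _)).
apply: (@le_trans _ _ (\sum_(K : elt N) 6 * A ^+ 4 * (z ^+ 2) ^+ 2 * (area K * vsum xs ys v K))).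
  apply: ler_sum => K _; rewrite mulrCA; apply: (tri_int_bound M).
    have [sv _ _] := eb_P1 En.
    exact: (sqcont_reaction (db_b D) (derivs_sqcont (db_c D)) component_C2 sv).
  move=> p Kp; have Kc := open_tri_cell M Kp.
  rewrite !normrM; apply: ler_pM => //; rewrite ?mulr_ge0//; last exact: P1_le_vsum.
  have := ler_pM (normr_ge0 _) (normr_ge0 _) (db_cb D (cell_Omega_bar Kc)) (component_eta Kc); lra.
rewrite -mulr_sumr; have := ler_wpM2l w0 (sum_v_all S En predT).
have z0 := ltW (root_rate_gt0 S); have z1 := root_rate_le1 S.
have zz : z ^+ 4 <= z ^+ 3 by rewrite [leLHS]exprS ler_piMl// exprn_ge0.
have ww : 0 <= 6 * A ^+ 5 * E by rewrite mulr_ge0 ?(eb_E En)// mulr_ge0// exprn_ge0.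
by have := ler_wpM2l ww zz; lra.
Qed.

Lemma component_err :
  \sum_(K : elt N) consistency_err eps beta b c delta Db v W K =
  \sum_(K : elt N) gx v K * IK K (stream_flux eps beta b c delta W K)
  + eps * \sum_(K : elt N) gy v K * IK K (etay W K)
  + \sum_(K : elt N) IK K (fun p => (c p - Db 1 0 p) * eta W K p * v p).
Proof. by rewrite mulr_sumr -!big_split/=; apply: eq_bigr => K _; rewrite /consistency_err; ring. Qed.
End component_theory.

(** Raises the powers of [A] to a common one, after which the comparisons are linear. *)
Lemma pow_le {R : realDomainType} (A w : R) m n : 1 <= A -> 0 <= w -> (m <= n)%N ->
  A ^+ m * w <= A ^+ n * w.
Proof. by move=> A1 w0 mn; rewrite ler_wpM2r// ler_weXn2l. Qed.

Lemma mul_diff_le {R : realDomainType} (a a' x x' a1 a2 x1 x2 : R) :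
  `|a'| <= a1 -> `|a' - a| <= a2 -> `|x| <= x1 -> `|x' - x| <= x2 ->
  `|a' * x' - a * x| <= a1 * x2 + a2 * x1.
Proof.
move=> h1 h2 h3 h4; have -> : a' * x' - a * x = a' * (x' - x) + (a' - a) * x by ring.
by apply: (le_trans (ler_normD _ _)); rewrite !normrM lerD// ler_pM.
Qed.

Section flux_algebra.
Context {R : realFieldType}.
(** [X], [Y] and [Z] stand for the x-derivative of the interpolation error, the error itself and eps
    times the Laplacian of the component at one point; [k] is z^2. The primed quantities introduced
    below are the values at the point translated by the cell width [H]. *)
Variables (A k tau e d b c X Y Z : R).
Hypotheses (A1 : 1 <= A) (k0 : 0 <= k) (kt : k <= tau) (t1 : tau <= 1)
  (e0 : 0 <= e) (ek : e <= k) (d0 : 0 <= d)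
  (bA : `|b| <= A) (cA : `|c| <= A)
  (XA : `|X| <= 2 * A ^+ 2 * k) (YA : `|Y| <= 6 * A ^+ 3 * k ^+ 2) (ZA : `|Z| <= 2 * A * tau).

Let A0 : 0 <= A. Proof. exact: le_trans A1. Qed.
Let tau0 : 0 <= tau. Proof. exact: le_trans kt. Qed.
Let kk : k ^+ 2 <= tau.
Proof. by apply: le_trans kt; rewrite expr2 ler_piMl// (le_trans kt). Qed.

Let conv_le : `|Z + b * X + c * Y| <= 10 * A ^+ 4 * tau.
Proof.
apply: (le_trans (ler_normD _ _)).
have h1 := le_trans (ler_normD Z (b * X)) (lerD ZA (lexx _)).
have h2 : `|b * X| <= A * (2 * A ^+ 2 * k) by rewrite normrM ler_pM.
have h3 : `|c * Y| <= A * (6 * A ^+ 3 * k ^+ 2) by rewrite normrM ler_pM.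
have p1 := @pow_le _ A tau 1 4 A1 tau0 isT; rewrite expr1 in p1.
have p2 := @pow_le _ A tau 3 4 A1 tau0 isT.
have p3 := ler_wpM2l (exprn_ge0 3 A0) kt; have p4 := ler_wpM2l (exprn_ge0 4 A0) kk; lra.
Qed.

Lemma flux_bound : `|e * X - b * Y + d * (b * (Z + b * X + c * Y))| <=
  28 * A ^+ 5 * (k ^+ 2 + d * tau).
Proof.
have h1 : `|e * X| <= k * (2 * A ^+ 2 * k) by rewrite normrM ler_pM// ger0_norm.
have h2 : `|b * Y| <= A * (6 * A ^+ 3 * k ^+ 2) by rewrite normrM ler_pM.
have h3 : `|d * (b * (Z + b * X + c * Y))| <= d * (A * (10 * A ^+ 4 * tau)).
  by rewrite !normrM (ger0_norm d0) ler_wpM2l// ler_pM.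
apply: (le_trans (ler_normD _ _)); have h4 := ler_normB (e * X) (b * Y).
have k2 := sqr_ge0 k.
have p1 := @pow_le _ A _ 2 5 A1 k2 isT; have p2 := @pow_le _ A _ 4 5 A1 k2 isT.
have p3 : 0 <= A ^+ 5 * (d * tau) by rewrite !mulr_ge0// exprn_ge0.
have p4 : 0 <= A ^+ 5 * k ^+ 2 by rewrite !mulr_ge0// exprn_ge0.
lra.
Qed.

Variables (H b' c' X' Y' Z' : R).
Hypotheses (H0 : 0 <= H) (b'A : `|b'| <= A) (c'A : `|c'| <= A)
  (db : `|b' - b| <= A * H) (dc : `|c' - c| <= A * H)
  (dX : `|X' - X| <= 2 * A ^+ 2 * k * H) (dY : `|Y' - Y| <= 6 * A ^+ 3 * k ^+ 2 * H)
  (dZ : `|Z' - Z| <= 2 * A * tau * H).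

Lemma flux_diff : `|(e * X' - b' * Y' + d * (b' * (Z' + b' * X' + c' * Y'))) -
    (e * X - b * Y + d * (b * (Z + b * X + c * Y)))| <=
  28 * A ^+ 5 * (k ^+ 2 + d * tau) * H.
Proof.
have k2 := sqr_ge0 k.
have h1 : `|e * (X' - X)| <= k * (2 * A ^+ 2 * k * H) by rewrite normrM ler_pM// ger0_norm.
have h2 := mul_diff_le b'A db YA dY.
have h3 := mul_diff_le b'A db XA dX.
have h4 := mul_diff_le c'A dc YA dY.
have kH : k * H <= tau * H by rewrite ler_wpM2r.
have kkH : k ^+ 2 * H <= tau * H by rewrite ler_wpM2r.
have tH : 0 <= tau * H by rewrite mulr_ge0.
have h5 : `|(Z' + b' * X' + c' * Y') - (Z + b * X + c * Y)| <= 18 * A ^+ 4 * (tau * H).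
  rewrite (_ : _ - _ = (Z' - Z) + (b' * X' - b * X) + (c' * Y' - c * Y)); last by ring.
  apply: (le_trans (ler_normD _ _)).
  have h6 := ler_normD (Z' - Z) (b' * X' - b * X); have h8 := dZ.
  have p1 := @pow_le _ A _ 1 4 A1 tH isT; rewrite expr1 in p1.
  have p2 := @pow_le _ A _ 3 4 A1 tH isT.
  have p3 := ler_wpM2l (exprn_ge0 3 A0) kH; have p4 := ler_wpM2l (exprn_ge0 4 A0) kkH; lra.
have h6 := ler_wpM2l d0 (mul_diff_le b'A db conv_le h5).
rewrite (_ : _ - _ = e * (X' - X) - (b' * Y' - b * Y) +
  d * (b' * (Z' + b' * X' + c' * Y') - b * (Z + b * X + c * Y))); last by ring.
apply: (le_trans (ler_normD _ _)); have h7 := ler_normB (e * (X' - X)) (b' * Y' - b * Y).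
rewrite [X in _ + X]normrM (ger0_norm d0).
have kh0 : 0 <= k ^+ 2 * H by rewrite mulr_ge0.
have p1 := @pow_le _ A _ 2 5 A1 kh0 isT; have p2 := @pow_le _ A _ 4 5 A1 kh0 isT.
have p4 : 0 <= A ^+ 5 * (k ^+ 2 * H) by rewrite !mulr_ge0// exprn_ge0.
lra.
Qed.
End flux_algebra.

(** The flags tell whether the cell is fine in x and in y. In the fine rows the parameter is
    multiplied by eps^(1/4), the factor that the square root of the area of these rows provides. *)
Record stab_bounds {R : realType} (eps : R) (N : nat) (A : R) (delta : elt N -> R)
    (dd : bool -> bool -> R) : Prop := StabBounds {
  sb_ge0 : forall bx b2, 0 <= dd bx b2;
  sb_dd : forall K, delta K = dd (nx N <= K.1.1)%N (fine_row N K.1.2);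
  sb_s : dd false false <= A * root_invN N;
  sb_y : dd false true * Num.sqrt (Num.sqrt eps) <= A * root_invN N ^+ 3;
  sb_x : dd true false <= A * eps * root_invN N ^+ 3;
  sb_xy : dd true true * Num.sqrt (Num.sqrt eps) <= A * eps * root_invN N ^+ 3 }.

(** * Flux estimates for a single component *)

Section component_flux.
Context {R : realType}.
Variables (eps beta : R) (N : nat) (A : R).
Hypothesis S : shishkin eps beta N A.
Variables (b c : R * R -> R) (Db Dc : nat -> nat -> R * R -> R).
Hypothesis D : data_bounds b c Db Dc A.
Variables (delta : elt N -> R) (dd : bool -> bool -> R) (v : R * R -> R) (E : R).
Hypothesis B : stab_bounds eps A delta dd.
Local Notation xs := (mesh_x eps beta N).
Local Notation ys := (mesh_y eps N).
Hypothesis En : energy_bounds xs ys eps A delta v E.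
Variables (W : nat -> nat -> R * R -> R) (t u : R) (mm : bool -> bool -> R).
Hypothesis C : component eps beta N A W t u mm.
Implicit Types (K : elt N) (p : R * R).
Local Notation hx := (stepx xs).
Local Notation hy := (stepy ys).
Local Notation area := (tri_area xs ys).
Local Notation gx := (gradx xs ys).
Local Notation gy := (grady xs ys).
Local Notation IK := (tri_int xs ys).
Local Notation cell := (@cell R N xs ys).
Local Notation eta := (@interp_err R eps beta N).
Local Notation etax := (@interp_err_x R eps beta N).
Local Notation etay := (@interp_err_y R eps beta N).
Local Notation flux := (@stream_flux R eps beta N b c delta W).
Local Notation r := (@root_invN R N).
Local Notation l := (@root_ln R N).
Local Notation z := (@root_rate R N).
Local Notation s := (Num.sqrt eps).
Local Notation q := (Num.sqrt (Num.sqrt eps)).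
Local Notation amp K := (mm (nx N <= K.1.1)%N (fine_row N K.1.2)).
Let M : is_mesh N xs ys := shishkin_is_mesh S.
Let A1 : 1 <= A. Proof. by have := sh_A8 S; lra. Qed.
Let A0 : 0 <= A. Proof. exact: le_trans A1. Qed.
Let k0 : 0 <= z ^+ 2. Proof. exact: sqr_ge0. Qed.
Let z0 : 0 <= z. Proof. exact: ltW (root_rate_gt0 S). Qed.
Let r0 : 0 <= r. Proof. exact: ltW (root_invN_gt0 S). Qed.
Let l1 : 1 <= l. Proof. exact: root_ln_ge1 S. Qed.
Let l0 : 0 <= l. Proof. exact: le_trans l1. Qed.
Let s0 : 0 < s. Proof. exact: sqrt_eps_gt0 S. Qed.
Let E0 : 0 <= E. Proof. exact: eb_E En. Qed.
Let e0 : 0 <= eps. Proof. exact: ltW (sh_eps S). Qed.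
Let k1 : z ^+ 2 <= 1.
Proof. by rewrite expr2; apply: mulr_ile1 => //; exact: root_rate_le1 S. Qed.
Let e_k : eps <= z ^+ 2.
Proof.
apply: (le_trans (sh_epsN S)); rewrite -root_invN_sqr.
by have h := root_invN_le S; have := ler_pM r0 r0 h h; rewrite !expr2.
Qed.
Let mmA K : amp K <= A.
Proof.
case: (cp_res C K) => [[_ []]//|] /le_trans; apply.
by rewrite ler_piMr// expr2 mulr_ile1.
Qed.
Let d0 K : 0 <= delta K. Proof. by rewrite (sb_dd B); exact: sb_ge0 B _ _. Qed.
Let jet := component_jet S C.
Let sflux K : sqcont (flux K).
Proof. exact: (sqcont_stream_flux (db_b D) (derivs_sqcont (db_c D)) (component_C2 C)). Qed.
Let setay K : sqcont (etay W K).
Proof. exact: (sqcont_interp_err_y (component_C2 C)). Qed.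

Lemma lipschitz_x f F H x y : derivs 3 f F -> (forall p, Omega_bar p -> `|F 1 0 p| <= A) ->
  0 <= H -> Omega_bar (x, y) -> Omega_bar (x + H, y) -> `|f (x + H, y) - f (x, y)| <= A * H.
Proof.
move=> dF FA H0 O1 O2; have [F0 _ _] := dF; rewrite -!F0//.
have FR := derivs_C1_rect (lexx 0) (lexx 1) (lexx 0) (lexx 1) dF (erefl : (0 + 0 < 3)%N).
move: O1 O2 => [/= X1 Y1] [/= X2 _]; rewrite !in_itv/= in X1 X2 Y1.
have BF p : orect 0 1 0 1 p -> `|F 1 0 p - 0| <= A.
  by rewrite subr0 => /orect_rect [h1 h2]; apply: FA; split; rewrite /= in_itv.
have := C1_rect_mvx ltr01 ltr01 FR BF X1 X2 Y1.
by rewrite mul0r subr0 (_ : x + H - x = H) ?(ger0_norm H0)//; ring.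
Qed.

(** A resolved component gains its second z^2 from the reflection; an unresolved one already has
    amplitude z^4. Away from the transition column both cells have the same width and the same
    amplitude. *)
Lemma pair_y_bound (i i' j : 'I_N) : val i' = i.+1 -> nx N != i' :> nat ->
  `|IK (i', j, true) (etay W (i', j, true)) + IK (i, j, false) (etay W (i, j, false))| <=
  6 * A ^+ 3 * (z ^+ 2) ^+ 2 * u * area (i', j, true).
Proof.
move=> ii inx.
have nxE : (nx N <= i')%N = (nx N <= i)%N by move: inx; rewrite ii leq_eqVlt ltnS => /negbTE ->.
have hh : hx i' = hx i.
  case: (leqP (nx N) i) => h; first by rewrite !(stepx_fine S)// nxE.
  by rewrite !(stepx_coarse S)// ltnNge nxE -ltnNge.
have aE : area (i', j, true) = area (i, j, false) by rewrite /tri_area/= hh.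
have := @tri_int_compare R N xs ys M (i', j, true) (i, j, false) (-1)
  (6 * A ^+ 3 * (z ^+ 2) ^+ 2 * u) (etay W (i', j, true)) (etay W (i, j, false))
  (@setay _) (@setay _) aE.
rewrite mulN1r opprK [X in _ -> _ <= X]mulrC; apply => p Tp.
have m0 := cp_mm C (nx N <= i)%N (fine_row N j).
have ampR : amplitude (rect (xs i) (xs i'.+1) (ys j) (ys j.+1)) 3 W (amp (i, j, true)) t u.
  move=> a a' [x y] ab [/= X Y]; case: (leP x (xs i.+1)) => h.
    by apply: (@cp_amp _ _ _ _ _ _ _ _ _ C (i, j, true) a a' (x, y) ab); split => //=; lra.
  have := @cp_amp _ _ _ _ _ _ _ _ _ C (i', j, true) a a' (x, y) ab; rewrite /= nxE; apply.
  by split => //=; move: h X; rewrite ii; lra.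
case: (cp_res C (i, j, true)) => /= [[h1 [h2 h3]]|h].
  have jR : C1_jet (xs i) (xs i'.+1) (ys j) (ys j.+1) W 3.
    by apply: jet; rewrite ?leqnSn ltn_ord//= andbT ii; exact: leqW (leqnSn i).
  have := pair_y_le M m0 (cp_t C) (cp_u C) A0 k0 ii hh jR ampR h1 h2 Tp.
  rewrite /interp_err_y => /le_trans; apply.
  have w : 0 <= 6 * A ^+ 2 * (z ^+ 2) ^+ 2 * u.
    by rewrite !mulr_ge0 ?exprn_ge0// (cp_u C).
  have := ler_wpM2l w h3; lra.
have cK : cell (i', j, true) (refmap xs ys (i', j, true) p).
  by apply: (open_tri_cell M); rewrite (refmap_otri M).
have cK2 : cell (i, j, false) (refmap xs ys (i, j, false) p).
  by apply: (open_tri_cell M); rewrite (refmap_otri M).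
have := component_etay_crude S C cK; have := component_etay_crude S C cK2; rewrite /= nxE => e1 e2.
apply: (le_trans (ler_normB _ _)); rewrite mulN1r normrN.
have mu := ler_wpM2r (cp_u C) h.
have w : 0 <= (z ^+ 2) ^+ 2 * u by rewrite mulr_ge0 ?exprn_ge0// (cp_u C).
have := @pow_le _ A _ 1 3 A1 w isT; have := mulr_ge0 A0 w; rewrite expr1; lra.
Qed.

(** The norm of chi_y costs 1 / s and the error in y has the factor [u]; both are paid by eps, as
    eps u / s = s u <= 1. There remains z^4 from the pairs, and z^2 times r from the transition
    column. *)
Lemma component_cross_x : eps * `|\sum_(K : elt N) gy v K * IK K (etay W K)| <=
  10 * A ^+ 3 * z ^+ 3 * E.
Proof.
have u0 := cp_u C.
have etayI K : `|IK K (etay W K)| <= area K * (2 * A ^+ 2 * z ^+ 2 * u).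
  by apply: (tri_int_bound M) => // p /(open_tri_cell M) Kp; exact: (component_etay S C Kp).
have a0 K := ltW (area_gt0 M K).
pose a := 6 * A ^+ 3 * (z ^+ 2) ^+ 2 * u; pose a' := 2 * A ^+ 2 * z ^+ 2 * u.
have aP : 0 <= a by rewrite !mulr_ge0 ?exprn_ge0.
have a'P : 0 <= a' by rewrite !mulr_ge0 ?exprn_ge0.
have [_ _ v0] := eb_P1 En.
have := @paired_gy_bound R N xs ys M v v0 predT (pred1 (nx N)) a a' (fun K => IK K (etay W K)).
have step : forall i i' j : 'I_N, predT j -> val i' = i.+1 ->
   `|IK (i', j, true) (etay W (i', j, true)) + IK (i, j, false) (etay W (i, j, false))| <=
   (a + a' *+ pred1 (nx N) i.+1) * (area (i', j, true) + area (i, j, true)).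
  move=> i i' j _ ii; have aa := addr_ge0 (a0 (i', j, true)) (a0 (i, j, true)).
  have := a0 (i', j, true); have := a0 (i, j, true) => ga ga'.
  rewrite /= -ii; case: eqP => [e|/eqP ne].
    rewrite mulr1n mulrDl; apply: (le_trans (ler_normD _ _)).
    have := etayI (i', j, true); have := etayI (i, j, false); rewrite -/a'.
    have -> : area (i, j, false) = area (i, j, true) by [].
    have := mulr_ge0 aP aa; lra.
  rewrite mulr0n addr0; apply: le_trans (pair_y_bound j ii _) _; first by rewrite eq_sym.
  by rewrite -/a ler_wpM2l// lerDl.
move=> /(_ step) h.
have {h} : `|\sum_(K : elt N) gy v K * IK K (etay W K)| <= a * (E / s) + a' * (2 * r * (E / s)).
  apply: (le_trans h).
  rewrite (eq_bigr (fun K : elt N => a * (area K * `|gy v K|) +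
    (if pred1 (nx N) (if K.2 then val K.1.1 else K.1.1.+1) then a' * (area K * `|gy v K|) else 0))); last first.
    by move=> K _ /=; case: eqP => _; rewrite ?mulr1n ?mulr0n; ring.
  rewrite big_split/= -mulr_sumr -big_mkcond -mulr_sumr; apply: lerD; apply: ler_wpM2l => //.
    exact: (@sum_gy_all _ _ _ _ _ S _ _ _ En).
  by apply: (sum_gy_transition S En) => K /eqP.
move=> /(ler_wpM2l e0) /le_trans; apply.
have su : eps * u / s <= 1.
  by have := cp_su C; rewrite -{2}(sqrt_eps_sqr S) => h; rewrite (_ : _ / _ = s * u)//; field; rewrite gt_eqF.
have -> : eps * (a * (E / s) + a' * (2 * r * (E / s))) =
  (eps * u / s) * ((6 * A ^+ 3 * (z ^+ 2) ^+ 2 + 4 * A ^+ 2 * z ^+ 2 * r) * E).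
  by rewrite /a /a'; ring.
have rz := root_invN_le S; have z1 := root_rate_le1 S.
have w1 := ler_wpM2l (exprn_ge0 3 z0) z1; have w2 := ler_wpM2l (exprn_ge0 2 z0) rz.
have ww : 0 <= (6 * A ^+ 3 * (z ^+ 2) ^+ 2 + 4 * A ^+ 2 * z ^+ 2 * r) * E.
  by rewrite mulr_ge0// addr_ge0// !mulr_ge0// exprn_ge0.
apply: (le_trans (ler_piMl ww su)); apply: ler_wpM2r => //.
have p1 := @pow_le _ A _ 2 3 A1 (exprn_ge0 3 z0) isT.
have := ler_wpM2l (exprn_ge0 3 A0) w1; have := ler_wpM2l (exprn_ge0 2 A0) w2; lra.
Qed.

Let lpow m n : (m <= n)%N -> l ^+ m <= l ^+ n.
Proof. by move=> mn; rewrite ler_weXn2l. Qed.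
Let k2l2 : (z ^+ 2) ^+ 2 * l ^+ 2 <= 3 * z ^+ 3.
Proof. by have := ler_wpM2l (exprn_ge0 3 z0) (root_rate_ln S); lra. Qed.
Let k2l m : (m <= 2)%N -> (z ^+ 2) ^+ 2 * l ^+ m <= 3 * z ^+ 3.
Proof.
by move=> m2; apply: le_trans k2l2; apply: ler_wpM2l; [exact: exprn_ge0|exact: lpow].
Qed.
Let r3l m : (m <= 3)%N -> r ^+ 3 * l ^+ m <= z ^+ 3.
Proof.
move=> m3; rewrite /root_rate exprMn mulrC; apply: ler_wpM2r; [exact: exprn_ge0|exact: lpow].
Qed.
Let eps1 : eps <= 1. Proof. exact: le_trans e_k k1. Qed.

Let a0 K := ltW (area_gt0 M K).
Let w0 : 0 <= 28 * A ^+ 5. Proof. by rewrite mulr_ge0// exprn_ge0. Qed.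
Let zE : 0 <= z ^+ 3 * E. Proof. by rewrite mulr_ge0// exprn_ge0. Qed.
Let zA m n : (m <= n)%N -> A ^+ m * (z ^+ 3 * E) <= A ^+ n * (z ^+ 3 * E).
Proof. exact: pow_le. Qed.
Local Notation total := (fun P : pred (elt N) => \sum_(K | P K) area K * `|gx v K|).

Section regular.
Hypotheses (t1 : t = 1) (mm_x : forall bx b2, mm bx b2 = mm false b2)
  (mm_coarse : eps * u ^+ 2 * mm false false <= A * z ^+ 2).
(** Size of eps times the Laplacian: of order 1 in the fine rows, where a layer in y has second
    derivatives of order 1/eps, and z^2 in the coarse rows, either because eps <= z^2 or because the
    layer has decayed. *)
Let tau K : R := if fine_row N K.1.2 then 1 else z ^+ 2.
Let k_tau K : z ^+ 2 <= tau K. Proof. by rewrite /tau; case: ifP. Qed.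
Let tau1 K : tau K <= 1. Proof. by rewrite /tau; case: ifP. Qed.
Let eu2 : eps * u ^+ 2 <= 1.
Proof.
have su0 : 0 <= s * u by rewrite mulr_ge0 ?(ltW s0)// (cp_u C).
by rewrite -(sqrt_eps_sqr S) -exprMn expr2; apply: mulr_ile1 => //; exact: cp_su C.
Qed.

Let amp_tau K : eps * (1 + u ^+ 2) * amp K <= 2 * A * tau K.
Proof.
have m0 := cp_mm C (nx N <= K.1.1)%N (fine_row N K.1.2); have mA := mmA K.
have e1 : eps * amp K <= A * tau K.
  by rewrite (mulrC A); apply: ler_pM => //; apply: le_trans e_k (k_tau K).
suff : eps * u ^+ 2 * amp K <= A * tau K by lra.
rewrite /tau; case: ifP => h; last by rewrite mm_x.
by rewrite mulr1; rewrite h in mA m0; apply: le_trans _ mA; exact: ler_piMl.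
Qed.

Let lap_le K V h p : amplitude (cell K) 2 V (amp K * h) 1 u -> cell K p -> 0 <= h ->
  `|eps * (V 2 0 p + V 0 2 p)| <= 2 * A * tau K * h.
Proof.
move=> HV Kp h0; rewrite normrM (ger0_norm e0).
have h1 := HV 2 0 p isT Kp; have h2 := HV 0 2 p isT Kp; rewrite !expr1n !expr0 !mul1r mulr1 in h1 h2.
have := ler_wpM2l e0 (le_trans (ler_normD _ _) (lerD h1 h2)).
have := ler_wpM2r h0 (amp_tau K); lra.
Qed.

Let amp2 K : amplitude (cell K) 2 W (amp K * 1) 1 u.
Proof.
move=> i j x ij; rewrite mulr1 -t1; apply: (cp_amp C); exact: leq_trans ij _.
Qed.

Let flux_le K : `|IK K (flux K)| <= area K * (28 * A ^+ 5 * ((z ^+ 2) ^+ 2 + delta K * tau K)).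
Proof.
apply: (tri_int_bound M) => // p /(open_tri_cell M) Kp; have Op := cell_Omega_bar S Kp.
apply: (flux_bound A1 k0 (k_tau K) (tau1 K) e0 e_k (d0 K) (db_b0 D Op) (db_c0 D Op)).
- by have := component_etax S C Kp; rewrite t1 mulr1.
- exact: (component_eta S C Kp).
- by have := lap_le (@amp2 K) Kp ler01; rewrite mulr1.
Qed.

(** The coefficients are Lipschitz, and the errors on the next cell differ by those of the
    translation difference, whose amplitude carries the cell width. *)
Let flux_diff_le (i i' j : 'I_N) lo : val i' = i.+1 -> (i' < nx N)%N ->
  `|IK (i', j, lo) (flux (i', j, lo)) - IK (i, j, lo) (flux (i, j, lo))| <=
  area (i, j, lo) * (28 * A ^+ 5 * ((z ^+ 2) ^+ 2 + delta (i, j, lo) * tau (i, j, lo))) * hx i.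
Proof.
move=> ii i'n; have i_n : (i < nx N)%N by rewrite (leq_trans _ (ltnW i'n))// ii.
have hh : hx i' = hx i by rewrite !(stepx_coarse S).
pose K := (i, j, lo) : elt N; pose K' := (i', j, lo) : elt N.
have aE : area K' = area K by rewrite /tri_area/= hh.
have dE : delta K' = delta K by rewrite !(sb_dd B)/= (leqNgt _ i) (leqNgt _ i') i_n i'n.
have H0 : 0 <= hx i := ltW (hx_gt0 M (ltn_ord i)).
have xi : xs i' = xs i.+1 by rewrite -ii.
have := @tri_int_compare R N xs ys M K' K 1
  (28 * A ^+ 5 * ((z ^+ 2) ^+ 2 + delta K * tau K) * hx i) (flux K') (flux K)
  (@sflux _) (@sflux _) aE.
rewrite mul1r aE mulrA; apply => p Tp.
have jR : C1_jet (xs i) (xs i'.+1) (ys j) (ys j.+1) W 3.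
  by apply: jet; rewrite ?leqnSn ltn_ord//= andbT ii; exact: leqW (leqnSn i).
have ampR : amplitude (rect (xs i) (xs i'.+1) (ys j) (ys j.+1)) 3 W (amp K) t u.
  move=> a a' [x y] ab [/= X Y]; rewrite mm_x; case: (leP x (xs i.+1)) => h.
    have := @cp_amp _ _ _ _ _ _ _ _ _ C K a a' (x, y) ab; rewrite mm_x; apply.
    by split => //=; lra.
  have := @cp_amp _ _ _ _ _ _ _ _ _ C K' a a' (x, y) ab; rewrite /= mm_x; apply.
  by split => //=; move: h X; rewrite xi; lra.
rewrite (refmap_shift ys j lo ii hh p).
have TK : cell K (refmap xs ys K p) by apply: (open_tri_cell M); rewrite (refmap_otri M).
have TK' : cell K' ((refmap xs ys K p).1 + hx i, (refmap xs ys K p).2).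
  by rewrite -(refmap_shift ys j lo ii hh p); apply: (open_tri_cell M); rewrite (refmap_otri M).
move: (refmap xs ys K p) TK TK' => {Tp p}p Kp Kp'.
have Op := cell_Omega_bar S Kp; have Op' := cell_Omega_bar S Kp'.
have Hj := @jet_shift R N xs ys M i i' j lo W ii hh jR.
have Hj2 : C1_jet (xs K.1.1) (xs K.1.1.+1) (ys K.1.2) (ys K.1.2.+1) (isometry_diff 1 (hx i) 0 W) 2.
  by move=> a a' aa; apply: Hj; exact: ltnW.
have Ha := @amplitude_shift R N xs ys M i i' j lo W _ _ _ ii hh jR ampR.
rewrite t1 mulr1 in Ha.
have m0 : 0 <= amp K * hx i by rewrite mulr_ge0// (cp_mm C).
have res : (hx K.1.1 * 1 <= A * z ^+ 2 /\ hy K.1.2 * u <= A * z ^+ 2 /\ amp K * hx i <= A * hx i) \/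
    amp K * hx i <= A * (z ^+ 2) ^+ 2 * hx i.
  by case: (cp_res C K) => [[h1 [h2 h3]]|h]; [left; rewrite t1 in h1; split=> //; split=> //|right]; exact: ler_wpM2r.
have X' := etax_le M m0 ler01 A1 k0 k1 Hj2 Ha H0 res Kp.
have Y' := eta_le M m0 ler01 (cp_u C) A1 k0 Hj2 Ha H0 res Kp.
rewrite mul1r; rewrite /stream_flux dE; apply: (flux_diff A1 k0 (k_tau K) (tau1 K) e0 e_k (d0 K)) => //.
- exact: (db_b0 D Op).
- exact: (db_c0 D Op).
- by have := component_etax S C Kp; rewrite t1 mulr1.
- exact: (component_eta S C Kp).
- by have := lap_le (@amp2 K) Kp ler01; rewrite mulr1.
- exact: (db_b0 D Op').
- exact: (db_c0 D Op').
- case: (p) Op Op' => x y Op Op'; exact: (lipschitz_x (db_b D) (db_b1 D) H0 Op Op').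
- case: (p) Op Op' => x y Op Op'; exact: (lipschitz_x (db_c D) (db_c1 D) H0 Op Op').
- rewrite /interp_err_x (etax_shift ys j lo W ii hh) normrN; by rewrite mulr1 in X'.
- by rewrite /interp_err (eta_shift ys j lo W ii hh) normrN.
- apply: le_trans _ (lap_le Ha Kp H0).
  rewrite -normrN le_eqVlt; apply/orP; left; apply/eqP; congr (`|_|).
  by rewrite /isometry_diff !expr1n !mul1r addr0; ring.
Qed.

Let fine_x_part (P : pred (elt N)) by2 : (forall K, P K -> (nx N <= K.1.1)%N && (fine_row N K.1.2 == by2)) ->
  `|\sum_(K | P K) gx v K * IK K (flux K)| <= 112 * A ^+ 7 * (z ^+ 3 * E).
Proof.
move=> HP; pose th : R := if by2 then 1 else z ^+ 2.
have H1 := @weighted_sum_bound _ _ P area (gx v) (fun K => IK K (flux K))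
  (28 * A ^+ 5 * ((z ^+ 2) ^+ 2 + dd true by2 * th)).
have Hg : total P <= A * l * E by apply: (sum_gx_fine S En) => K /HP/andP[].
apply: le_trans (H1 _) _.
  move=> K /HP/andP[hx /eqP hy2].
  by have := flux_le K; rewrite (sb_dd B) /tau hx hy2.
have T0 : 0 <= total P by apply: sumr_ge0 => K _; rewrite mulr_ge0.
have AE : 0 <= A * E by rewrite mulr_ge0.
have h1 : (z ^+ 2) ^+ 2 * total P <= 3 * A * (z ^+ 3 * E).
  apply: le_trans (ler_wpM2l (sqr_ge0 _) Hg) _.
  by have := ler_wpM2r AE (k2l (isT : (1 <= 2)%N)); rewrite expr1; lra.
suff h2 : dd true by2 * th * total P <= A ^+ 2 * (z ^+ 3 * E).
  have := ler_wpM2l w0 h1; have := ler_wpM2l w0 h2.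
  by have := zA (isT : (6 <= 7)%N); lra.
have dd0 := sb_ge0 B true by2.
rewrite /th; case: (by2) HP dd0 => HP dd0.
  have Hc : total P <= A * q * l ^+ 2 * E.
    by apply: (sum_gx_corner S En) => K /HP /andP[-> /eqP ->].
  rewrite mulr1; apply: le_trans (ler_wpM2l dd0 Hc) _.
  have b1 := ler_wpM2r (mulr_ge0 AE (exprn_ge0 2 l0)) (sb_xy B).
  have e2 : eps * (r ^+ 3 * l ^+ 2) <= 1 * z ^+ 3.
    by apply: ler_pM eps1 (r3l _) => //; rewrite mulr_ge0// exprn_ge0.
  by have := ler_wpM2l (mulr_ge0 A0 AE) e2; lra.
have b0 : dd true false * (z ^+ 2 * (l * 1)) <= A * (r ^+ 3 * l).
  have b1 : dd true false * z ^+ 2 <= A * r ^+ 3 * 1.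
    apply: ler_pM => //; apply: (le_trans (sb_x B)).
    by rewrite -mulrA ler_wpM2l// ler_piMl// exprn_ge0.
  by have := ler_wpM2r l0 b1; lra.
apply: le_trans (ler_wpM2l (mulr_ge0 dd0 k0) Hg) _.
have := ler_wpM2r AE b0.
by have := ler_wpM2l (mulr_ge0 A0 AE) (r3l (isT : (1 <= 3)%N)); rewrite expr1; lra.
Qed.

(** Summation by parts replaces chi_x on the coarse part by vertex values of chi and by chi_x inside
    the layer, neither of which brings in eps^(-1/2). *)
Let coarse_x_part (PJ : pred 'I_N) by2 : (forall j, PJ j -> fine_row N j = by2) ->
  `|\sum_(K : elt N | (K.1.1 < nx N)%N && PJ K.1.2) gx v K * IK K (flux K)| <= 224 * A ^+ 8 * (z ^+ 3 * E).
Proof.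
move=> HP; pose th : R := if by2 then 1 else z ^+ 2.
pose a := 28 * A ^+ 5 * ((z ^+ 2) ^+ 2 + dd false by2 * th).
have dd0 := sb_ge0 B false by2.
have th0 : 0 <= th by rewrite /th; case: (by2).
have aP : 0 <= a by rewrite mulr_ge0// addr_ge0 ?mulr_ge0// exprn_ge0.
have [_ _ v0] := eb_P1 En.
have := @sum_gx_by_parts R N xs ys M v v0 (nx N) (2 * (1 - lambda_x eps beta N) / N%:R) a
  (fun K => IK K (flux K)) PJ (nx_gt0 S) (nx_lt S) _ aP (fun i => @stepx_coarse _ _ _ _ _ S i).
have H0 : 0 < 2 * (1 - lambda_x eps beta N) / N%:R.
  by rewrite -(stepx_coarse S (nx_gt0 S)) (stepx_gt0 S).
have h1 : forall (i j : 'I_N) lo, (i < nx N)%N -> PJ j ->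
    `|IK (i, j, lo) (flux (i, j, lo))| <= area (i, j, lo) * a.
  move=> i j lo ilt /HP jb; have := flux_le (i, j, lo).
  by rewrite (sb_dd B) /tau /= jb leqNgt ilt.
have h2 : forall (i i' j : 'I_N) lo, val i' = i.+1 -> (i' < nx N)%N -> PJ j ->
    `|IK (i', j, lo) (flux (i', j, lo)) - IK (i, j, lo) (flux (i, j, lo))| <=
    area (i, j, lo) * a * (2 * (1 - lambda_x eps beta N) / N%:R).
  move=> i i' j lo ii i'n /HP jb; have := flux_diff_le j lo ii i'n.
  have ilt : (i < nx N)%N by rewrite (leq_trans _ (ltnW i'n))// ii.
  by rewrite (sb_dd B) /tau /= jb leqNgt ilt (stepx_coarse S ilt).
move=> /(_ H0 h1 h2) /le_trans; apply.
set V := \sum_(K | _) _ * vsum _ _ _ _; set G := \sum_(K | _) _.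
have V1 : V <= A * E by exact: (sum_v_all S En).
have G1 : G <= A * l * E by apply: (sum_gx_fine S En) => K /andP[].
have AE : 0 <= A * E by rewrite mulr_ge0.
have VG1 : V + G <= 2 * (A * E) * l.
  by have := ler_wpM2l AE l1; lra.
have h3 : (z ^+ 2) ^+ 2 * (V + G) <= 6 * A * (z ^+ 3 * E).
  apply: le_trans (ler_wpM2l (sqr_ge0 _) VG1) _.
  by have := ler_wpM2r AE (k2l (isT : (1 <= 2)%N)); rewrite expr1; lra.
suff h4 : dd false by2 * th * (V + G) <= 2 * A ^+ 3 * (z ^+ 3 * E).
  rewrite /a; have := ler_wpM2l w0 h3; have := ler_wpM2l w0 h4.
  by have := zA (isT : (6 <= 8)%N); lra.
have p23 := zA (isT : (2 <= 3)%N).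
rewrite /th; case: (by2) HP dd0 => HP dd0.
  (* In the fine rows both sums contain q = eps^(1/4), which turns [dd false true] into r^3; the
     powers of l then complete z^3. *)
  have V2 : V <= A ^+ 2 * q * l * E by apply: (sum_v_fine S En) => K /andP[_ /HP].
  have G2 : G <= A * q * l ^+ 2 * E by apply: (sum_gx_corner S En) => K /andP[-> /HP ->].
  have qE : 0 <= q * E by rewrite mulr_ge0// ltW// (root4_eps_gt0 S).
  have VG2 : V + G <= 2 * A ^+ 2 * (q * E) * l ^+ 2.
    have p1 := ler_wpM2l (mulr_ge0 (sqr_ge0 A) qE) (lpow (isT : (1 <= 2)%N)); rewrite expr1 in p1.
    have p2 := @pow_le _ A _ 1 2 A1 (mulr_ge0 qE (exprn_ge0 2 l0)) isT; rewrite expr1 in p2.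
    lra.
  rewrite mulr1; apply: le_trans (ler_wpM2l dd0 VG2) _.
  have w : 0 <= 2 * A ^+ 2 * E * l ^+ 2 by rewrite !mulr_ge0// exprn_ge0.
  have b1 := ler_wpM2r w (sb_y B).
  have ww : 0 <= A ^+ 3 * E by rewrite mulr_ge0// exprn_ge0.
  by have := ler_wpM2l ww (r3l (isT : (2 <= 3)%N)); lra.
apply: le_trans (ler_wpM2l (mulr_ge0 dd0 k0) VG1) _.
have w : 0 <= z ^+ 2 * (2 * (A * E) * l) by rewrite !mulr_ge0.
have := ler_wpM2r w (sb_s B).
(* The worst term: r from the stabilization, z^2 from the Laplacian, l from the boundary term in the
   layer. This is where the exponent -1/2 in the bound for delta_s is decisive. *)
have zz : z ^+ 3 = r * z ^+ 2 * l by rewrite /root_rate; ring.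
by move: p23; rewrite zz; lra.
Qed.

Lemma regular_flux : `|\sum_(K : elt N) gx v K * IK K (flux K)| <= 672 * A ^+ 8 * (z ^+ 3 * E).
Proof.
rewrite (bigID (fun K : elt N => nx N <= K.1.1)%N)/=.
rewrite (bigID (fun K : elt N => fine_row N K.1.2) (fun K : elt N => (nx N <= K.1.1)%N))/=.
rewrite (bigID (fun K : elt N => fine_row N K.1.2) (fun K : elt N => ~~ (nx N <= K.1.1)%N))/=.
under [X in _ + (X + _)]eq_bigl do rewrite -ltnNge.
under [X in _ + (_ + X)]eq_bigl do rewrite -ltnNge.
have h1 := @fine_x_part (fun K => (nx N <= K.1.1)%N && fine_row N K.1.2) true.
have h2 := @fine_x_part (fun K => (nx N <= K.1.1)%N && ~~ fine_row N K.1.2) false.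
have h3 := @coarse_x_part (fun j => fine_row N j) true.
have h4 := @coarse_x_part (fun j => ~~ fine_row N j) false.
apply: (le_trans (ler_normD _ _)).
apply: (le_trans (lerD (ler_normD _ _) (ler_normD _ _))).
have /h1 g1 : forall K : elt N, (nx N <= K.1.1)%N && fine_row N K.1.2 -> (nx N <= K.1.1)%N && (fine_row N K.1.2 == true).
  by move=> K /andP[-> ->].
have /h2 g2 : forall K : elt N, (nx N <= K.1.1)%N && ~~ fine_row N K.1.2 -> (nx N <= K.1.1)%N && (fine_row N K.1.2 == false).
  by move=> K /andP[-> /negbTE ->].
have /h3 g3 : forall j : 'I_N, fine_row N j -> fine_row N j = true by [].
have /h4 g4 : forall j : 'I_N, ~~ fine_row N j -> fine_row N j = false by move=> j /negbTE.
(* 672 = 112 + 112 + 224 + 224, for the four parts of the mesh. *)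
by have := zA (isT : (7 <= 8)%N); lra.
Qed.
End regular.

Section layer.
Hypotheses (tE : t = eps^-1) (mm_coarse : forall b2, mm false b2 <= A * r ^+ 5).
Let ep : 0 < eps. Proof. exact: sh_eps S. Qed.
Let et : eps * t = 1. Proof. by rewrite tE divff// gt_eqF. Qed.
Let t0 : 0 <= t. Proof. exact: cp_t C. Qed.
Let t1 : 1 <= t. Proof. by rewrite tE invf_ge1. Qed.
Let eu2 : eps * u ^+ 2 <= 1.
Proof.
have su0 : 0 <= s * u by rewrite mulr_ge0 ?(ltW s0)// (cp_u C).
by rewrite -(sqrt_eps_sqr S) -exprMn expr2; apply: mulr_ile1 => //; exact: (cp_su C).
Qed.
Let setax K : sqcont (etax W K). Proof. exact: (sqcont_interp_err_x (component_C2 C)). Qed.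
Let seta K : sqcont (eta W K). Proof. exact: (sqcont_interp_err (component_C2 C)). Qed.
Let sW i j : (i + j <= 2)%N -> sqcont (W i j). Proof. exact: (component_C2 C). Qed.
Let sb : sqcont b. Proof. exact: (derivs_sqcont (db_b D)). Qed.
Let sc : sqcont c. Proof. exact: (derivs_sqcont (db_c D)). Qed.

Let pair_x_bound (i j j' : 'I_N) : val j' = j.+1 -> ~~ transition_row N j' ->
  `|IK (i, j', true) (etax W (i, j', true)) + IK (i, j, false) (etax W (i, j, false))| <=
  6 * A ^+ 3 * (z ^+ 2) ^+ 2 * t * area (i, j', true).
Proof.
move=> jj tj; rewrite -[nat_of_ord j']/(val j') jj in tj.
have fE : fine_row N j' = fine_row N j by rewrite -[nat_of_ord j']/(val j') jj transition_fine_row.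
have hh : hy j' = hy j.
  have jN : (j.+1 < N)%N by rewrite -jj; exact: (ltn_ord j').
  by rewrite -[nat_of_ord j']/(val j') jj; exact: (transition_stepy S jN tj).
have aE : area (i, j', true) = area (i, j, false) by rewrite /tri_area/= hh.
have := @tri_int_compare R N xs ys M (i, j', true) (i, j, false) (-1)
  (6 * A ^+ 3 * (z ^+ 2) ^+ 2 * t) (etax W (i, j', true)) (etax W (i, j, false))
  (@setax _) (@setax _) aE.
rewrite mulN1r opprK [X in _ -> _ <= X]mulrC; apply => p Tp.
have m0 := cp_mm C (nx N <= i)%N (fine_row N j).
have ampR : amplitude (rect (xs i) (xs i.+1) (ys j) (ys j'.+1)) 3 W (amp (i, j, true)) t u.
  move=> a a' [x y] ab [/= X Y]; case: (leP y (ys j.+1)) => h.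
    by apply: (@cp_amp _ _ _ _ _ _ _ _ _ C (i, j, true) a a' (x, y) ab); split => //=; lra.
  have := @cp_amp _ _ _ _ _ _ _ _ _ C (i, j', true) a a' (x, y) ab; rewrite /= fE; apply.
  have yj : ys j' = ys j.+1 by rewrite -jj.
  by split => //=; move: h Y; rewrite yj; lra.
case: (cp_res C (i, j, true)) => /= [[h1 [h2 h3]]|h].
  have jR : C1_jet (xs i) (xs i.+1) (ys j) (ys j'.+1) W 3.
    by apply: jet; rewrite ?leqnSn ltn_ord//= andbT jj; exact: leqW (leqnSn j).
  have := pair_x_le M m0 (cp_t C) (cp_u C) A0 k0 jj hh jR ampR h1 h2 Tp.
  rewrite /interp_err_x => /le_trans; apply.
  have w : 0 <= 6 * A ^+ 2 * (z ^+ 2) ^+ 2 * t by rewrite !mulr_ge0 ?exprn_ge0.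
  have := ler_wpM2l w h3; lra.
have cK : cell (i, j', true) (refmap xs ys (i, j', true) p).
  by apply: (open_tri_cell M); rewrite (refmap_otri M).
have cK2 : cell (i, j, false) (refmap xs ys (i, j, false) p).
  by apply: (open_tri_cell M); rewrite (refmap_otri M).
have := component_etax_crude S C cK; have := component_etax_crude S C cK2; rewrite /= fE => e1 e2.
apply: (le_trans (ler_normB _ _)); rewrite mulN1r normrN.
have mu := ler_wpM2r t0 h.
have w : 0 <= (z ^+ 2) ^+ 2 * t by rewrite mulr_ge0 ?exprn_ge0.
have := @pow_le _ A _ 1 3 A1 w isT; have := mulr_ge0 A0 w; rewrite expr1; lra.
Qed.

(** With eps t = 1 the x-derivative of the error contributes z^2 per triangle, too much by a factor
    z. Pairs gain z^2; in the transition rows the square root of the area gains z. *)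
Let fine_etax : `|\sum_(K : elt N | (nx N <= K.1.1)%N) gx v K * (eps * IK K (etax W K))| <=
  26 * A ^+ 4 * (z ^+ 3 * E).
Proof.
have etaxI K : `|IK K (etax W K)| <= area K * (2 * A ^+ 2 * z ^+ 2 * t).
  by apply: (tri_int_bound M) => // p /(open_tri_cell M) Kp; exact: (component_etax S C Kp).
pose a := 6 * A ^+ 3 * (z ^+ 2) ^+ 2 * t; pose a' := 2 * A ^+ 2 * z ^+ 2 * t.
have aP : 0 <= a by rewrite !mulr_ge0 ?exprn_ge0.
have a'P : 0 <= a' by rewrite !mulr_ge0 ?exprn_ge0.
have [_ _ v0] := eb_P1 En.
have step : forall i j j' : 'I_N, (nx N <= i)%N -> val j' = j.+1 ->
   `|IK (i, j', true) (etax W (i, j', true)) + IK (i, j, false) (etax W (i, j, false))| <=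
   (a + a' *+ transition_row N j.+1) * (area (i, j', true) + area (i, j, true)).
  move=> i j j' _ jj; have aa := addr_ge0 (a0 (i, j', true)) (a0 (i, j, true)).
  have ga' := a0 (i, j', true); have ga := a0 (i, j, true).
  rewrite -jj; case: (boolP (transition_row N (val j'))) => h.
    rewrite mulr1n mulrDl; apply: (le_trans (ler_normD _ _)).
    have := etaxI (i, j', true); have := etaxI (i, j, false); rewrite -/a'.
    have -> : area (i, j, false) = area (i, j, true) by [].
    have := mulr_ge0 aP aa; lra.
  rewrite mulr0n addr0; apply: le_trans (pair_x_bound i jj h) _.
  by rewrite -/a ler_wpM2l// lerDl.
have h := @paired_gx_bound R N xs ys M v v0 (fun i : 'I_N => (nx N <= i)%N)
  (transition_row N) a a' (fun K => IK K (etax W K)) step.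
have {h} : `|\sum_(K : elt N | (nx N <= K.1.1)%N) gx v K * IK K (etax W K)| <=
    a * (A * l * E) + a' * (4 * A * z * E).
  apply: (le_trans h).
  rewrite (eq_bigr (fun K : elt N => a * (area K * `|gx v K|) +
    (if transition_row N (if K.2 then val K.1.2 else K.1.2.+1) then a' * (area K * `|gx v K|) else 0))); last first.
    by move=> K _ /=; case: (transition_row N _); rewrite ?mulr1n ?mulr0n; ring.
  rewrite big_split/= -mulr_sumr -big_mkcondr -mulr_sumr; apply: lerD; apply: ler_wpM2l => //.
    exact: (@sum_gx_fine _ _ _ _ _ S _ _ _ En).
  by apply: (sum_gx_transition S En) => K /andP.
move=> /(ler_wpM2l e0) h.
rewrite (eq_bigr (fun K => eps * (gx v K * IK K (etax W K)))); last by move=> K _; ring.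
rewrite -mulr_sumr normrM (ger0_norm e0); apply: (le_trans h).
rewrite (_ : eps * _ = (eps * t) * (6 * A ^+ 4 * E * ((z ^+ 2) ^+ 2 * l) + 8 * A ^+ 3 * (z ^+ 3 * E))); last first.
  by rewrite /a /a'; ring.
rewrite et mul1r.
have ww : 0 <= 6 * A ^+ 4 * E by rewrite !mulr_ge0// exprn_ge0.
have := ler_wpM2l ww (k2l (isT : (1 <= 2)%N)); have := zA (isT : (3 <= 4)%N); rewrite expr1; lra.
Qed.

(** The stream flux without eps times the x-derivative of the error, which is the only part that
    needs the pairing. *)
Let rest K p := - (b p * eta W K p)
  + delta K * (b p * (eps * (W 2 0 p + W 0 2 p) + b p * etax W K p + c p * eta W K p)).
Let srest K : sqcont (rest K).
Proof.
have s20 := @sW 2 0 isT; have s02 := @sW 0 2 isT; have se := @seta K; have sx := @setax K.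
by have sb' := sb; have sc' := sc; rewrite /rest; sqc.
Qed.

Let rest_le K : `|IK K (rest K)| <= area K * (10 * A ^+ 5 * ((z ^+ 2) ^+ 2 + delta K * t)).
Proof.
apply: (tri_int_bound M) => // p /(open_tri_cell M) Kp; have Op := cell_Omega_bar S Kp.
have X := component_etax S C Kp; have Y := component_eta S C Kp; rewrite /rest.
move: (etax W K p) (eta W K p) X Y => X Y HX HY.
have h1 := @cp_amp _ _ _ _ _ _ _ _ _ C K 2 0 p isT Kp.
have h2 := @cp_amp _ _ _ _ _ _ _ _ _ C K 0 2 p isT Kp.
rewrite !expr0 ?mul1r mulr1 in h1 h2.
have mA := mmA K; have m0 := cp_mm C (nx N <= K.1.1)%N (fine_row N K.1.2).
have bA := db_b0 D Op; have cA := db_c0 D Op; have k00 := k0; have k11 := k1; have dK := d0 K.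
have e1 : eps * (amp K * t ^+ 2) <= A * t.
  have -> : eps * (amp K * t ^+ 2) = (eps * t) * (amp K * t) by ring.
  by rewrite et mul1r ler_wpM2r.
have e2 : eps * (amp K * u ^+ 2) <= A * t.
  rewrite mulrCA; apply: ler_pM => //; first by rewrite mulr_ge0// sqr_ge0.
  exact: le_trans eu2 t1.
have Z : `|eps * (W 2 0 p + W 0 2 p)| <= 2 * A * t.
  rewrite normrM (ger0_norm e0).
  by have := ler_wpM2l e0 (le_trans (ler_normD _ _) (lerD h1 h2)); lra.
have bX : `|b p * X| <= A * (2 * A ^+ 2 * z ^+ 2 * t) by rewrite normrM ler_pM.
have cY : `|c p * Y| <= A * (6 * A ^+ 3 * (z ^+ 2) ^+ 2) by rewrite normrM ler_pM.
have bY : `|b p * Y| <= A * (6 * A ^+ 3 * (z ^+ 2) ^+ 2) by rewrite normrM ler_pM.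
have T : `|eps * (W 2 0 p + W 0 2 p) + b p * X + c p * Y| <= 10 * A ^+ 4 * t.
  apply: (le_trans (ler_normD _ _)); have h3 := ler_normD (eps * (W 2 0 p + W 0 2 p)) (b p * X).
  have p1 := @pow_le _ A t 1 4 A1 t0 isT; rewrite expr1 in p1.
  have p2 := @pow_le _ A t 3 4 A1 t0 isT.
  have w3 : 0 <= A ^+ 3 * t by rewrite mulr_ge0// exprn_ge0.
  have p3 := ler_wpM2l w3 k11.
  have kk1 : (z ^+ 2) ^+ 2 <= t.
    by apply: le_trans t1; rewrite expr2; apply: mulr_ile1.
  have p4 := ler_wpM2l (exprn_ge0 4 A0) kk1; lra.
have dT : `|delta K * (b p * (eps * (W 2 0 p + W 0 2 p) + b p * X + c p * Y))| <= delta K * (A * (10 * A ^+ 4 * t)).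
  by rewrite !normrM (ger0_norm dK) ler_wpM2l// ler_pM.
apply: (le_trans (ler_normD _ _)); rewrite normrN.
have p5 := @pow_le _ A _ 4 5 A1 (sqr_ge0 (z ^+ 2)) isT.
have p6 : 0 <= A ^+ 5 * (z ^+ 2) ^+ 2 by rewrite mulr_ge0// exprn_ge0.
lra.
Qed.

(** The bounds on delta_x and delta_xy contain a factor eps, or eps once multiplied by eps^(1/4); it
    cancels the derivative scale [t] = 1/eps. *)
Let fine_rest_part (P : pred (elt N)) by2 : (forall K, P K -> (nx N <= K.1.1)%N && (fine_row N K.1.2 == by2)) ->
  `|\sum_(K | P K) gx v K * IK K (rest K)| <= 40 * A ^+ 7 * (z ^+ 3 * E).
Proof.
move=> HP.
have H1 := @weighted_sum_bound _ _ P area (gx v) (fun K => IK K (rest K))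
  (10 * A ^+ 5 * ((z ^+ 2) ^+ 2 + dd true by2 * t)).
have Hg : total P <= A * l * E by apply: (sum_gx_fine S En) => K /HP/andP[].
apply: le_trans (H1 _) _.
  move=> K /HP/andP[hx /eqP hy2].
  by have := rest_le K; rewrite (sb_dd B) hx hy2.
have T0 : 0 <= total P by apply: sumr_ge0 => K _; rewrite mulr_ge0.
have AE : 0 <= A * E by rewrite mulr_ge0.
have w10 : 0 <= 10 * A ^+ 5 by rewrite mulr_ge0// exprn_ge0.
have h1 : (z ^+ 2) ^+ 2 * total P <= 3 * A * (z ^+ 3 * E).
  apply: le_trans (ler_wpM2l (sqr_ge0 _) Hg) _.
  by have := ler_wpM2r AE (k2l (isT : (1 <= 2)%N)); rewrite expr1; lra.
suff h2 : dd true by2 * t * total P <= A ^+ 2 * (z ^+ 3 * E).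
  have := ler_wpM2l w10 h1; have := ler_wpM2l w10 h2.
  by have := zA (isT : (6 <= 7)%N); lra.
have dd0 := sb_ge0 B true by2.
case: (by2) HP dd0 => HP dd0.
  have Hc : total P <= A * q * l ^+ 2 * E.
    by apply: (sum_gx_corner S En) => K /HP /andP[-> /eqP ->].
  apply: le_trans (ler_wpM2l (mulr_ge0 dd0 t0) Hc) _.
  have w : 0 <= t * (A * E * l ^+ 2) by rewrite !mulr_ge0// exprn_ge0.
  have := ler_wpM2r w (sb_xy B).
  rewrite (_ : A * eps * r ^+ 3 * _ = (eps * t) * (A * (A * E) * (r ^+ 3 * l ^+ 2))); last by ring.
  by rewrite et mul1r; have := ler_wpM2l (mulr_ge0 A0 AE) (r3l (isT : (2 <= 3)%N)); lra.
apply: le_trans (ler_wpM2l (mulr_ge0 dd0 t0) Hg) _.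
have w : 0 <= t * (A * E * l) by rewrite !mulr_ge0.
have := ler_wpM2r w (sb_x B).
rewrite (_ : A * eps * r ^+ 3 * _ = (eps * t) * (A * (A * E) * (r ^+ 3 * l))); last by ring.
by rewrite et mul1r; have := ler_wpM2l (mulr_ge0 A0 AE) (r3l (isT : (1 <= 3)%N)); rewrite expr1; lra.
Qed.

Let tri_int_normD K f g x y : sqcont f -> sqcont g -> `|IK K f| <= x -> `|IK K g| <= y ->
  `|IK K (fun p => f p + g p)| <= x + y.
Proof.
by move=> sf sg hf hg; rewrite (tri_intD M)//; apply: (le_trans (ler_normD _ _)); exact: lerD.
Qed.
Let tri_int_normZ K a f x y : sqcont f -> `|a| <= y -> `|IK K f| <= x -> `|IK K (fun p => a * f p)| <= y * x.
Proof. by move=> sf ha hf; rewrite (tri_intZ M)// normrM ler_pM. Qed.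

(** The x-derivatives carry factors 1/eps that the small amplitude A r^5 cannot beat. The flux is
    therefore expanded into single terms, and x-derivatives of the component are integrated by parts
    within the triangle, so that edge values of lower derivatives appear. The prefactor is an edge
    length instead of an area. *)
Let coarse_flux_le K : (K.1.1 < nx N)%N -> `|IK K (flux K)| <=
  hy K.1.2 * (A * r ^+ 5) * (3 * eps + 3 * A * hx K.1.1 + 15 * A ^+ 2 * delta K).
Proof.
move=> Kc; set m := A * r ^+ 5; set h := hx K.1.1; set g := hy K.1.2.
have h0 : 0 < h by exact: (hx_gt0 M (ltn_ord _)).
have g0 : 0 < g by exact: (hy_gt0 M (ltn_ord _)).
have m0 : 0 <= m by rewrite mulr_ge0// exprn_ge0.
have am : amp K <= m by rewrite leqNgt Kc; exact: mm_coarse.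
have aE : area K = h * g / 2 by [].
have h1 : h <= 1.
  have [h2 r1] := (stepx_le2 S K.1.1, root_invN_le S).
  have /andP[_ ] := stepx_coarse_bounds S Kc; rewrite -/h => hh.
  have rr : r ^+ 2 * 6 <= 1.
    by rewrite root_invN_sqr mulrC ler_pdivrMr ?ltr0n ?(sh_N S)// mul1r (ler_nat _ 6); exact: N_ge6 S.
  by lra.
have ag : area K <= g / 2.
  by rewrite aE; have := ler_wpM2r (ltW g0) h1; lra.
have sb' := sb; have sc' := sc; have dK := d0 K.
have s00 := @sW 0 0 isT; have s10 := @sW 1 0 isT; have s20 := @sW 2 0 isT; have s02 := @sW 0 2 isT.
have sDb : sqcont (Db 1 0) := derivs_cont (db_b D) (isT : (1 + 0 <= 3)%N).
have se := @seta K.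
have bd i j p : (i + j <= 2)%N -> cell K p -> `|W i j p| <= m * (t ^+ i * u ^+ j).
  move=> ij Kp; have ij3 : (i + j <= 3)%N by exact: leq_trans ij _.
  apply: le_trans (@cp_amp _ _ _ _ _ _ _ _ _ C K i j p ij3 Kp) _.
  by apply: ler_wpM2r => //; rewrite mulr_ge0// exprn_ge0// (cp_u C).
have b00 p : cell K p -> `|W 0 0 p| <= m by move=> /(bd 0 0 _ isT); rewrite !expr0 !mulr1.
have b10 p : cell K p -> `|W 1 0 p| <= m * t by move=> /(bd 1 0 _ isT); rewrite expr0 mulr1 expr1.
have be p : cell K p -> `|eta W K p| <= 6 * m.
  by move=> Kp; apply: (le_trans (component_eta_crude S C Kp)); rewrite ler_wpM2l.
have bb p : cell K p -> `|b p| <= A by move=> Kp; exact: (db_b0 D (cell_Omega_bar S Kp)).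
have bc p : cell K p -> `|c p| <= A by move=> Kp; exact: (db_c0 D (cell_Omega_bar S Kp)).
have bD p : cell K p -> `|Db 1 0 p| <= A by move=> Kp; exact: (db_b1 D (cell_Omega_bar S Kp)).
have Oin p : open_tri xs ys K p -> Omega p by move=> Kp; exact: (otri_Omega M Kp).
have [w dW] := cp_W C.
have dx00 p : open_tri xs ys K p -> is_derive p.1 1 (fun x => W 0 0 (x, p.2)) (W 1 0 p).
  by move=> /Oin Op; exact: (derivs_x dW (isT : (0 + 0 < 3)%N) Op).
have dx10 p : open_tri xs ys K p -> is_derive p.1 1 (fun x => W 1 0 (x, p.2)) (W 2 0 p).
  by move=> /Oin Op; exact: (derivs_x dW (isT : (1 + 0 < 3)%N) Op).
have dxb p : open_tri xs ys K p -> is_derive p.1 1 (fun x => b (x, p.2)) (Db 1 0 p).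
  by move=> /Oin Op; exact: (derivs0_x (db_b D) isT Op).
(* The slope times [h] is a difference of two values of the component, so no factor 1/eps enters. *)
have gxm : `|gx (W 0 0) K| * h <= 2 * m.
  rewrite gradxE normrM normfV (gtr0_norm h0) mulfVK ?gt_eqF//.
  have Kx := cornx_itv M K; have Ky := corny_itv M K.
  have xle : xs K.1.1 <= xs K.1.1.+1 := ltW (mesh_xs_lt M (ltn_ord K.1.1)).
  have c1 : cell K (xs K.1.1.+1, corny ys K) by split => //=; rewrite xle lexx.
  have c2 : cell K (xs K.1.1, corny ys K) by split => //=; rewrite xle lexx.
  by apply: (le_trans (ler_normB _ _)); have := b00 _ c1; have := b00 _ c2; lra.
have ig : `|gx (W 0 0) K| * area K <= g * m by rewrite aE; have := ler_wpM2l (ltW g0) gxm; lra.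
have i10 : `|IK K (W 1 0)| <= 2 * g * m.
  by apply: (tri_int_dx_bound M s00 s10 dx00) => p p1 p2; exact: (b00 p (conj p1 p2)).
have ibe : `|IK K (fun p => b p * eta W K p)| <= area K * (A * (6 * m)).
  apply: (tri_int_bound M); first by sqc.
  by move=> p /(open_tri_cell M) Kp; rewrite normrM; apply: ler_pM => //; [exact: bb|exact: be].
(* With b w_xx = (b w_x)_x - b_x w_x a single factor [t] is left, which the accompanying eps
   cancels. *)
have i20 : `|IK K (fun p => b p * W 2 0 p)| <= 3 * (g * A * (m * t)).
  rewrite (@eq_tri_int _ _ xs ys K _ (fun p => (b p * W 2 0 p + Db 1 0 p * W 1 0 p) + (-1) * (Db 1 0 p * W 1 0 p))); last first.
    by move=> p _; ring.
  have j1 : `|IK K (fun p => b p * W 2 0 p + Db 1 0 p * W 1 0 p)| <= 2 * g * (A * (m * t)).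
    apply: (@tri_int_dx_bound _ _ _ _ M K (fun p => b p * W 1 0 p)); [by sqc|by sqc| |].
      move=> p Kp; have := is_derive1M (dxb p Kp) (dx10 p Kp) => dd1.
      by apply: is_derive_eq dd1 _; rewrite -!surjective_pairing; ring.
    move=> p p1 p2; have Kp : cell K p by split.
    by rewrite normrM; apply: ler_pM => //; [exact: bb|exact: b10].
  have j2 : `|IK K (fun p => Db 1 0 p * W 1 0 p)| <= area K * (A * (m * t)).
    apply: (tri_int_bound M); first by sqc.
    by move=> p /(open_tri_cell M) Kp; rewrite normrM; apply: ler_pM => //; [exact: bD|exact: b10].
  have w6 : 0 <= A * (m * t) by rewrite !mulr_ge0.
  apply: (@le_trans _ _ (2 * g * (A * (m * t)) + 1 * (area K * (A * (m * t))))).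
    apply: tri_int_normD => //; [by sqc|by sqc|].
    by apply: tri_int_normZ => //; [sqc|rewrite normrN1].
  by have := ler_wpM2r w6 ag; have := mulr_ge0 (ltW g0) w6; lra.
have i02 : `|IK K (fun p => b p * W 0 2 p)| <= area K * (A * (m * u ^+ 2)).
  apply: (tri_int_bound M); first by sqc.
  move=> p /(open_tri_cell M) Kp; rewrite normrM; apply: ler_pM => //; first exact: bb.
  by have := bd 0 2 p isT Kp; rewrite expr0 mul1r.
have ibb : `|IK K (fun p => b p * b p)| <= area K * (A * A).
  apply: (tri_int_bound M); first by sqc.
  by move=> p /(open_tri_cell M) Kp; rewrite normrM; apply: ler_pM => //; exact: bb.
(* With b^2 w_x = (b^2 w)_x - 2 b b_x w no factor [t] is left. *)
have ib10 : `|IK K (fun p => b p * b p * W 1 0 p)| <= 4 * (g * A ^+ 2 * m).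
  rewrite (@eq_tri_int _ _ xs ys K _ (fun p => (b p * b p * W 1 0 p + 2 * (b p * Db 1 0 p * W 0 0 p)) + (-2) * (b p * Db 1 0 p * W 0 0 p))); last first.
    by move=> p _; ring.
  have j1 : `|IK K (fun p => b p * b p * W 1 0 p + 2 * (b p * Db 1 0 p * W 0 0 p))| <= 2 * g * (A * A * m).
    apply: (@tri_int_dx_bound _ _ _ _ M K (fun p => b p * b p * W 0 0 p)); [by sqc|by sqc| |].
      move=> p Kp; have := is_derive1M (is_derive1M (dxb p Kp) (dxb p Kp)) (dx00 p Kp) => dd1.
      by apply: is_derive_eq dd1 _; rewrite -!surjective_pairing; ring.
    move=> p p1 p2; have Kp : cell K p by split.
    rewrite !normrM.
    exact: (ler_pM (mulr_ge0 (normr_ge0 _) (normr_ge0 _)) (normr_ge0 _) (ler_pM (normr_ge0 _) (normr_ge0 _) (bb _ Kp) (bb _ Kp)) (b00 _ Kp)).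
  have j2 : `|IK K (fun p => b p * Db 1 0 p * W 0 0 p)| <= area K * (A * A * m).
    apply: (tri_int_bound M); first by sqc.
    move=> p /(open_tri_cell M) Kp; rewrite !normrM.
    exact: (ler_pM (mulr_ge0 (normr_ge0 _) (normr_ge0 _)) (normr_ge0 _) (ler_pM (normr_ge0 _) (normr_ge0 _) (bb _ Kp) (bD _ Kp)) (b00 _ Kp)).
  have w6 : 0 <= A * A * m by rewrite !mulr_ge0.
  apply: (@le_trans _ _ (2 * g * (A * A * m) + 2 * (area K * (A * A * m)))).
    apply: tri_int_normD => //; [by sqc|by sqc|].
    by apply: tri_int_normZ => //; [sqc|rewrite normrN ger0_norm].
  by have := ler_wpM2r w6 ag; have := mulr_ge0 (ltW g0) w6; lra.
have ice : `|IK K (fun p => b p * c p * eta W K p)| <= area K * (A * A * (6 * m)).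
  apply: (tri_int_bound M); first by sqc.
  move=> p /(open_tri_cell M) Kp; rewrite !normrM.
  exact: (ler_pM (mulr_ge0 (normr_ge0 _) (normr_ge0 _)) (normr_ge0 _) (ler_pM (normr_ge0 _) (normr_ge0 _) (bb _ Kp) (bc _ Kp)) (be _ Kp)).
pose G := gx (W 0 0) K.
rewrite (@eq_tri_int _ _ xs ys K _ (fun p => eps * G + (- eps) * W 1 0 p + (-1) * (b p * eta W K p)
  + (delta K * eps) * (b p * W 2 0 p) + (delta K * eps) * (b p * W 0 2 p)
  + (delta K * G) * (b p * b p) + (- delta K) * (b p * b p * W 1 0 p)
  + delta K * (b p * c p * eta W K p))); last first.
  by move=> p _; rewrite /stream_flux /interp_err_x /G; ring.
have de0 : 0 <= delta K * eps by rewrite mulr_ge0.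
apply: (@le_trans _ _ (eps * (g * m) + eps * (2 * g * m) + 1 * (area K * (A * (6 * m)))
  + (delta K * eps) * (3 * (g * A * (m * t))) + (delta K * eps) * (area K * (A * (m * u ^+ 2)))
  + (delta K * `|G|) * (area K * (A * A)) + delta K * (4 * (g * A ^+ 2 * m))
  + delta K * (area K * (A * A * (6 * m))))).
  do 6 (apply: tri_int_normD; [by sqc|by sqc| |by apply: tri_int_normZ; [by sqc| |by []];
     rewrite ?normrN ?normrM ?normr1 ?normr_id ?(ger0_norm dK) ?(ger0_norm e0)]).
  apply: tri_int_normD; [by sqc|by sqc| |by apply: tri_int_normZ; rewrite ?normrN ?(ger0_norm e0)].
  rewrite (tri_int_cst M) normrM (gtr0_norm (area_gt0 M K)) normrM (ger0_norm e0) -mulrA.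
  by rewrite ler_wpM2l.
have w1 : 0 <= delta K * A * g * m by rewrite !mulr_ge0// ltW.
have q1 := ler_wpM2l (mulr_ge0 dK (sqr_ge0 A)) ig.
have q2 : (delta K * eps) * (area K * (A * (m * u ^+ 2))) <= delta K * A * g * m / 2.
  have w2 : 0 <= delta K * A * m by rewrite !mulr_ge0.
  have := ler_pM (a0 K) (mulr_ge0 e0 (sqr_ge0 u)) ag eu2.
  by move=> /(ler_wpM2l w2); lra.
have q3 : (delta K * eps) * (3 * (g * A * (m * t))) = 3 * (delta K * A * g * m).
  by rewrite -[RHS]mul1r -et; ring.
have q4 : delta K * A * g * m <= delta K * A ^+ 2 * g * m.
  have w3 : 0 <= delta K * g * m by rewrite !mulr_ge0// ltW.
  by have := @pow_le _ A _ 1 2 A1 w3 isT; rewrite expr1; lra.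
have q5 : delta K * (area K * (A * A * (6 * m))) <= 3 * (delta K * A ^+ 2 * g * m).
  have w4 : 0 <= delta K * A ^+ 2 * m by rewrite !mulr_ge0// sqr_ge0.
  by have := ler_wpM2l w4 ag; lra.
have q6 : 1 * (area K * (A * (6 * m))) = 3 * A * h * g * m by rewrite aE; field.
rewrite q3 q6 /G; have w5 : 0 <= delta K * A ^+ 2 * g * m by rewrite !mulr_ge0// ?sqr_ge0// ltW.
lra.
Qed.

Let gx_vsum K : hx K.1.1 * `|gx v K| <= vsum xs ys v K.
Proof.
have h0 := hx_gt0 M (ltn_ord K.1.1).
have le : `|legx xs K| = hx K.1.1.
  by rewrite /legx; case: ifP => _; rewrite ?normrN gtr0_norm.
rewrite /gradx normrM normfV le mulrCA divff ?gt_eqF// mulr1 /vsum.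
apply: (le_trans (ler_normB _ _)); rewrite addrC; have := normr_ge0 (vert2 xs ys v K); lra.
Qed.

(** A coarse step is at least r^2. Hence the edge length is at most 2 area / r^2, and r^2 |v_x| is
    bounded by vertex values. Of the amplitude r^5 there remains r^3, and the stabilization term is
    kept with the streamline part of the norm. *)
Let coarse_term_le K : (K.1.1 < nx N)%N -> `|gx v K * IK K (flux K)| <=
  18 * A ^+ 2 * r ^+ 3 * (area K * vsum xs ys v K) +
  30 * A ^+ 3 * r ^+ 3 * Num.sqrt (delta K) * (area K * (Num.sqrt (delta K) * `|gx v K|)).
Proof.
move=> Kc; rewrite normrM; apply: (le_trans (ler_wpM2l (normr_ge0 _) (coarse_flux_le Kc))).
have /andP[r1 r2] := stepx_coarse_bounds S Kc; have gv := gx_vsum K; have dK := d0 K.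
have G0 := normr_ge0 (gx v K); have g0 : 0 < hy K.1.2 := hy_gt0 M (ltn_ord _).
have sdE : Num.sqrt (delta K) ^+ 2 = delta K by rewrite sqr_sqrtr.
have er : eps <= r ^+ 2 by rewrite root_invN_sqr; exact: (sh_epsN S).
have aE : area K = hx K.1.1 * hy K.1.2 / 2 by [].
move: (Num.sqrt _) sdE => sd sdE.
have Vr : r ^+ 2 * `|gx v K| <= vsum xs ys v K.
  by apply: le_trans gv; rewrite ler_wpM2r.
have gr : r ^+ 2 * hy K.1.2 <= 2 * area K.
  by have := ler_wpM2r (ltW g0) r1; rewrite aE; lra.
have r3 := exprn_ge0 3 r0; have r5 := exprn_ge0 5 r0.
have b1 : 3 * eps + 3 * A * hx K.1.1 <= 9 * A * r ^+ 2.
  have := ler_wpM2l A0 r2; have := @pow_le _ A _ 0 1 A1 (sqr_ge0 r) isT; rewrite expr0 expr1; lra.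
have w : 0 <= `|gx v K| * (hy K.1.2 * (A * r ^+ 5)) by rewrite !mulr_ge0// ltW.
have b2 := ler_wpM2l w b1.
have c1 : (r ^+ 2 * hy K.1.2) * (r ^+ 2 * `|gx v K|) <= 2 * area K * vsum xs ys v K.
  by apply: ler_pM => //; rewrite mulr_ge0 ?sqr_ge0// ltW.
have wA : 0 <= 9 * A ^+ 2 * r ^+ 3 by rewrite !mulr_ge0// exprn_ge0.
have wB : 0 <= 15 * A ^+ 3 * r ^+ 3 * (delta K * `|gx v K|) by rewrite !mulr_ge0// exprn_ge0.
have b3 := ler_wpM2l wA c1; have b4 := ler_wpM2l wB gr.
have -> : 30 * A ^+ 3 * r ^+ 3 * sd * (area K * (sd * `|gx v K|)) =
  30 * A ^+ 3 * r ^+ 3 * (area K * (delta K * `|gx v K|)) by rewrite -sdE; ring.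
lra.
Qed.

Let coarse_part (P : pred (elt N)) by2 : (forall K, P K -> (K.1.1 < nx N)%N && (fine_row N K.1.2 == by2)) ->
  `|\sum_(K | P K) gx v K * IK K (flux K)| <= 48 * A ^+ 6 * (z ^+ 3 * E).
Proof.
move=> HP; pose sd := Num.sqrt (dd false by2); have sd0 : 0 <= sd := sqrtr_ge0 _.
have sdE : sd ^+ 2 = dd false by2 by rewrite sqr_sqrtr// (sb_ge0 B).
set T := \sum_(K | P K) area K * (Num.sqrt (delta K) * `|gx v K|).
apply: (@le_trans _ _ (18 * A ^+ 2 * r ^+ 3 * \sum_(K | P K) area K * vsum xs ys v K +
   30 * A ^+ 3 * r ^+ 3 * sd * T)).
  apply: (le_trans (ler_norm_sum _ _ _)); rewrite !mulr_sumr -big_split/=; apply: ler_sum => K PK.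
  have /andP[Kc /eqP Kf] := HP K PK; apply: (le_trans (coarse_term_le Kc)).
  have -> // : Num.sqrt (delta K) = sd.
  by rewrite (sb_dd B) Kf leqNgt Kc.
have V1 := sum_v_all S En P; have r3 := exprn_ge0 3 r0.
have rz : r ^+ 3 <= z ^+ 3 by have := r3l (isT : (0 <= 3)%N); rewrite expr0 mulr1.
have r1 : r <= 1 by have := root_invN_le S; have := root_rate_le1 S; lra.
have AE : 0 <= A * E by rewrite mulr_ge0.
(* One factor sqrt(delta) belongs to the streamline norm, the other has to be bounded. In the fine
   rows delta_y may grow like eps^(-1/4), which q = eps^(1/4) from the square root of the area
   outweighs. *)
have suffT : sd * T <= A ^+ 3 * E.
  rewrite /T; move: sd0 sdE (sb_s B) (sb_y B); rewrite /sd; case: (by2) HP => HP.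
    move: (Num.sqrt (dd false true)) => sd' sd0' sdE' _ Hy.
    have T1 := sum_dgx_fine S En (P := P) (fun K PK => eqP (proj2 (andP (HP K PK)))).
    apply: (le_trans (ler_wpM2l sd0' T1)).
    have q0 : 0 <= q by exact: ltW (root4_eps_gt0 S).
    have q1 : q <= 1.
      by rewrite -sqrtr1; apply: ler_wsqrtr; rewrite -sqrtr1; apply: ler_wsqrtr.
    have key : sd' * q * l <= A.
      have sql : 0 <= sd' * q * l by rewrite !mulr_ge0.
      rewrite -(@ler_pXn2r _ 2)// ?nnegrE// !exprMn sdE'.
      have w : 0 <= q * l ^+ 2 by rewrite mulr_ge0// sqr_ge0.
      have h1 := ler_wpM2r w Hy.
      have h2 : q * (r ^+ 3 * l ^+ 2) <= 1 * 1.
        apply: ler_pM => //; first by rewrite mulr_ge0// sqr_ge0.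
        by apply: (le_trans (r3l (isT : (2 <= 3)%N))); apply: exprn_ile1 => //; exact: root_rate_le1 S.
      have h3 := ler_wpM2l A0 h2; have h4 := @pow_le _ A 1 1 2 A1 ler01 isT; lra.
    have w : 0 <= A ^+ 2 * E by rewrite mulr_ge0// exprn_ge0.
    by have := ler_wpM2l w key; lra.
  move: (Num.sqrt (dd false false)) => sd' sd0' sdE' Hs _.
  have T1 := sum_dgx_all S En P.
  have key : sd' <= A.
    rewrite -(@ler_pXn2r _ 2)// ?nnegrE// sdE'; apply: (le_trans Hs).
    have := ler_wpM2l A0 r1; have := @pow_le _ A 1 1 2 A1 ler01 isT; lra.
  have T0 : 0 <= \sum_(K | P K) area K * (Num.sqrt (delta K) * `|gx v K|).
    by apply: sumr_ge0 => K _; apply: mulr_ge0; [exact: a0|rewrite mulr_ge0 ?sqrtr_ge0].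
  apply: (le_trans (ler_pM sd0' T0 key T1)).
  by have := @pow_le _ A E 2 3 A1 E0 isT; lra.
have w1 : 0 <= 18 * A ^+ 2 * r ^+ 3 by rewrite !mulr_ge0// exprn_ge0.
have w2 : 0 <= 30 * A ^+ 3 * r ^+ 3 by rewrite !mulr_ge0// exprn_ge0.
have h1 := ler_wpM2l w1 V1; have h2 := ler_wpM2l w2 suffT.
have w3 : 0 <= 18 * A ^+ 3 * E by rewrite !mulr_ge0// exprn_ge0.
have w4 : 0 <= 30 * A ^+ 6 * E by rewrite !mulr_ge0// exprn_ge0.
have h3 := ler_wpM2l w3 rz; have h4 := ler_wpM2l w4 rz.
by have := zA (isT : (3 <= 6)%N); lra.
Qed.

Lemma layer_flux : `|\sum_(K : elt N) gx v K * IK K (flux K)| <= 672 * A ^+ 8 * (z ^+ 3 * E).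
Proof.
rewrite (bigID (fun K : elt N => nx N <= K.1.1)%N)/=.
have split_flux K : gx v K * IK K (flux K) = gx v K * (eps * IK K (etax W K)) + gx v K * IK K (rest K).
  have sx := @setax K; have sr := @srest K.
  have -> : IK K (flux K) = IK K (fun p => eps * etax W K p + rest K p).
    by apply: eq_tri_int => p _; rewrite /stream_flux /rest; ring.
  by rewrite (tri_intD M)//; [rewrite (tri_intZ M)//; ring|sqc].
rewrite (eq_bigr _ (fun K _ => split_flux K)) big_split/=.
rewrite (bigID (fun K : elt N => fine_row N K.1.2) (fun K : elt N => (nx N <= K.1.1)%N)
  (fun K => gx v K * IK K (rest K)))/=.
rewrite (bigID (fun K : elt N => fine_row N K.1.2) (fun K : elt N => ~~ (nx N <= K.1.1)%N))/=.
have h1 := @fine_rest_part (fun K => (nx N <= K.1.1)%N && fine_row N K.1.2) true.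
have h2 := @fine_rest_part (fun K => (nx N <= K.1.1)%N && ~~ fine_row N K.1.2) false.
have h3 := @coarse_part (fun K => ~~ (nx N <= K.1.1)%N && fine_row N K.1.2) true.
have h4 := @coarse_part (fun K => ~~ (nx N <= K.1.1)%N && ~~ fine_row N K.1.2) false.
apply: (le_trans (ler_normD _ _)).
apply: (le_trans (lerD (le_trans (ler_normD _ _) (lerD fine_etax (ler_normD _ _))) (ler_normD _ _))).
have /h1 g1 : forall K : elt N, (nx N <= K.1.1)%N && fine_row N K.1.2 -> (nx N <= K.1.1)%N && (fine_row N K.1.2 == true).
  by move=> K /andP[-> ->].
have /h2 g2 : forall K : elt N, (nx N <= K.1.1)%N && ~~ fine_row N K.1.2 -> (nx N <= K.1.1)%N && (fine_row N K.1.2 == false).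
  by move=> K /andP[-> /negbTE ->].
have /h3 g3 : forall K : elt N, ~~ (nx N <= K.1.1)%N && fine_row N K.1.2 -> (K.1.1 < nx N)%N && (fine_row N K.1.2 == true).
  by move=> K /andP[? ->]; rewrite ltnNge andbT.
have /h4 g4 : forall K : elt N, ~~ (nx N <= K.1.1)%N && ~~ fine_row N K.1.2 -> (K.1.1 < nx N)%N && (fine_row N K.1.2 == false).
  by move=> K /andP[? /negbTE ->]; rewrite ltnNge andbT.
have := zA (isT : (7 <= 8)%N); have := zA (isT : (6 <= 8)%N); have := zA (isT : (4 <= 8)%N).
have := mulr_ge0 (exprn_ge0 8 A0) zE; lra.
Qed.
End layer.

Lemma component_err_bound :
  `|\sum_(K : elt N) gx v K * IK K (flux K)| <= 672 * A ^+ 8 * (z ^+ 3 * E) ->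
  `|\sum_(K : elt N) consistency_err eps beta b c delta Db v W K| <= 688 * A ^+ 8 * (z ^+ 3 * E).
Proof.
move=> h1; rewrite component_err; apply: (le_trans (ler_normD _ _)).
have h2 := component_reaction S D En C; have h3 := component_cross_x.
have h4 := ler_normD (\sum_(K : elt N) gx v K * IK K (flux K)) (eps * \sum_(K : elt N) gy v K * IK K (etay W K)).
rewrite normrM (ger0_norm e0) in h4.
by have := zA (isT : (5 <= 8)%N); have := zA (isT : (3 <= 8)%N); lra.
Qed.
End component_flux.

Lemma powR_root {R : realType} (y : R) m n : 0 < y -> (0 < m)%N ->
  (y ^+ m) `^ (n%:R / m%:R) = y ^+ n.
Proof.
move=> y0 m0; rewrite -powR_mulrn ?ltW// -powRrM mulrCA divff ?pnatr_eq0 -?lt0n// mulr1.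
by rewrite powR_mulrn// ltW.
Qed.

(** * The components of the solution on the Shishkin mesh *)

Section layers.
Context {R : realType}.
Variables (eps beta : R) (N : nat) (A : R).
Hypothesis S : shishkin eps beta N A.
Local Notation xs := (mesh_x eps beta N).
Local Notation ys := (mesh_y eps N).
Local Notation hx := (stepx xs).
Local Notation hy := (stepy ys).
Local Notation L := (ln N%:R : R).
Local Notation lx := (lambda_x eps beta N).
Local Notation ly := (lambda_y eps N).
Local Notation cell := (@cell R N xs ys).
Local Notation r := (@root_invN R N).
Local Notation l := (@root_ln R N).
Local Notation z := (@root_rate R N).
Local Notation s := (Num.sqrt eps).
Local Notation q := (Num.sqrt (Num.sqrt eps)).
Let M : is_mesh N xs ys := shishkin_is_mesh S.
Let e0 : 0 < eps. Proof. exact: (sh_eps S). Qed.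
Let s0 : 0 < s. Proof. exact: (sqrt_eps_gt0 S). Qed.
Let q0 : 0 < q. Proof. exact: (root4_eps_gt0 S). Qed.
Let r0 : 0 < r. Proof. exact: (root_invN_gt0 S). Qed.
Let z0 : 0 < z. Proof. exact: (root_rate_gt0 S). Qed.
Let q2 : q ^+ 2 = s. Proof. exact: root4_eps_sqr. Qed.
Let s2 : s ^+ 2 = eps. Proof. exact: (sqrt_eps_sqr S). Qed.
Let N0 : 0 < N%:R :> R. Proof. by rewrite ltr0n; exact: (sh_N S). Qed.

Lemma powR_N n : N%:R `^ (- (n%:R / 2)) = r ^+ n.
Proof.
have -> : N%:R = (r^-1) ^+ 2 by rewrite exprVn root_invN_sqr invrK.
by rewrite powRN (@powR_root R r^-1 2 n) ?invr_gt0// exprVn invrK.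
Qed.
Lemma powR_ln : L `^ (3 / 2) = l ^+ 3.
Proof. by rewrite -(root_ln_sqr S) (@powR_root R l 2 3)//; have := root_ln_ge1 S; lra. Qed.
Let q4 : q ^+ 4 = eps. Proof. by rewrite (exprM q 2 2) q2 s2. Qed.
Lemma powR_eps_14 : eps `^ (- (1 / 4)) = q^-1.
Proof. by rewrite powRN -{1}q4 (@powR_root R q 4 1)// expr1. Qed.
Lemma powR_eps_34 : eps `^ (3 / 4) = q ^+ 3.
Proof. by rewrite -{1}q4 (@powR_root R q 4 3). Qed.
Lemma powR_eps_half j : eps `^ (- (j%:R / 2)) = s^-1 ^+ j.
Proof. by rewrite powRN -{1}s2 (@powR_root R s 2 j)// exprVn. Qed.
Lemma powR_eps_nat i : eps `^ (- i%:R) = eps^-1 ^+ i.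
Proof. by rewrite powRN powR_mulrn ?ltW// exprVn. Qed.
Lemma powR_eps_mix i j : eps `^ (- (i%:R + j%:R / 2)) = eps^-1 ^+ i * s^-1 ^+ j.
Proof. by rewrite opprD powRD ?powR_eps_nat ?powR_eps_half//; apply/implyP => _; rewrite gt_eqF. Qed.

Lemma exp_layer_le1 p : Omega_bar p -> 0 <= exp_layer eps beta p <= 1.
Proof.
move=> [/=]; rewrite in_itv/= => /andP[_ p1] _; rewrite expR_ge0 expR_le1.
rewrite mulNr mulNr oppr_le0 divr_ge0 ?(ltW e0)// mulr_ge0 ?(ltW (sh_beta S))//; lra.
Qed.

Lemma exp_layer_coarse p : p.1 <= 1 - lx -> exp_layer eps beta p <= r ^+ 5.
Proof.
move=> p1; rewrite -(root_invN_exp S) ler_expR mulNr mulNr mulNr lerN2.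
have -> : 5 / 2 * L = beta * lx / eps.
  by rewrite /lambda_x /rho; field; rewrite !gt_eqF ?(sh_beta S).
apply: ler_wpM2r; first by rewrite invr_ge0 ltW.
by apply: ler_wpM2l; [exact: ltW (sh_beta S)|lra].
Qed.

Lemma char_layer_le2 p : Omega_bar p -> 0 <= char_layer eps p <= 2.
Proof.
move=> [_ /=]; rewrite in_itv/= => /andP[p0 p1]; rewrite addr_ge0 ?expR_ge0//=.
have e (y : R) : 0 <= y -> expR (- y / s) <= 1.
  by move=> y0; rewrite expR_le1 mulNr oppr_le0 divr_ge0// ltW.
by rewrite /char_layer; have := e p.2 p0; have := e (1 - p.2); lra.
Qed.

Lemma char_layer_coarse p : ly <= p.2 <= 1 - ly -> char_layer eps p <= 2 * r ^+ 5.
Proof.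
move=> /andP[p0 p1].
have e (y : R) : ly <= y -> expR (- y / s) <= r ^+ 5.
  move=> yl; rewrite -(root_invN_exp S) ler_expR !mulNr lerN2.
  have -> : 5 / 2 * L = ly / s by rewrite /lambda_y /rho; field; rewrite gt_eqF.
  by apply: ler_wpM2r => //; rewrite invr_ge0 ltW.
by rewrite /char_layer; have := e p.2 p0; have := e (1 - p.2); lra.
Qed.

Lemma cell_coarse_x (K : elt N) p : cell K p -> (K.1.1 < nx N)%N -> p.1 <= 1 - lx.
Proof.
move=> [/= /andP[_ h] _] Kc; apply: (le_trans h); rewrite -(mesh_x_nx S).
by apply: (xs_le M); rewrite Kc ltnW// (nx_lt S).
Qed.

Lemma cell_fine_x (K : elt N) p : cell K p -> (nx N <= K.1.1)%N -> 1 - lx <= p.1.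
Proof.
move=> [/= /andP[h _] _] Kc; apply: le_trans h; rewrite -(mesh_x_nx S).
by apply: (xs_le M); rewrite Kc ltnW// ltn_ord.
Qed.

Let y3 : ys (N %/ 3) = ly /\ ys (2 * N %/ 3) = 1 - ly.
Proof.
have N6 := sh_N6 S; have n6 := N_ge6 S.
have [k Nk] : exists k, N = (6 * k)%N by exists (N %/ 6)%N; rewrite mulnC divnK.
have n3 : (N %/ 3 = 2 * k)%N by rewrite Nk (_ : 6 * k = 2 * k * 3)%N ?mulnK// mulnAC.
have n23 : (2 * N %/ 3 = 4 * k)%N by rewrite Nk (_ : 2 * (6 * k) = 4 * k * 3)%N ?mulnK// mulnAC mulnA.
have k0 : (0 < k)%N by move: n6; rewrite Nk; case: (k).
have kN : k%:R = N%:R / 6 :> R by rewrite Nk natrM; field.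
have nN0 : N%:R != 0 :> R by rewrite gt_eqF.
split; rewrite /mesh_y n3 n23.
  by rewrite leqnn natrM kN; field.
rewrite leqnn leq_pmul2r//= natrM kN; field.
exact: nN0.
Qed.

Lemma cell_coarse_y (K : elt N) p : cell K p -> ~~ fine_row N K.1.2 -> ly <= p.2 <= 1 - ly.
Proof.
move=> [_ /= /andP[h1 h2]]; rewrite /fine_row negb_or -leqNgt -ltnNge => /andP[j1 j2].
have [y1 y2] := y3; have n23 : (2 * N %/ 3 <= N)%N.
  by rewrite -[leqRHS](mulKn N (isT : 0 < 3)%N) leq_div2r// leq_mul2r orbT.
apply/andP; split.
- by apply: le_trans h1; rewrite -y1; apply: (ys_le M); rewrite j1 ltnW// ltn_ord.
- by apply: (le_trans h2); rewrite -y2; apply: (ys_le M); rewrite j2 n23.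
Qed.

Lemma cell_fine_y (K : elt N) p : cell K p -> fine_row N K.1.2 -> fine_y eps N p.2.
Proof.
move=> [_ /= /andP[h1 h2]]; rewrite /fine_row => h.
have [y1 y2] := y3; have n3 : (N %/ 3 <= N)%N by exact: leq_div.
have p0 : 0 <= p.2.
  by apply: le_trans h1; rewrite -(mesh_ys0 M); apply: (ys_le M); rewrite leq0n ltnW// ltn_ord.
have p1 : p.2 <= 1.
  by apply: (le_trans h2); rewrite -(mesh_ysN M); apply: (ys_le M); rewrite ltn_ord leqnn.
case/orP: h => h; [left|right]; rewrite /= in_itv/=; apply/andP; split => //.
- by apply: (le_trans h2); rewrite -y1; apply: (ys_le M); rewrite h n3.
- by apply: le_trans h1; rewrite -y2; apply: (ys_le M); rewrite h ltnW// ltn_ord.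
Qed.

Lemma tri_cell (K : elt N) p : tri eps beta K p -> cell K p.
Proof.
rewrite tri_gtri (gtriE M) => -[/= a0 b0 ab].
have [H1 H2 H3 H4] := @refmap_box _ _ _ _ M K (Kinv xs ys K p).1 (Kinv xs ys K p).2 a0 b0 ab.
have pE := refmap_inv M K p; rewrite -surjective_pairing pE in H1 H2 H3 H4.
by split; apply/andP.
Qed.

Section decomposition_components.
Variables (Creg : R) (w : R * R -> R).
(** The factor 2 bounds the sum of the two exponentials in [char_layer]; the absolute value makes
    the amplitude nonnegative whatever the sign of [Creg]. *)
Let B := 2 * `|Creg|.
Hypothesis BA : B <= A.
Let B0 : 0 <= B. Proof. by rewrite mulr_ge0. Qed.
Let A0 : 0 <= A. Proof. exact: le_trans B0 BA. Qed.
Let C0 : Creg <= `|Creg|. Proof. exact: ler_norm. Qed.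
Let nC0 : 0 <= `|Creg|. Proof. exact: normr_ge0. Qed.
Let hxk (i : nat) : hx i * 1 <= A * z ^+ 2. Proof. by rewrite mulr1; exact: (stepx_le S). Qed.
Let hyk (K : elt N) : hy K.1.2 * 1 <= A * z ^+ 2.
Proof. by rewrite mulr1; exact: (stepy_le S (ltn_ord _)). Qed.
Let z1 : z <= 1. Proof. exact: (root_rate_le1 S). Qed.
Let r51 : 0 <= r ^+ 5. Proof. by rewrite exprn_ge0// ltW. Qed.
Let rz5 : r ^+ 5 <= (z ^+ 2) ^+ 2.
Proof.
rewrite -exprM; have h := root_invN_le S; rewrite exprSr.
rewrite -[leRHS]mulr1; apply: ler_pM; rewrite ?exprn_ge0 ?(ltW r0)//; last exact: le_trans h z1.
by apply: lerXn2r; rewrite ?nnegrE ?(ltW r0) ?(ltW z0).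
Qed.
Let Br5 : B * r ^+ 5 <= A * (z ^+ 2) ^+ 2. Proof. exact: ler_pM. Qed.
Let s1 : s <= 1.
Proof. exact: le_trans (sqrt_eps_le S) (le_trans (root_invN_le S) z1). Qed.
Let ez : eps <= z ^+ 2.
Proof.
apply: (le_trans (sh_epsN S)); rewrite -root_invN_sqr.
by apply: lerXn2r; rewrite ?nnegrE ?(ltW r0) ?(ltW z0)//; exact: root_invN_le S.
Qed.
Let fin_x (K : elt N) : (nx N <= K.1.1)%N -> hx K.1.1 * eps^-1 <= A * z ^+ 2.
Proof. by move=> h; rewrite ler_pdivrMr//; exact: (stepx_fine_le S h). Qed.
Let fin_y (K : elt N) : fine_row N K.1.2 -> hy K.1.2 * s^-1 <= A * z ^+ 2.
Proof. by move=> h; rewrite ler_pdivrMr//; exact: (stepy_fine_le S (ltn_ord _) h). Qed.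

Lemma smooth_component : derivs_bounded_by Creg w (fun _ _ _ => 1) ->
  exists2 W, derivs 3 w W & component eps beta N A W 1 1 (fun _ _ => B).
Proof.
move=> [W dW HW]; exists W => //; split => //.
- by exists w.
- by rewrite mulr1.
- move=> K i j p ij Kp; have := HW i j p ij (cell_Omega_bar S Kp).
  by rewrite !expr1n !mulr1 /B => /le_trans; apply; have := C0; have := nC0; lra.
- by move=> K; left.
Qed.

Lemma char_component :
  derivs_bounded_by Creg w (fun _ j p => eps `^ (- (j%:R / 2)) * char_layer eps p) ->
  exists2 W, derivs 3 w W &
    component eps beta N A W 1 s^-1 (fun _ b2 => if b2 then B else B * r ^+ 5).
Proof.
move=> [W dW HW]; exists W => //; split => //.
- by exists w.
- by rewrite divff// gt_eqF.
- by move=> _ [] //; exact: mulr_ge0.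
- move=> K i j p ij Kp; have Op := cell_Omega_bar S Kp.
  apply: (le_trans (HW i j p ij Op)); rewrite powR_eps_half expr1n mul1r.
  have sj : 0 <= s^-1 ^+ j by rewrite exprn_ge0// invr_ge0 ltW.
  have /andP[c0 c2] := char_layer_le2 Op.
  have w0 : 0 <= s^-1 ^+ j * char_layer eps p by exact: mulr_ge0.
  apply: (le_trans (ler_wpM2r w0 C0)); rewrite mulrCA [leRHS]mulrC; apply: ler_wpM2l => //.
  case: ifP => [_|/negbT h]; first by have := ler_wpM2l nC0 c2; rewrite /B; lra.
  by have := ler_wpM2l nC0 (char_layer_coarse (cell_coarse_y Kp h)); rewrite /B; lra.
- by move=> K; case: ifP => h; [left; split=> //; split=> //; exact: fin_y|right].
Qed.

Lemma exp_component :
  derivs_bounded_by Creg w (fun i _ p => eps `^ (- i%:R) * exp_layer eps beta p) ->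
  exists2 W, derivs 3 w W &
    component eps beta N A W eps^-1 1 (fun bx _ => if bx then B else B * r ^+ 5).
Proof.
move=> [W dW HW]; exists W => //; split => //.
- by exists w.
- by rewrite invr_ge0 ltW.
- by rewrite mulr1.
- by move=> [] _ //; exact: mulr_ge0.
- move=> K i j p ij Kp; have Op := cell_Omega_bar S Kp.
  apply: (le_trans (HW i j p ij Op)); rewrite powR_eps_nat expr1n mulr1.
  have sj : 0 <= eps^-1 ^+ i by rewrite exprn_ge0// invr_ge0 ltW.
  have /andP[c0 c2] := exp_layer_le1 Op.
  have w0 : 0 <= eps^-1 ^+ i * exp_layer eps beta p by exact: mulr_ge0.
  apply: (le_trans (ler_wpM2r w0 C0)); rewrite mulrCA [leRHS]mulrC; apply: ler_wpM2l => //.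
  case: ifP => [_|/negbT h]; first by have := ler_wpM2l nC0 c2; rewrite /B; have := nC0; lra.
  rewrite -ltnNge in h; have := ler_wpM2l nC0 (exp_layer_coarse (cell_coarse_x Kp h)).
  by have := mulr_ge0 nC0 r51; rewrite /B; lra.
- by move=> K; case: ifP => h; [left; split; [exact: fin_x|split]|right].
Qed.

(** Only where the mesh is fine in both directions are both scales resolved; elsewhere at least one
    of the two exponential factors has decayed to O(r^5). *)
Lemma corner_component :
  derivs_bounded_by Creg w (fun i j p => eps `^ (- (i%:R + j%:R / 2)) *
    exp_layer eps beta p * char_layer eps p) ->
  exists2 W, derivs 3 w W &
    component eps beta N A W eps^-1 s^-1 (fun bx b2 => if bx && b2 then B else B * r ^+ 5).
Proof.
move=> [W dW HW]; exists W => //; split => //.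
- by exists w.
- by rewrite invr_ge0 ltW.
- by rewrite divff// gt_eqF.
- by move=> bx b2; case: ifP => // _; exact: mulr_ge0.
- move=> K i j p ij Kp; have Op := cell_Omega_bar S Kp.
  apply: (le_trans (HW i j p ij Op)); rewrite powR_eps_mix.
  have ti : 0 <= eps^-1 ^+ i * s^-1 ^+ j by rewrite mulr_ge0// exprn_ge0// invr_ge0 ltW.
  have /andP[x0 x1] := exp_layer_le1 Op; have /andP[c0 c2] := char_layer_le2 Op.
  have w0 : 0 <= eps^-1 ^+ i * s^-1 ^+ j * exp_layer eps beta p * char_layer eps p.
    by rewrite !mulr_ge0// exprn_ge0// invr_ge0 ltW.
  apply: (le_trans (ler_wpM2r w0 C0)); rewrite -mulrA mulrCA [leRHS]mulrC; apply: ler_wpM2l => //.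
  case: ifP => [_|].
    by have := ler_wpM2l nC0 (ler_pM x0 c0 x1 c2); rewrite /B; lra.
  have [h _|h /= /negbT h2] := ltnP K.1.1 (nx N).
    have := ler_wpM2l nC0 (ler_pM x0 c0 (exp_layer_coarse (cell_coarse_x Kp h)) c2).
    by rewrite /B; lra.
  have := ler_wpM2l nC0 (ler_pM x0 c0 x1 (char_layer_coarse (cell_coarse_y Kp h2))).
  by rewrite /B; lra.
- by move=> K; case: ifP => [/andP[h1 h2]|_]; [left; split; [exact: fin_x|split=> //; exact: fin_y]|right].
Qed.
End decomposition_components.
End layers.

(** * The error estimate *)

Section final_estimates.
Context {R : realType}.
Variables (eps beta mu0 : R) (N : nat) (A : R) (b c : R * R -> R) (Db Dc : nat -> nat -> R * R -> R).
Hypotheses (S : shishkin eps beta N A) (D : data_bounds b c Db Dc A).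
Variables (delta : elt N -> R) (v : R * R -> R).
Local Notation xs := (mesh_x eps beta N).
Local Notation ys := (mesh_y eps N).
Local Notation area := (tri_area xs ys).
Local Notation gx := (gradx xs ys).
Local Notation gy := (grady xs ys).
Local Notation IK := (tri_int xs ys).
Local Notation E := (norm_SD eps beta mu0 b delta v).
Local Notation nK := (normK eps beta mu0 b delta v).
Let M : is_mesh N xs ys := shishkin_is_mesh S.

Lemma norm_energy_bounds : 0 < mu0 -> 6 / Num.sqrt mu0 <= A ->
  (forall p, Omega_bar p -> beta <= b p) -> (forall K, 0 <= delta K) ->
  P1_function N xs ys v -> energy_bounds xs ys eps A delta v E.
Proof.
move=> mu00 Amu bb d0 Pv; have e0 := sh_eps S; have be0 := sh_beta S.
have sb : sqcont b := derivs_sqcont (db_b D).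
have E2 := norm_SD_sqr M sb e0 mu00 d0 Pv.
have E0 : 0 <= E by exact: sqrtr_ge0.
have a0 K := ltW (area_gt0 M K).
have g2 (K : elt N) : 0 <= area K * gx v K ^+ 2 + area K * gy v K ^+ 2.
  by apply: addr_ge0; exact: (mulr_ge0 (a0 K) (sqr_ge0 _)).
have iv (K : elt N) : 0 <= IK K (fun p => v p ^+ 2) by apply: tri_int_ge0 => p _; exact: sqr_ge0.
have ib (K : elt N) : area K * beta ^+ 2 <= IK K (fun p => b p ^+ 2).
  rewrite mulrC -(tri_int_cst M); apply: (tri_int_le M); [exact: sqcont_cst|exact: sqcont_sqr|].
  move=> p Kp; have := bb p (cell_Omega_bar S (open_tri_cell M Kp)) => h.
  by apply: lerXn2r; rewrite ?nnegrE ?(ltW be0)// (le_trans (ltW be0)).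
have dg (K : elt N) : 0 <= delta K * gx v K ^+ 2 by rewrite mulr_ge0// sqr_ge0.
have ib0 (K : elt N) : 0 <= IK K (fun p => b p ^+ 2).
  exact: le_trans (mulr_ge0 (a0 K) (sqr_ge0 _)) (ib K).
have nE K : nK K = eps * (area K * gx v K ^+ 2 + area K * gy v K ^+ 2)
   + mu0 * IK K (fun p => v p ^+ 2) + delta K * gx v K ^+ 2 * IK K (fun p => b p ^+ 2).
  by rewrite /normK; ring.
have sE : Num.sqrt eps ^+ 2 = eps := sqrt_eps_sqr S.
have part (F : elt N -> R) (a : R) : 0 < a -> (forall K, a * F K <= nK K) ->
    \sum_(K : elt N) F K <= E ^+ 2 / a.
  move=> a1 H; rewrite ler_pdivlMr// E2 mulrC mulr_sumr; exact: ler_sum.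
have A0 : 0 <= A by have := sh_A8 S; lra.
split => //.
- rewrite exprMn exprVn sE; apply: part => // K; rewrite nE.
  have := mulr_ge0 (ltW mu00) (iv K); have := mulr_ge0 (dg K) (ib0 K).
  have := mulr_ge0 (ltW e0) (mulr_ge0 (a0 K) (sqr_ge0 (gy v K))); lra.
- rewrite exprMn exprVn sE; apply: part => // K; rewrite nE.
  have := mulr_ge0 (ltW mu00) (iv K); have := mulr_ge0 (dg K) (ib0 K).
  have := mulr_ge0 (ltW e0) (mulr_ge0 (a0 K) (sqr_ge0 (gx v K))); lra.
- apply: (@le_trans _ _ (E ^+ 2 / (mu0 / 36))).
    apply: part => [|K]; first by rewrite divr_gt0.
    rewrite nE (P1_sqr_int M _ Pv).
    set x := vert0 _ _ _ _; set y := vert1 _ _ _ _; set t := vert2 _ _ _ _.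
    have vs : vsum xs ys v K ^+ 2 <= 3 * (x ^+ 2 + y ^+ 2 + t ^+ 2 + (x + y + t) ^+ 2).
      rewrite /vsum -/x -/y -/t -(real_normK (num_real x)) -(real_normK (num_real y)) -(real_normK (num_real t)).
      have h1 := sqr_ge0 (`|x| - `|y|); have h2 := sqr_ge0 (`|x| - `|t|); have h3 := sqr_ge0 (`|y| - `|t|).
      have h4 := sqr_ge0 (x + y + t); lra.
    have w : 0 <= mu0 * area K := mulr_ge0 (ltW mu00) (a0 K).
    have := ler_wpM2l w vs; have := mulr_ge0 (dg K) (ib0 K).
    have := mulr_ge0 (ltW e0) (g2 K); lra.
  rewrite [leRHS]exprMn mulrC; apply: ler_wpM2r; first exact: sqr_ge0.
  have s0 : 0 < Num.sqrt mu0 by rewrite sqrtr_gt0.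
  have x0 : 0 <= 6 / Num.sqrt mu0 by rewrite divr_ge0// ltW.
  have -> : (mu0 / 36)^-1 = (6 / Num.sqrt mu0) ^+ 2.
    by rewrite exprMn exprVn sqr_sqrtr ?ltW//; field; rewrite gt_eqF.
  by apply: lerXn2r.
- apply: (@le_trans _ _ (E ^+ 2 / beta ^+ 2)).
    apply: part => [|K]; first by rewrite exprn_gt0.
    rewrite nE exprMn sqr_sqrtr//.
    have := ler_wpM2l (dg K) (ib K); have := mulr_ge0 (ltW mu00) (iv K).
    have := mulr_ge0 (ltW e0) (g2 K); lra.
  rewrite [leRHS]exprMn mulrC; apply: ler_wpM2r; first exact: sqr_ge0.
  have ib1 : 0 <= beta^-1 by rewrite invr_ge0 ltW.
  have bA : beta^-1 <= A by have := sh_Ab S; lra.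
  by rewrite -exprVn; apply: lerXn2r.
Qed.

Lemma stab_param_bounds Cstar d_s d_x d_y d_xy : 0 <= Cstar -> Cstar <= A ->
  stab_param eps beta delta d_s d_x d_y d_xy -> (forall K, 0 <= delta K) ->
  d_s <= Cstar * N%:R `^ (- (1 / 2)) ->
  d_y <= Cstar * eps `^ (- (1 / 4)) * N%:R `^ (- (3 / 2)) ->
  d_x <= Cstar * eps * N%:R `^ (- (3 / 2)) ->
  d_xy <= Cstar * eps `^ (3 / 4) * N%:R `^ (- (3 / 2)) ->
  stab_bounds eps A delta
    (fun bx b2 => if bx then (if b2 then d_xy else d_x) else (if b2 then d_y else d_s)).
Proof.
move=> C0 CA sp d0; rewrite (powR_N S 1) (powR_N S 3) (powR_eps_14 S) (powR_eps_34 S) expr1.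
move=> hs hy hx hxy.
have r0 := ltW (root_invN_gt0 S); have q0 := root4_eps_gt0 S; have e0 := sh_eps S.
have r3 := exprn_ge0 3 r0.
have q2 : Num.sqrt (Num.sqrt eps) ^+ 2 = Num.sqrt eps := root4_eps_sqr eps.
have q4 : Num.sqrt (Num.sqrt eps) ^+ 4 = eps.
  by rewrite (exprM _ 2 2) q2 (sqrt_eps_sqr S).
have dE K : delta K = if (nx N <= K.1.1)%N then (if fine_row N K.1.2 then d_xy else d_x)
    else (if fine_row N K.1.2 then d_y else d_s).
  have [s1 s2 s3 s4] := sp K.
  have inc (Om : set (R * R)) : (forall p, @cell R N xs ys K p -> Omega_bar p -> Om p) ->
      tri eps beta K `<=` Om.
    by move=> H p /(tri_cell S) Kp; exact: H Kp (cell_Omega_bar S Kp).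
  case: (leqP (nx N) K.1.1) => hK; case: (boolP (fine_row N K.1.2)) => fK.
  - apply: s4; apply: inc => p Kp [/= o1 _]; split; last exact: (cell_fine_y S Kp fK).
    by move: o1; rewrite /= !in_itv/= => /andP[_ ->]; rewrite (cell_fine_x S Kp hK).
  - apply: s2; apply: inc => p Kp [/= o1 _]; split; last first.
      by rewrite /= in_itv/=; exact: (cell_coarse_y S Kp fK).
    by move: o1; rewrite /= !in_itv/= => /andP[_ ->]; rewrite (cell_fine_x S Kp hK).
  - apply: s3; apply: inc => p Kp [/= o1 _]; split; last exact: (cell_fine_y S Kp fK).
    by move: o1; rewrite /= !in_itv/= => /andP[-> _]; rewrite (cell_coarse_x S Kp hK).
  - apply: s1; apply: inc => p Kp [/= o1 _]; split; last first.
      by rewrite /= in_itv/=; exact: (cell_coarse_y S Kp fK).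
    by move: o1; rewrite /= !in_itv/= => /andP[-> _]; rewrite (cell_coarse_x S Kp hK).
have N6 := N_ge6 S.
have j0 : (0 < N)%N by exact: leq_trans N6.
have j1 : (N %/ 3 < N)%N by rewrite ltn_Pdiv.
have f0 : fine_row N 0 by rewrite /fine_row divn_gt0// (leq_trans _ N6).
have f1 : fine_row N (N %/ 3) = false.
  rewrite /fine_row ltnn/= leqNgt; apply/negbTE; rewrite negbK.
  rewrite -(@ltn_pmul2r 3)// -(@ltn_pmul2l 1)//.
  have d3 : (3 %| N)%N by exact: dvdn_trans (sh_N6 S).
  by rewrite !mul1n !divnK ?dvdn_mull// ltn_Pmull.
have f2 : (nx N <= 0)%N = false by rewrite leqNgt (nx_gt0 S).
split => //=.
(* The signs of the four values are read off from one element in each subdomain: column 0 or N / 2,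
   row 0 or N / 3. *)
- move=> bx b2.
  pose i : 'I_N := if bx then Ordinal (nx_lt S) else Ordinal j0.
  pose j : 'I_N := if b2 then Ordinal j0 else Ordinal j1.
  have := d0 (i, j, true); rewrite dE /i /j.
  by case: bx {i}; case: b2 {j}; rewrite /= ?leqnn ?f0 ?f1 ?f2.
- by apply: (le_trans hs); rewrite ler_wpM2r.
- have := ler_wpM2r (ltW q0) hy; have := ler_wpM2r r3 CA.
  rewrite (_ : Cstar * _^-1 * _ * _ = Cstar * root_invN N ^+ 3); first lra.
  by field; rewrite gt_eqF.
- by apply: (le_trans hx); rewrite -!mulrA ler_wpM2r// mulr_ge0// ltW.
- have := ler_wpM2r (ltW q0) hxy; have w : 0 <= eps * root_invN N ^+ 3 by rewrite mulr_ge0// ltW.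
  have := ler_wpM2r w CA; move: (Num.sqrt (Num.sqrt eps)) q4 => q q4.
  by rewrite (_ : Cstar * q ^+ 3 * root_invN N ^+ 3 * q = Cstar * (q ^+ 4 * root_invN N ^+ 3)); [rewrite q4; lra|ring].
Qed.
End final_estimates.

Lemma derivsW {R : realType} k m (g : R * R -> R) D : (m <= k)%N -> derivs k g D -> derivs m g D.
Proof.
move=> mk [D0 Dc Dd]; split => // i j ij; first by apply: Dc; exact: leq_trans mk.
by apply: Dd; exact: leq_trans mk.
Qed.

Lemma C2D {R : realType} (W W' : nat -> nat -> R * R -> R) : C2 W -> C2 W' ->
  C2 (fun i j p => W i j p + W' i j p).
Proof. by move=> h h' i j ij; apply: sqcontD; [exact: h|exact: h']. Qed.

Lemma exists_data_bounds {R : realType} (b c : R * R -> R) Db Dc : derivs 3 b Db -> derivs 3 c Dc ->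
  exists2 m : R, 0 <= m & forall A, m <= A -> data_bounds b c Db Dc A.
Proof.
move=> db dc.
have sb := derivs_sqcont db; have sc := derivs_sqcont dc.
have sDb : sqcont (Db 1 0) := derivs_cont db (isT : (1 + 0 <= 3)%N).
have sDc : sqcont (Dc 1 0) := derivs_cont dc (isT : (1 + 0 <= 3)%N).
have scb : sqcont (fun p => c p + - Db 1 0 p) by sqc.
have [m1 h1] := sqcont_bounded sb; have [m2 h2] := sqcont_bounded sDb.
have [m3 h3] := sqcont_bounded sc; have [m4 h4] := sqcont_bounded sDc.
have [m5 h5] := sqcont_bounded scb.
have [n1 n2 n3 n4 n5] := And5 (normr_ge0 m1) (normr_ge0 m2) (normr_ge0 m3) (normr_ge0 m4) (normr_ge0 m5).
have [l1 l2 l3 l4 l5] := And5 (ler_norm m1) (ler_norm m2) (ler_norm m3) (ler_norm m4) (ler_norm m5).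
exists (`|m1| + `|m2| + `|m3| + `|m4| + `|m5|); first lra.
move=> A hA; split => // p Op.
- by have := h1 p Op; lra.
- by have := h2 p Op; lra.
- by have := h3 p Op; lra.
- by have := h4 p Op; lra.
- by have := h5 p Op; lra.
Qed.

Theorem theorem4p1 (R : realType) (b c f : R * R -> R)
    (Db : nat -> nat -> R * R -> R) (beta mu0 Cstar Creg : R)
    (b_smooth : derivs 3 b Db) (c_smooth : smooth 3 c) (f_smooth : smooth 3 f)
    (beta_gt0 : 0 < beta) (mu0_gt0 : 0 < mu0) (Cstar_gt0 : 0 < Cstar)
    (b_ge : forall p, Omega_bar p -> beta <= b p)
    (c_ge : forall p, Omega_bar p -> mu0 <= c p - 1 / 2 * Db 1%N 0%N p) :
  exists C : R, forall (eps : R) (N : nat)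
    (u S E1 E2 E12 uI uN : R * R -> R)
    (delta : elt N -> R) (d_s d_x d_y d_xy : R),
    0 < eps -> (0 < N)%N -> (6 %| N)%N ->
    eps <= Num.min N%:R^-1 (ln N%:R ^- 6) ->
    lambda_x eps beta N <= 1 / 2 -> lambda_y eps N <= 1 / 4 ->
    bvp_solution eps b c f u ->
    decomposition eps beta Creg u S E1 E2 E12 ->
    nodal_interpolant eps beta N u uI ->
    stab_param eps beta delta d_s d_x d_y d_xy ->
    sdfem_solution eps beta b c f delta uN ->
    (forall K : elt N, 0 <= delta K /\
      ((delta K)%:E <= mu0%:E / (2%:E * Linfnorm (tri eps beta K) c ^+ 2))%E) ->
    d_s <= Cstar * N%:R `^ (- (1 / 2)) ->
    d_y <= Cstar * eps `^ (- (1 / 4)) * N%:R `^ (- (3 / 2)) ->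
    d_x <= Cstar * eps * N%:R `^ (- (3 / 2)) ->
    d_xy <= Cstar * eps `^ (3 / 4) * N%:R `^ (- (3 / 2)) ->
    norm_eps eps mu0 (uI \- uN) <= norm_SD eps beta mu0 b delta (uI \- uN) /\
    norm_SD eps beta mu0 b delta (uI \- uN)
      <= C * N%:R `^ (- (3 / 2)) * ln N%:R `^ (3 / 2).
Proof.
have [Dc dc] := c_smooth.
have [m m0 Hm] := exists_data_bounds b_smooth dc.
have smu0 : 0 <= 6 / Num.sqrt mu0 by rewrite divr_ge0// sqrtr_ge0.
have ibeta0 : 0 <= 5 / beta by rewrite divr_ge0// ltW.
have nC := normr_ge0 Creg.
(* One constant for all data: 8 covers the numerical factors in the mesh steps, 5 / beta those of
   [lambda_x], 6 / sqrt(mu0) the passage from the L2 norm to vertex values, 2 |Creg| the amplitudes,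
   and [m] the coefficients with their x-derivatives. *)
pose A := 8 + 5 / beta + 6 / Num.sqrt mu0 + 2 * `|Creg| + Cstar + m.
have [a1 a2 a3 [a4 a5 a6]] : [/\ 8 <= A, 5 / beta <= A, 6 / Num.sqrt mu0 <= A &
    [/\ 2 * `|Creg| <= A, Cstar <= A & m <= A]].
  by rewrite /A; split; [lra|lra|lra|split; lra].
have A0 : 0 <= A by lra.
(* 5504 = 2 * 4 * 688: a factor 2 from coercivity, and 688 for each of the four components. *)
exists (5504 * A ^+ 8) => eps N u S E1 E2 E12 uI uN delta d_s d_x d_y d_xy.
move=> eps_gt0 N_gt0 N6 epsN lx ly u_sol u_dec uI_int sp uN_sol delta_bd hs hy hx hxy.
have Sh : shishkin eps beta N A.
  by split => //; move: epsN; rewrite le_min => /andP[].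
have D := Hm A a6.
have d0 K : 0 <= delta K by case: (delta_bd K).
have M := shishkin_is_mesh Sh.
have sc := derivs_sqcont dc.
set v := uI \- uN.
have Pv : P1_function N (mesh_x eps beta N) (mesh_y eps N) v.
  by apply: P1B; [exact: (VN_P1 uI_int.1)|exact: (VN_P1 uN_sol.1)].
have [sv _ _] := Pv.
have Sb := stab_param_bounds Sh (ltW Cstar_gt0) a5 sp d0 hs hy hx hxy.
have En := norm_energy_bounds Sh D mu0_gt0 a3 b_ge d0 Pv.
split; first exact: norm_eps_le_SD.
set E := norm_SD _ _ _ _ _ _ in En *.
have E0 : 0 <= E := eb_E En.
set z := @root_rate R N.
have z0 : 0 < z := root_rate_gt0 Sh.
have rl5 : 0 <= root_invN N ^+ 5 :> R by rewrite exprn_ge0// ltW// (root_invN_gt0 Sh).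
have [u_eq dS dE1 dE2 dE12] := u_dec.
have [W1 dS_ C1] := smooth_component Sh a4 dS.
have [W2 dE1_ C2'] := exp_component Sh a4 dE1.
have [W3 dE2_ C3] := char_component Sh a4 dE2.
have [W4 dE12_ C4] := corner_component Sh a4 dE12.
have nC2 : 0 <= 2 * `|Creg| by lra.
have ez : eps <= z ^+ 2.
  apply: (le_trans (sh_epsN Sh)); rewrite -root_invN_sqr.
  by apply: lerXn2r; rewrite ?nnegrE ?(ltW (root_invN_gt0 Sh)) ?(ltW z0)//; exact: (root_invN_le Sh).
have r54 : (root_invN N : R) ^+ 5 <= z ^+ 2.
  have r0 := root_invN_gt0 Sh; have r1 := le_trans (root_invN_le Sh) (root_rate_le1 Sh).
  apply: (@le_trans _ _ (root_invN N ^+ 2)).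
    by apply: ler_wiXn2l => //; exact: ltW.
  by apply: lerXn2r; rewrite ?nnegrE ?(ltW r0) ?(ltW z0)//; exact: (root_invN_le Sh).
have Br : 2 * `|Creg| * root_invN N ^+ 5 <= A * root_invN N ^+ 5 by exact: ler_wpM2r.
have mc1 : eps * 1 ^+ 2 * (2 * `|Creg|) <= A * z ^+ 2.
  by rewrite expr1n mulr1 mulrC; apply: ler_pM => //; exact: ltW.
have mc3 : eps * (Num.sqrt eps)^-1 ^+ 2 * (2 * `|Creg| * root_invN N ^+ 5) <= A * z ^+ 2.
  by rewrite exprVn (sqrt_eps_sqr Sh) divff ?gt_eqF// mul1r; exact: ler_pM.
(* S and E2 vary on the scale 1 in x, E1 and E12 on the scale eps; this decides between the two flux
   estimates. *)
have err1 := component_err_bound Sh D En C1 (regular_flux Sh D Sb En C1 erefl (fun _ _ => erefl) mc1).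
have err3 := component_err_bound Sh D En C3 (regular_flux Sh D Sb En C3 erefl (fun _ _ => erefl) mc3).
have err2 := component_err_bound Sh D En C2' (layer_flux Sh D Sb En C2' erefl (fun _ => Br)).
have err4 := component_err_bound Sh D En C4 (layer_flux Sh D Sb En C4 erefl (fun _ => Br)).
pose U i j p := W1 i j p + W2 i j p + W3 i j p + W4 i j p.
(* The derivatives of the four components add up to derivatives of [u], so the error identity, which
   is linear in them, splits along the decomposition. *)
have dU : derivs 2 u U.
  apply: (@derivsW _ 3) => //; apply: eq_derivs (derivsD (derivsD (derivsD dS_ dE1_) dE2_) dE12_).
  by move=> p Op; rewrite u_eq.
have k1 := component_C2 C1; have k2 := component_C2 C2'; have k3 := component_C2 C3; have k4 := component_C2 C4.
have errU : \sum_(K : elt N) consistency_err eps beta b c delta Db v U K =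
    \sum_(K : elt N) consistency_err eps beta b c delta Db v W1 K +
    \sum_(K : elt N) consistency_err eps beta b c delta Db v W2 K +
    \sum_(K : elt N) consistency_err eps beta b c delta Db v W3 K +
    \sum_(K : elt N) consistency_err eps beta b c delta Db v W4 K.
  rewrite -!big_split/=; apply: eq_bigr => K _; rewrite /U.
  have e1 := consistency_errD delta M b_smooth sc K k1 k2 sv.
  have e2 := consistency_errD delta M b_smooth sc K (C2D k1 k2) k3 sv.
  have e3 := consistency_errD delta M b_smooth sc K (C2D (C2D k1 k2) k3) k4 sv.
  by rewrite e3 e2 e1.
have orth := galerkin_orthogonality M b_smooth sc dU u_sol uI_int uN_sol.
have cK K p : open_tri (mesh_x eps beta N) (mesh_y eps N) K p -> delta K * c p ^+ 2 <= mu0 / 2.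
  have [dK dL] := delta_bd K; apply: (@Linfnorm_bound _ (tri eps beta K)) => //.
  - exact: open_otri.
  - by rewrite tri_gtri; exact: otri_gtri.
  - by move=> q /(otri_Omega M) Oq; exact: sqcont_at.
have coer := coercive M b_smooth sc eps_gt0 mu0_gt0 d0 cK c_ge Pv.
have nE := norm_SD_sqr M (derivs_sqcont b_smooth) eps_gt0 mu0_gt0 d0 Pv.
rewrite -nE -/E orth errU in coer.
have EE : E ^+ 2 <= 5504 * A ^+ 8 * z ^+ 3 * E.
  have n1 := le_trans (ler_norm _) err1; have n2 := le_trans (ler_norm _) err2.
  have n3 := le_trans (ler_norm _) err3; have n4 := le_trans (ler_norm _) err4.
  by move: coer n1 n2 n3 n4; rewrite -/z; clear; lra.
rewrite (powR_N Sh 3) (powR_ln Sh).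
have -> : 5504 * A ^+ 8 * root_invN N ^+ 3 * root_ln N ^+ 3 = 5504 * A ^+ 8 * z ^+ 3.
  by rewrite /z /root_rate; ring.
have [E_0|En0] := eqVneq E 0.
  rewrite E_0; apply: mulr_ge0; last exact: (exprn_ge0 3 (ltW z0)).
  by apply: mulr_ge0; [exact: ler0n|exact: exprn_ge0].
have Ep : 0 < E by rewrite lt_neqAle eq_sym En0.
by move: EE; rewrite expr2 ler_pM2r.
Qed.
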